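(* Let $d\ge1$, let $\mathcal{O}\subset\mathbb{R}^d$ be bounded, open and convex with piecewise $C^2$-boundary, assume that $\psi:\mathbb{R}\to\mathbb{R}$ satisfies (C1)--(C6), with $a\ge0$, $b>0$, $s\in(0,2]$ as in (C4) (see context), and that $B\in L_2(U,V)$. Let $u$ and $v$ be solutions to $$dX_t=\operatorname{div}[\phi(\nabla X_t)]\,dt+B\,dW_t$$ (with zero Dirichlet boundary conditions and the same Wiener process $W$) with initial data $u_0,v_0\in V=H_0^1(\mathcal{O})$, respectively. Let $d_0:=1\vee\frac d2$. Then for $0\le\alpha\le1$ and $l\ge1$ there is a constant $C(l,\alpha,\mathcal{O},d)$ such that, $\mathbb{P}$-a.s. for all $t>0$, $$\|u_t-v_t\|_H^{2\alpha}\le t^{-\alpha l}\,C(l,\alpha,\mathcal{O},d)\left(\frac1t\int_0^t(a|\mathcal{O}|)^{\alpha d_0}+b^{\alpha d_0}\|u_\tau\|_V^{\alpha d_0s}+b^{\alpha d_0}\|v_\tau\|_V^{\alpha d_0s}\,d\tau\right)^{\frac{l}{d_0}}\|u_0-v_0\|_H^{2\alpha}.$$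
   Context: Notation: $a\vee b=\max(a,b)$, $a\wedge b=\min(a,b)$, $|\mathcal{O}|$ is the Lebesgue measure of $\mathcal{O}$. $H:=L^2(\mathcal{O})$, $V:=H_0^1(\mathcal{O})$ with $\|u\|_V=\|\nabla u\|_{L^2}$, $V^\ast=H^{-1}(\mathcal{O})$. $U$ is a separable Hilbert space, $L_2(U,V)$ denotes the Hilbert--Schmidt operators from $U$ to $V$, and $\{W_t\}_{t\ge0}$ is a cylindrical Wiener process in $U$ on a stochastic basis $(\Omega,\mathcal{F},\{\mathcal{F}_t\}_{t\ge0},\mathbb{P})$ satisfying the standard assumptions. Assumptions on $\psi$: $\psi\in W^{1,1}_{\mathrm{loc}}(\mathbb{R})$ and there is $C>0$ such that (C1) $\psi'(r)>0$ for every $r>0$; (C2) $\psi(r)=-\psi(-r)$ for every $r\in\mathbb{R}$; (C3) $\psi(r)\le C(1+|r|)$ for every $r\ge0$; (C4) there exist $a\ge0$, $b>0$, $s\in(0,2]$ with $(a+b|r|^s)|\psi'(r)|\ge1$ for every $r\ge0$; (C5) there exist $c>0$, $K\ge0$ such that $\psi(r)\cdot r\ge c|r|-K$ for every $r\ge0$; (C6) $0<s\le\frac4d\wedge2$. Define $\phi:\mathbb{R}^d\to\mathbb{R}^d$ by $\phi(z)=\psi(|z|)\frac{z}{|z|}$ for $z\ne0$ and $\phi(0)=0$, and $A:V\to V^\ast$ by ${}_{V^\ast}\langle A(u),v\rangle_V=\int_{\mathcal{O}}\langle\phi(\nabla u),\nabla v\rangle\,dx$. A solution with initial datum $u_0\in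 V$ is a continuous $\{\mathcal{F}_t\}$-adapted $H$-valued process $X$ such that, for every $T>0$, $X\in L^2(\Omega;C([0,T];H))\cap L^2([0,T]\times\Omega;V)$ and $X_t=u_0-\int_0^tA(X_\tau)\,d\tau+BW_t$ in $V^\ast$, $\mathbb{P}$-a.s. for all $t\in[0,T]$. *)

(* Defs.v *)
From HB Require Import structures.
From mathcomp Require Import all_boot all_order all_algebra.
From mathcomp Require Import all_classical all_reals all_analysis.
Set Implicit Arguments. Unset Strict Implicit. Unset Printing Implicit Defensive.
Import Order.TTheory GRing.Theory Num.Theory numFieldNormedType.Exports.
Local Open Scope classical_set_scope.
Local Open Scope ring_scope.

(* R^d is 'rV[R]_d: its norm `|x| is the sup norm (used only for the topology
   and for boundedness), so the Euclidean norm is defined separately below.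
   Its sigma-algebra is generated by the coordinates; it is the Borel one. *)
Definition rV_display : measure_display. Proof. exact: default_measure_display. Qed.

Section rV_measurable.
Context {R : realType} (d : nat).

Let coord (i : 'I_d) (x : 'rV[R]_d) : measurableTypeR R := x ord0 i.

Let rV_set0 : g_sigma_preimage coord set0.
Proof. exact: sigma_algebra0. Qed.

Let rV_setC A : g_sigma_preimage coord A -> g_sigma_preimage coord (~` A).
Proof. exact: sigma_algebraC. Qed.

Let rV_bigcup (F : _^nat) : (forall i, g_sigma_preimage coord (F i)) ->
  g_sigma_preimage coord (\bigcup_i (F i)).
Proof. exact: sigma_algebra_bigcup. Qed.

HB.instance Definition _ := @isMeasurable.Build rV_display
  'rV[R]_d (g_sigma_preimage coord) rV_set0 rV_setC rV_bigcup.

Lemma measurable_coord (i : 'I_d) : measurable_fun [set: 'rV[R]_d] (coord i).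
Proof.
move=> _ Y mY; rewrite setTI; apply: sub_sigma_algebra => /=.
rewrite -bigcup_seq/=; exists i => /=; first by rewrite mem_index_enum.
by exists Y => //; rewrite setTI.
Qed.

Lemma measurable_fun_rV d1 (T : measurableType d1) (f : T -> 'rV[R]_d) :
  (forall i, measurable_fun setT (coord i \o f)) -> measurable_fun setT f.
Proof.
move=> mf; suff H : g_sigma_preimage (fun i => coord i \o f) `<=` measurable.
  move: H; rewrite g_sigma_preimage_comp => prefS _ A mA.
  by apply: prefS; exists A.
apply: smallest_sub; first exact: sigma_algebra_measurable.
rewrite -bigcup_seq/=; apply: bigcup_sub => i _.
by move=> A [B mB <-]; exact: mf.
Qed.

End rV_measurable.

Section lebesgue_rV.
Context {R : realType}.

Definition rV_cons n (p : measurableTypeR R * 'rV[R]_n) : 'rV[R]_n.+1 :=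
  row_mx (p.1 : R)%:M p.2.

Lemma measurable_rV_cons n : measurable_fun setT (@rV_cons n).
Proof.
apply: measurable_fun_rV => i; rewrite /comp /rV_cons.
case: (@split_ordP 1 n i) => j ->.
- rewrite (_ : (fun _ => _) = fst); first exact: measurable_fst.
  by apply/funext => p; rewrite (@row_mxEl R 1 1 n) mxE !ord1 eqxx mulr1n.
- rewrite (_ : (fun _ => _) = (fun p : measurableTypeR R * 'rV[R]_n => p.2 ord0 j)).
    exact: (measurableT_comp (measurable_coord j) measurable_snd).
  by apply/funext => p; rewrite (@row_mxEr R 1 1 n).
Qed.

Lemma measurable_rV_head n :
  measurable_fun setT (fun x : 'rV[R]_n.+1 => x ord0 ord0 : measurableTypeR R).
Proof. exact: measurable_coord. Qed.

Lemma measurable_rV_behead n :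
  measurable_fun setT (fun x : 'rV[R]_n.+1 => @rsubmx R 1 1 n x).
Proof.
apply: measurable_fun_rV => i /=; rewrite /comp.
under eq_fun do rewrite mxE; exact: measurable_coord.
Qed.

Lemma rV_consK n (x : 'rV[R]_n.+1) :
  rV_cons (x ord0 ord0, @rsubmx R 1 1 n x) = x.
Proof.
apply/rowP => i; rewrite /rV_cons.
case: (@split_ordP 1 n i) => j ->.
  by rewrite (@row_mxEl R 1 1 n) mxE !ord1 eqxx mulr1n; congr (x _ _); exact/val_inj.
by rewrite (@row_mxEr R 1 1 n) mxE.
Qed.

(* Lebesgue measure on R^(n+1) is the image of the product of the one on R and
   the one on R^n. *)
Section step.
Variables (n : nat) (mu : {sigma_finite_measure set 'rV[R]_n -> \bar R}).

Definition lebesgue_rV_step : set 'rV[R]_n.+1 -> \bar R :=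
  pushforward (lebesgue_measure \x mu)%E (@rV_cons n).


Let step0 : lebesgue_rV_step set0 = 0%E.
Proof. by rewrite /lebesgue_rV_step /pushforward preimage_set0 measure0. Qed.

Let step_ge0 A : (0 <= lebesgue_rV_step A)%E.
Proof. by rewrite /lebesgue_rV_step /pushforward; exact: measure_ge0. Qed.

Let step_sigma_additive : semi_sigma_additive lebesgue_rV_step.
Proof.
have mc := @measurable_rV_cons n.
pose M : {measure set 'rV[R]_n.+1 -> \bar R} :=
  measure_function_pushforward__canonical__measure_function_Measure
    (lebesgue_measure \x mu)%E mc.
exact: (@measure_semi_sigma_additive _ _ _ M).
Qed.

HB.instance Definition _ :=
  isMeasure.Build _ _ _ lebesgue_rV_step step0 step_ge0 step_sigma_additive.

Let step_sigma_finite : sigma_finite setT lebesgue_rV_step.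
Proof.
have bK : cancel (@rV_cons n) (fun x => (x ord0 ord0, @rsubmx R 1 1 n x)).
  move=> [x y]; rewrite /rV_cons; congr (_, _); last exact: (@row_mxKr R 1 1 n).
  have -> : ord0 = @lshift 1 n ord0 by exact/val_inj.
  by rewrite (@row_mxEl R 1 1 n) mxE eqxx mulr1n.
pose b (x : 'rV[R]_n.+1) : measurableTypeR R * 'rV[R]_n :=
  (x ord0 ord0, @rsubmx R 1 1 n x).
have mb : measurable_fun setT b.
  by apply/measurable_fun_pair => /=;
    [exact: measurable_rV_head|exact: measurable_rV_behead].
have /sigma_finiteP[F [TF ndF Foo]] := sigma_finiteT (@lebesgue_measure R).
have /sigma_finiteP[G [TG ndG Goo]] := sigma_finiteT mu.
exists (fun k => b @^-1` (F k `*` G k)).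
  rewrite -preimage_bigcup (_ : \bigcup_k _ = setT) ?preimage_setT//.
  rewrite -subTset => -[x y] _.
  have [k _ Fkx] : (\bigcup_k F k) x by rewrite -TF.
  have [l _ Gly] : (\bigcup_k G k) y by rewrite -TG.
  exists (maxn k l) => //; split => /=.
    by move: x Fkx; exact/subsetPset/ndF/leq_maxl.
  by move: y Gly; exact/subsetPset/ndG/leq_maxr.
move=> k; have [mFk Fkoo] := Foo k; have [mGk Gkoo] := Goo k; split.
  by rewrite -[X in measurable X]setTI; apply: mb => //; exact: measurableX.
rewrite /lebesgue_rV_step /pushforward -comp_preimage.
rewrite (_ : b \o _ = id); last by apply/funext => p; exact: bK.
by rewrite preimage_id product_measure1E// lte_mul_pinfty// ge0_fin_numE.
Qed.

HB.instance Definition _ :=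
  Measure_isSigmaFinite.Build _ _ _ lebesgue_rV_step step_sigma_finite.

End step.

Fixpoint lebesgue_rV (d : nat) : {sigma_finite_measure set 'rV[R]_d -> \bar R} :=
  if d is n.+1 then lebesgue_rV_step (lebesgue_rV n) else \d_(0 : 'rV[R]_0).

Lemma lebesgue_rV_box d (A : 'I_d -> set (measurableTypeR R)) :
  (forall i, measurable (A i)) ->
  lebesgue_rV d [set x | forall i, A i (x ord0 i)] =
  (\prod_(i < d) lebesgue_measure (A i))%E.
Proof.
elim: d A => [|n IH] A mA.
  by rewrite big_ord0 /= diracE mem_set//= => -[].
rewrite big_ord_recl -IH//= /lebesgue_rV_step /pushforward.
rewrite [X in (_ \x _)%E X](_ : _ = A ord0 `*`
    [set x : 'rV[R]_n | forall i : 'I_n, A (lift ord0 i) (x ord0 i)]).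
  rewrite product_measure1E//.
  rewrite (_ : mkset _ = \bigcap_(i : 'I_n)
      [set x : 'rV[R]_n | A (lift ord0 i) (x ord0 i)]); last first.
    by apply/seteqP; split => x /= h i; [move=> _|]; exact: h.
  apply: fin_bigcap_measurable => // i _.
  rewrite -[X in measurable X]setTI.
  exact: (@measurable_coord R n i measurableT _ (mA (lift ord0 i))).
have r0 (x : R) (y : 'rV[R]_n) : rV_cons (x, y) ord0 ord0 = x.
  rewrite /rV_cons (_ : ord0 = @lshift 1 n ord0); last exact/val_inj.
  by rewrite (@row_mxEl R 1 1 n) mxE eqxx mulr1n.
have rS (x : R) (y : 'rV[R]_n) i : rV_cons (x, y) ord0 (lift ord0 i) = y ord0 i.
  rewrite /rV_cons (_ : lift ord0 i = @rshift 1 n i); last exact/val_inj.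
  by rewrite (@row_mxEr R 1 1 n).
apply/seteqP; split => -[x y] /=.
  by move=> h; split => [|i]; [rewrite -(r0 x y)|rewrite -(rS x y)]; exact: h.
move=> [hx hy] i; have [j ->|->] := unliftP ord0 i; first by rewrite rS.
by rewrite r0.
Qed.

End lebesgue_rV.

Section domain.
Context {R : realType} {d : nat}.
Local Notation leb := (lebesgue_rV d).
Implicit Types (O : set 'rV[R]_d) (u v f : 'rV[R]_d -> R).

Definition dot (x y : 'rV[R]_d) : R := \sum_i x ord0 i * y ord0 i.
Definition enorm (x : 'rV[R]_d) : R := Num.sqrt (dot x x).

Definition partial (i : 'I_d) f : 'rV[R]_d -> R := 'D_(delta_mx ord0 i) f.

(* f is of class C^k on the open set O *)
Fixpoint Ck (k : nat) O f : Prop :=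
  (forall x, O x -> {for x, continuous f}) /\
  if k is m.+1 then
    forall i, (forall x, O x -> derivable f x (delta_mx ord0 i)) /\
              Ck m O (partial i f)
  else True.

(* The boundary is a finite union of closed pieces, each lying on an embedded
   C^2 hypersurface {g = 0}, with g of class C^2 around the piece and nonzero
   gradient on the piece. *)
Definition piecewise_C2_boundary O : Prop :=
  exists (n : nat) (Gam : 'I_n -> set 'rV[R]_d),
    closure O `\` interior O = \bigcup_(i : 'I_n) Gam i /\
    forall i, closed (Gam i) /\
      exists (N : set 'rV[R]_d) (g : 'rV[R]_d -> R),
        [/\ open N, Gam i `<=` N, Ck 2 N g &
            forall x, Gam i x -> g x = 0 /\ exists j, partial j g x != 0].

Definition test_function O (eta : 'rV[R]_d -> R) : Prop :=
  (forall k, Ck k [set: 'rV[R]_d] eta) /\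
  exists K : set 'rV[R]_d,
    [/\ compact K, K `<=` O & forall x, ~ K x -> eta x = 0].

(* Elements of H = L^2(O) are represented by functions R^d -> R, of which only
   the values a.e. on O matter. *)
Definition L2 O f : Prop :=
  measurable_fun O f /\ leb.-integrable O (fun x => (f x ^+ 2)%:E).

Definition ipH O f g : R := \int[leb]_(x in O) (f x * g x).
Definition normH O f : R := Num.sqrt (ipH O f f).

Definition weak_gradient O u (g : 'rV[R]_d -> 'rV[R]_d) : Prop :=
  forall i eta, test_function O eta ->
    \int[leb]_(x in O) (u x * partial i eta x) =
    - \int[leb]_(x in O) (g x ord0 i * eta x).

(* u is in H^1_0(O), the closure of the test functions in H^1(O), and g is its
   weak gradient. *)
Definition H10_gradient O u (g : 'rV[R]_d -> 'rV[R]_d) : Prop :=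
  [/\ L2 O u, forall i, L2 O (fun x => g x ord0 i), weak_gradient O u g &
      exists eta : nat -> 'rV[R]_d -> R,
        [/\ forall n, test_function O (eta n),
            normH O (u \- eta n) @[n --> \oo] --> 0 &
            forall i, normH O (fun x => g x ord0 i - partial i (eta n) x)
                        @[n --> \oo] --> 0]].

Definition H10 O u : Prop := exists g, H10_gradient O u g.

(* a representative of the weak gradient; junk value 0 outside H^1_0(O) *)
Definition grad O u : 'rV[R]_d -> 'rV[R]_d :=
  xget (cst 0) [set g | H10_gradient O u g].

(* the norm of V = H^1_0(O), extended by +oo to functions outside V *)
Definition normV O u : \bar R :=
  if `[< H10 O u >] then
    (Num.sqrt (\int[leb]_(x in O) (enorm (grad O u x) ^+ 2)))%:E
  else +oo%E.

Definition phi (psi : R -> R) (z : 'rV[R]_d) : 'rV[R]_d :=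
  if z == 0 then 0 else (psi (enorm z) / enorm z) *: z.

(* the duality pairing of A(u) in V^* with v in V *)
Definition Apair (psi : R -> R) O u v : R :=
  \int[leb]_(x in O) dot (phi psi (grad O u x)) (grad O v x).

(* open subsets of H, as sets of representatives *)
Definition openH O (G : set ('rV[R]_d -> R)) : Prop :=
  forall f, L2 O f -> G f ->
    exists2 r : R, 0 < r & forall h, L2 O h -> normH O (f \- h) < r -> G h.

End domain.

Section psi.
Context {R : realType}.
Local Notation leb := (@lebesgue_measure R).

Definition test_functionR (eta : R -> R) : Prop :=
  (forall n x, derivable (derive1n n eta) x 1) /\
  exists M : R, forall x, M < `|x| -> eta x = 0.

(* psi is the continuous representative of an element of W^{1,1}_loc(R) and dpsi
   is a representative of its weak derivative. *)
Definition W11loc (psi dpsi : R -> R) : Prop :=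
  [/\ continuous psi,
      forall x y : R, leb.-integrable `[x, y] (EFin \o dpsi) &
      forall eta, test_functionR eta ->
        \int[leb]_x (psi x * derive1 eta x) = - \int[leb]_x (dpsi x * eta x)].

(* As the weak derivative is defined up to null sets, pointwise conditions on it
   are read almost everywhere; read literally, the one with a + b |r|^s could
   not hold at r = 0 when a = 0. *)
Definition psi_conditions (d : nat) (psi : R -> R) (a b s : R) : Prop :=
  exists2 dpsi : R -> R, W11loc psi dpsi &
  [/\ {ae leb, forall r : R, 0 < r -> 0 < dpsi r},
      forall r, psi r = - psi (- r),
      exists2 C : R, 0 < C & forall r : R, 0 <= r -> psi r <= C * (1 + `|r|),
      [/\ 0 <= a, 0 < b, 0 < s <= 2 &
          {ae leb, forall r : R, 0 <= r ->
            1 <= (a + b * `|r| `^ s) * `|dpsi r| }] &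
      (exists c K : R, [/\ 0 < c, 0 <= K &
        forall r : R, 0 <= r -> c * `|r| - K <= psi r * r]) /\
      0 < s <= Num.min (4 / d%:R) 2].

End psi.

Section hilbert.
Context {R : realType} {U : completeNormedModType R}.
Implicit Type ip : U -> U -> R.

Definition inner_product ip : Prop :=
  [/\ forall x y, ip x y = ip y x,
      forall (k : R) x y z, ip (k *: x + y) z = k * ip x z + ip y z &
      forall x, ip x x = `|x| ^+ 2].

Definition separable_hilbert ip : Prop :=
  inner_product ip /\ exists2 D : set U, countable D & dense D.

(* The nonzero e k form an orthonormal basis: the sequence is padded with zeros
   when U is finite-dimensional. *)
Definition onb ip (e : nat -> U) : Prop :=
  [/\ forall j k, j != k -> ip (e j) (e k) = 0,
      forall k, e k = 0 \/ ip (e k) (e k) = 1 &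
      forall x, (forall k, ip x (e k) = 0) -> x = 0].

(* B is in L_2(U, V) for V = H^1_0(O) *)
Definition hilbert_schmidt ip (d : nat) (O : set 'rV[R]_d)
    (B : U -> 'rV[R]_d -> R) : Prop :=
  [/\ forall x, H10 O (B x),
      forall (k : R) x y, {ae lebesgue_rV d, forall z, O z ->
        B (k *: x + y) z = k * B x z + B y z},
      exists M : R, forall x, (normV O (B x) <= (M * `|x|)%:E)%E &
      exists2 e, onb ip e & (\sum_(0 <= k <oo) normV O (B (e k)) ^+ 2 < +oo)%E].

End hilbert.

Section stochastic.
Context {R : realType} {dO : measure_display} {Om : measurableType dO}.
Variables (P : probability Om R) (F : R -> set (set Om)).

(* Times are real numbers; only nonnegative times are constrained. *)
Definition usual_filtration : Prop :=
  [/\ forall t : R, 0 <= t -> sigma_algebra setT (F t) /\ F t `<=` measurable,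
      forall t t' : R, 0 <= t -> t <= t' -> F t `<=` F t',
      forall t : R, 0 <= t -> F t = \bigcap_(t' in `]t, +oo[) F t' &
      forall N, P.-negligible N -> F 0 N].

Definition brownian (beta : R -> Om -> R) : Prop :=
  [/\ forall (t : R) (D : set (measurableTypeR R)), 0 <= t -> measurable D ->
        F t (beta t @^-1` D),
      {ae P, forall w, beta 0 w = 0},
      {ae P, forall w, {within `[0, +oo[, continuous (beta ^~ w)}},
      forall (t t' : R) (D : set (measurableTypeR R)), 0 <= t -> t < t' ->
        measurable D -> P ((beta t' \- beta t) @^-1` D) =
                        normal_prob 0 (Num.sqrt (t' - t)) D &
      forall (t t' : R) (D : set (measurableTypeR R)) G, 0 <= t -> t < t' ->
        measurable D -> F t G ->
        P ((beta t' \- beta t) @^-1` D `&` G) =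
        (P ((beta t' \- beta t)%R @^-1` D) * P G)%E].

Definition sigma_process (beta : R -> Om -> R) : set (set Om) :=
  <<s [set G | exists (t : R) (D : set (measurableTypeR R)),
        [/\ 0 <= t, measurable D & G = beta t @^-1` D]] >>.

Definition independent_processes (beta : nat -> R -> Om -> R) : Prop :=
  forall (n : nat) (G : nat -> set Om),
    (forall k, sigma_process (beta k) (G k)) ->
    P (\bigcap_(k < n) G k) = (\prod_(k < n) P (G k))%E.

(* The cylindrical Wiener process W_t = sum_k beta_k(t) e_k; the beta_k are zero
   at the padding indices of the basis. *)
Definition cylindrical_wiener {U : completeNormedModType R} (ip : U -> U -> R)
    (e : nat -> U) (beta : nat -> R -> Om -> R) : Prop :=
  [/\ onb ip e,
      forall k, e k = 0 -> forall t w, beta k t w = 0,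
      forall k, e k != 0 -> brownian (beta k) &
      independent_processes beta].

Section solution.
Context {U : completeNormedModType R} {d : nat}.
Variables (O : set 'rV[R]_d) (psi : R -> R).
Variables (e : nat -> U) (beta : nat -> R -> Om -> R) (B : U -> 'rV[R]_d -> R).
Implicit Types X Y : R -> Om -> 'rV[R]_d -> R.

(* X_t is F_t-measurable as a map to H with its Borel sigma-algebra *)
Definition adaptedH X : Prop :=
  forall t : R, 0 <= t -> forall G, openH O G -> F t [set w | G (X t w)].

Definition continuousH X : Prop :=
  {ae P, forall w, forall t : R, 0 <= t ->
    normH O (X t' w \- X t w) @[t' --> within `[0, +oo[ (nbhs t)] --> 0}.

(* Y is the continuous V-valued version of (B W_t): for every t, B W_t is the
   limit in L^2(Om; V) of sum_(k < n) beta_k(t) B e_k. *)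
Definition BW_process Y : Prop :=
  [/\ forall (t : R) w, 0 <= t -> H10 O (Y t w),
      adaptedH Y,
      {ae P, forall w, forall t : R, 0 <= t ->
        (normV O (Y t' w \- Y t w)%R @[t' --> within `[0%R, +oo[ (nbhs t)]
          --> 0)%E} &
      forall t : R, 0 <= t ->
        ((\int[P]_w (normV O (fun x =>
            (Y t w x - \sum_(k < n) beta k t w * B (e k) x)%R)) ^+ 2)
          @[n --> \oo] --> 0)%E].

(* The identity in V^* is tested against every v in V. *)
Definition solution (u0 : 'rV[R]_d -> R) X : Prop :=
  [/\ forall (t : R) w, 0 <= t -> L2 O (X t w),
      adaptedH X,
      continuousH X,
      forall T : R, 0 < T ->
        (\int[P]_w ereal_sup [set (normH O (X t w) ^+ 2)%:E | t in `[0%R, T]]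
           < +oo)%E /\
        (\int[P]_w \int[lebesgue_measure]_(t in `[0%R, T])
           (normV O (X t w) ^+ 2) < +oo)%E &
      exists2 Y, BW_process Y &
        forall T : R, 0 < T -> {ae P, forall w, forall t : R, 0 <= t <= T ->
          forall v, H10 O v ->
            ipH O (X t w) v =
            ipH O u0 v
            - \int[lebesgue_measure]_(tau in `[0, t]) Apair psi O (X tau w) v
            + ipH O (Y t w) v}].

End solution.
End stochastic.

(* Main.v *)
Require Import Defs.
From HB Require Import structures.
From mathcomp Require Import all_boot all_order all_algebra.
From mathcomp Require Import all_classical all_reals all_analysis.
From mathcomp Require Import measurable_realfun zify ring lra.
Set Implicit Arguments. Unset Strict Implicit. Unset Printing Implicit Defensive.
Import Order.TTheory GRing.Theory Num.Theory numFieldNormedType.Exports.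
Local Open Scope classical_set_scope.
Local Open Scope ring_scope.

(** Two solutions are driven by the same noise, so their difference w solves an
    equation without noise, path by path: w_t = w_0 - int_0^t (A u - A v).
    Testing it with its Yosida regularisation (of the Dirichlet Laplacian) and
    removing the regularisation yields
    |w_t|^2 = |w_0|^2 - 2 int_0^t <A u - A v, w>.

    By (C4) the increments of psi are at least those of kap * id on [0, M], with
    kap = 1 / (a + b M^s), whence <phi x - phi y, x - y> >= |x - y|^2 / om with
    om = a + b max(|x|, |y|)^s. A weighted Sobolev inequality
    |w|_2^2 <= C |om|_(L^d0) int |grad w|^2 / om, obtained from the Loomis-Whitney
    inequality, then gives |w|^2 <= c Z^(1 / (alpha d0)) <A u - A v, w>, where Z is
    the integrand of the statement; (C6) is what makes s d0 <= 2.

    Finally [0, t] is cut into n >= l equal intervals. On at least half of each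
    of them Z is at most 2 n times its mean over [0, t], so |w|^2 gets divided n times by
    1 + h / G >= max(1, h / G), and max(1, q)^n >= q^l. *)

(** * Symmetric bilinear forms and their resolvents *)

(** A path of the difference is continuous only in H, lies in V only for almost every time, and its
    equation may be tested only with a fixed v in V. The resolvent J_n overcomes this: it is
    symmetric and continuous from H to V, so t -> J_n w_t is continuous in V and (J_n w_t, w_t)
    obeys an exact product rule over each time step. Its envelopes, continuous on H and increasing
    to the squared V-norm, also supply measurability in time and in omega.

    The Sobolev inequality must keep the weight, since the operator may degenerate where gradients
    are large and then controls only |grad w|^2 / om. For d >= 2 the one-dimensional estimate is
    applied to |w|^p with p = 2 (d - 1) / d: the product over the d directions, to the power 1 / (d
    - 1), is then |w|^2, and a power of |w|_2 on the right cancels.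

    The constant is chosen before psi, a, b, s and the probabilistic data, so every constant is
    traced explicitly through alpha, l, d and the volume. Each solution comes with its own version
    of the noise; that the two agree at all times off one null set has to be proved before they are
    subtracted. *)

Lemma div_natS_le (R : realType) (M eps : R) : 0 < eps ->
  exists N, forall n, (N <= n)%N -> M / n.+1%:R <= eps.
Proof.
move=> e0; exists (Num.truncn (M / eps)) => n Nn.
rewrite ler_pdivrMr// mulrC -ler_pdivrMr//; apply/ltW.
by apply: lt_le_trans (truncnS_gt _) _; rewrite ler_nat.
Qed.

Section forms.
Context {R : realType} {E : lmodType R}.
Implicit Types (S H V : set E) (q h : E -> E -> R).

(** The form need only behave on [S] and may vanish at nonzero vectors: functions are kept as
    representatives, and equality almost everywhere is absorbed by [q x x = 0] instead of a
    quotient. *)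
Record form_on S q : Prop := FormOn {
  form0 : S 0;
  formS : forall a x y, S x -> S y -> S (a *: x + y);
  formC : forall x y, S x -> S y -> q x y = q y x;
  formPl : forall a x y z, S x -> S y -> S z ->
    q (a *: x + y) z = a * q x z + q y z;
  form_ge0 : forall x, S x -> 0 <= q x x }.

Section form_theory.
Variables (S : set E) (q : E -> E -> R).
Hypothesis F : form_on S q.

Lemma form_setD x y : S x -> S y -> S (x + y).
Proof. by move=> Sx Sy; rewrite -[x]scale1r; exact: (formS F). Qed.

Lemma form_setZ a x : S x -> S (a *: x).
Proof. by move=> Sx; rewrite -[_ *: _]addr0; exact: (formS F a Sx (form0 F)). Qed.

Lemma form_setN x : S x -> S (- x).
Proof. by rewrite -scaleN1r; exact: form_setZ. Qed.

Lemma form_setB x y : S x -> S y -> S (x - y).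
Proof. by move=> Sx Sy; apply: form_setD => //; exact: form_setN. Qed.

Lemma formDl x y z : S x -> S y -> S z -> q (x + y) z = q x z + q y z.
Proof. by move=> *; rewrite -[x]scale1r (formPl F)// mul1r scale1r. Qed.

Lemma form0l z : S z -> q 0 z = 0.
Proof.
move=> Sz; have := formDl (form0 F) (form0 F) Sz.
by rewrite addr0 => /eqP; rewrite -subr_eq0 opprD addrA subrr sub0r oppr_eq0 => /eqP.
Qed.

Lemma formZl a x z : S x -> S z -> q (a *: x) z = a * q x z.
Proof.
by move=> Sx Sz; rewrite -[a *: x]addr0 (formPl F)//; [rewrite form0l ?addr0|exact: (form0 F)].
Qed.

Lemma formNl x z : S x -> S z -> q (- x) z = - q x z.
Proof. by move=> *; rewrite -scaleN1r formZl// mulN1r. Qed.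

Lemma formBl x y z : S x -> S y -> S z -> q (x - y) z = q x z - q y z.
Proof. by move=> Sx Sy Sz; rewrite formDl ?formNl//; exact: form_setN. Qed.

Lemma formDr x y z : S x -> S y -> S z -> q z (x + y) = q z x + q z y.
Proof.
by move=> *; rewrite (formC F)// ?formDl//; [rewrite !(formC F (y := z))|exact: form_setD].
Qed.

Lemma formZr a x z : S x -> S z -> q z (a *: x) = a * q z x.
Proof.
by move=> *; rewrite (formC F)// ?formZl// ?[q x z](formC F)//; exact: form_setZ.
Qed.

Lemma formBr x y z : S x -> S y -> S z -> q z (x - y) = q z x - q z y.
Proof.
move=> Sx Sy Sz; rewrite (formC F)//; last exact: form_setB.
by rewrite formBl// !(formC F (y := z)).
Qed.

Lemma form_sqrD x y : S x -> S y ->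
  q (x + y) (x + y) = q x x + 2 * q x y + q y y.
Proof.
move=> Sx Sy; have Sxy := form_setD Sx Sy.
by rewrite formDl// !formDr// (formC F (x := y) (y := x))//; ring.
Qed.

Lemma form_sqrB x y : S x -> S y ->
  q (x - y) (x - y) = q x x - 2 * q x y + q y y.
Proof.
move=> Sx Sy; have Sxy := form_setB Sx Sy.
by rewrite formBl// !formBr// (formC F (x := y) (y := x))//; ring.
Qed.

Lemma form_sqrBC x y : S x -> S y -> q (x - y) (x - y) = q (y - x) (y - x).
Proof. by move=> Sx Sy; rewrite !form_sqrB// (formC F (x := y))//; ring. Qed.

Lemma form_sqrZ a x : S x -> q (a *: x) (a *: x) = a ^+ 2 * q x x.
Proof.
by move=> Sx; rewrite formZl ?formZr//; [ring|exact: form_setZ].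
Qed.

(** The polynomial [q (t *: x - y) (t *: x - y)] in t is nonnegative; it is evaluated at its
    minimiser [q x y / q x x]. *)
Lemma form_CS x y : S x -> S y -> q x y ^+ 2 <= q x x * q y y.
Proof.
move=> Sx Sy.
have pos t : 0 <= t ^+ 2 * q x x - 2 * t * q x y + q y y.
  have := form_ge0 F (form_setB (form_setZ t Sx) Sy).
  by rewrite form_sqrB ?form_sqrZ ?formZl//; [rewrite mulrA|exact: form_setZ].
have [q0|q0] := eqVneq (q x x) 0.
  rewrite q0 mul0r; have [->|xy0] := eqVneq (q x y) 0; first by rewrite expr0n.
  (* With [q x x = 0] the polynomial is affine in t, and this t would give it the value -1. *)
  have := pos ((q y y + 1) / (2 * q x y)); rewrite q0.
  have -> : 2 * ((q y y + 1) / (2 * q x y)) * q x y = q y y + 1 by field.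
  by move=> ?; lra.
have qp : 0 < q x x by rewrite lt_def q0 (form_ge0 F).
have := pos (q x y / q x x).
have -> : (q x y / q x x) ^+ 2 * q x x - 2 * (q x y / q x x) * q x y + q y y =
  (q x x * q y y - q x y ^+ 2) / q x x by field.
by rewrite pmulr_lge0 ?invr_gt0// subr_ge0.
Qed.

Lemma form_abs_le x y : S x -> S y ->
  `|q x y| <= Num.sqrt (q x x) * Num.sqrt (q y y).
Proof.
move=> Sx Sy; rewrite -sqrtrM ?(form_ge0 F)// -sqrtr_sqr ler_wsqrtr//.
exact: form_CS.
Qed.

Lemma form_norm_leD x y : S x -> S y ->
  Num.sqrt (q (x + y) (x + y)) <= Num.sqrt (q x x) + Num.sqrt (q y y).
Proof.
move=> Sx Sy; rewrite -[leRHS]ger0_norm ?addr_ge0 ?sqrtr_ge0// -sqrtr_sqr.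
rewrite ler_wsqrtr// form_sqrD// sqrrD !sqr_sqrtr ?(form_ge0 F)// lerD2r lerD2l.
rewrite -[leRHS]mulr_natl ler_pM2l//.
exact: le_trans (ler_norm _) (form_abs_le Sx Sy).
Qed.

Lemma form_norm_leB x y : S x -> S y ->
  Num.sqrt (q x x) - Num.sqrt (q y y) <= Num.sqrt (q (x - y) (x - y)).
Proof.
move=> Sx Sy; rewrite lerBlDr.
have := form_norm_leD (form_setB Sx Sy) Sy.
by rewrite subrK.
Qed.

Lemma form_sqrD_le2 x y : S x -> S y ->
  q (x + y) (x + y) <= 2 * q x x + 2 * q y y.
Proof.
move=> Sx Sy; have := form_ge0 F (form_setB Sx Sy).
by rewrite form_sqrB// form_sqrD// => ?; lra.
Qed.

Lemma form_null x y : S x -> S y -> q x x = 0 -> q x y = 0.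
Proof.
move=> Sx Sy x0; have := form_CS Sx Sy; rewrite x0 mul0r => le0.
by apply/eqP; rewrite -sqrf_eq0 eq_le le0 sqr_ge0.
Qed.

End form_theory.

Section resolvent.
Variables (H V : set E) (h q : E -> E -> R) (c : R).
Hypotheses (Fh : form_on H h) (Fq : form_on V q) (VH : V `<=` H).
Hypothesis h_le_q : forall x, V x -> h x x <= c * q x x.
Hypothesis V_complete : forall x : nat -> E, (forall n, V (x n)) ->
  (forall eps : R, 0 < eps -> exists N, forall m n, (N <= m)%N -> (N <= n)%N ->
    q (x m - x n) (x m - x n) <= eps) ->
  exists2 y, V y & forall eps : R, 0 < eps -> exists N, forall n, (N <= n)%N ->
    q (x n - y) (x n - y) <= eps.

(* g = lam (lam + L)^-1 f, where L is the operator of the form q *)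
Definition is_resolvent (lam : R) f g :=
  V g /\ forall v, V v -> q g v + lam * h g v = lam * h f v.

Definition resolvent lam f : E := xget 0 [set g | is_resolvent lam f g].

(** The resolvent is its minimiser over V: [is_resolvent] is the Euler-Lagrange equation of this
    functional. *)
Definition energy lam f g := q g g + lam * h (f - g) (f - g).

(** The energy is a quadratic polynomial on V and the equation of [g] kills its linear part at [g];
    only the quadratic part remains as excess. This gives minimality and stability at once. *)
Lemma is_resolvent_energy lam f g x : H f -> is_resolvent lam f g -> V x ->
  energy lam f x =
  energy lam f g + q (x - g) (x - g) + lam * h (x - g) (x - g).
Proof.
move=> Hf [Vg gE] Vx; have Hx := VH Vx; have Hg := VH Vg.
have := gE _ (form_setB Fq Vx Vg); rewrite /energy.
rewrite !(form_sqrB Fh)// (form_sqrB Fq)// (formBr Fq)// !(formBr Fh)//.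
by rewrite (formC Fq Vx Vg) (formC Fh Hx Hg) => ?; lra.
Qed.

Lemma energy_min_resolvent lam f g : H f -> V g ->
  (forall x, V x -> energy lam f g <= energy lam f x) -> is_resolvent lam f g.
Proof.
move=> Hf Vg gmin; split => // v Vv; have Hg := VH Vg; have Hv := VH Vv.
pose L := q g v + lam * h g v - lam * h f v.
pose A := q v v + lam * h v v.
suff L0 : L = 0 by rewrite /L in L0; lra.
have pos t : 0 <= 2 * t * L + t ^+ 2 * A.
  have := gmin _ (form_setD Fq (form_setZ Fq t Vv) Vg).
  have Htv := form_setZ Fh t Hv; have Htg := form_setD Fh Htv Hg.
  rewrite /energy (form_sqrD Fq)//; last exact: (form_setZ Fq).
  rewrite (form_sqrZ Fq)// (formZl Fq)//.
  rewrite !(form_sqrB Fh)// (form_sqrD Fh)// (form_sqrZ Fh)// (formZl Fh)//.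
  rewrite (formDr Fh)// (formZr Fh)// [q v g](formC Fq)// [h v g](formC Fh)//.
  by rewrite /L /A => ?; lra.
have [A0|A0] := eqVneq A 0.
  have := pos (- L); rewrite A0; have := sqr_ge0 L => ? ?.
  by apply/eqP; rewrite -sqrf_eq0 eq_le sqr_ge0 andbT; nra.
(* The sign of [A] is unknown here, as [lam] is arbitrary: the values [- L / A] and [L / A] of t
   bound [L ^+ 2 / A] from both sides by 0. *)
have := pos (- L / A).
have -> : 2 * (- L / A) * L + (- L / A) ^+ 2 * A = - (L ^+ 2 / A) by field.
have := pos (L / A).
have -> : 2 * (L / A) * L + (L / A) ^+ 2 * A = 3 * (L ^+ 2 / A) by field.
move=> p1 p2; have /eqP : L ^+ 2 / A = 0 by lra.
by rewrite mulf_eq0 invr_eq0 (negbTE A0) orbF sqrf_eq0 => /eqP.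
Qed.

(** Direct method of the calculus of variations. A minimising sequence is Cauchy for [q] by the
    parallelogram law applied to midpoints, completeness gives a limit, and the energy passes to it
    because [h] is dominated by [q]. *)
Lemma resolvent_exists (lam : R) f : 0 < lam -> H f -> exists g, is_resolvent lam f g.
Proof.
move=> lam0 Hf.
pose M := [set energy lam f x | x in V].
have M0 : lbound M 0.
  move=> _ [x Vx <-]; rewrite /energy addr_ge0 ?(form_ge0 Fq)// mulr_ge0//.
    exact: ltW.
  by apply: (form_ge0 Fh); apply: (form_setB Fh) => //; exact: VH.
have hiM : has_inf M.
  split; last by exists 0.
  by exists (energy lam f 0); exists 0 => //; exact: (form0 Fq).
have /choice[x xP] n : exists x, V x /\ energy lam f x < inf M + n.+1%:R^-1.
  have [|_ [y Vy <-] yM] := @inf_adherent _ M n.+1%:R^-1 _ hiM; last by exists y.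
  by rewrite invr_gt0.
have infM y : V y -> inf M <= energy lam f y.
  by move=> Vy; apply: ge_inf; [exists 0|exists y].
have par a b : V a -> V b ->
    q (a - b) (a - b) <= 2 * energy lam f a + 2 * energy lam f b - 4 * inf M.
  move=> Va Vb; have Ha := VH Va; have Hb := VH Vb.
  have := infM _ (form_setZ Fq 2^-1 (form_setD Fq Va Vb)).
  have Hab := form_setB Fh Ha Hb.
  have := form_ge0 Fh Hab.
  rewrite /energy (form_sqrZ Fq); last exact: (form_setD Fq).
  rewrite !(form_sqrB Fh)//; last exact/(form_setZ Fh)/(form_setD Fh).
  rewrite (formZr Fh)//; last exact: (form_setD Fh).
  rewrite (form_sqrZ Fh)//; last exact: (form_setD Fh).
  rewrite (form_sqrD Fq)// (form_sqrB Fq)// (form_sqrD Fh)// (formDr Fh)//.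
  by move=> ? ?; nra.
have xcauchy m n : q (x m - x n) (x m - x n) <= 2 * m.+1%:R^-1 + 2 * n.+1%:R^-1.
  have [Vm mP] := xP m; have [Vn nP] := xP n.
  apply: le_trans (par _ _ Vm Vn) _; move: (ltW mP) (ltW nP).
  by set a := m.+1%:R^-1; set b := n.+1%:R^-1 => ? ?; lra.
have small (eps : R) : 0 < eps ->
    exists N, forall n, (N <= n)%N -> n.+1%:R^-1 <= eps.
  by move=> /(div_natS_le 1)[N NP]; exists N => n /NP; rewrite mul1r.
have [||g Vg gP] := V_complete (x := x).
- by move=> n; case: (xP n).
- move=> eps e0; have [|N NP] := small (eps / 4); first by rewrite divr_gt0.
  exists N => m n Nm Nn; have := xcauchy m n; have := NP _ Nm; have := NP _ Nn.
  by set a := m.+1%:R^-1; set b := n.+1%:R^-1 => ? ? ?; lra.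
exists g; apply: energy_min_resolvent => // y Vy; apply: le_trans (infM _ Vy).
apply/ler_addgt0Pl => /= eps e0.
have c0 : 0 <= Num.max c 0 by rewrite le_max lexx orbT.
have h_le x0 : V x0 -> h x0 x0 <= Num.max c 0 * q x0 x0.
  move=> Vx0; apply: le_trans (h_le_q Vx0) _.
  by rewrite ler_wpM2r ?le_max ?lexx// (form_ge0 Fq).
(* energy is a seminorm squared, hence (1+d)-subadditive up to (1+1/d) *)
have young (d : R) n : 0 < d ->
    energy lam f g <= (1 + d) * energy lam f (x n) +
      (1 + d^-1) * (1 + lam * Num.max c 0) * q (x n - g) (x n - g).
  move=> d0; have [Vn _] := xP n; have Hn := VH Vn; have Hg := VH Vg.
  have Vng := form_setB Fq Vn Vg; have Hng := VH Vng.
  have yg (S : set E) (r : E -> E -> R) : form_on S r -> forall a b, S a -> S b ->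
      r (a + b) (a + b) <= (1 + d) * r a a + (1 + d^-1) * r b b.
    move=> Fr a b Sa Sb; rewrite (form_sqrD Fr)//.
    have Sda := form_setZ Fr d Sa.
    have := form_ge0 Fr (form_setB Fr Sda Sb).
    rewrite (form_sqrB Fr)// (form_sqrZ Fr)// (formZl Fr)// => p.
    have : 0 <= d^-1 * (d ^+ 2 * r a a - 2 * (d * r a b) + r b b).
      by rewrite mulr_ge0// invr_ge0 ltW.
    have -> : d^-1 * (d ^+ 2 * r a a - 2 * (d * r a b) + r b b) =
       d * r a a - 2 * r a b + d^-1 * r b b by field; rewrite gt_eqF.
    by move=> ?; lra.
  have yq := yg _ _ Fq _ _ Vn (form_setN Fq Vng).
  have yh := yg _ _ Fh _ _ (form_setB Fh Hf Hn) Hng.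
  have hq := h_le _ Vng.
  have eq1 : x n - (x n - g) = g by rewrite opprB addrC subrK.
  have eq2 : f - x n + (x n - g) = f - g by rewrite addrA subrK.
  rewrite eq1 in yq; rewrite eq2 in yh; rewrite /energy.
  have qN : q (- (x n - g)) (- (x n - g)) = q (x n - g) (x n - g).
    by rewrite -scaleN1r (form_sqrZ Fq)// sqrrN expr1n mul1r.
  rewrite qN in yq.
  have dd : 0 <= 1 + d^-1 by rewrite addr_ge0// invr_ge0 ltW.
  have : lam * h (f - g) (f - g) <= lam * ((1 + d) * h (f - x n) (f - x n) +
     (1 + d^-1) * (Num.max c 0 * q (x n - g) (x n - g))).
    rewrite ler_pM2l//; apply: le_trans yh _; rewrite lerD2l.
    by rewrite ler_wpM2l.
  by move=> ?; nra.
pose m := inf M.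
have m0 : 0 <= m by apply: lb_le_inf => //; case: hiM.
(* Chosen so that the factor [1 + d] costs at most [eps / 4] on the infimum [m]; the remaining error
   then carries the fixed factor [k] introduced below. *)
pose d := Num.min 1 (eps / (4 * (m + 1))).
have d0 : 0 < d by rewrite lt_min ltr01 divr_gt0// mulr_gt0// ltr_wpDl.
have dm : d * m <= eps / 4.
  apply: (@le_trans _ _ (eps / (4 * (m + 1)) * m)).
    by rewrite ler_wpM2r// ge_min lexx orbT.
  rewrite mulrAC ler_pdivrMr; last by rewrite mulr_gt0// ltr_wpDl.
  have -> : eps / 4 * (4 * (m + 1)) = eps * (m + 1) by field.
  by rewrite ler_pM2l// lerDl.
pose k := (1 + d^-1) * (1 + lam * Num.max c 0).
have k1 : 1 <= k.
  rewrite /k -[leLHS]mulr1 ler_pM// ?lerDl ?invr_ge0 ?(ltW d0)//.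
  by rewrite mulr_ge0// ltW.
have k0 : 0 < k by exact: lt_le_trans k1.
have [|N1 N1P] := small (eps / 8); first by rewrite divr_gt0.
have [|N2 N2P] := gP (eps / (4 * k)); first by rewrite divr_gt0// mulr_gt0.
have := young d (maxn N1 N2) d0; rewrite -/k.
have := N1P _ (leq_maxl N1 N2); have := N2P _ (leq_maxr N1 N2).
have [_] := xP (maxn N1 N2); set n := maxn N1 N2; set n1 := n.+1%:R^-1.
set e := energy _ _ (x n); set qq := q _ _ => en qn nn Young.
have kq : k * qq <= eps / 4.
  have : k * qq <= k * (eps / (4 * k)) by rewrite ler_pM2l.
  by have -> : k * (eps / (4 * k)) = eps / 4 by field; rewrite gt_eqF.
have d1 : d <= 1 by rewrite ge_min lexx.
have : (1 + d) * e <= (1 + d) * (m + eps / 8).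
  by rewrite ler_pM2l ?addr_gt0//; rewrite /m; lra.
by rewrite -/m => ?; nra.
Qed.

Variable lam : R.
Hypothesis lam_gt0 : 0 < lam.
Local Notation J := (resolvent lam).

Lemma resolventP f : H f -> is_resolvent lam f (J f).
Proof.
move=> Hf; have [g gP] := resolvent_exists lam_gt0 Hf.
by rewrite /resolvent; case: xgetP => // /(_ g).
Qed.

Lemma resolvent_in f : H f -> V (J f).
Proof. by move=> /resolventP[]. Qed.

Lemma resolvent_inH f : H f -> H (J f).
Proof. by move=> /resolvent_in/VH. Qed.

Lemma resolventE f v : H f -> V v -> q (J f) v + lam * h (J f) v = lam * h f v.
Proof. by move=> /resolventP[_]; exact. Qed.

(** Test both equations with the difference D of the resolvents, then absorb the mixed term through
    [h (D - (f - g)) (D - (f - g)) >= 0]. This makes the resolvent continuous from H to V. *)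
Lemma resolvent_lip f g : H f -> H g ->
  q (J f - J g) (J f - J g) <= lam * h (f - g) (f - g).
Proof.
move=> Hf Hg; have VJf := resolvent_in Hf; have VJg := resolvent_in Hg.
have HJf := VH VJf; have HJg := VH VJg.
have VD := form_setB Fq VJf VJg; have HD := VH VD.
have Ef := resolventE Hf VD; have Eg := resolventE Hg VD.
have := form_ge0 Fh (form_setB Fh HD (form_setB Fh Hf Hg)).
rewrite (form_sqrB Fh)//; last exact: (form_setB Fh).
have e1 : h (J f - J g) (f - g) = h f (J f - J g) - h g (J f - J g).
  by rewrite (formC Fh)//; [rewrite (formBl Fh)|exact: (form_setB Fh)].
have e2 : h (J f - J g) (J f - J g) = h (J f) (J f - J g) - h (J g) (J f - J g).
  by rewrite (formBl Fh).
have e3 : q (J f - J g) (J f - J g) = q (J f) (J f - J g) - q (J g) (J f - J g).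
  by rewrite (formBl Fq).
have p0 := form_ge0 Fh (form_setB Fh Hf Hg).
have p1 := form_ge0 Fh HD.
have := resolvent_in Hf => _; rewrite e1 => p.
rewrite e3 in Ef Eg *.
have -> : q (J f) (J f - J g) - q (J g) (J f - J g) =
   lam * (h f (J f - J g) - h g (J f - J g) - h (J f - J g) (J f - J g)).
  by rewrite e2; lra.
rewrite ler_pM2l//; lra.
Qed.

(** The equation of each resolvent is tested with the other one; the left sides coincide by symmetry
    of the forms. *)
Lemma resolvent_sym f g : H f -> H g -> h f (J g) = h (J f) g.
Proof.
move=> Hf Hg; have VJf := resolvent_in Hf; have VJg := resolvent_in Hg.
have HJf := VH VJf; have HJg := VH VJg.
have := resolventE Hf VJg; have := resolventE Hg VJf.
rewrite (formC Fq VJg VJf) (formC Fh HJg HJf) (formC Fh Hg HJf) => -> /eqP.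
by rewrite (inj_eq (mulfI (lt0r_neq0 lam_gt0))) => /eqP.
Qed.

(** The quadratic form of the Yosida approximation [lam (id - J)]. It equals the Moreau envelope of
    [q], that is the minimum of [energy], but in this form its continuity for [h] is visible. *)
Definition envelope f := lam * h (f - J f) f.

Lemma envelopeE f : H f -> envelope f = energy lam f (J f).
Proof.
move=> Hf; have VJ := resolvent_in Hf; have HJ := VH VJ.
have := resolventE Hf VJ; rewrite /envelope /energy (form_sqrB Fh)// (formBl Fh)//.
by rewrite (formC Fh HJ Hf) => ?; lra.
Qed.

Lemma envelope_ge0 f : H f -> 0 <= envelope f.
Proof.
move=> Hf; rewrite envelopeE// /energy addr_ge0//.
  by rewrite (form_ge0 Fq)//; exact: resolvent_in.
rewrite mulr_ge0 ?(ltW lam_gt0)// (form_ge0 Fh)//.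
by apply: (form_setB Fh) => //; exact: resolvent_inH.
Qed.

Lemma envelope_le f : V f -> envelope f <= q f f.
Proof.
move=> Vf; have Hf := VH Vf; rewrite envelopeE//.
have := is_resolvent_energy Hf (resolventP Hf) Vf.
have VJ := resolvent_in Hf; have HJ := VH VJ.
have := form_ge0 Fq (form_setB Fq Vf VJ); have := form_ge0 Fh (form_setB Fh Hf HJ).
have -> : energy lam f f = q f f.
  by rewrite /energy subrr (form0l Fh) ?mulr0 ?addr0; last exact: (form0 Fh).
move=> p1 p2; have : 0 <= lam * h (f - J f) (f - J f) by rewrite mulr_ge0// ltW.
by move=> ? ?; lra.
Qed.

Lemma resolvent_form_le f : V f -> q (J f) (J f) <= q f f.
Proof.
move=> Vf; have Hf := VH Vf; apply: le_trans (envelope_le Vf).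
rewrite envelopeE// /energy lerDl mulr_ge0 ?(ltW lam_gt0)// (form_ge0 Fh)//.
by apply: (form_setB Fh) => //; exact: resolvent_inH.
Qed.

(** Stands in for the density of V in H: by symmetry the resolvent moves onto [v], where it takes
    values in V, so data that agree against V cannot be told apart. *)
Lemma resolvent_uniq f g : H f -> H g -> (forall v, V v -> h f v = h g v) ->
  forall v, H v -> h (J f) v = h (J g) v.
Proof.
move=> Hf Hg fg v Hv; rewrite -!resolvent_sym// fg//; exact: resolvent_in.
Qed.

End resolvent.

Section resolvent_limit.
Variables (H V : set E) (h q : E -> E -> R) (c : R).
Hypotheses (Fh : form_on H h) (Fq : form_on V q) (VH : V `<=` H).
Hypothesis h_le_q : forall x, V x -> h x x <= c * q x x.
Hypothesis V_complete : forall x : nat -> E, (forall n, V (x n)) ->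
  (forall eps : R, 0 < eps -> exists N, forall m n, (N <= m)%N -> (N <= n)%N ->
    q (x m - x n) (x m - x n) <= eps) ->
  exists2 y, V y & forall eps : R, 0 < eps -> exists N, forall n, (N <= n)%N ->
    q (x n - y) (x n - y) <= eps.
Local Notation J n := (resolvent V h q n.+1%:R).
Local Notation env n := (envelope V h q n.+1%:R).

Let ltn0 n : 0 < n.+1%:R :> R. Proof. by rewrite ltr0n. Qed.
Let JP n f (Hf : H f) := resolventP Fh Fq VH h_le_q V_complete (ltn0 n) Hf.
Let Jin n f (Hf : H f) := resolvent_in Fh Fq VH h_le_q V_complete (ltn0 n) Hf.

(** [J n f] is a competitor in the minimisation behind [env m f], and the excess in
    [is_resolvent_energy] is the distance of the two minimisers. So the envelopes increase, and
    where they stay bounded the resolvents are Cauchy in V. *)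
Lemma envelope_cauchy m n f : H f -> (m <= n)%N ->
  env m f + q (J n f - J m f) (J n f - J m f) <= env n f.
Proof.
move=> Hf mn; rewrite !(envelopeE Fh Fq VH h_le_q V_complete)//.
have Vm := Jin m Hf; have Vn := Jin n Hf; have Hm := VH Vm; have Hn := VH Vn.
have := is_resolvent_energy Fh Fq VH Hf (JP m Hf) Vn.
have : 0 <= m.+1%:R * h (J n f - J m f) (J n f - J m f).
  by rewrite mulr_ge0 ?(form_ge0 Fh)//; exact: (form_setB Fh).
suff : energy h q m.+1%:R f (J n f) <= energy h q n.+1%:R f (J n f) by move=> ? ? ?; lra.
rewrite /energy lerD2l ler_wpM2r ?ler_nat// (form_ge0 Fh)//; exact: (form_setB Fh).
Qed.

(* Lower semicontinuity of q with respect to h: g is the q-limit of the J_n f. *)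
Lemma envelope_bounded f M : H f -> (forall n, env n f <= M) ->
  exists g, [/\ V g, h (f - g) (f - g) = 0, q g g <= M &
    forall eps : R, 0 < eps -> exists N, forall n, (N <= n)%N ->
      q (J n f - g) (J n f - g) <= eps].
Proof.
move=> Hf envM.
have ndenv m n : (m <= n)%N -> env m f <= env n f.
  move=> mn; have := envelope_cauchy Hf mn.
  by have := form_ge0 Fq (form_setB Fq (Jin n Hf) (Jin m Hf)) => ? ?; lra.
pose A := [set env n f | n in [set: nat]].
have A0 : has_sup A.
  by split; [exists (env 0 f); exists 0|exists M => _ [n _ <-]].
have envsup n : env n f <= sup A by apply: sup_upper_bound => //; exists n.
have supM : sup A <= M.
  by apply: ge_sup => [|_ [n _ <-]//]; case: A0.
have [||g Vg gP] := V_complete (x := fun n => J n f).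
- by move=> n; exact: Jin.
- move=> eps e0; have [_ [N _ <-] NP] := sup_adherent e0 A0; exists N.
  suff main m n : (m <= n)%N -> (N <= m)%N -> q (J n f - J m f) (J n f - J m f) <= eps.
    move=> m n Nm Nn; have [mn|/ltnW nm] := leqP m n; last exact: main.
    by rewrite (form_sqrBC Fq)//; [exact: main|exact: Jin|exact: Jin].
  move=> mn Nm; have := envelope_cauchy Hf mn; have := ndenv _ _ Nm.
  by have := envsup n => ? ? ?; lra.
exists g; have Hg := VH Vg.
have qJM n : q (J n f) (J n f) <= M.
  apply: le_trans (envM n); rewrite (envelopeE Fh Fq VH h_le_q V_complete)//.
  rewrite /energy lerDl mulr_ge0// (form_ge0 Fh)//; apply: (form_setB Fh) => //.
  exact/VH/Jin.
have hJM n : h (f - J n f) (f - J n f) <= M / n.+1%:R.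
  rewrite ler_pdivlMr// mulrC; apply: le_trans (envM n).
  rewrite (envelopeE Fh Fq VH h_le_q V_complete)// /energy lerDr.
  by rewrite (form_ge0 Fq)//; exact: Jin.
have M0 : 0 <= M.
  apply: le_trans (envM 0); exact: (envelope_ge0 Fh Fq VH h_le_q V_complete).
split => //.
(* The energy bound gives [h (f - J n f) (f - J n f) <= M / n.+1%:R], and [h_le_q] turns the
   [q]-convergence of [J n f] to [g] into [h]-convergence. *)
- apply/eqP; rewrite eq_le (form_ge0 Fh) ?andbT; last exact: (form_setB Fh).
  apply/ler_addgt0Pl => eps e0; rewrite addr0.
  have c0 : 0 <= Num.max c 0 by rewrite le_max lexx orbT.
  have k0 : 0 < 4 * (Num.max c 0 + 1) by rewrite mulr_gt0// ltr_wpDl.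
  have [|N NP] := gP (eps / (4 * (Num.max c 0 + 1))); first by rewrite divr_gt0.
  have [|N' NP'] := div_natS_le M (eps := eps / 4); first by rewrite divr_gt0.
  pose n := maxn N N'.
  have VJ := Jin n Hf; have HJ := VH VJ.
  have := form_sqrD_le2 Fh (form_setB Fh Hf HJ) (form_setB Fh HJ Hg).
  rewrite addrA subrK.
  have n1 : h (f - J n f) (f - J n f) <= eps / 4.
    by apply: le_trans (hJM n) _; apply: NP'; exact: leq_maxr.
  have n2 : h (J n f - g) (J n f - g) <= eps / 4.
    have VD := form_setB Fq VJ Vg.
    apply: le_trans (h_le_q VD) _.
    have qn := NP _ (leq_maxl N N').
    have q0 := form_ge0 Fq VD.
    apply: (@le_trans _ _ ((Num.max c 0 + 1) * (eps / (4 * (Num.max c 0 + 1))))).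
      apply: (@le_trans _ _ ((Num.max c 0 + 1) * q (J n f - g) (J n f - g))).
        rewrite ler_wpM2r//; apply: (@le_trans _ _ (Num.max c 0)).
          by rewrite le_max lexx.
        by rewrite lerDl.
      by rewrite ler_wpM2l// addr_ge0.
    have -> : (Num.max c 0 + 1) * (eps / (4 * (Num.max c 0 + 1))) = eps / 4.
      by field; rewrite gt_eqF// ltr_wpDl.
    by [].
  by move=> ?; lra.
- apply/ler_addgt0Pl => /= eps e0.
  pose b := Num.sqrt M; have bb : b ^+ 2 = M by rewrite sqr_sqrtr.
  have b0 : 0 <= b by exact: sqrtr_ge0.
  pose a := Num.sqrt (q g g).
  have aa : a ^+ 2 = q g g by rewrite sqr_sqrtr// (form_ge0 Fq).
  have a0 : 0 <= a by exact: sqrtr_ge0.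
  suff ab : a <= b by rewrite -aa -bb; nra.
  apply/ler_addgt0Pl => d d0.
  have [|N NP] := gP (d ^+ 2); first by rewrite exprn_gt0.
  have VJ := Jin N Hf; have := form_norm_leB Fq Vg VJ.
  rewrite (form_sqrBC Fq)// => /le_trans/(_ (ler_wsqrtr (NP N (leqnn _)))).
  rewrite sqrtr_sqr gtr0_norm// lerBlDr => /le_trans; apply.
  by rewrite lerD2l ler_wsqrtr.
Qed.

Hypothesis h_null : forall x, V x -> h x x = 0 -> q x x = 0.

(** All envelopes are at most [q f f], so the resolvents converge in [q] to some [g] with
    [h (f - g) (f - g) = 0]; by [h_null] this limit is at [q]-distance 0 from [f]. *)
Lemma resolvent_cvg f : V f -> forall eps : R, 0 < eps ->
  exists N, forall n, (N <= n)%N -> q (J n f - f) (J n f - f) <= eps.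
Proof.
move=> Vf eps e0; have Hf := VH Vf.
have [n|g [Vg fg0 _ gP]] := @envelope_bounded f (q f f) Hf.
  exact: (envelope_le Fh Fq VH h_le_q V_complete).
have VJ n := Jin n Hf; have VD := form_setB Fq Vf Vg.
have fg := h_null VD fg0.
have [|N NP] := gP (eps / 2); first by rewrite divr_gt0.
exists N => n /NP; have VJg := form_setB Fq (VJ n) Vg.
have := form_sqrB Fq VJg VD.
have -> : J n f - g - (f - g) = J n f - f by rewrite opprB addrA subrK.
by rewrite fg (formC Fq VJg VD) (form_null Fq VD VJg fg) => -> ?; lra.
Qed.

End resolvent_limit.
End forms.

(** * Fatou's lemma and the completeness of the space of square-integrable functions *)

Lemma limn_einf_le (R : realType) (u : (\bar R)^nat) c N :
  (forall n, (N <= n)%N -> (u n <= c)%E) -> (limn_einf u <= c)%E.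
Proof.
move=> uc; rewrite limn_einf_lim; apply: lime_le; first exact: is_cvg_einfs.
near=> n; apply: (@le_trans _ _ (u (maxn N n))); last by apply: uc; exact: leq_maxl.
by apply: ereal_inf_lbound; exists (maxn N n) => //=; exact: leq_maxr.
Unshelve. all: by end_near. Qed.

Lemma fatou_le {dd} {T : measurableType dd} {R : realType}
    (mu : {measure set T -> \bar R}) (D : set T) (f_ : nat -> T -> \bar R) f c N :
  measurable D -> (forall n, measurable_fun D (f_ n)) ->
  (forall n x, D x -> 0 <= f_ n x)%E -> measurable_fun D f ->
  (forall x, D x -> 0 <= f x)%E ->
  {ae mu, forall x, D x -> f_ n x @[n --> \oo] --> f x} ->
  (forall n, (N <= n)%N -> \int[mu]_(x in D) f_ n x <= c)%E ->
  (\int[mu]_(x in D) f x <= c)%E.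
Proof.
move=> mD mf_ f_0 mf f0 f_f fc.
apply: (@le_trans _ _ (\int[mu]_(x in D) limn_einf (f_ ^~ x))%E); last first.
  by apply: le_trans (fatou mu mD mf_ f_0) _; exact: limn_einf_le fc.
apply: ae_ge0_le_integral => //.
- move=> x Dx; rewrite limn_einf_lim; apply: lime_ge; first exact: is_cvg_einfs.
  by near=> n; apply: le_ereal_inf_tmp => _ [m _ <-]; exact: f_0.
- rewrite (_ : (fun _ => _) = (fun x => - limn_esup (fun n => - f_ n x))%E).
    by apply: measurableT_comp => //; apply: measurable_fun_limn_esup => n;
      exact: measurableT_comp.
  apply/funext => x; rewrite -limn_einfN; congr limn_einf.
  by apply/funext => n /=; rewrite oppeK.
- apply: filterS f_f => x + Dx => /(_ Dx) /cvg_limn_einf_sup[-> _]; exact: lexx.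
Unshelve. all: by end_near. Qed.

Section square_integrable.
Context {dd : measure_display} {T : measurableType dd} {R : realType}.
Variables (mu : {measure set T -> \bar R}) (D : set T).
Hypothesis mD : measurable D.
Implicit Types f g : T -> R.

(** Stated for an abstract measure; for the Lebesgue measure on a domain, [sqint] and [ipL2] are
    convertible with [L2] and [ipH], so the lemmas transfer without rewriting. *)
Definition sqint f :=
  measurable_fun D f /\ mu.-integrable D (fun x => (f x ^+ 2)%:E).

Definition ipL2 f g : R := \int[mu]_(x in D) (f x * g x).

Lemma integrable_le f (g : T -> R) : measurable_fun D f ->
  (forall x, D x -> `|f x| <= g x) -> mu.-integrable D (EFin \o g) ->
  mu.-integrable D (EFin \o f).
Proof.
move=> mf fg ig; apply: le_integrable ig => //; first exact/measurable_EFinP.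
move=> x Dx /=; rewrite lee_fin; apply: le_trans (fg x Dx) _; exact: ler_norm.
Qed.

Lemma sqint_mul f g : sqint f -> sqint g ->
  mu.-integrable D (EFin \o (fun x => f x * g x)).
Proof.
move=> [mf f2] [mg g2].
apply: (@integrable_le _ (fun x => f x ^+ 2 + g x ^+ 2)).
- exact: measurable_funM.
- move=> x _; rewrite normrM -(real_normK (num_real (f x))) -(real_normK (num_real (g x))).
  have := sqr_ge0 (`|f x| - `|g x|); have := normr_ge0 (f x); have := normr_ge0 (g x).
  by set a := `|f x|; set b := `|g x| => ? ? ?; nra.
- exact: integrableD f2 g2.
Qed.

Lemma sqintS a f g : sqint f -> sqint g -> sqint (a *: f + g).
Proof.
move=> sf sg; have [mf f2] := sf; have [mg g2] := sg; split.
  by apply: measurable_funD => //; exact: measurable_funM.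
have -> : (fun x => (((a *: f + g) x) ^+ 2)%:E) =
    (((fun x => (a ^+ 2)%:E * (f x ^+ 2)%:E) \+
    (fun x => (2 * a)%:E * (f x * g x)%:E)) \+ (fun x => (g x ^+ 2)%:E))%E.
  by apply/funext => x /=; rewrite -!EFinM -!EFinD; congr EFin => /=;
    rewrite -[(a *: f + g) x]/(a * f x + g x); ring.
do 2 (apply: integrableD => //); first exact: integrableZl.
by apply: integrableZl => //; exact: sqint_mul.
Qed.

Lemma sqint0 : sqint 0.
Proof.
split; first exact: measurable_cst.
by apply: eq_integrable (integrable0 _ _) => // x _; rewrite expr0n.
Qed.

Lemma sqint_form : form_on sqint ipL2.
Proof.
split; [exact: sqint0|exact: sqintS| | |].
- by move=> f g _ _; apply: eq_Rintegral => x _; rewrite mulrC.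
- move=> a f g k sf sg sk; rewrite /ipL2 -RintegralZl -?RintegralD//; last 3 first.
  + apply: (@eq_integrable _ _ _ _ _ mD (fun x => a%:E * (f x * k x)%:E)%E) => //.
    by apply: (integrableZl mD); exact: sqint_mul.
  + exact: sqint_mul.
  + exact: sqint_mul.
  by apply: eq_Rintegral => x _; rewrite -[(a *: f + g) x]/(a * f x + g x); ring.
- by move=> f sf; apply: Rintegral_ge0 => x _; rewrite -expr2 sqr_ge0.
Qed.

Lemma ipL2E f g : sqint f -> sqint g ->
  (ipL2 f g)%:E = (\int[mu]_(x in D) (f x * g x)%:E)%E.
Proof.
move=> sf sg; rewrite fineK//; exact: integrable_fin_num (sqint_mul sf sg).
Qed.

Lemma ipL2_sqr f : sqint f -> (ipL2 f f)%:E = (\int[mu]_(x in D) (f x ^+ 2)%:E)%E.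
Proof. by move=> sf; rewrite ipL2E. Qed.

Lemma ipL2_null f : sqint f -> ipL2 f f = 0 -> {ae mu, forall x, D x -> f x = 0}.
Proof.
move=> sf f0; have [mf f2] := sf.
have : ae_eq mu D (fun x => (f x ^+ 2)%:E) (cst 0)%E.
  apply/(ae_eq_integral_abs mu mD); first exact: (measurable_int mu f2).
  transitivity (\int[mu]_(x in D) (f x ^+ 2)%:E)%E.
    by apply: eq_integral => x _; rewrite gee0_abs// lee_fin sqr_ge0.
  by rewrite -ipL2_sqr// f0.
apply: filterS => x /[apply] -[] /eqP; rewrite sqrf_eq0 => /eqP//.
Qed.

Lemma ipL2_ae0 f g : sqint f -> sqint g -> {ae mu, forall x, D x -> f x = 0} ->
  ipL2 f g = 0.
Proof.
move=> sf sg f0; rewrite /ipL2 /Rintegral (ae_eq_integral (cst 0%E))//.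
- by rewrite integral0.
- exact: measurable_int (sqint_mul sf sg).
- by apply: filterS f0 => x /[apply] ->; rewrite mul0r.
Qed.

Lemma sqint_le f g : measurable_fun D f -> (forall x, D x -> `|f x| <= `|g x|) ->
  sqint g -> sqint f.
Proof.
move=> mf fg [mg g2]; split => //.
apply: (@integrable_le (fun x => f x ^+ 2) (fun x => g x ^+ 2)) => //.
  exact: measurable_funX.
move=> x Dx; rewrite ger0_norm ?sqr_ge0// -(real_normK (num_real (f x))) -(real_normK (num_real (g x))).
by rewrite lerXn2r ?nnegrE// fg.
Qed.

Section completeness.
Hypothesis muD : (mu D < +oo)%E.

Lemma sqint_cst c : sqint (cst c).
Proof.
split; first exact: measurable_cst.
apply: (@measurable_bounded_integrable _ _ _ _ (cst (c ^+ 2))) => //.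
exists (c ^+ 2); split; first by rewrite num_real.
by move=> x cx y _ /=; rewrite ger0_norm ?sqr_ge0// ltW.
Qed.

Lemma sqint_integrable f : sqint f -> mu.-integrable D (EFin \o f).
Proof.
move=> /sqint_mul/(_ (sqint_cst 1)); apply: eq_integrable => // x _ /=.
by rewrite mulr1.
Qed.

(** Cauchy-Schwarz against the constant 1. It turns the summable L^2 increments of a subsequence
    into summable L^1 increments. *)
Lemma integral_abs_le f : sqint f ->
  (\int[mu]_(x in D) `|f x|%:E <=
    (Num.sqrt (fine (mu D)) * Num.sqrt (ipL2 f f))%:E)%E.
Proof.
move=> sf; have [mf f2] := sf.
have sa : sqint (fun x => `|f x|).
  apply: sqint_le sf => [|x _]; [exact: measurableT_comp|by rewrite normr_id].
have := form_abs_le sqint_form (sqint_cst 1) sa.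
have -> : ipL2 (cst 1) (cst 1) = fine (mu D).
  transitivity (\int[mu]_(x in D) 1 : R); last by rewrite Rintegral_cst// mul1r.
  by apply: eq_Rintegral => x _; rewrite mulr1.
have -> : ipL2 (fun x => `|f x|) (fun x => `|f x|) = ipL2 f f.
  by apply: eq_Rintegral => x _; rewrite -normrM ger0_norm// -expr2 sqr_ge0.
rewrite -lee_fin => /(le_trans _); apply.
rewrite -(@gee0_abs _ (\int[mu]_(x in D) `|f x|%:E)%E); last exact: integral_ge0.
rewrite (eq_integral (fun x => (cst 1 x * `|f x|)%:E)); last by move=> x _; rewrite mul1r.
by rewrite -(ipL2E (sqint_cst 1) sa).
Qed.

(** Riesz-Fischer theorem: a subsequence with increments of norm at most 2^-k has a telescoping
    series that converges absolutely almost everywhere, and Fatou's lemma hands the Cauchy estimate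
    over to the limit. *)
Lemma sqint_complete (f : nat -> T -> R) : (forall n, sqint (f n)) ->
  (forall eps : R, 0 < eps -> exists N, forall m n, (N <= m)%N -> (N <= n)%N ->
    ipL2 (f m - f n) (f m - f n) <= eps) ->
  exists2 g, sqint g & forall eps : R, 0 < eps -> exists N, forall n, (N <= n)%N ->
    ipL2 (f n - g) (f n - g) <= eps.
Proof.
move=> sf fcauchy.
have /choice[N0 N0P] k : exists N, forall m n, (N <= m)%N -> (N <= n)%N ->
    ipL2 (f m - f n) (f m - f n) <= (2^-1 ^+ k) ^+ 2.
  by apply: fcauchy; rewrite !exprn_gt0// invr_gt0.
(* The sum makes [N] nondecreasing and at least [N0 k]; the extra [k] ensures [k <= N k], which is
   used when Fatou's lemma is applied from rank [n] on. *)
pose N k := (\sum_(j < k.+1) N0 j + k)%N.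
have N0N k : (N0 k <= N k)%N by rewrite /N big_ord_recr /= -addnA addnC -addnA leq_addr.
have NS k : (N k <= N k.+1)%N 
  by rewrite /N; apply: leq_add => //; rewrite [leqRHS]big_ord_recr leq_addr.
pose g k := f (N k); pose dg k := g k.+1 - g k.
have sg k : sqint (g k) by exact: sf.
have sdg k : sqint (dg k) by apply: (form_setB sqint_form).
have mg k : measurable_fun D (g k) by case: (sg k).
have mdg k : measurable_fun D (dg k) by case: (sdg k).
have dgk k : ipL2 (dg k) (dg k) <= (2^-1 ^+ k) ^+ 2.
  by apply: N0P => //; apply: leq_trans (NS k).
have sum_fin : (\sum_(k <oo) \int[mu]_(x in D) `|dg k x|%:E < +oo)%E.
  apply: (@le_lt_trans _ _ (\sum_(k <oo)
     (Num.sqrt (fine (mu D)) / (2 ^ k)%:R)%:E)%E).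
    apply: lee_nneseries => [k _ _|k _]; first exact: integral_ge0.
    apply: le_trans (integral_abs_le (sdg k)) _; rewrite lee_fin ler_wpM2l ?sqrtr_ge0//.
    rewrite natrX -exprVn; apply: le_trans (ler_wsqrtr (dgk k)) _.
    by rewrite sqrtr_sqr ger0_norm// exprn_ge0.
  apply: (@le_lt_trans _ _ (\sum_(k <oo)
     (2 * Num.sqrt (fine (mu D)) / (2 ^ k.+1)%:R)%:E)%E).
    apply: lee_nneseries => [k _ _|k _]; rewrite lee_fin.
      by rewrite divr_ge0// sqrtr_ge0.
    have -> // : Num.sqrt (fine (mu D)) / (2 ^ k)%:R =
      2 * Num.sqrt (fine (mu D)) / (2 ^ k.+1)%:R.
    by rewrite expnS natrM; field; rewrite pnatr_eq0 expn_eq0.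
  apply: le_lt_trans (ltry _); apply: epsilon_trick0.
  by rewrite mulr_ge0 ?sqrtr_ge0.
(* An upper limit is measurable whatever happens on the null set where the subsequence diverges. *)
pose gl x := fine (limn_esup (fun k => (g k x)%:E)).
have mgl : measurable_fun D gl.
  apply: (@measurableT_comp _ _ _ _ _ _ fine) => //.
  by apply: measurable_fun_limn_esup => k; exact/measurable_EFinP.
have gcvg : {ae mu, forall x, D x -> g k x @[k --> \oo] --> gl x}.
  have : {ae mu, forall x, D x -> (\sum_(k <oo) `|dg k x|%:E)%E \is a fin_num}.
    apply: integrable_ae => //; apply/integrableP; split.
      apply: ge0_emeasurable_sum => // k _; apply/measurable_EFinP.
      exact: measurableT_comp.
    under eq_integral do rewrite gee0_abs ?nneseries_ge0//.
    rewrite integral_nneseries// => k; apply/measurable_EFinP.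
    exact: measurableT_comp.
  apply: filterS => x + Dx => /(_ Dx) fin.
  have /normed_cvg : cvgn [normed series (fun k => dg k x : R^o)].
    apply: nondecreasing_is_cvgn.
      move=> m n mn.
      by refine (@nondecreasing_series _ (fun k => `|dg k x|) xpredT 0 _ m n mn).
    exists (fine (\sum_(k <oo) `|dg k x|%:E)%E) => _ [n _ <-].
    rewrite -lee_fin fineK// /series /= -sumEFin.
    by apply: nneseries_lim_ge => k _ _; rewrite lee_fin.
  move=> /cvg_ex[l sl].
  have gl_ : g k x @[k --> \oo] --> g 0 x + l.
    have -> : (fun k => g k x) = (fun k => g 0 x + series (fun k => dg k x) k).
      apply/funext => k; rewrite /series /= (@telescope_sumr _ 0 k (fun k => g k x))//.
      by rewrite addrC subrK.
    by apply: cvgD => //; exact: cvg_cst.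
  have -> // : gl x = g 0 x + l.
  rewrite /gl; have /cvg_limn_einf_sup[_ ->//] : (g k x)%:E @[k --> \oo] --> (g 0 x + l)%:E.
  by apply/cvg_EFin => //; near=> k.
have mfgl n : measurable_fun D (f n - gl).
  by apply: measurable_funB => //; case: (sf n).
have fatou_ n (eps : R) :
    (forall k, (n <= k)%N -> ipL2 (f n - f k) (f n - f k) <= eps) ->
    (\int[mu]_(x in D) (((f n - gl) x) ^+ 2)%:E <= eps%:E)%E.
  move=> fe; apply: (@fatou_le _ _ _ mu D (fun k x => (((f n - g k) x) ^+ 2)%:E)
    _ _ n) => //.
  - by move=> k; apply/measurable_EFinP; apply: measurable_funX;
      case: (form_setB sqint_form (sf n) (sg k)).
  - by move=> k x _; rewrite lee_fin sqr_ge0.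
  - by apply/measurable_EFinP; exact: measurable_funX.
  - by move=> x _; rewrite lee_fin sqr_ge0.
  - apply: filterS gcvg => x + Dx => /(_ Dx) gx.
    apply/cvg_EFin; first by near=> k.
    have gx' : (f n - g k) x @[k --> \oo] --> (f n - gl) x.
      by apply: cvgB => //; exact: cvg_cst.
    rewrite [X in X @ _ --> _](_ : _ = (fun k => (f n - g k) x * (f n - g k) x)).
      by rewrite expr2; exact: cvgM.
    by apply/funext => k /=; rewrite expr2.
  - move=> k nk; rewrite -ipL2_sqr ?lee_fin; last exact: (form_setB sqint_form).
    by apply: fe; apply: leq_trans nk _; exact: leq_addl.
have sfgl n : (N0 0 <= n)%N -> sqint (f n - gl).
  move=> Nn; split => //; apply/integrableP; split.
    by apply/measurable_EFinP; exact: measurable_funX.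
  under eq_integral do rewrite gee0_abs ?lee_fin ?sqr_ge0//.
  apply: le_lt_trans (ltry 1); apply: (fatou_ n) => k nk.
  by have := N0P 0%N n k Nn (leq_trans Nn nk); rewrite expr0 expr1n.
exists gl.
  have -> : gl = f (N0 0) - (f (N0 0) - gl) by rewrite opprB addrC subrK.
  by apply: (form_setB sqint_form) => //; exact: sfgl.
move=> eps e0; have [M MP] := fcauchy eps e0; exists (maxn M (N0 0)) => n.
rewrite geq_max => /andP[Mn Nn]; rewrite -lee_fin ipL2_sqr; last exact: sfgl.
by apply: fatou_ => k nk; apply: MP => //; exact: leq_trans nk.
Unshelve. all: by end_near. Qed.

End completeness.
End square_integrable.

(** * The Loomis-Whitney inequality *)

Lemma eqW {disp : Order.disp_t} {T : porderType disp} (x y : T) :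
  x = y -> (x <= y)%O.
Proof. by move->. Qed.

Section rV_topology_measure.
Context {R : realType}.

(** The sigma-algebra is generated by the coordinates, so the open set is written as the countable
    union of those boxes with rational centre and radius [q.2.+1%:R^-1] that it contains. *)
Lemma open_rV_measurable d (A : set 'rV[R]_d) : open A -> measurable A.
Proof.
move=> oA.
pose B (q : 'rV[rat]_d * nat) : set 'rV[R]_d :=
  [set x | forall i, `|x ord0 i - ratr (q.1 ord0 i)| < q.2.+1%:R^-1].
pose B' q := if `[< B q `<=` A >] then B q else set0.
have -> : A = \bigcup_q B' q.
  apply/seteqP; split => [x Ax|x [q _]]; last first.
    by rewrite /B'; case: ifP => // /asboolP; exact.
  have /nbhs_ballP[e /= e0 xeA] := open_nbhs_nbhs (conj oA Ax).
  have [n nP] := div_natS_le 2 e0.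
  have /choice[q qP] i : exists q : rat, `|x ord0 i - ratr q| < n.+1%:R^-1.
    have [|q] := @rat_in_itvoo R (x ord0 i - n.+1%:R^-1) (x ord0 i + n.+1%:R^-1).
      by rewrite ltrBlDr -addrA ltrDl addr_gt0// invr_gt0.
    by rewrite in_itv/= => qi; exists q; rewrite ltr_distlC.
  exists (\row_i q i, n) => //; rewrite /B' ifT.
    by move=> i; rewrite mxE; exact: qP.
  apply/asboolP => y yB; apply: xeA; split => // i j; rewrite ord1.
  apply: lt_le_trans (nP n (leqnn _)); have := yB j; rewrite mxE => yq.
  rewrite (_ : x ord0 j - y ord0 j =
    (x ord0 j - ratr (q j)) - (y ord0 j - ratr (q j))); last by ring.
  apply: le_lt_trans (ler_normB _ _) _; rewrite mulr_natl mulr2n.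
  by apply: ltrD => //; exact: qP.
apply: countable_bigcupT_measurable => [|q]; first exact: countableP.
rewrite /B'; case: ifP => _; last exact: measurable0.
rewrite (_ : B q = \bigcap_(i : 'I_d)
    [set x : 'rV[R]_d | `|x ord0 i - ratr (q.1 ord0 i)| < q.2.+1%:R^-1]).
  apply: fin_bigcap_measurable => // i _.
  rewrite -[X in measurable X]setTI.
  rewrite (_ : [set _ | _] = (fun x : 'rV[R]_d => x ord0 i : measurableTypeR R) @^-1`
     `]ratr (q.1 ord0 i) - q.2.+1%:R^-1, ratr (q.1 ord0 i) + q.2.+1%:R^-1[).
    by apply: measurable_coord.
  by apply/seteqP; split => x /=; rewrite in_itv/= ltr_distl.
by apply/seteqP; split => x /= xi i => [_|]; exact: xi.
Qed.

Lemma continuous_rV_measurable d (f : 'rV[R]_d -> R) : continuous f ->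
  measurable_fun setT f.
Proof.
move=> cf; apply: (measurability _ (RGenOInfty.measurableE R)).
move=> _ [_ [a ->] <-]; rewrite setTI; apply: open_rV_measurable.
by move/continuousP : cf; apply; exact: interval_open.
Qed.

Lemma coord_norm_le d (x : 'rV[R]_d) i : `|x ord0 i| <= `|x|.
Proof.
rewrite [leRHS]/Num.Def.normr/= mx_normrE.
by apply: (le_trans _ (le_bigmax _ _ (ord0, i))).
Qed.

Lemma bounded_rV_box d (A : set 'rV[R]_d) : bounded_set A ->
  exists M : R, 0 < M /\ forall x, A x -> forall i, `|x ord0 i| <= M.
Proof.
move=> /pinfty_ex_gt0[M M0 AM]; exists M; split => // x Ax i.
exact: le_trans (coord_norm_le _ _) (AM _ Ax).
Qed.

Lemma bounded_rV_fin_measure d (A : set 'rV[R]_d) : measurable A -> bounded_set A ->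
  (lebesgue_rV d A < +oo)%E.
Proof.
move=> mA /bounded_rV_box[M [M0 AM]].
pose box : set 'rV[R]_d := [set x | forall i, (`[-M, M]%classic : set R) (x ord0 i)].
have mbox : measurable box.
  rewrite (_ : box = \bigcap_(i : 'I_d)
    [set x : 'rV[R]_d | (`[-M, M]%classic : set R) (x ord0 i)]).
    apply: fin_bigcap_measurable => // i _.
    rewrite -[X in measurable X]setTI.
    exact: (@measurable_coord R d i measurableT).
  by apply/seteqP; split => x /= xi i => [_|]; exact: xi.
apply: (@le_lt_trans _ _ (lebesgue_rV d box)).
  apply: le_measure; rewrite ?inE//.
  by move=> x Ax i /=; rewrite in_itv/= -ler_norml; exact: AM.
rewrite (@lebesgue_rV_box _ _ (fun=> `[-M, M]%classic))//.
suff : (\prod_(i < d) lebesgue_measure (`[(- M)%R, M]%classic : set R) \is a fin_num)%E.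
  by rewrite fin_numElt => /andP[].
elim/big_ind : _ => // [x y|i _]; first exact: fin_numM.
by rewrite lebesgue_measure_itv/=; case: ifP.
Qed.

Lemma integral_rV_cons n (f : 'rV[R]_n.+1 -> \bar R) :
  measurable_fun setT f -> (forall x, 0 <= f x)%E ->
  (\int[lebesgue_rV n.+1]_x f x =
   \int[lebesgue_measure]_x \int[lebesgue_rV n]_y f (rV_cons (x, y)))%E.
Proof.
move=> mf f0.
transitivity (\int[(lebesgue_measure \x lebesgue_rV n)%E]_z (f \o @rV_cons R n) z)%E.
  by rewrite /= (ge0_integral_pushforward (@measurable_rV_cons R n)).
apply: (@fubini_tonelli1 _ _ _ _ R lebesgue_measure (lebesgue_rV n) (f \o @rV_cons R n)) => //=.
by apply: (measurableT_comp mf); exact: measurable_rV_cons.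
Qed.

Definition upd d (x : 'rV[R]_d) (i : 'I_d) (r : R) : 'rV[R]_d :=
  \row_j if j == i then r else x ord0 j.

Lemma measurable_upd d (i : 'I_d) :
  measurable_fun setT (fun z : 'rV[R]_d * measurableTypeR R => upd z.1 i z.2).
Proof.
apply: measurable_fun_rV => j; rewrite /comp.
have [->|ji] := eqVneq j i.
  rewrite (_ : (fun _ => _) = snd); first exact: measurable_snd.
  by apply/funext => z; rewrite mxE eqxx.
rewrite (_ : (fun _ => _) = (fun z : 'rV[R]_d * measurableTypeR R => z.1 ord0 j)).
  exact: (measurableT_comp (measurable_coord j) measurable_fst).
by apply/funext => z; rewrite mxE (negbTE ji).
Qed.

Lemma rV_cons_head n (x : R) (y : 'rV[R]_n) : rV_cons (x, y) ord0 ord0 = x.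
Proof.
rewrite /rV_cons (_ : ord0 = @lshift 1 n ord0); last exact/val_inj.
by rewrite (@row_mxEl R 1 1 n) mxE eqxx mulr1n.
Qed.

Lemma rV_cons_behead n (x : R) (y : 'rV[R]_n) i :
  rV_cons (x, y) ord0 (lift ord0 i) = y ord0 i.
Proof.
rewrite /rV_cons (_ : lift ord0 i = @rshift 1 n i); last exact/val_inj.
by rewrite (@row_mxEr R 1 1 n).
Qed.

Lemma upd_cons0 n (x r : R) (y : 'rV[R]_n) :
  upd (rV_cons (x, y)) ord0 r = rV_cons (r, y).
Proof.
apply/rowP => j; rewrite mxE; have [k ->|->] := unliftP ord0 j.
  by rewrite !rV_cons_behead.
by rewrite eqxx rV_cons_head.
Qed.

Lemma upd_consS n (x r : R) (y : 'rV[R]_n) (i : 'I_n) :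
  upd (rV_cons (x, y)) (lift ord0 i) r = rV_cons (x, upd y i r).
Proof.
apply/rowP => j; rewrite mxE; have [k ->|->] := unliftP ord0 j.
  by rewrite !rV_cons_behead mxE (inj_eq (@lift_inj _ ord0)).
by rewrite !rV_cons_head.
Qed.

End rV_topology_measure.

Section poweR_integral.
Local Open Scope ereal_scope.

Lemma measurable_poweR (R : realType) (r : R) :
  measurable_fun setT (fun x : \bar R => x `^ r).
Proof.
rewrite (_ : (fun _ => _) = (fun x : \bar R =>
    if x == +oo then +oo `^ r else
    if x == -oo then -oo `^ r else ((fine x) `^ r)%:E)); last first.
  by apply/funext => -[x| |].
apply: measurable_fun_ifT => //; first exact: measurable_fun_eqe.
apply: measurable_fun_ifT => //; first exact: measurable_fun_eqe.
apply/measurable_EFinP; apply: (@measurableT_comp _ _ _ _ _ _ (fun x : R => x `^ r)%R _ fine) => //.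
Qed.

Lemma le_poweR (R : realType) (r : R) (x y : \bar R) : (0 <= r)%R -> 0 <= x ->
  x <= y -> x `^ r <= y `^ r.
Proof.
move=> r0 x0 xy; apply: gt0_ler_poweR => //; rewrite in_itv/= leey andbT//.
exact: le_trans xy.
Qed.

Lemma poweR_prod (R : realType) (I : Type) (s : seq I) (f : I -> \bar R) (r : R) :
  (forall i, 0 <= f i) -> (\prod_(i <- s) f i) `^ r = \prod_(i <- s) (f i `^ r).
Proof.
move=> f0; elim: s => [|i s IH]; first by rewrite !big_nil poweR1r.
by rewrite !big_cons poweRM ?IH// prode_ge0.
Qed.

Context d (T : measurableType d) (R : realType).
Variable mu : {measure set T -> \bar R}.

Lemma emeasurable_prod (I : Type) (s : seq I) (D : set T) (f : I -> T -> \bar R) :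
  (forall i, measurable_fun D (f i)) ->
  measurable_fun D (fun x => \prod_(i <- s) f i x).
Proof.
move=> mf; elim: s => [|i s IH].
  by under eq_fun do rewrite big_nil; exact: measurable_cst.
by under eq_fun do rewrite big_cons; exact: emeasurable_funM.
Qed.

(** Weighted arithmetic-geometric mean inequality for [x / a] and [y / b]. In Hoelder's inequality
    [a] and [b] are the two integrals, so that the right side integrates to a^t b^(1 - t). *)
Lemma young_poweR (x y : \bar R) (a b t : R) : 0 <= x -> 0 <= y ->
  (0 < a)%R -> (0 < b)%R -> (0 < t < 1)%R ->
  x `^ t * y `^ (1 - t) <=
  (a `^ t * b `^ (1 - t))%:E * ((t / a)%:E * x + ((1 - t) / b)%:E * y).
Proof.
move=> x0 y0 a0 b0 /andP[t0 t1]; have t1' : (0 < 1 - t)%R by rewrite subr_gt0.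
have ab : (0 < a `^ t * b `^ (1 - t))%R by rewrite mulr_gt0// powR_gt0.
case: x x0 => [x| |] // x0; case: y y0 => [y| |] // y0.
- rewrite !poweR_EFin -!EFinM lee_fin.
  rewrite !lee_fin in x0 y0.
  have := @conjugate_powR R ((x / a) `^ t)%R ((y / b) `^ (1 - t))%R t^-1%R (1 - t)^-1%R.
  rewrite !powR_ge0 !invr_gt0 !invrK -!powRrM !divff ?gt_eqF// t0 t1'.
  rewrite !powRr1 ?divr_ge0 ?(ltW a0) ?(ltW b0)// => /(_ isT isT isT isT).
  rewrite addrCA subrr addr0 => /(_ erefl).
  move=> /(ler_wpM2l (ltW ab)) H.
  have e (u v w : R) : (0 < v)%R -> (0 <= u)%R -> (u `^ w = v `^ w * (u / v) `^ w)%R.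
    move=> v0 u0; rewrite -powRM ?divr_ge0 ?(ltW v0)//; congr (_ `^ _)%R.
    by field; rewrite gt_eqF.
  rewrite (e x a t)// (e y b (1 - t)%R)//.
  by apply: le_trans (le_trans _ H) _; apply: eqW; ring.
- rewrite (@mulry _ ((1 - t) / b)) gtr0_sg ?divr_gt0// mul1e addey// mulry gtr0_sg//.
  by rewrite mul1e leey.
- rewrite (@mulry _ (t / a)) gtr0_sg ?divr_gt0// mul1e addye// mulry gtr0_sg//.
  by rewrite mul1e leey.
- rewrite (@mulry _ (t / a)) gtr0_sg ?divr_gt0// mul1e.
  rewrite (@mulry _ ((1 - t) / b)) gtr0_sg ?divr_gt0// mul1e addye// mulry gtr0_sg//.
  by rewrite mul1e leey.
Qed.

Variable D : set T.
Hypothesis mD : measurable D.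

Lemma ge0_integral_eq0 (f : T -> \bar R) : measurable_fun D f ->
  (forall x, D x -> 0 <= f x) -> \int[mu]_(x in D) f x = 0 -> ae_eq mu D f (cst 0).
Proof.
move=> mf f0 i0; apply/ae_eq_integral_abs => //.
by rewrite -[RHS]i0; apply: eq_integral => x /[!inE] Dx; rewrite gee0_abs// f0.
Qed.

(** Everything is extended-valued because integrals over lines may be infinite in the Loomis-Whitney
    argument. Integrals equal to 0 or to [+oo] are treated first; otherwise they normalise Young's
    inequality. *)
Lemma hoelder_poweR (f g : T -> \bar R) (t : R) : (0 < t <= 1)%R ->
  measurable_fun D f -> measurable_fun D g ->
  (forall x, D x -> 0 <= f x) -> (forall x, D x -> 0 <= g x) ->
  \int[mu]_(x in D) (f x `^ t * g x `^ (1 - t)) <=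
  (\int[mu]_(x in D) f x) `^ t * (\int[mu]_(x in D) g x) `^ (1 - t).
Proof.
move=> /andP[t0 t1] mf mg f0 g0.
have If0 : 0 <= \int[mu]_(x in D) f x by exact: integral_ge0.
have Ig0 : 0 <= \int[mu]_(x in D) g x by exact: integral_ge0.
have [->|tn1] := eqVneq t 1%R.
  rewrite subrr poweRe0 mule1 poweRe1//; apply/eqW/eq_integral => x /[!inE] Dx.
  by rewrite poweRe0 mule1 poweRe1// f0.
have t01 : (0 < t < 1)%R by rewrite t0 lt_neqAle tn1.
have t1' : (0 < 1 - t)%R by rewrite subr_gt0; case/andP : t01.
have mpow h r : measurable_fun D h -> measurable_fun D (fun x => h x `^ r).
  by move=> mh; apply: (measurableT_comp (measurable_poweR r)).
have mfg : measurable_fun D (fun x => f x `^ t * g x `^ (1 - t)).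
  by apply: emeasurable_funM; exact: mpow.
have zero : ae_eq mu D (fun x => f x `^ t * g x `^ (1 - t)) (cst 0) ->
    \int[mu]_(x in D) (f x `^ t * g x `^ (1 - t)) = 0.
  by move=> h; rewrite (ae_eq_integral (cst 0))// integral0.
have [If|If] := eqVneq (\int[mu]_(x in D) f x) 0.
  rewrite zero ?mule_ge0 ?poweR_ge0//.
  apply: filterS (ge0_integral_eq0 mf f0 If) => x /[apply] ->.
  by rewrite poweR0r ?mul0e// gt_eqF.
have [Ig|Ig] := eqVneq (\int[mu]_(x in D) g x) 0.
  rewrite zero ?mule_ge0 ?poweR_ge0//.
  apply: filterS (ge0_integral_eq0 mg g0 Ig) => x /[apply] ->.
  by rewrite [_ `^ (1 - t)]poweR0r ?mule0// gt_eqF.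
have If' : 0 < \int[mu]_(x in D) f x by rewrite lt_def If.
have Ig' : 0 < \int[mu]_(x in D) g x by rewrite lt_def Ig.
have [Ify|Ify] := eqVneq (\int[mu]_(x in D) f x) +oo.
  by rewrite Ify poweRyr ?gt_eqF// gt0_mulye ?leey// poweR_gt0.
have [Igy|Igy] := eqVneq (\int[mu]_(x in D) g x) +oo.
  by rewrite Igy poweRyr ?gt_eqF// gt0_muley ?leey// poweR_gt0.
have Ff : \int[mu]_(x in D) f x \is a fin_num by rewrite ge0_fin_numE// lt_neqAle Ify leey.
have Fg : \int[mu]_(x in D) g x \is a fin_num by rewrite ge0_fin_numE// lt_neqAle Igy leey.
have a0 : (0 < fine (\int[mu]_(x in D) f x))%R by rewrite -lte_fin fineK.
have b0 : (0 < fine (\int[mu]_(x in D) g x))%R by rewrite -lte_fin fineK.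
have aE := fineK Ff; have bE := fineK Fg.
set a := fine _ in a0 aE; set b := fine _ in b0 bE.
have c0 : (0 <= a `^ t * b `^ (1 - t))%R by rewrite mulr_ge0// powR_ge0.
have ta0 : (0 <= t / a)%R by rewrite divr_ge0// ltW.
have tb0 : (0 <= (1 - t) / b)%R by rewrite divr_ge0// ltW.
have m1 : measurable_fun D (fun x => (t / a)%:E * f x) by exact: measurable_funeM.
have m2 : measurable_fun D (fun x => ((1 - t) / b)%:E * g x) by exact: measurable_funeM.
have p1 x : D x -> 0 <= (t / a)%:E * f x by move=> Dx; rewrite mule_ge0 ?f0.
have p2 x : D x -> 0 <= ((1 - t) / b)%:E * g x by move=> Dx; rewrite mule_ge0 ?g0.
apply: (@le_trans _ _ (\int[mu]_(x in D) ((a `^ t * b `^ (1 - t))%:E *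
    ((t / a)%:E * f x + ((1 - t) / b)%:E * g x)))).
  apply: ge0_le_integral => //.
  - by move=> x _; rewrite mule_ge0 ?poweR_ge0.
  - by apply: measurable_funeM; exact: emeasurable_funD.
  - by move=> x Dx; apply: young_poweR; rewrite ?f0 ?g0.
rewrite ge0_integralZl//; last 2 first.
- exact: emeasurable_funD.
- by move=> x Dx; rewrite adde_ge0 ?p1 ?p2.
rewrite ge0_integralD// !ge0_integralZl// -aE -bE !poweR_EFin -!EFinM.
rewrite lee_fin !divfK ?gt_eqF// addrCA subrr addr0 mulr1//.
Qed.

(** One factor is split off with the exponents 1 / (m + 2) and (m + 1) / (m + 2); the other factors
    form the product of the induction hypothesis raised to the second exponent, by the identity
    [tE]. *)
Lemma prod_hoelder_poweR m (G : 'I_m.+1 -> T -> \bar R) :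
  (forall j, measurable_fun D (G j)) -> (forall j x, D x -> 0 <= G j x) ->
  \int[mu]_(x in D) \prod_j (G j x `^ m.+1%:R^-1) <=
  \prod_j (\int[mu]_(x in D) G j x) `^ m.+1%:R^-1.
Proof.
elim: m G => [|m IH] G mG G0.
  rewrite big_ord_recl big_ord0 mule1 invr1 poweRe1 ?integral_ge0//; last exact: G0.
  apply/eqW/eq_integral => x /[!inE] Dx.
  by rewrite big_ord_recl big_ord0 mule1 poweRe1// G0.
have tE : (m.+2%:R^-1 = m.+1%:R^-1 * (1 - m.+2%:R^-1) :> R)%R.
  have k0 : (0 < m.+1%:R :> R)%R by rewrite ltr0n.
  rewrite -(natr1 m.+1); move: (m.+1%:R) k0 => k k0; field.
  by rewrite !gt_eqF// addr_gt0.
have t01 : (0 < (m.+2%:R^-1 : R) <= 1)%R.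
  by rewrite invr_gt0 ltr0n/= invf_le1 ?ltr0n// ler1n.
have pE (f : 'I_m.+1 -> \bar R) : (forall j, 0 <= f j) ->
    \prod_j (f j `^ m.+2%:R^-1) = (\prod_j (f j `^ m.+1%:R^-1)) `^ (1 - m.+2%:R^-1).
  move=> f0; rewrite poweR_prod; last by move=> j; exact: poweR_ge0.
  by apply: eq_bigr => j _; rewrite [in LHS]tE poweRrM.
rewrite big_ord_recl pE; last by move=> j; apply: integral_ge0 => x; exact: G0.
have mP : measurable_fun D (fun x => \prod_(j < m.+1) (G (lift ord0 j) x `^ m.+1%:R^-1)).
  apply: emeasurable_prod => j.
  by apply: (measurableT_comp (measurable_poweR _)).
apply: (@le_trans _ _ (\int[mu]_(x in D) (G ord0 x `^ m.+2%:R^-1 *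
    (\prod_(j < m.+1) (G (lift ord0 j) x `^ m.+1%:R^-1)) `^ (1 - m.+2%:R^-1)))).
  apply/eqW/eq_integral => x /[!inE] Dx; rewrite big_ord_recl pE// => j.
  exact: G0.
apply: le_trans (hoelder_poweR t01 _ _ _ _) _ => //.
- by move=> x Dx; exact: G0.
- by move=> x Dx; apply: prode_ge0 => j _; exact: poweR_ge0.
apply: lee_wpmul2l; first exact: poweR_ge0.
apply: le_poweR.
- by rewrite subr_ge0; case/andP : t01.
- by apply: integral_ge0 => x Dx; apply: prode_ge0 => j _; exact: poweR_ge0.
- by apply: IH => // j x; exact: G0.
Qed.

End poweR_integral.

Section loomis_whitney.
Local Open Scope ereal_scope.
Context {R : realType}.
Local Notation leb := (@lebesgue_measure R).

Lemma measurable_integral_upd d (g : 'rV[R]_d -> \bar R) i :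
  measurable_fun setT g -> (forall x, 0 <= g x) ->
  measurable_fun setT (fun x => \int[leb]_r g (upd x i r)).
Proof.
move=> mg g0.
apply: (@measurable_fun_fubini_tonelli_F _ _ _ _ R leb (fun z => g (upd z.1 i z.2))) => //.
by apply: (measurableT_comp mg); exact: measurable_upd.
Qed.

Section cons_sections.
Variables (n : nat) (g : 'rV[R]_n.+1 -> \bar R).
Hypotheses (mg : measurable_fun setT g) (g0 : forall x, 0 <= g x).

Let mgc : measurable_fun setT (g \o @rV_cons R n).
Proof. by apply: (measurableT_comp mg); exact: measurable_rV_cons. Qed.

Lemma measurable_cons_section x : measurable_fun setT (fun y => g (rV_cons (x, y))).
Proof. by apply: (measurableT_comp mgc); exact: measurable_pair1. Qed.

Lemma measurable_integral_behead :
  measurable_fun setT (fun x : measurableTypeR R => \int[lebesgue_rV n]_y g (rV_cons (x, y))).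
Proof.
by apply: (@measurable_fun_fubini_tonelli_F _ _ _ _ R (lebesgue_rV n) (g \o @rV_cons R n)) => //=.
Qed.

Lemma measurable_integral_head :
  measurable_fun setT (fun y => \int[leb]_x g (rV_cons (x, y))).
Proof.
by apply: (@measurable_fun_fubini_tonelli_G _ _ _ _ R leb (g \o @rV_cons R n)) => //=.
Qed.

Lemma integral_rV_consC : \int[lebesgue_rV n.+1]_x g x =
  \int[lebesgue_rV n]_y \int[leb]_x g (rV_cons (x, y)).
Proof.
rewrite integral_rV_cons//.
by apply: (@fubini_tonelli _ _ _ _ R leb (lebesgue_rV n) (g \o @rV_cons R n)) => //=.
Qed.

End cons_sections.

Lemma integral_rV1 (g : 'rV[R]_1 -> \bar R) (y : 'rV[R]_1) :
  measurable_fun setT g -> (forall x, 0 <= g x) ->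
  \int[lebesgue_rV 1]_x g x = \int[leb]_r g (upd y ord0 r).
Proof.
move=> mg g0; rewrite integral_rV_cons//; apply: eq_integral => r _.
rewrite /= integral_dirac//; last exact: measurable_cons_section.
rewrite diracT mul1e; congr g; apply/rowP => j; rewrite (ord1 j).
by rewrite [RHS]mxE eqxx rV_cons_head.
Qed.

(** Induction on the dimension by splitting off the first coordinate. In dimension 2 each of the two
    factors depends on one variable only, and the claim is Tonelli's theorem. *)
Lemma loomis_whitney n (g : 'I_n.+2 -> 'rV[R]_n.+2 -> \bar R) :
  (forall i, measurable_fun setT (g i)) -> (forall i x, 0 <= g i x) ->
  \int[lebesgue_rV n.+2]_x \prod_i
    (\int[leb]_r g i (upd x i r)) `^ n.+1%:R^-1
  <= \prod_i (\int[lebesgue_rV n.+2]_x g i x) `^ n.+1%:R^-1.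
Proof.
elim: n g => [|n IH] g mg g0.
  have I0 i : 0 <= \int[lebesgue_rV 2]_x g i x by exact: integral_ge0.
  rewrite integral_rV_cons; last 2 first.
  - apply: emeasurable_prod => i; apply: (measurableT_comp (measurable_poweR _)).
    exact: measurable_integral_upd.
  - by move=> x; apply: prode_ge0 => i _; exact: poweR_ge0.
  rewrite !big_ord_recl !big_ord0 !mule1 invr1 !poweRe1//.
  under eq_integral => x _.
    under eq_integral => y _.
      rewrite !big_ord_recl !big_ord0 !mule1 !poweRe1 ?integral_ge0//.
      under eq_integral do rewrite upd_cons0.
      under [X in _ * X]eq_integral do rewrite upd_consS.
      rewrite -(@integral_rV1 (fun z => g (lift ord0 ord0) (rV_cons (x, z))) y)//; last first.
        exact: measurable_cons_section.
      over.
    rewrite ge0_integralZr//; last 3 first.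
    - exact: measurable_integral_head.
    - by move=> y _; exact: integral_ge0.
    - exact: integral_ge0.
    rewrite -integral_rV_consC//; over.
  rewrite ge0_integralZl//; last 2 first.
  - exact: measurable_integral_behead.
  - by move=> y _; exact: integral_ge0.
  by rewrite -integral_rV_cons.
have k0 : (0 < n.+1%:R :> R)%R by rewrite ltr0n.
have tE : (n.+2%:R^-1 = n.+1%:R^-1 * (1 - n.+2%:R^-1) :> R)%R.
  rewrite -(natr1 n.+1); move: (n.+1%:R) k0 => k k0; field.
  by rewrite !gt_eqF// addr_gt0.
have t01 : (0 < (n.+2%:R^-1 : R) <= 1)%R.
  by rewrite invr_gt0 ltr0n/= invf_le1 ?ltr0n// ler1n.
have pE (f : 'I_n.+2 -> \bar R) : (forall j, 0 <= f j) ->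
    \prod_j (f j `^ n.+2%:R^-1) = (\prod_j (f j `^ n.+1%:R^-1)) `^ (1 - n.+2%:R^-1).
  move=> f0; rewrite poweR_prod; last by move=> j; exact: poweR_ge0.
  by apply: eq_bigr => j _; rewrite [in LHS]tE poweRrM.
rewrite integral_rV_cons; last 2 first.
- apply: emeasurable_prod => i; apply: (measurableT_comp (measurable_poweR _)).
  exact: measurable_integral_upd.
- by move=> x; apply: prode_ge0 => i _; exact: poweR_ge0.
(* This factor does not depend on the first coordinate [x]. In each slice Hoelder's inequality
   separates it from the others, to which the induction hypothesis applies; the product that remains
   is integrated in [x] by [prod_hoelder_poweR]. *)
pose F0 y := \int[leb]_r g ord0 (rV_cons (r, y)).
have F00 y : 0 <= F0 y by exact: integral_ge0.
have mF0 : measurable_fun setT F0 by exact: measurable_integral_head.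
pose gj x (j : 'I_n.+2) y := g (lift ord0 j) (rV_cons (x, y)).
have mgj x j : measurable_fun setT (gj x j) by exact: measurable_cons_section.
pose F x j y := \int[leb]_r gj x j (upd y j r).
have Fge0 x j y : 0 <= F x j y by apply: integral_ge0 => r _; exact: g0.
have mF x j : measurable_fun setT (F x j).
  by apply: measurable_integral_upd => // y; exact: g0.
pose G j x := \int[lebesgue_rV n.+2]_y gj x j y.
have G0 j x : 0 <= G j x by apply: integral_ge0 => y _; exact: g0.
have mG j : measurable_fun setT (G j).
  by apply: measurable_integral_behead => // y; exact: g0.
apply: (@le_trans _ _ (\int[leb]_x ((\int[lebesgue_rV n.+2]_y F0 y) `^ n.+2%:R^-1 *
    \prod_j (G j x `^ n.+2%:R^-1)))).
  apply: ge0_le_integral => //.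
  - by move=> x _; apply: integral_ge0 => y _; apply: prode_ge0 => i _; exact: poweR_ge0.
  - apply: (@measurable_integral_behead _ (fun z : 'rV[R]_n.+3 =>
      \prod_i (\int[leb]_r g i (upd z i r)) `^ n.+2%:R^-1)).
      apply: emeasurable_prod => i; apply: (measurableT_comp (measurable_poweR _)).
      exact: measurable_integral_upd.
    by move=> x; apply: prode_ge0 => i _; exact: poweR_ge0.
  - apply: emeasurable_funM => //; apply: emeasurable_prod => j.
    by apply: (measurableT_comp (measurable_poweR _)).
  move=> x _; rewrite pE//.
  apply: (@le_trans _ _ (\int[lebesgue_rV n.+2]_y (F0 y `^ n.+2%:R^-1 *
      (\prod_j (F x j y `^ n.+1%:R^-1)) `^ (1 - n.+2%:R^-1)))).
    apply/eqW/eq_integral => y _; rewrite big_ord_recl -pE//; congr (_ `^ _ * _).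
      by apply: eq_integral => r _; rewrite upd_cons0.
    apply: eq_bigr => j _; congr (_ `^ _).
    by apply: eq_integral => r _; rewrite upd_consS.
  apply: le_trans (hoelder_poweR _ _ t01 _ _ _ _) _ => //.
  - apply: emeasurable_prod => j.
    by apply: (measurableT_comp (measurable_poweR _)).
  - by move=> y _; apply: prode_ge0 => j _; exact: poweR_ge0.
  apply: lee_wpmul2l; first exact: poweR_ge0.
  apply: le_poweR.
  - by rewrite subr_ge0; case/andP : t01.
  - by apply: integral_ge0 => y _; apply: prode_ge0 => j _; exact: poweR_ge0.
  - by apply: (IH (gj x)) => // i y; exact: g0.
rewrite ge0_integralZl//; last 3 first.
- apply: emeasurable_prod => j.
  by apply: (measurableT_comp (measurable_poweR _)).
- by move=> x _; apply: prode_ge0 => j _; exact: poweR_ge0.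
- exact: poweR_ge0.
rewrite [leRHS]big_ord_recl; apply: lee_pmul => //.
- exact: poweR_ge0.
- by apply: integral_ge0 => x _; apply: prode_ge0 => j _; exact: poweR_ge0.
- by rewrite -integral_rV_consC.
apply: le_trans (prod_hoelder_poweR _ _ _ _) _ => //.
by apply/eqW/eq_bigr => j _; rewrite -integral_rV_cons.
Qed.

End loomis_whitney.

(** * A weighted Sobolev inequality *)

Section real_line.
Context {R : realType}.
Local Notation leb := (@lebesgue_measure R).

Lemma integral_is_derive (F f : R -> R) (a b : R) : a < b ->
  (forall r : R, is_derive r 1 F (f r)) -> continuous f ->
  (\int[leb]_(r in `[a, b]) (f r)%:E = (F b - F a)%:E)%E.
Proof.
move=> ab dF cf; rewrite EFinB; apply: continuous_FTC2 => //.
- by apply: continuous_subspaceT.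
- have cF x : {for x, continuous F}.
    by apply/differentiable_continuous/derivable1_diffP; exact: ex_derive.
  split.
  + by move=> x _; exact: ex_derive.
  + by apply: cvg_at_right_filter; exact: cF.
  + by apply: cvg_at_left_filter; exact: cF.
- by move=> x _; rewrite derive1E derive_val.
Qed.

(* The regularisation (h^2 + e)^(p/2) of |h|^p is differentiable, and its
   derivative is dominated by the formal one since p/2 - 1 <= 0. *)
Lemma powR_le_integral_line (h dh : R -> R) (p x : R) : 1 <= p <= 2 ->
  (forall r : R, is_derive r 1 h (dh r)) -> continuous dh ->
  (exists M : R, forall r : R, M < `|r| -> h r = 0) ->
  ((`|h x| `^ p)%:E <= \int[leb]_r (p * `|h r| `^ (p - 1) * `|dh r|)%:E)%E.
Proof.
move=> /andP[p1 p2] dh_ cdh [/= M hM].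
have p0 : 0 < p by exact: lt_le_trans p1.
have ch : continuous h.
  by move=> r; apply/differentiable_continuous/derivable1_diffP; exact: ex_derive.
have mh : measurable_fun setT h by exact: continuous_measurable_fun.
have mdh : measurable_fun setT dh by exact: continuous_measurable_fun.
set I := (\int[leb]_r _)%E.
have mI : measurable_fun setT (fun r => (p * `|h r| `^ (p - 1) * `|dh r|)%:E).
  apply/measurable_EFinP; apply: measurable_funM; last exact: measurableT_comp.
  apply: measurable_funM => //.
  apply: (measurableT_comp (@measurable_powR R (p - 1))).
  exact: measurableT_comp.
suff main (e : R) : 0 < e -> ((`|h x| `^ p)%:E <= (e `^ (p / 2))%:E + I)%E.
  have [->|Iy] := eqVneq I +oo%E; first exact: leey.
  have I0 : (0 <= I)%E.
    by apply: integral_ge0 => r _; rewrite lee_fin !mulr_ge0 ?powR_ge0// ltW.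
  have Ifin : I \is a fin_num by rewrite ge0_fin_numE// lt_neqAle Iy leey.
  rewrite -(fineK Ifin) lee_fin; apply/ler_addgt0Pl => eps e0.
  have e1 : 0 < eps `^ (2 / p) by rewrite powR_gt0.
  have := main _ e1; rewrite -powRrM -[X in (_ <= _ + X)%E](fineK Ifin) lee_fin.
  have -> : 2 / p * (p / 2) = 1 by field; rewrite gt_eqF.
  by rewrite powRr1// ltW.
move=> e0.
pose F r := (h r ^+ 2 + e) `^ (p / 2).
pose f r := p * h r * (h r ^+ 2 + e) `^ (p / 2 - 1) * dh r.
have he r : 0 < h r ^+ 2 + e by rewrite ltr_wpDl// sqr_ge0.
have dF (r : R) : is_derive r 1 F (f r).
  have d1 : is_derive r 1 (fun r => h r ^+ 2 + e) (2 * h r * dh r).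
    have -> : (fun r => h r ^+ 2 + e) = (h * h) + (cst e : R -> R).
      by apply/funext => z; rewrite expr2.
    have dr := dh_ r; apply: is_derive_eq.
    by rewrite /GRing.scale/= addr0; ring.
  have d2 := @is_derive1_comp R (fun y => y `^ (p / 2))
    (fun r => h r ^+ 2 + e) r _ _ (is_derive1_powR (p / 2) (he r)) d1.
  by apply: (is_derive_eq d2); rewrite /f; field.
have cf : continuous f.
  move=> r; apply: cvgM; last exact: cdh.
  apply: cvgM; first by apply: cvgM; [exact: cvg_cst|exact: ch].
  have cp : {for h r ^+ 2 + e, continuous (fun y => y `^ (p / 2 - 1))}.
    apply/differentiable_continuous/derivable1_diffP.
    by apply: ex_derive; exact: is_derive1_powR.
  apply: (@cvg_comp _ _ _ (fun r => h r ^+ 2 + e) (fun y => y `^ (p / 2 - 1))); last exact: cp.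
  apply: cvgD; last exact: cvg_cst.
  rewrite expr2 [X in X @ _ --> _](_ : _ = (fun r => h r * h r)).
    by apply: cvgM; exact: ch.
  by apply/funext => z; rewrite expr2.
(* A point to the left of [x] and outside the support of [h], where the regularised power equals
   e^(p / 2). *)
pose a : R := - (`|M| + `|x| + 1).
have ax : a < x.
  rewrite /a; have := normr_ge0 M; have := ler_norm (- x); rewrite normrN => ? ?; lra.
have ha : h a = 0.
  apply: hM; rewrite /a normrN ger0_norm ?addr_ge0//.
  have := ler_norm M; have := normr_ge0 x => ? ?; lra.
have := integral_is_derive ax dF cf.
have mf : measurable_fun setT f by exact: continuous_measurable_fun.
have -> : F x - F a = F x - e `^ (p / 2) by rewrite /F ha expr0n/= add0r.
move=> Ixa.
have : ((F x - e `^ (p / 2))%:E <= I)%E.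
  rewrite -Ixa; apply: le_trans (le_trans (lee_abs _) (le_abse_integral _ _ _)) _ => //.
    by apply/measurable_EFinP; apply: measurable_funTS.
  apply: (@le_trans _ _ (\int[leb]_(r in `[a, x]) (p * `|h r| `^ (p - 1) * `|dh r|)%:E)%E).
    apply: ge0_le_integral => //.
    - apply/measurable_EFinP; apply: measurableT_comp => //; exact: measurable_funTS.
    - exact: measurable_funTS.
    move=> r _; rewrite lee_fin /f !normrM (ger0_norm (ltW p0)) ler_wpM2r//.
    rewrite (ger0_norm (powR_ge0 _ _)) -mulrA ler_wpM2l ?(ltW p0)//.
    have [->|h0] := eqVneq (h r) 0; first by rewrite normr0 mul0r powR_ge0.
    have hr : 0 < `|h r| by rewrite normr_gt0.
    have -> : `|h r| `^ (p - 1) = `|h r| * (`|h r| ^+ 2) `^ (p / 2 - 1).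
      rewrite -[X in _ = X * _]powRr1// -powR_mulrn// -powRrM -powRD; last first.
        by rewrite (gt_eqF hr) implybT.
      by congr (_ `^ _); field.
    rewrite ler_pM2l// real_normK ?num_real//.
    have n0 : 1 - p / 2 >= 0 by lra.
    have -> : p / 2 - 1 = - (1 - p / 2) by ring.
    have h2 : 0 < h r ^+ 2 by rewrite lt_def sqr_ge0 sqrf_eq0 h0.
    rewrite !powRN lef_pV2 ?posrE ?powR_gt0//.
    by apply: ge0_ler_powR; rewrite ?nnegrE ?sqr_ge0 ?(ltW (he r))// lerDl ltW.
  apply: ge0_subset_integral => //.
  by move=> r _; rewrite lee_fin !mulr_ge0 ?powR_ge0// ltW.
rewrite EFinB leeBlDr// addeC; apply: le_trans.
rewrite lee_fin /F -[`|h x|]ger0_norm// -[in leLHS]sqrtr_sqr real_normK ?num_real//.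
rewrite -powR12_sqrt ?sqr_ge0// -powRrM mulrC.
by apply: ge0_ler_powR; rewrite ?nnegrE ?sqr_ge0 ?(ltW (he x))// ?lerDl ?ltW// divr_gt0.
Qed.

End real_line.

Section test_functions.
Context {R : realType} {d : nat}.
Local Notation leb := (lebesgue_rV d).
Implicit Types (O : set 'rV[R]_d) (eta : 'rV[R]_d -> R).

Lemma test_function_continuous O eta : test_function O eta -> continuous eta.
Proof. by move=> [/(_ 0%N)[c _] _] x; exact: c. Qed.

Lemma test_function_derivable O eta i x : test_function O eta ->
  derivable eta x (delta_mx ord0 i).
Proof. by move=> [/(_ 1%N)[_ /(_ i)[D _]] _]; exact: D. Qed.

Lemma test_function_out O eta x : test_function O eta -> ~ O x -> eta x = 0.
Proof. by move=> [_ [K [_ KO K0]]] Ox; apply: K0 => /KO. Qed.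

Lemma test_function_partial O eta i : test_function O eta ->
  test_function O (partial i eta).
Proof.
move=> [C [K [cK KO K0]]]; split.
  by move=> k; have [_ /(_ i)[_]] := C k.+1.
exists K; split => // x Kx; rewrite /partial.
rewrite (@near_eq_derive _ _ _ _ (cst 0)); first by rewrite derive_cst.
have oK : open (~` K).
  by apply: closed_openC; apply: compact_closed cK; exact: norm_hausdorff.
have : \near x, (~` K) x by exact: open_nbhs_nbhs.
by apply: filterS => y; exact: K0.
Qed.

Lemma test_function_bounded O eta : test_function O eta ->
  exists B, forall x, `|eta x| <= B.
Proof.
move=> T; have [_ [K [cK KO K0]]] := T; have ce := test_function_continuous T.
have [|M [Mr MP]] := @compact_bounded R R^o (eta @` K).
  by apply: continuous_compact => //; exact: continuous_subspaceT.
exists (Num.max 0 (M + 1)) => x; rewrite le_max; apply/orP.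
have [Kx|Kx] := pselect (K x); last by left; rewrite K0// normr0.
by right; apply: MP; [rewrite ltrDl|exists x].
Qed.

Lemma test_function_support O eta : test_function O eta ->
  exists M : R, forall (x : 'rV[R]_d) i, M < `|x ord0 i| -> eta x = 0.
Proof.
move=> [_ [K [cK KO K0]]].
have [M [M0 MP]] := bounded_rV_box (compact_bounded cK).
exists M => x i Mx; apply: K0 => Kx.
by have := MP _ Kx i; rewrite leNgt Mx.
Qed.

Lemma upd_id (x : 'rV[R]_d) i : upd x i (x ord0 i) = x.
Proof. by apply/rowP => j; rewrite mxE; case: eqP => // ->. Qed.

Lemma is_derive_upd O eta (x : 'rV[R]_d) i (r : R) : test_function O eta ->
  is_derive r 1 (fun r => eta (upd x i r)) (partial i eta (upd x i r)).
Proof.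
move=> T; have D := @test_function_derivable O eta i (upd x i r) T.
have E : (fun h : R => h^-1 *: (((fun r => eta (upd x i r)) \o shift r) (h *: 1) -
    eta (upd x i r))) = (fun h => h^-1 *: ((eta \o shift (upd x i r)) (h *: delta_mx ord0 i) -
    eta (upd x i r))).
  apply/funext => h /=; congr (_ *: (eta _ - _)); apply/rowP => j.
  have [->|ji] := eqVneq j i.
    by rewrite /upd !mxE !eqxx.
  by rewrite /upd !mxE (negbTE ji) andbF mulr0 add0r.
by split; [rewrite /derivable E|rewrite /derive E].
Qed.

Lemma test_function_line_support O eta (x : 'rV[R]_d) i : test_function O eta ->
  exists M : R, forall r : R, M < `|r| -> eta (upd x i r) = 0.
Proof.
by move=> /test_function_support[M MP]; exists M => r Mr; apply: (MP _ i); rewrite mxE eqxx.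
Qed.

Lemma upd_continuous (x : 'rV[R]_d) i : continuous (upd x i).
Proof.
move=> r; apply/cvg_ballP => e e0; apply: filterS (nbhsx_ballx r e e0) => s rs.
by split => // k j; rewrite (ord1 k) !mxE; case: eqP => _ //; exact: ballxx.
Qed.

Lemma powR_le_integral_upd O eta (x : 'rV[R]_d) i (p : R) : 1 <= p <= 2 ->
  test_function O eta ->
  ((`|eta x| `^ p)%:E <= \int[@lebesgue_measure R]_r
    (p * `|eta (upd x i r)| `^ (p - 1) * `|partial i eta (upd x i r)|)%:E)%E.
Proof.
move=> p12 T; rewrite -{1}(upd_id x i).
apply: (@powR_le_integral_line _ (fun r => eta (upd x i r))
  (fun r => partial i eta (upd x i r)) p (x ord0 i)) => //.
- by move=> r; apply: is_derive_upd T.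
- move=> r; apply: (@continuous_comp _ _ _ (upd x i) (partial i eta)).
    exact: upd_continuous.
  by apply: test_function_continuous; exact: test_function_partial T.
- exact: test_function_line_support T.
Qed.

Lemma test_function_measurable O eta : test_function O eta -> measurable_fun setT eta.
Proof. by move=> /test_function_continuous; exact: continuous_rV_measurable. Qed.

Lemma test_function_sqint O eta : open O -> bounded_set O -> test_function O eta ->
  sqint leb O eta.
Proof.
move=> oO bO T; have mO := open_rV_measurable oO.
have [B BP] := test_function_bounded T.
apply: (@sqint_le _ _ _ leb O mO eta (cst B)).
- by apply: measurable_funTS; exact: test_function_measurable T.
- by move=> x _; apply: le_trans (BP x) (ler_norm _).
- by apply: sqint_cst => //; exact: bounded_rV_fin_measure.
Qed.

End test_functions.

Section sobolev_test.
Context {R : realType}.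

Lemma measurable_fun_inv_ge0 dd (X : measurableType dd) (D : set X) (f : X -> R) :
  measurable D -> measurable_fun D f -> (forall x, D x -> 0 <= f x) ->
  measurable_fun D (fun x => (f x)^-1).
Proof.
move=> mD mf f0; apply: (eq_measurable_fun (fun x => f x `^ (-1))).
  by move=> x /[!inE] Dx; rewrite powR_inv1// f0.
by apply: (measurableT_comp (@measurable_powR R (-1))).
Qed.

Lemma lee_prod_ge0 n (f g : 'I_n -> \bar R) : (forall i, 0 <= f i <= g i)%E ->
  (\prod_i f i <= \prod_i g i)%E.
Proof.
move=> fg; suff : ((0 <= \prod_i f i) && (\prod_i f i <= \prod_i g i))%E by case/andP.
elim/big_ind2 : _ => //; first by rewrite lexx lee01.
move=> x1 x2 y1 y2 /andP[x0 x12] /andP[y0 y12].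
by rewrite mule_ge0// lee_pmul.
Qed.

Lemma prode_EFin_cst n (c : R) : (\prod_(i < n) c%:E = (c ^+ n)%:E)%E.
Proof.
elim: n => [|n IH]; first by rewrite big_ord0.
by rewrite big_ord_recl IH -EFinM exprS.
Qed.

Section support.
Context {d : nat}.
Local Notation leb := (lebesgue_rV d).

Lemma integral_supported (O : set 'rV[R]_d) (f : 'rV[R]_d -> \bar R) :
  measurable O -> (forall x, ~ O x -> f x = 0%E) ->
  (\int[leb]_x f x = \int[leb]_(x in O) f x)%E.
Proof.
move=> mO f0; rewrite [RHS]integral_mkcond; apply: eq_integral => x _.
rewrite patchE; case: ifPn => // /negP xO; apply: f0 => Ox; apply: xO.
by rewrite inE.
Qed.

End support.

Section weighted.
Context {d : nat} (O : set 'rV[R]_d) (om : 'rV[R]_d -> R) (e : R).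
Local Notation leb := (lebesgue_rV d).
Hypotheses (oO : open O) (bO : bounded_set O) (mom : measurable_fun O om).
Hypotheses (e0 : 0 < e) (eom : forall x, O x -> e <= om x).
Variables (eta : 'rV[R]_d -> R).
Hypothesis (T : test_function O eta).

Let mO : measurable O. Proof. exact: open_rV_measurable. Qed.
Let om0 x : O x -> 0 < om x. Proof. by move=> /eom; exact: lt_le_trans. Qed.
Let om0' x : O x -> 0 <= om x. Proof. by move=> /om0/ltW. Qed.
Let meta : measurable_fun O eta.
Proof. by apply: measurable_funTS; exact: test_function_measurable T. Qed.
Let mpart i : measurable_fun O (partial i eta).
Proof.
apply: measurable_funTS; apply: test_function_measurable.
exact: test_function_partial T.
Qed.

Definition wdir : R := \int[leb]_(x in O) ((\sum_i partial i eta x ^+ 2) / om x).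

Let mquot : measurable_fun O (fun x => (\sum_i partial i eta x ^+ 2) / om x).
Proof.
apply: measurable_funM; last exact: measurable_fun_inv_ge0.
by apply: measurable_sum => i; exact: measurable_funX.
Qed.

Lemma integrable_wdir :
  leb.-integrable O (EFin \o (fun x => (\sum_i partial i eta x ^+ 2) / om x)).
Proof.
have sp i : sqint leb O (partial i eta).
  by apply: test_function_sqint => //; exact: test_function_partial T.
apply: (@integrable_le _ _ _ leb O mO _
  (fun x => e^-1 * \sum_i partial i eta x ^+ 2)).
- exact: mquot.
- move=> x Ox; rewrite ger0_norm; last first.
    by rewrite divr_ge0 ?om0'// sumr_ge0// => i _; exact: sqr_ge0.
  rewrite mulrC ler_wpM2r ?sumr_ge0// => [i _|]; first exact: sqr_ge0.
  by rewrite lef_pV2 ?posrE ?om0// eom.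
- apply: (@eq_integrable _ _ _ _ _ mO (fun x => e^-1%:E * \sum_i (partial i eta x ^+ 2)%:E)%E).
  by move=> x _; rewrite /= sumEFin -EFinM.
apply: integrableZl => //; apply: integrable_sum => // i _.
by case: (sp i).
Qed.

(** Cauchy-Schwarz after multiplying [f] and dividing the derivative by the square root of the
    weight. The first integral may be infinite, hence the extended reals. *)
Lemma integral_partial_le (f : 'rV[R]_d -> R) i : measurable_fun O f ->
  (\int[leb]_(x in O) (`|f x| * `|partial i eta x|)%:E <=
   (\int[leb]_(x in O) (f x ^+ 2 * om x)%:E) `^ 2^-1 * (wdir%:E) `^ 2^-1)%E.
Proof.
move=> mf.
have -> : wdir%:E = (\int[leb]_(x in O) ((\sum_i partial i eta x ^+ 2) / om x)%:E)%E.
  by rewrite /wdir fineK//; exact: integrable_fin_num integrable_wdir.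
have t01 : 0 < (2^-1 : R) <= 1 by rewrite invr_gt0 ltr0n/= invf_le1// ler1n.
apply: (@le_trans _ _ ((\int[leb]_(x in O) (f x ^+ 2 * om x)%:E) `^ 2^-1 *
   (\int[leb]_(x in O) (partial i eta x ^+ 2 / om x)%:E) `^ (1 - 2^-1))%E); last first.
  have -> : 1 - 2^-1 = 2^-1 :> R by field.
  apply: lee_wpmul2l; first exact: poweR_ge0.
  apply: le_poweR; rewrite ?invr_ge0//.
    by apply: integral_ge0 => x Ox; rewrite lee_fin divr_ge0 ?sqr_ge0 ?om0'.
  apply: ge0_le_integral => //.
  - by move=> x Ox; rewrite lee_fin divr_ge0 ?sqr_ge0 ?om0'.
  - apply/measurable_EFinP; apply: measurable_funM; first exact: measurable_funX.
    exact: measurable_fun_inv_ge0.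
  - exact/measurable_EFinP.
  move=> x Ox; rewrite lee_fin ler_wpM2r ?invr_ge0 ?om0'// (bigD1 i)//= lerDl.
  by rewrite sumr_ge0// => j _; exact: sqr_ge0.
apply: le_trans (hoelder_poweR leb mO t01 _ _ _ _).
- apply/eqW/eq_integral => x /[!inE] Ox; rewrite !poweR_EFin -EFinM; congr EFin.
  have -> : 1 - 2^-1 = 2^-1 :> R by field.
  have f0 : 0 <= f x ^+ 2 * om x by apply: mulr_ge0; [exact: sqr_ge0|exact: om0'].
  have d0 : 0 <= partial i eta x ^+ 2 / om x.
    by apply: divr_ge0; [exact: sqr_ge0|exact: om0'].
  rewrite (powR12_sqrt f0) (powR12_sqrt d0).
  rewrite (sqrtrM _ (sqr_ge0 (f x))) (sqrtrM _ (sqr_ge0 (partial i eta x))) !sqrtr_sqr.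
  rewrite sqrtrV ?om0'//; set w := Num.sqrt _.
  have w0 : w != 0 by rewrite gt_eqF// sqrtr_gt0 om0.
  by field.
- by apply/measurable_EFinP/measurable_funM => //; exact: measurable_funX.
- apply/measurable_EFinP; apply: measurable_funM; first exact: measurable_funX.
  exact: measurable_fun_inv_ge0.
- by move=> x Ox; rewrite lee_fin mulr_ge0 ?sqr_ge0 ?om0'.
- by move=> x Ox; rewrite lee_fin divr_ge0 ?sqr_ge0 ?om0'.
Qed.

End weighted.

(** On the line the integral of the derivative bounds the supremum of [eta]; Cauchy-Schwarz brings
    in the weight, and integrating the pointwise bound over [O] produces the volume. *)
Lemma sobolev_test1 (O : set 'rV[R]_1) (om : 'rV[R]_1 -> R) (e : R) eta :
  open O -> bounded_set O -> measurable_fun O om -> 0 < e ->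
  (forall x, O x -> e <= om x) -> test_function O eta ->
  (lebesgue_rV 1).-integrable O (EFin \o om) ->
  ipL2 (lebesgue_rV 1) O eta eta <= fine (lebesgue_rV 1 O) *
    ((\int[lebesgue_rV 1]_(x in O) om x) * wdir O om eta).
Proof.
move=> oO bO mom e0 eom T iom; have mO := open_rV_measurable oO.
have Tp := @test_function_partial _ _ _ _ ord0 T.
have mp := test_function_measurable Tp.
have om0 x : O x -> 0 <= om x by move=> /eom; apply: le_trans; exact: ltW.
have volfin := bounded_rV_fin_measure mO bO.
have vol0 : (lebesgue_rV 1 O \is a fin_num) by rewrite ge0_fin_numE.
set G := \int[lebesgue_rV 1]_(x in O) om x; set D := wdir _ _ _.
have G0 : 0 <= G by exact: Rintegral_ge0.
have D0 : 0 <= D.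
  by apply: Rintegral_ge0 => x Ox; rewrite divr_ge0 ?om0// sumr_ge0// => i _; exact: sqr_ge0.
have pt x : ((`|eta x|)%:E <= (G `^ 2^-1 * D `^ 2^-1)%:E)%E.
  have p12 : 1 <= (1 : R) <= 2 by rewrite lexx ler1n.
  have := powR_le_integral_upd x ord0 p12 T; rewrite powRr1// => /le_trans; apply.
  under eq_integral do rewrite subrr powRr0 !mul1r.
  rewrite -(@integral_rV1 R (fun z => `|partial ord0 eta z|%:E) x)//; last first.
    by apply/measurable_EFinP; exact: measurableT_comp.
  rewrite (integral_supported mO); last first.
    by move=> z Oz; rewrite (test_function_out Tp Oz) normr0.
  have := @integral_partial_le 1 O om e oO bO mom e0 eom eta T (cst 1) ord0.
  under eq_integral do rewrite normr1 mul1r.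
  move=> /(_ (measurable_cst _)) /le_trans; apply.
  under eq_integral do rewrite expr1n mul1r.
  rewrite -[X in (X `^ _ * _)%E](@fineK _ (\int[_]_(x in O) (om x)%:E)%E).
    by rewrite !poweR_EFin -EFinM.
  exact: integrable_fin_num iom.
have sq x : eta x * eta x <= G * D.
  have := pt x; rewrite lee_fin !powR12_sqrt// => le.
  rewrite -expr2 -(real_normK (num_real _)).
  apply: (@le_trans _ _ ((Num.sqrt G * Num.sqrt D) ^+ 2)).
    by rewrite lerXn2r ?nnegrE ?mulr_ge0 ?sqrtr_ge0.
  by rewrite exprMn !sqr_sqrtr.
have seta : sqint (lebesgue_rV 1) O eta by exact: test_function_sqint.
rewrite [leRHS]mulrC -Rintegral_cst//; apply: le_Rintegral => //.
- exact: (sqint_mul mO seta seta).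
- by apply: sqint_integrable => //; exact: sqint_cst.
Qed.

(** Gagliardo's argument with a weight. A power of [eta] is bounded along each coordinate line,
    Loomis-Whitney multiplies the bounds, Cauchy-Schwarz and Hoelder's inequality insert the weight.
    With d the dimension this gives Q^(2 (d - 1) / d) <= p^2 Q^(1 - 2 / d) G^(2 / d) D, to be
    divided by a power of Q. *)
Lemma sobolev_test2 (n : nat) (O : set 'rV[R]_n.+2) (om : 'rV[R]_n.+2 -> R) (e : R) eta :
  open O -> bounded_set O -> measurable_fun O om -> 0 < e ->
  (forall x, O x -> e <= om x) -> test_function O eta ->
  (lebesgue_rV n.+2).-integrable O (EFin \o (fun x => om x `^ (n.+2%:R / 2))) ->
  ipL2 (lebesgue_rV n.+2) O eta eta <= 4 *
    ((\int[lebesgue_rV n.+2]_(x in O) (om x `^ (n.+2%:R / 2))) `^ (2 / n.+2%:R) *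
     wdir O om eta).
Proof.
move=> oO bO mom e0 eom T iom; have mO := open_rV_measurable oO.
set leb := lebesgue_rV n.+2.
have Tp i := @test_function_partial _ _ _ _ i T.
have mp i := test_function_measurable (Tp i).
have meta := test_function_measurable T.
have om0 x : O x -> 0 <= om x by move=> /eom; apply: le_trans; exact: ltW.
set G := \int[leb]_(x in O) _; set D := wdir _ _ _.
have G0 : 0 <= G by apply: Rintegral_ge0 => x _; exact: powR_ge0.
have D0 : 0 <= D.
  by apply: Rintegral_ge0 => x Ox; rewrite divr_ge0 ?om0// sumr_ge0// => i _; exact: sqr_ge0.
have GE : G%:E = (\int[leb]_(x in O) (om x `^ (n.+2%:R / 2))%:E)%E.
  by rewrite fineK//; exact: integrable_fin_num iom.
have seta : sqint leb O eta by exact: test_function_sqint.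
set Q := ipL2 leb O eta eta.
have Q0 : 0 <= Q by exact: (form_ge0 (sqint_form leb mO) seta).
have QE : Q%:E = (\int[leb]_(x in O) (eta x ^+ 2)%:E)%E by exact: ipL2_sqr.
pose m : R := n.+1%:R; have mE : n.+1%:R = m by [].
have m1 : 1 <= m by rewrite ler1n.
have m0 : 0 < m by exact: lt_le_trans m1.
have dE : n.+2%:R = m + 1 :> R by rewrite -natr1.
clearbody m.
have dnz : m + 1 != 0 by rewrite gt_eqF// addr_gt0.
have mnz : m != 0 by rewrite gt_eqF.
(* The dimension is [m + 1]. With this exponent the product of [m + 1] factors |eta|^p, each raised
   to the power 1 / m, is eta^2; moreover p <= 2, whence the final constant 4. *)
pose p : R := 2 * m / (m + 1).
have p12 : 1 <= p <= 2.
  rewrite /p ler_pdivlMr ?addr_gt0// ler_pdivrMr ?addr_gt0//; apply/andP; split; lra.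
have p0 : 0 <= p by case/andP: p12 => p1 _; exact: le_trans p1.
pose g i x := (p * `|eta x| `^ (p - 1) * `|partial i eta x|)%:E.
have mpow (r : R) : measurable_fun setT (fun x => `|eta x| `^ r).
  apply: (measurableT_comp (@measurable_powR R r)); exact: measurableT_comp.
have mg i : measurable_fun setT (g i).
  apply/measurable_EFinP; apply: measurable_funM; last exact: measurableT_comp.
  exact: measurable_funM.
have g0 i x : (0 <= g i x)%E.
  by rewrite lee_fin mulr_ge0// mulr_ge0// powR_ge0.
(* Hoelder's bound for the integral of |eta|^(2 (p - 1)) om: as p - 1 = 1 - 2 / d, the integrand is
   the product of (eta^2)^(1 - 2 / d) and (om^(d / 2))^(2 / d). *)
pose A := Q `^ (1 - 2 / n.+2%:R) * G `^ (2 / n.+2%:R).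
have A0 : 0 <= A by rewrite mulr_ge0 ?powR_ge0.
have Ig i : (\int[leb]_x g i x <= (p * (A * D) `^ 2^-1)%:E)%E.
  rewrite (integral_supported mO); last first.
    by move=> z Oz; rewrite /g (test_function_out (Tp i) Oz) normr0 mulr0.
  under eq_integral do rewrite /g -mulrA EFinM.
  have mgi : measurable_fun O (fun x => (`|eta x| `^ (p - 1) * `|partial i eta x|)%:E).
    apply/measurable_EFinP; apply: measurable_funTS; apply: measurable_funM => //.
    exact: measurableT_comp.
  have gi0 x : O x -> (0 <= (`|eta x| `^ (p - 1) * `|partial i eta x|)%:E)%E.
    by move=> _; rewrite lee_fin mulr_ge0// powR_ge0.
  rewrite ge0_integralZl//.
  rewrite [leRHS]EFinM; apply: lee_wpmul2l => //.
  have := @integral_partial_le _ O om e oO bO mom e0 eom eta T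
    (fun x => `|eta x| `^ (p - 1)) i (measurable_funTS (mpow _)).
  move=> H; apply: le_trans (le_trans _ H) _.
    by apply/eqW/eq_integral => x _; rewrite (ger0_norm (powR_ge0 _ _)).
  rewrite powRM// [leRHS]EFinM -[(A `^ _)%:E]poweR_EFin; apply: lee_wpmul2r.
    exact: poweR_ge0.
  apply: le_poweR; rewrite ?invr_ge0//.
    by apply: integral_ge0 => x Ox; rewrite lee_fin mulr_ge0 ?sqr_ge0 ?om0.
  have t01 : 0 < (2 / n.+2%:R : R) <= 1.
    by rewrite divr_gt0 ?ltr0n//= ler_pdivrMr ?ltr0n// mul1r ler_nat.
  have := @hoelder_poweR _ _ _ leb O mO (fun x => (om x `^ (n.+2%:R / 2))%:E)
    (fun x => (eta x ^+ 2)%:E) _ t01 (measurable_int leb iom).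
  rewrite -GE -QE !poweR_EFin -EFinM [G `^ _ * _]mulrC => H2.
  apply: le_trans (H2 _ _ _).
  - apply/eqW/eq_integral => x /[!inE] Ox; rewrite !poweR_EFin -EFinM; congr EFin.
    rewrite -powRrM dE (_ : (m + 1) / 2 * (2 / (m + 1)) = 1); last by field.
    rewrite powRr1 ?om0// mulrC; congr (_ * _).
    rewrite -(real_normK (num_real (eta x))) !expr2 powRM//.
    by have -> : p - 1 = 1 - 2 / (m + 1) by rewrite /p; field.
  - by apply/measurable_EFinP/measurable_funX; exact: measurable_funTS.
  - by move=> x _; rewrite lee_fin powR_ge0.
  - by move=> x _; rewrite lee_fin sqr_ge0.
have QLW : (Q%:E <= \prod_(i < n.+2) ((p * (A * D) `^ 2^-1)%:E `^ n.+1%:R^-1))%E.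
  apply: (@le_trans _ _ (\prod_i (\int[leb]_x g i x) `^ n.+1%:R^-1)%E); last first.
    apply: lee_prod_ge0 => i; apply/andP; split; [exact: poweR_ge0|apply: le_poweR => //].
    by apply: integral_ge0 => x _; exact: g0.
  apply: le_trans (loomis_whitney mg g0).
  rewrite QE -(integral_supported mO (f := fun x => (eta x ^+ 2)%:E)); last first.
    by move=> x Ox; rewrite (test_function_out T Ox) expr0n.
  apply: ge0_le_integral => //.
  - by move=> x _; rewrite lee_fin sqr_ge0.
  - by apply/measurable_EFinP; exact: measurable_funX.
  - apply: emeasurable_prod => i; apply: (measurableT_comp (measurable_poweR _)).
    exact: measurable_integral_upd.
  move=> x _.
  have -> : ((eta x ^+ 2)%:E = \prod_(i < n.+2) ((`|eta x| `^ p)%:E `^ n.+1%:R^-1))%E.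
    rewrite poweR_EFin prode_EFin_cst -[X in _ = X%:E]powR_mulrn ?powR_ge0// -2!powRrM dE; congr EFin.
    have -> : p * (n.+1%:R^-1 * (m + 1)) = 2%:R.
      by rewrite mE /p; field; rewrite ?mnz ?dnz.
    by rewrite powR_mulrn// real_normK ?num_real.
  apply: lee_prod_ge0 => i; apply/andP; split; [exact: poweR_ge0|apply: le_poweR => //].
  exact: (powR_le_integral_upd x i p12 T).
have [Qz|Qnz] := eqVneq Q 0.
  by rewrite Qz !mulr_ge0// powR_ge0.
have Qp : 0 < Q by rewrite lt_def Qnz.
have B0 : 0 <= p ^+ 2 * (A * D) by rewrite mulr_ge0 ?sqr_ge0// mulr_ge0.
have : Q `^ (2 * m / (m + 1)) <= p ^+ 2 * (A * D).
  move: QLW; rewrite poweR_EFin prode_EFin_cst lee_fin -[leRHS]powR_mulrn ?powR_ge0// -powRrM.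
  have -> : p * (A * D) `^ 2^-1 = (p ^+ 2 * (A * D)) `^ 2^-1.
    have AD0 : 0 <= A * D by rewrite mulr_ge0.
    rewrite [RHS]powRM ?sqr_ge0//; congr (_ * _).
    by rewrite powR12_sqrt ?sqr_ge0// sqrtr_sqr ger0_norm.
  rewrite -powRrM dE mE => QB.
  have r0 : 0 <= 2 * m / (m + 1) by rewrite divr_ge0// ?mulr_ge0// ltW// addr_gt0.
  have := ge0_ler_powR r0 _ _ QB; rewrite !nnegrE => /(_ Q0 (powR_ge0 _ _)).
  rewrite -powRrM (_ : 2^-1 * (m^-1 * (m + 1)) * (2 * m / (m + 1)) = 1); last first.
    by field; rewrite ?mnz ?dnz.
  by rewrite powRr1.
have -> : 2 * m / (m + 1) = (1 - 2 / n.+2%:R) + 1 by rewrite dE; field.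
rewrite powRD; last by rewrite Qnz implybT.
rewrite powRr1// /A => H.
have q0 : 0 < Q `^ (1 - 2 / n.+2%:R) by exact: powR_gt0.
have : Q <= p ^+ 2 * (G `^ (2 / n.+2%:R) * D).
  rewrite -(ler_pM2l q0); apply: le_trans H _; apply: eqW.
  by set x := Q `^ _; set y := G `^ _; ring.
move=> /le_trans; apply; rewrite ler_wpM2r ?mulr_ge0 ?powR_ge0//.
have -> : 4 = 2 ^+ 2 :> R by rewrite -natrX.
by rewrite lerXn2r ?nnegrE//; case/andP: p12.
Qed.

(** [d0] is 1 on the line and half the dimension otherwise; the constants of the two cases, the
    volume and 4, are both dominated by their sum. *)
Lemma sobolev_test d (O : set 'rV[R]_d) (om : 'rV[R]_d -> R) (e : R) eta
    (d0 := Num.max 1 (d%:R / 2) : R) :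
  (0 < d)%N -> open O -> bounded_set O -> measurable_fun O om -> 0 < e ->
  (forall x, O x -> e <= om x) -> test_function O eta ->
  (lebesgue_rV d).-integrable O (EFin \o (fun x => om x `^ d0)) ->
  ipL2 (lebesgue_rV d) O eta eta <= (4 + fine (lebesgue_rV d O)) *
    ((\int[lebesgue_rV d]_(x in O) (om x `^ d0)) `^ d0^-1 * wdir O om eta).
Proof.
move=> + oO bO mom e0 eom T.
have vol0 : 0 <= fine (lebesgue_rV d O) by exact: fine_ge0.
have om0 x : O x -> 0 <= om x by move=> /eom; apply: le_trans; exact: ltW.
have D0 : 0 <= wdir O om eta.
  by apply: Rintegral_ge0 => x Ox; rewrite divr_ge0 ?om0// sumr_ge0// => i _; exact: sqr_ge0.
have P0 : 0 <= (\int[lebesgue_rV d]_(x in O) (om x `^ d0)) `^ d0^-1 * wdir O om eta.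
  by rewrite mulr_ge0// powR_ge0.
move: O om eta oO bO mom eom T vol0 om0 D0 P0; rewrite {}/d0.
case: d => [//|[|n]] O om eta oO bO mom eom T vol0 om0 D0 P0 _.
  move: P0; have -> : Num.max 1 (1%:R / 2) = 1 :> R.
    by rewrite max_l// ler_pdivrMr// mul1r ler1n.
  move=> P0.
  move=> iom; have E : {in O, (fun x => om x `^ 1) =1 om}.
    by move=> x /[!inE] Ox; rewrite powRr1// om0.
  have iom1 : (lebesgue_rV 1).-integrable O (EFin \o om).
    apply: eq_integrable iom; first exact: open_rV_measurable.
    by move=> x Ox /=; rewrite E.
  rewrite invr1 (eq_Rintegral _ E) powRr1; last exact: Rintegral_ge0.
  apply: le_trans (sobolev_test1 oO bO mom e0 eom T iom1) _.
  rewrite ler_wpM2r// ?lerDr// mulr_ge0//; exact: Rintegral_ge0.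
have -> : Num.max 1 (n.+2%:R / 2) = n.+2%:R / 2 :> R.
  by rewrite max_r// ler_pdivlMr// mul1r ler_nat.
have -> : (n.+2%:R / 2)^-1 = 2 / n.+2%:R :> R by rewrite invf_div.
move=> iom; apply: le_trans (sobolev_test2 oO bO mom e0 eom T iom) _.
apply: ler_wpM2r; first by apply: mulr_ge0; [exact: powR_ge0|exact: D0].
by rewrite lerDl.
Qed.

End sobolev_test.

Section form_convergence.
Context {R : realType} {E : lmodType R}.

Lemma cvg0P (a : nat -> R) : (forall n, 0 <= a n) ->
  (a n @[n --> \oo] --> 0) <->
  (forall eps : R, 0 < eps -> exists N, forall n, (N <= n)%N -> a n <= eps).
Proof.
move=> a0; split => [/cvgrPdist_le ac eps e0|ac].
  have [N _ NP] := ac _ e0; exists N => n Nn.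
  by have := NP n Nn; rewrite sub0r normrN ger0_norm.
apply/cvgrPdist_le => eps e0; have [N NP] := ac _ e0.
by exists N => // n /NP; rewrite sub0r normrN ger0_norm.
Qed.

Variables (S : set E) (q : E -> E -> R).
Hypothesis F : form_on S q.

Lemma form_cvg2 {I : Type} {G : set_system I} {FG : Filter G} (x y : I -> E) l m :
  (forall i, S (x i)) -> (forall i, S (y i)) -> S l -> S m ->
  Num.sqrt (q (x i - l) (x i - l)) @[i --> G] --> 0 ->
  Num.sqrt (q (y i - m) (y i - m)) @[i --> G] --> 0 ->
  q (x i) (y i) @[i --> G] --> q l m.
Proof.
move=> Sx Sy Sl Sm xl ym.
pose a i := Num.sqrt (q (x i - l) (x i - l)); pose b i := Num.sqrt (q (y i - m) (y i - m)).
pose c := Num.sqrt (q l l); pose e := Num.sqrt (q m m).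
have bound i : `|q l m - q (x i) (y i)| <= a i * b i + a i * e + c * b i.
  have Sxl := form_setB F (Sx i) Sl; have Sym := form_setB F (Sy i) Sm.
  rewrite distrC (_ : _ - _ = q (x i - l) (y i - m) + q (x i - l) m + q l (y i - m)).
    do 2 (apply: le_trans (ler_normD _ _) _; apply: lerD => //; try exact: (form_abs_le F)).
  by rewrite !(formBl F)// !(formBr F)//; ring.
have lim0 : a i * b i + a i * e + c * b i @[i --> G] --> 0.
  rewrite [X in _ --> X](_ : 0 = 0 * 0 + 0 * e + c * 0); last by ring.
  by apply: cvgD; [apply: cvgD|]; apply: cvgM => //; exact: cvg_cst.
apply/cvgrPdist_le => eps e0; move/cvgrPdist_le : lim0 => /(_ _ e0).
apply: filterS => i; rewrite sub0r normrN => /(le_trans (ler_norm _)).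
exact: le_trans (bound i).
Qed.

Lemma form_cvg {I : Type} {G : set_system I} {FG : Filter G} (x : I -> E) l m :
  (forall i, S (x i)) -> S l -> S m ->
  Num.sqrt (q (x i - l) (x i - l)) @[i --> G] --> 0 ->
  q (x i) m @[i --> G] --> q l m.
Proof.
move=> Sx Sl Sm xl; apply: (form_cvg2 (y := fun=> m)) => //.
by rewrite subrr (form0l F) ?sqrtr0; [exact: cvg_cst|exact: form0 F].
Qed.

Lemma form_cvg_sqr (x : nat -> E) l : (forall n, S (x n)) -> S l ->
  (Num.sqrt (q (x n - l) (x n - l)) @[n --> \oo] --> 0) <->
  (forall eps : R, 0 < eps -> exists N, forall n, (N <= n)%N ->
    q (x n - l) (x n - l) <= eps).
Proof.
move=> Sx Sl; have q0 n : 0 <= q (x n - l) (x n - l).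
  by apply: (form_ge0 F); exact: (form_setB F).
rewrite cvg0P; last by move=> n; exact: sqrtr_ge0.
split => xl eps e0.
  have [|N NP] := xl (Num.sqrt eps); first by rewrite sqrtr_gt0.
  by exists N => n /NP; rewrite ler_sqrt// ltW.
have [|N NP] := xl (eps ^+ 2); first by rewrite exprn_gt0.
exists N => n /NP /ler_wsqrtr/le_trans; apply.
by rewrite sqrtr_sqr ger0_norm// ltW.
Qed.

End form_convergence.

Section test_function_linear.
Context {R : realType} {d : nat}.
Implicit Types (O : set 'rV[R]_d) (f g : 'rV[R]_d -> R).

Lemma Ck_setT_derivable k f : Ck k.+1 [set: 'rV[R]_d] f ->
  forall i x, derivable f x (delta_mx ord0 i).
Proof. by move=> [_ D] i x; have [+ _] := D i; exact. Qed.

Lemma partial_lin (a : R) f g i :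
  (forall x, derivable f x (delta_mx ord0 i)) ->
  (forall x, derivable g x (delta_mx ord0 i)) ->
  partial i (a *: f + g) = a *: partial i f + partial i g.
Proof.
move=> df dg; apply/funext => x; rewrite /partial.
have dfx := df x; have dgx := dg x.
have dafx : derivable (a *: f) x (delta_mx ord0 i) by apply: derivableZ.
by rewrite (deriveD dafx dgx) deriveZ.
Qed.

Lemma continuous_lin (a : R) f g x : {for x, continuous f} ->
  {for x, continuous g} -> {for x, continuous (a *: f + g)}.
Proof.
move=> cf cg; have : a * f z + g z @[z --> x] --> a * f x + g x.
  exact: (cvgD (cvgM (cvg_cst a) cf) cg).
exact.
Qed.

Lemma continuous_zero x : {for x, continuous (0 : 'rV[R]_d -> R)}.
Proof. exact: (@cst_continuous _ _ (0 : R)). Qed.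

Lemma Ck_lin k (a : R) f g : Ck k [set: 'rV[R]_d] f -> Ck k [set: 'rV[R]_d] g ->
  Ck k [set: 'rV[R]_d] (a *: f + g).
Proof.
have ck n (u : 'rV[R]_d -> R) : Ck n [set: 'rV[R]_d] u -> forall x, {for x, continuous u}.
  by case: n => [|n] [C _] x; exact: C.
elim: k f g => [|k IH] f g Cf Cg.
  by split; [move=> x _; exact: (continuous_lin (ck _ _ Cf x) (ck _ _ Cg x))|exact: Logic.I].
have df := Ck_setT_derivable Cf; have dg := Ck_setT_derivable Cg.
split; first by move=> x _; exact: (continuous_lin (ck _ _ Cf x) (ck _ _ Cg x)).
move=> i; split; first by move=> x _; apply: derivableD => //; exact: derivableZ.
by rewrite partial_lin//; apply: IH; [case: Cf => _ /(_ i)[]|case: Cg => _ /(_ i)[]].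
Qed.

Lemma test_function_lin O (a : R) f g : test_function O f -> test_function O g ->
  test_function O (a *: f + g).
Proof.
move=> [Cf [K [cK KO K0]]] [Cg [L [cL LO L0]]]; split.
  by move=> k; exact: Ck_lin.
exists (K `|` L); split.
- exact: compactU.
- by move=> x [/KO|/LO].
- move=> x /not_orP[xK xL]; rewrite -[LHS]/(a * f x + g x).
  by rewrite K0// L0// mulr0 addr0.
Qed.

Lemma test_function_partial_lin O (a : R) f g i :
  test_function O f -> test_function O g ->
  partial i (a *: f + g) = a *: partial i f + partial i g.
Proof.
by move=> Tf Tg; apply: partial_lin => x; apply: test_function_derivable;
  [exact: Tf|exact: Tg].
Qed.

Lemma partial0 i : partial i (0 : 'rV[R]_d -> R) = 0.
Proof. by apply/funext => x; rewrite /partial derive_cst. Qed.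

Lemma test_function0 O : test_function O 0.
Proof.
split; last by exists set0; split => //; exact: compact0.
elim=> [|k IH]; first by split => // x _; exact: continuous_zero.
split => [x _|i]; first exact: continuous_zero.
by rewrite partial0; split => // x _; exact: derivable_cst.
Qed.

End test_function_linear.

(** * The space of Sobolev functions with zero trace *)

Lemma cvg_sumr {R : realType} {I J : Type} {G : set_system J} {FG : Filter G}
    (s : seq I) (f : I -> J -> R) (l : I -> R) :
  (forall i, f i j @[j --> G] --> l i) ->
  \sum_(i <- s) f i j @[j --> G] --> \sum_(i <- s) l i.
Proof.
move=> fl; elim: s => [|i s IH].
  by rewrite big_nil; under eq_fun do rewrite big_nil; exact: cvg_cst.
by rewrite big_cons; under eq_fun do rewrite big_cons; exact: cvgD.
Qed.

Lemma sqrt_cvg0_le {R : realType} (c : R) (a b : nat -> R) :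
  (forall n, a n <= c ^+ 2 * b n) -> Num.sqrt (b n) @[n --> \oo] --> 0 ->
  Num.sqrt (a n) @[n --> \oo] --> 0.
Proof.
move=> ab b0; apply/cvg0P; first by move=> n; exact: sqrtr_ge0.
have l0 : `|c| * Num.sqrt (b n) @[n --> \oo] --> 0.
  rewrite [X in _ --> X](_ : 0 = `|c| * 0); last by rewrite mulr0.
  by apply: cvgM => //; exact: cvg_cst.
move/cvg0P : l0 => l0 eps e0; have [|N NP] := l0 _ eps e0.
  by move=> n; rewrite mulr_ge0 ?sqrtr_ge0.
exists N => n /NP; apply: le_trans.
by apply: le_trans (ler_wsqrtr (ab n)) _; rewrite sqrtrM ?sqr_ge0// sqrtr_sqr.
Qed.

Section form_limits.
Context {R : realType} {E : lmodType R} (S : set E) (q : E -> E -> R).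
Hypothesis F : form_on S q.

Lemma form_norm_cvg0_lin (a : R) (x y : nat -> E) : (forall n, S (x n)) -> (forall n, S (y n)) ->
  Num.sqrt (q (x n) (x n)) @[n --> \oo] --> 0 ->
  Num.sqrt (q (y n) (y n)) @[n --> \oo] --> 0 ->
  Num.sqrt (q (a *: x n + y n) (a *: x n + y n)) @[n --> \oo] --> 0.
Proof.
move=> Sx Sy x0 y0; apply/cvg0P; first by move=> n; exact: sqrtr_ge0.
have l0 : `|a| * Num.sqrt (q (x n) (x n)) + Num.sqrt (q (y n) (y n)) @[n --> \oo] --> 0.
  rewrite [X in _ --> X](_ : 0 = `|a| * 0 + 0); last by rewrite mulr0 addr0.
  by apply: cvgD => //; apply: cvgM => //; exact: cvg_cst.
move/cvg0P : l0; rewrite /= => l0 eps e0.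
have [|N NP] := l0 _ eps e0.
  by move=> n; rewrite addr_ge0 ?sqrtr_ge0// mulr_ge0 ?sqrtr_ge0.
exists N => n /NP; apply: le_trans.
apply: le_trans (form_norm_leD F (form_setZ F a (Sx n)) (Sy n)) _.
by rewrite lerD2r (form_sqrZ F)// sqrtrM ?sqr_ge0// sqrtr_sqr.
Qed.

End form_limits.

Section H10_space.
Context {R : realType} {d : nat} (O : set 'rV[R]_d).
Hypotheses (oO : open O) (bO : bounded_set O).
Local Notation leb := (lebesgue_rV d).
Local Notation fld := ('rV[R]_d -> 'rV[R]_d).
Local Notation ip := (ipH O).

Let mO : measurable O. Proof. exact: open_rV_measurable. Qed.

Lemma L2_form : form_on (L2 O) ip. Proof. exact: (sqint_form leb mO). Qed.
Local Notation FH := L2_form.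

Definition comp (i : 'I_d) (g : fld) : 'rV[R]_d -> R := fun x => g x ord0 i.

Lemma comp_lin i a (g h : fld) : comp i (a *: g + h) = a *: comp i g + comp i h.
Proof. by apply/funext => x; rewrite /comp !mxE. Qed.

Lemma compB i (g h : fld) : comp i (g - h) = comp i g - comp i h.
Proof. by apply/funext => x; rewrite /comp !mxE. Qed.

Definition L2fld : set fld := [set g | forall i, L2 O (comp i g)].
Definition ipG (g h : fld) : R := \sum_i ip (comp i g) (comp i h).

Lemma L2fld_form : form_on L2fld ipG.
Proof.
split.
- move=> i; have -> : comp i 0 = 0 by apply/funext => x; rewrite /comp mxE.
  exact: form0 FH.
- by move=> a g h Sg Sh i; rewrite comp_lin; apply: (formS FH).
- by move=> g h Sg Sh; apply: eq_bigr => i _; rewrite (formC FH).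
- move=> a g h k Sg Sh Sk; rewrite mulr_sumr -big_split; apply: eq_bigr => i _ /=.
  by rewrite comp_lin (formPl FH).
- by move=> g Sg; apply: sumr_ge0 => i _; apply: (form_ge0 FH).
Qed.
Local Notation FG := L2fld_form.

Lemma ip_comp_le i g : L2fld g -> ip (comp i g) (comp i g) <= ipG g g.
Proof.
move=> Sg; rewrite /ipG (bigD1 i)//= lerDl sumr_ge0// => j _.
exact: (form_ge0 FH).
Qed.

Definition tgrad (eta : 'rV[R]_d -> R) : fld := fun x => \row_i partial i eta x.

Lemma comp_tgrad i eta : comp i (tgrad eta) = partial i eta.
Proof. by apply/funext => x; rewrite /comp mxE. Qed.

Lemma test_L2 eta : test_function O eta -> L2 O eta.
Proof. exact: test_function_sqint. Qed.

Lemma tgrad_L2 eta : test_function O eta -> L2fld (tgrad eta).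
Proof. by move=> T i; rewrite comp_tgrad; apply/test_L2/test_function_partial. Qed.

Lemma tgrad_lin a eta xi : test_function O eta -> test_function O xi ->
  tgrad (a *: eta + xi) = a *: tgrad eta + tgrad xi.
Proof.
move=> T T'; apply/funext => x; apply/rowP => i; rewrite !mxE.
by rewrite (test_function_partial_lin a i T T').
Qed.

(** The approximation clause of [H10_gradient], with the limits of the components gathered into one
    limit for [ipG], so that the theory of forms applies. *)
Definition H10_approx u g (eta : nat -> 'rV[R]_d -> R) :=
  [/\ forall n, test_function O (eta n),
      Num.sqrt (ip (eta n - u) (eta n - u)) @[n --> \oo] --> 0 &
      Num.sqrt (ipG (tgrad (eta n) - g) (tgrad (eta n) - g)) @[n --> \oo] --> 0].

Lemma H10_gradientP u g : H10_gradient O u g <->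
  [/\ L2 O u, L2fld g, weak_gradient O u g & exists eta, H10_approx u g eta].
Proof.
split=> -[Lu Lg wg [eta [T eu eg]]]; split => //; exists eta.
  split => //.
    rewrite [X in X @ _ --> _](_ : _ = (fun n => normH O (u \- eta n)))//.
    apply/funext => n; rewrite (form_sqrBC FH)//; exact: test_L2.
  have sq0 : ipG (tgrad (eta n) - g) (tgrad (eta n) - g) @[n --> \oo] --> 0.
    have i0 (i : 'I_d) : (normH O (fun x => g x ord0 i - partial i (eta n) x)) *
        (normH O (fun x => g x ord0 i - partial i (eta n) x)) @[n --> \oo] --> 0.
      by rewrite [X in _ --> X](_ : 0 = 0 * 0); [apply: cvgM; exact: eg|rewrite mulr0].
    rewrite [X in _ --> X](_ : 0 = \sum_(i < d) 0); last by rewrite big1.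
    rewrite [X in X @ _ --> _](_ : _ = (fun n => \sum_i
        (normH O (fun x => g x ord0 i - partial i (eta n) x)) *
        (normH O (fun x => g x ord0 i - partial i (eta n) x)))).
      exact: cvg_sumr.
    apply/funext => n; apply: eq_bigr => i _.
    have Lp : L2 O (partial i (eta n)) by apply: test_L2; exact: test_function_partial.
    have Lt := tgrad_L2 (T n).
    rewrite -expr2 /normH sqr_sqrtr; last exact: (form_ge0 FH (form_setB FH (Lg i) Lp)).
    by rewrite compB comp_tgrad (form_sqrBC FH)//; exact: Lg.
  rewrite [X in _ --> X](_ : 0 = Num.sqrt 0); last by rewrite sqrtr0.
  by apply: (continuous_cvg _ (@sqrt_continuous R _) sq0).
split => //.
  rewrite [X in X @ _ --> _](_ : _ = (fun n => Num.sqrt (ip (eta n - u) (eta n - u))))//.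
  apply/funext => n; rewrite (form_sqrBC FH)//; exact: test_L2.
move=> i; apply: (@sqrt_cvg0_le _ 1 _ _ _ eg) => n.
have Lt := tgrad_L2 (T n).
rewrite expr1n mul1r; apply: le_trans (ip_comp_le i (form_setB FG Lt Lg)).
rewrite compB comp_tgrad (form_sqrBC FH)//; first exact: Lg.
by apply: test_L2; exact: test_function_partial.
Qed.

Lemma ip_ae_eq u u' v : L2 O u -> L2 O u' -> L2 O v ->
  {ae leb, forall x, O x -> u x = u' x} -> ip u v = ip u' v.
Proof.
move=> Lu Lu' Lv uu'; apply/eqP; rewrite -subr_eq0 -(formBl FH)//; apply/eqP.
apply: (@ipL2_ae0 _ _ _ leb O mO) => //; first exact: (form_setB FH).
by apply: filterS uu' => x /[apply] xx; rewrite -[LHS]/(u x - u' x) xx subrr.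
Qed.

(** By the weak formulation the difference of the gradients is orthogonal to all test functions. It
    is also a limit of gradients of test functions, whose components are again test functions. So it
    is orthogonal to itself, and the density of test functions in L^2 is avoided. *)
Lemma H10_gradient_unique u u' g g' : H10_gradient O u g -> H10_gradient O u' g' ->
  {ae leb, forall x, O x -> u x = u' x} -> ipG (g - g') (g - g') = 0.
Proof.
move=> /H10_gradientP[Lu Lg wg [eta [T eu eg]]].
move=> /H10_gradientP[Lu' Lg' wg' [eta' [T' eu' eg']]] uu'.
have Lk := form_setB FG Lg Lg'.
pose xi n := (-1) *: eta' n + eta n.
have Txi n : test_function O (xi n) by exact: test_function_lin.
have xiE n : tgrad (xi n) = tgrad (eta n) - tgrad (eta' n).
  by rewrite tgrad_lin// scaleN1r addrC.
have orth eta0 i : test_function O eta0 -> ip (comp i (g - g')) eta0 = 0.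
  move=> T0; have L0 := test_L2 T0; rewrite compB (formBl FH)//.
  have := wg i eta0 T0; have := wg' i eta0 T0.
  rewrite -[LHS]/(ip u' (partial i eta0)) -[X in _ = - X]/(ip (comp i g') eta0).
  move=> e1; rewrite -[LHS]/(ip u (partial i eta0)) -[X in _ = - X]/(ip (comp i g) eta0).
  rewrite (@ip_ae_eq u u')//; last by apply: test_L2; exact: test_function_partial.
  by rewrite e1 => /eqP; rewrite eqr_opp => /eqP ->; rewrite subrr.
have lim : Num.sqrt (ipG (tgrad (xi n) - (g - g')) (tgrad (xi n) - (g - g')))
    @[n --> \oo] --> 0.
  have e n : tgrad (xi n) - (g - g') =
      (-1) *: (tgrad (eta' n) - g') + (tgrad (eta n) - g).
    rewrite xiE scaleN1r !opprB [g' - g]addrC addrACA [RHS]addrC.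
    by rewrite [g' - _]addrC.
  pose dif n := (-1) *: (tgrad (eta' n) - g') + (tgrad (eta n) - g).
  apply: (@sqrt_cvg0_le _ 1 _ (fun n => ipG (dif n) (dif n))) => [n|].
    by rewrite e expr1n mul1r.
  by apply: (form_norm_cvg0_lin FG) => // n; apply: (form_setB FG) => //; exact: tgrad_L2.
have L n := tgrad_L2 (Txi n).
have lim0 : ipG (tgrad (xi n)) (g - g') @[n --> \oo] --> ipG (g - g') (g - g').
  by apply: (form_cvg FG).
have E : (fun n => ipG (tgrad (xi n)) (g - g')) = cst 0.
  apply/funext => n; rewrite (formC FG)// /ipG big1// => i _.
  by rewrite comp_tgrad; apply: orth; exact: test_function_partial.
by move: lim0; rewrite E => h; rewrite -(cvg_lim (@Rhausdorff R) h) lim_cst.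
Qed.

Lemma H10_gradient_lin a u v g h : H10_gradient O u g -> H10_gradient O v h ->
  H10_gradient O (a *: u + v) (a *: g + h).
Proof.
move=> /H10_gradientP[Lu Lg wg [eta [T eu eg]]].
move=> /H10_gradientP[Lv Lh wh [zeta [T' ev eh]]].
apply/H10_gradientP; split.
- exact: (formS FH).
- exact: (formS FG).
- move=> i xi Txi; have Lxi := test_L2 Txi.
  have Lp := test_L2 (test_function_partial i Txi).
  rewrite -[LHS]/(ip (a *: u + v) (partial i xi)) -[X in _ = - X]/(ip (comp i (a *: g + h)) xi).
  rewrite comp_lin !(formPl FH)// opprD -mulrN.
  by congr (a * _ + _); [exact: wg|exact: wh].
exists (fun n => a *: eta n + zeta n); split.
- by move=> n; exact: test_function_lin.
- have e n : a *: eta n + zeta n - (a *: u + v) = a *: (eta n - u) + (zeta n - v).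
    by rewrite scalerBr opprD addrACA.
  under eq_fun do rewrite e.
  by apply: (form_norm_cvg0_lin FH) => // n; apply: (form_setB FH) => //; exact: test_L2.
- have e n : tgrad (a *: eta n + zeta n) - (a *: g + h) =
      a *: (tgrad (eta n) - g) + (tgrad (zeta n) - h).
    by rewrite tgrad_lin// scalerBr opprD addrACA.
  under eq_fun do rewrite e.
  by apply: (form_norm_cvg0_lin FG) => // n; apply: (form_setB FG) => //; exact: tgrad_L2.
Qed.

Lemma H10_gradient0 : H10_gradient O 0 0.
Proof.
apply/H10_gradientP; split; [exact: form0 FH|exact: form0 FG| |].
  move=> i eta T; rewrite -[LHS]/(ip 0 (partial i eta)).
  have -> : ip 0 (partial i eta) = 0.
    by rewrite (form0l FH)//; apply: test_L2; exact: test_function_partial.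
  rewrite -[X in _ = - X]/(ip (comp i 0) eta).
  have -> : comp i 0 = 0 by apply/funext => x; rewrite /comp mxE.
  by rewrite (form0l FH) ?oppr0//; exact: test_L2.
exists (fun=> 0); split.
- by move=> _; exact: test_function0.
- by rewrite subrr (form0l FH) ?sqrtr0; [exact: cvg_cst|exact: form0 FH].
- have -> : tgrad 0 = 0 by apply/funext => x; apply/rowP => i; rewrite !mxE partial0.
  by rewrite subrr (form0l FG) ?sqrtr0; [exact: cvg_cst|exact: form0 FG].
Qed.

Lemma gradP u : H10 O u -> H10_gradient O u (grad O u).
Proof. by move=> [g gP]; rewrite /grad; case: xgetP => [y ->//|/(_ g)]. Qed.

Lemma H10_L2 u : H10 O u -> L2 O u. Proof. by move=> [g []]. Qed.

Lemma grad_L2 u : H10 O u -> L2fld (grad O u).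
Proof. by move=> /gradP []. Qed.

Definition ipV u v : R := ipG (grad O u) (grad O v).

Lemma ipV_gradient u g v : H10_gradient O u g -> H10 O v ->
  ipV u v = ipG g (grad O v).
Proof.
move=> ug Hv; have Hu : H10 O u by exists g.
have Lg : L2fld g by case: ug.
have Lu := grad_L2 Hu; have Lv := grad_L2 Hv.
apply/eqP; rewrite -subr_eq0 -(formBl FG)//; apply/eqP.
apply: (form_null FG) => //; first exact: (form_setB FG).
by apply: H10_gradient_unique (gradP Hu) ug _; apply: aeW.
Qed.

Lemma H10_form : form_on (H10 O) ipV.
Proof.
split.
- by exists 0; exact: H10_gradient0.
- by move=> a u v [g ug] [h vh]; exists (a *: g + h); exact: H10_gradient_lin.
- by move=> u v Hu Hv; apply: (formC FG); exact: grad_L2.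
- move=> a u v w Hu Hv Hw.
  rewrite (ipV_gradient (H10_gradient_lin a (gradP Hu) (gradP Hv)) Hw).
  by rewrite (formPl FG)//; exact: grad_L2.
- by move=> u Hu; apply: (form_ge0 FG); exact: grad_L2.
Qed.

(** Such a [u] vanishes almost everywhere, 0 has the gradient 0, and gradients are unique up to null
    sets. This provides [h_null] for the convergence of resolvents. *)
Lemma ipV_null u : H10 O u -> ip u u = 0 -> ipV u u = 0.
Proof.
move=> Hu u0; rewrite (@form_null _ _ _ _ H10_form)//.
have Lu := H10_L2 Hu.
have := H10_gradient_unique (gradP Hu) H10_gradient0.
rewrite subr0; apply; exact: (ipL2_null mO Lu u0).
Qed.

Lemma H10_ae_eq u v : L2 O v -> H10 O u -> {ae leb, forall x, O x -> u x = v x} ->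
  H10_gradient O v (grad O u).
Proof.
move=> Lv Hu uv; have /H10_gradientP[Lu Lg wg [eta [T eu eg]]] := gradP Hu.
apply/H10_gradientP; split => //.
  move=> i xi Txi; rewrite -(wg i xi Txi); apply/esym/(ip_ae_eq Lu Lv _ uv).
  by apply: test_L2; exact: test_function_partial.
exists eta; split => //.
apply: (@sqrt_cvg0_le _ 1 _ _ _ eu) => n.
rewrite expr1n mul1r; have Le := test_L2 (T n).
rewrite !(form_sqrB FH)// (formC FH Le Lv) (formC FH Le Lu).
rewrite -(ip_ae_eq Lu Lv Le uv) -(ip_ae_eq Lu Lv Lv uv).
by rewrite (formC FH Lu Lv) -(ip_ae_eq Lu Lv Lu uv).
Qed.

End H10_space.

Lemma Rintegral_sumr dd (T : measurableType dd) (R : realType)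
    (mu : {measure set T -> \bar R}) (D : set T) (I : Type) (s : seq I) (f : I -> T -> R) :
  measurable D -> (forall i, mu.-integrable D (EFin \o f i)) ->
  mu.-integrable D (EFin \o (fun x => \sum_(i <- s) f i x)) /\
  \int[mu]_(x in D) (\sum_(i <- s) f i x) = \sum_(i <- s) \int[mu]_(x in D) f i x.
Proof.
move=> mD fi; elim: s => [|i s [IHi IH]].
  split; last first.
    rewrite big_nil -[RHS](@Rintegral_set0 _ _ _ mu (fun=> 0)) /Rintegral.
    rewrite integral_set0; congr fine; apply: integral0_eq => x _.
    by rewrite big_nil.
  apply: eq_integrable (integrable0 mu D) => // x _ /=; by rewrite big_nil.
split.
  apply: (@eq_integrable _ _ _ _ _ mD (fun x => (f i x)%:E + ((\sum_(j <- s) f j x)%R)%:E)%E).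
    by move=> x _ /=; rewrite big_cons.
  exact: (integrableD mD (fi i) IHi).
rewrite big_cons -IH -RintegralD//.
by apply: eq_Rintegral => x _; rewrite big_cons.
Qed.

Section H10_sobolev.
Context {R : realType} {d : nat} (O : set 'rV[R]_d).
Hypotheses (d_gt0 : (0 < d)%N) (oO : open O) (bO : bounded_set O).
Local Notation leb := (lebesgue_rV d).
Local Notation fld := ('rV[R]_d -> 'rV[R]_d).
Local Notation ip := (ipH O).
Local Notation FH := (L2_form oO).
Local Notation FG := (L2fld_form oO).

Definition dim0 : R := Num.max 1 (d%:R / 2).
Definition vol : R := fine (leb O).

Let mO : measurable O. Proof. exact: open_rV_measurable. Qed.
Let volfin : (leb O < +oo)%E. Proof. exact: bounded_rV_fin_measure. Qed.

Lemma dim0_ge1 : 1 <= dim0. Proof. by rewrite le_max lexx. Qed.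
Lemma dim0_gt0 : 0 < dim0. Proof. exact: lt_le_trans dim0_ge1. Qed.
Lemma vol_ge0 : 0 <= vol. Proof. exact: fine_ge0. Qed.

Lemma dotE (x : 'rV[R]_d) : dot x x = \sum_i x ord0 i ^+ 2.
Proof. by apply: eq_bigr => i _; rewrite expr2. Qed.

Lemma dot_ge0 (x : 'rV[R]_d) : 0 <= dot x x.
Proof. by rewrite dotE sumr_ge0// => i _; exact: sqr_ge0. Qed.

Lemma ipG_dot (g h : fld) : L2fld O g -> L2fld O h ->
  leb.-integrable O (EFin \o (fun x => dot (g x) (h x))) /\
  ipG O g h = \int[leb]_(x in O) dot (g x) (h x).
Proof.
move=> Lg Lh.
have [] := @Rintegral_sumr _ _ _ leb O 'I_d (index_enum 'I_d)
  (fun i x => g x ord0 i * h x ord0 i) mO.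
  by move=> i; apply: (sqint_mul mO); [exact: Lg|exact: Lh].
by move=> ii E; split; [exact: ii|exact: (esym E)].
Qed.

Section weight.
Variables (om : 'rV[R]_d -> R) (e : R).
Hypotheses (mom : measurable_fun O om) (e0 : 0 < e) (eom : forall x, O x -> e <= om x).

Let om0 x : O x -> 0 < om x. Proof. by move=> /eom; exact: lt_le_trans. Qed.

(** Dividing by the root of the weight turns the weighted Dirichlet integral into a sum of plain L^2
    products, and [e <= om] makes this division a bounded operator on L^2. *)
Let W (f : 'rV[R]_d -> R) : 'rV[R]_d -> R := fun x => f x * (Num.sqrt (om x))^-1.

Let mw : measurable_fun O (fun x => (Num.sqrt (om x))^-1).
Proof.
apply: (@measurable_fun_inv_ge0 R _ _ O (fun x => Num.sqrt (om x)) mO); last first.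
  by move=> x _; exact: sqrtr_ge0.
apply: (eq_measurable_fun (fun x => om x `^ 2^-1)).
  by move=> x /[!inE] Ox; rewrite powR12_sqrt// ltW// om0.
by apply: (measurableT_comp (@measurable_powR R _)).
Qed.

Let W_L2 f : L2 O f -> L2 O (W f).
Proof.
move=> Lf; have Lef := form_setZ FH ((Num.sqrt e)^-1) Lf.
apply: (@sqint_le _ _ _ leb O mO _ _ _ _ Lef).
  by rewrite /W; apply: measurable_funM; [case: Lf|exact: mw].
move=> x Ox; rewrite -[X in _ <= `|X|]/((Num.sqrt e)^-1 * f x) /W mulrC !normrM ler_wpM2r//.
rewrite !ger0_norm ?invr_ge0 ?sqrtr_ge0// lef_pV2 ?posrE ?sqrtr_gt0 ?om0//.
by rewrite ler_wsqrtr// eom.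
Qed.

Let W_ip f : L2 O f -> ip (W f) (W f) <= ((Num.sqrt e)^-1) ^+ 2 * ip f f.
Proof.
move=> Lf; have Lw := W_L2 Lf.
rewrite -RintegralZl//; last exact: (sqint_mul mO Lf Lf).
apply: le_Rintegral => //; first exact: (sqint_mul mO Lw Lw).
  apply: (@eq_integrable _ _ _ _ _ mO (fun x => ((Num.sqrt e)^-1 ^+ 2)%:E * (f x * f x)%:E)%E) => //.
  by apply: (integrableZl mO); exact: (sqint_mul mO Lf Lf).
move=> x Ox; rewrite /W mulrACA -!expr2 mulrC ler_wpM2r ?sqr_ge0//.
rewrite lerXn2r ?nnegrE ?invr_ge0 ?sqrtr_ge0// lef_pV2 ?posrE ?sqrtr_gt0 ?om0//.
by rewrite ler_wsqrtr// eom.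
Qed.

Let W_dot (g : fld) : L2fld O g ->
  \int[leb]_(x in O) (dot (g x) (g x) / om x) = \sum_i ip (W (comp i g)) (W (comp i g)).
Proof.
move=> Lg.
have [_ <-] := @Rintegral_sumr _ _ _ leb O 'I_d (index_enum 'I_d)
  (fun i x => W (comp i g) x * W (comp i g) x) mO
  (fun i => sqint_mul mO (W_L2 (Lg i)) (W_L2 (Lg i))).
apply: eq_Rintegral => x /[!inE] Ox; rewrite /dot mulr_suml; apply: eq_bigr => i _.
rewrite /W /comp mulrACA; congr (_ * _).
by rewrite -invfM -expr2 sqr_sqrtr// ltW// om0.
Qed.

(** Passage to the limit from test functions: both sides are continuous for the convergence in
    [H10_approx], the right one thanks to the lower bound of the weight. *)
Lemma sobolev_H10 u g : leb.-integrable O (EFin \o (fun x => om x `^ dim0)) ->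
  H10_gradient O u g ->
  ip u u <= (4 + vol) * ((\int[leb]_(x in O) (om x `^ dim0)) `^ dim0^-1 *
    \int[leb]_(x in O) (dot (g x) (g x) / om x)).
Proof.
move=> iom /(H10_gradientP oO bO)[Lu Lg _ [eta [T eu eg]]].
set c := (\int[leb]_(x in O) _) `^ _.
have Le n := test_L2 oO bO (T n).
have Lp i n : L2 O (partial i (eta n)).
  by apply: (test_L2 oO bO); exact: test_function_partial.
have l1 : ip (eta n) (eta n) @[n --> \oo] --> ip u u by apply: (form_cvg2 FH).
have l2 : \sum_i ip (W (partial i (eta n))) (W (partial i (eta n))) @[n --> \oo] -->
    \sum_i ip (W (comp i g)) (W (comp i g)).
  apply: cvg_sumr => i; have Lw n := W_L2 (Lp i n).
  have lw : Num.sqrt (ip (W (partial i (eta n)) - W (comp i g))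
      (W (partial i (eta n)) - W (comp i g))) @[n --> \oo] --> 0.
    apply: (@sqrt_cvg0_le _ (Num.sqrt e)^-1 _ _ _ eg) => n.
    have Lt := tgrad_L2 oO bO (T n).
    have -> : W (partial i (eta n)) - W (comp i g) = W (comp i (tgrad (eta n) - g)).
      by rewrite compB comp_tgrad; apply/funext => x; rewrite /W [RHS]mulrDl mulNr.
    apply: le_trans (W_ip (form_setB FG Lt Lg i)) _.
    rewrite ler_wpM2l ?sqr_ge0//; apply: (ip_comp_le oO).
    exact: (form_setB FG).
  by apply: (form_cvg2 FH) => //; exact: W_L2.
have l3 : (4 + vol) * (c * \sum_i ip (W (partial i (eta n))) (W (partial i (eta n))))
    @[n --> \oo] --> (4 + vol) * (c * \sum_i ip (W (comp i g)) (W (comp i g))).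
  by do 2 (apply: cvgM; first exact: cvg_cst).
rewrite W_dot//; apply: (ler_cvg_to l1 l3); near=> n.
apply: le_trans (sobolev_test d_gt0 oO bO mom e0 eom (T n) iom) _.
rewrite /vol -/c ler_wpM2l ?addr_ge0 ?vol_ge0// ler_wpM2l ?powR_ge0//.
rewrite /wdir; apply: eqW.
have := W_dot (tgrad_L2 oO bO (T n)).
under [X in _ = X -> _]eq_bigr do rewrite comp_tgrad.
move=> <-; apply: eq_Rintegral => x _; rewrite dotE; congr (_ / _).
by apply: eq_bigr => i _; rewrite mxE.
Unshelve. all: by end_near. Qed.

End weight.

(** The constant of [sobolev_H10] for the weight 1, whose integral is the volume. *)
Definition poincare_cst : R := (4 + vol) * vol `^ dim0^-1.

Lemma poincare_gradient u g : H10_gradient O u g -> ip u u <= poincare_cst * ipG O g g.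
Proof.
move=> ug; have Lg : L2fld O g by case: ug.
have one x : O x -> (1 : R) <= cst (1 : R) x by [].
have mone : measurable_fun O (cst (1 : R) : 'rV[R]_d -> R) by exact: measurable_cst.
have iom : leb.-integrable O (EFin \o (fun x : 'rV[R]_d => cst (1 : R) x `^ dim0)).
  rewrite (_ : EFin \o _ = EFin \o cst (1 : R)); last by apply/funext => x /=; rewrite powR1.
  exact: (sqint_integrable mO volfin (@sqint_cst _ _ _ leb O mO volfin 1)).
apply: le_trans (sobolev_H10 mone ltr01 one iom ug) _.
rewrite /poincare_cst -mulrA; apply: eqW; congr (_ * (_ `^ _ * _)).
  under eq_Rintegral do rewrite powR1.
  by rewrite Rintegral_cst// mul1r.
have [_ ->] := ipG_dot Lg Lg.
by apply: eq_Rintegral => x _; rewrite divr1.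
Qed.

Lemma poincare u : H10 O u -> ip u u <= poincare_cst * ipV O u u.
Proof. by move=> /gradP/poincare_gradient. Qed.

Lemma L2fld_complete (g : nat -> fld) : (forall n, L2fld O (g n)) ->
  (forall eps : R, 0 < eps -> exists N, forall m n, (N <= m)%N -> (N <= n)%N ->
    ipG O (g m - g n) (g m - g n) <= eps) ->
  exists2 k, L2fld O k &
    Num.sqrt (ipG O (g n - k) (g n - k)) @[n --> \oo] --> 0.
Proof.
move=> Lg gc.
have /choice[k kP] i : exists k, sqint leb O k /\ forall eps : R, 0 < eps ->
    exists N, forall n, (N <= n)%N -> ip (comp i (g n) - k) (comp i (g n) - k) <= eps.
  have [|k Lk kP] := @sqint_complete _ _ _ leb O mO volfin (fun n => comp i (g n)) (fun n => Lg n i).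
    move=> eps /gc[N NP]; exists N => m n Nm Nn.
    apply: le_trans (NP m n Nm Nn).
    rewrite -[X in X <= _]/(ip (comp i (g m) - comp i (g n)) (comp i (g m) - comp i (g n))).
    by rewrite -compB; apply: (ip_comp_le oO); exact: (form_setB FG).
  by exists k.
pose K : fld := fun x => \row_i k i x.
have compK i : comp i K = k i by apply/funext => x; rewrite /comp mxE.
have LK : L2fld O K by move=> i; rewrite compK; case: (kP i).
exists K => //.
have sq0 : ipG O (g n - K) (g n - K) @[n --> \oo] --> 0.
  rewrite [X in _ --> X](_ : 0 = \sum_(i < d) 0); last by rewrite big1.
  apply: cvg_sumr => i.
  rewrite [X in X @ _ --> _](_ : _ = fun n => ip (comp i (g n) - k i) (comp i (g n) - k i)).
    apply/cvg0P; last by have [] := kP i.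
    move=> n; apply: (form_ge0 FH); apply: (form_setB FH); first exact: Lg.
    by have [] := kP i.
  by apply/funext => n; rewrite compB compK.
rewrite [X in _ --> X](_ : 0 = Num.sqrt 0); last by rewrite sqrtr0.
by apply: (continuous_cvg _ (@sqrt_continuous R _) sq0).
Qed.

Lemma ipV_gradient2 a b g h : H10_gradient O a g -> H10_gradient O b h ->
  ipV O a b = ipG O g h.
Proof.
move=> ag bh; have Hb : H10 O b by exists h.
have Lg : L2fld O g by case: ag.
have Lh : L2fld O h by case: bh.
have Lb := grad_L2 Hb.
rewrite (ipV_gradient oO bO ag Hb) (formC FG)// [RHS](formC FG)//.
apply/eqP; rewrite -subr_eq0 -(formBl FG)//; apply/eqP.
apply: (form_null FG) => //; first exact: (form_setB FG).
by apply: (H10_gradient_unique oO bO (gradP Hb) bh); apply: aeW.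
Qed.

Lemma H10_gradientB a b g h : H10_gradient O a g -> H10_gradient O b h ->
  H10_gradient O (a - b) (g - h).
Proof.
move=> ag bh; have := H10_gradient_lin oO bO (-1) bh ag.
by rewrite !scaleN1r addrC [- h + g]addrC.
Qed.

(** The weak formulation passes to the limit by continuity. For the approximation, a test function
    within [n.+1%:R^-1] of [u n], together with its gradient, is chosen for each n. *)
Lemma H10_gradient_closed (u : nat -> 'rV[R]_d -> R) (g : nat -> fld) v k :
  (forall n, H10_gradient O (u n) (g n)) -> L2 O v -> L2fld O k ->
  Num.sqrt (ip (u n - v) (u n - v)) @[n --> \oo] --> 0 ->
  Num.sqrt (ipG O (g n - k) (g n - k)) @[n --> \oo] --> 0 ->
  H10_gradient O v k.
Proof.
move=> ug Lv Lk uv gk.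
have Lu n : L2 O (u n) by case: (ug n).
have Lg n : L2fld O (g n) by case: (ug n).
apply/(H10_gradientP oO bO); split => //.
  move=> i eta T; have Le := test_L2 oO bO T.
  have Lp : L2 O (partial i eta).
    by apply: (test_L2 oO bO); exact: test_function_partial.
  have l1 : ip (u n) (partial i eta) @[n --> \oo] --> ip v (partial i eta).
    exact: (form_cvg FH).
  have l2 : - ip (comp i (g n)) eta @[n --> \oo] --> - ip (comp i k) eta.
    apply: cvgN; apply: (form_cvg FH) => //; first by move=> n; exact: Lg.
    apply: (@sqrt_cvg0_le _ 1 _ _ _ gk) => n; rewrite expr1n mul1r -compB.
    by apply: (ip_comp_le oO); exact: (form_setB FG).
  have E : (fun n => ip (u n) (partial i eta)) = (fun n => - ip (comp i (g n)) eta).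
    by apply/funext => n; have [_ _ wg _] := ug n; exact: wg.
  by move: l1; rewrite E => l1; apply: (cvg_unique _ l1 l2).
have /choice[eta etaP] n : exists eta, test_function O eta /\
    Num.sqrt (ip (eta - u n) (eta - u n)) <= n.+1%:R^-1 /\
    Num.sqrt (ipG O (tgrad eta - g n) (tgrad eta - g n)) <= n.+1%:R^-1.
  have /(H10_gradientP oO bO)[_ _ _ [eta [T e1 e2]]] := ug n.
  have n0 : 0 < n.+1%:R^-1 :> R by rewrite invr_gt0.
  have /cvg0P : forall m, 0 <= Num.sqrt (ip (eta m - u n) (eta m - u n)).
    by move=> m; exact: sqrtr_ge0.
  move=> [/(_ e1) /(_ _ n0)[N1 H1] _].
  have /cvg0P : forall m, 0 <= Num.sqrt (ipG O (tgrad (eta m) - g n) (tgrad (eta m) - g n)).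
    by move=> m; exact: sqrtr_ge0.
  move=> [/(_ e2) /(_ _ n0)[N2 H2] _].
  by exists (eta (maxn N1 N2)); split => //; split;
    [apply: H1; exact: leq_maxl|apply: H2; exact: leq_maxr].
have sum0 (a b : nat -> R) : (forall n, 0 <= a n) ->
    (forall n, a n <= n.+1%:R^-1 + b n) -> b n @[n --> \oo] --> 0 ->
    a n @[n --> \oo] --> 0.
  move=> a0 ab b0.
  have l : n.+1%:R^-1 + b n @[n --> \oo] --> 0.
    by rewrite [X in _ --> X](_ : 0 = 0 + 0); [|by rewrite addr0]; exact: (cvgD (@cvg_harmonic R) b0).
  apply: (squeeze_cvgr _ (cvg_cst 0) l); apply: nearW => n.
  by rewrite a0 ab.
exists eta; split => [n||]; first by case: (etaP n).
  apply: (sum0 _ _ _ _ uv) => n; first exact: sqrtr_ge0.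
  have [T [e1 _]] := etaP n; have Le := test_L2 oO bO T.
  have -> : eta n - v = (eta n - u n) + (u n - v) by rewrite addrA subrK.
  apply: le_trans (form_norm_leD FH (form_setB FH Le (Lu n)) (form_setB FH (Lu n) Lv)) _.
  by rewrite lerD2r.
apply: (sum0 _ _ _ _ gk) => n; first exact: sqrtr_ge0.
have [T [_ e1]] := etaP n; have Le := tgrad_L2 oO bO T.
have -> : tgrad (eta n) - k = (tgrad (eta n) - g n) + (g n - k) by rewrite addrA subrK.
apply: le_trans (form_norm_leD FG (form_setB FG Le (Lg n)) (form_setB FG (Lg n) Lk)) _.
by rewrite lerD2r.
Qed.

Lemma poincare_cst_ge0 : 0 <= poincare_cst.
Proof. by rewrite /poincare_cst mulr_ge0 ?powR_ge0// addr_ge0// vol_ge0. Qed.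

(** By Poincare's inequality the functions are Cauchy in L^2 as well as their gradients, and
    closedness says that the second limit is the gradient of the first. It discharges the hypothesis
    [V_complete] of the resolvent theory. *)
Lemma H10_complete (u : nat -> 'rV[R]_d -> R) : (forall n, H10 O (u n)) ->
  (forall eps : R, 0 < eps -> exists N, forall m n, (N <= m)%N -> (N <= n)%N ->
    ipV O (u m - u n) (u m - u n) <= eps) ->
  exists2 v, H10 O v & forall eps : R, 0 < eps -> exists N, forall n, (N <= n)%N ->
    ipV O (u n - v) (u n - v) <= eps.
Proof.
move=> Hu uc; pose g n := grad O (u n).
have ug n : H10_gradient O (u n) (g n) by exact: gradP.
have Lg n : L2fld O (g n) by case: (ug n).
have Lu n : L2 O (u n) by case: (ug n).
have gE a b p r : H10_gradient O a p -> H10_gradient O b r ->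
    ipV O (a - b) (a - b) = ipG O (p - r) (p - r).
  by move=> ap br; apply: ipV_gradient2; exact: H10_gradientB.
have gc (eps : R) : 0 < eps -> exists N, forall m n, (N <= m)%N -> (N <= n)%N ->
    ipG O (g m - g n) (g m - g n) <= eps.
  move=> /uc[N NP]; exists N => m n Nm Nn.
  by rewrite -(gE _ _ _ _ (ug m) (ug n)) NP.
have [k Lk gk] := L2fld_complete Lg gc.
have c0 : 0 < poincare_cst + 1 by rewrite ltr_wpDl// poincare_cst_ge0.
have [|v Lv uv] := @sqint_complete _ _ _ leb O mO volfin u Lu.
  move=> eps e0; have [|N NP] := gc (eps / (poincare_cst + 1)); first exact: divr_gt0.
  exists N => m n Nm Nn; have := NP m n Nm Nn; rewrite ler_pdivlMr// => h.
  apply: le_trans h; apply: le_trans (poincare_gradient (H10_gradientB (ug m) (ug n))) _.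
  rewrite mulrC ler_wpM2l//; last by rewrite lerDl.
  by apply: (form_ge0 FG); exact: (form_setB FG).
have vk : H10_gradient O v k.
  apply: (H10_gradient_closed ug Lv Lk) => //.
  by apply/(form_cvg_sqr FH).
exists v; first by exists k.
move=> eps e0; have /(form_cvg_sqr FG) := gk => /(_ Lg Lk) /(_ _ e0)[N NP].
by exists N => n /NP; rewrite (gE _ _ _ _ (ug n) vk).
Qed.

End H10_sobolev.

(** * Continuous functionals on H and the Yosida regularisation *)

Section H_continuity.
Context {R : realType} {d : nat} (O : set 'rV[R]_d).
Hypothesis oO : open O.
Local Notation ip := (ipH O).
Local Notation FH := (L2_form oO).
Local Notation fct := ('rV[R]_d -> R).

(** Formulated on representatives to match [openH]: adaptedness of a process then makes every such
    functional of it measurable. *)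
Definition H_continuous (Phi : fct -> R) : Prop :=
  forall f, L2 O f -> forall eps : R, 0 < eps -> exists2 r : R, 0 < r &
    forall h, L2 O h -> normH O (f - h) < r -> `|Phi f - Phi h| < eps.

Lemma normHC f g : L2 O f -> L2 O g -> normH O (f - g) = normH O (g - f).
Proof. by move=> Lf Lg; rewrite /normH (form_sqrBC FH). Qed.

Lemma H_continuous_seq (Phi : fct -> R) :
  (forall f (g : nat -> fct), L2 O f -> (forall n, L2 O (g n)) ->
    normH O (g n - f) @[n --> \oo] --> 0 -> Phi (g n) @[n --> \oo] --> Phi f) ->
  H_continuous Phi.
Proof.
move=> seqc f Lf eps e0; apply: contrapT => nex.
have /choice[g gP] n : exists g, L2 O g /\ normH O (f - g) < n.+1%:R^-1 /\
    eps <= `|Phi f - Phi g|.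
  apply: contrapT => ng; apply: nex; exists n.+1%:R^-1; first by rewrite invr_gt0.
  move=> h Lh fh; rewrite ltNge; apply/negP => le; apply: ng; by exists h.
have Lg n : L2 O (g n) by case: (gP n).
have gf : normH O (g n - f) @[n --> \oo] --> 0.
  apply: (squeeze_cvgr _ (cvg_cst 0) (@cvg_harmonic R)); apply: nearW => n.
  by rewrite sqrtr_ge0/= normHC// ltW//; case: (gP n) => _ [].
have /cvgrPdist_lt/(_ _ e0)[N _ NP] := seqc f g Lf Lg gf.
by have [_ [_]] := gP N; rewrite leNgt NP/=.
Qed.

Lemma H_continuous_cvg (Phi : fct -> R) {I : Type} {G : set_system I} {FG : Filter G} (x : I -> fct) l :
  H_continuous Phi -> L2 O l -> (\forall i \near G, L2 O (x i)) ->
  normH O (x i - l) @[i --> G] --> 0 -> Phi (x i) @[i --> G] --> Phi l.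
Proof.
move=> cPhi Ll Lx xl; apply/cvgrPdist_lt => eps e0.
have [r r0 rP] := cPhi l Ll eps e0.
move/cvgrPdist_lt : xl => /(_ _ r0); apply: filterS2 Lx => i Lx.
by rewrite sub0r normrN ger0_norm ?sqrtr_ge0// normHC// => /rP; apply.
Qed.

Lemma H_continuous_openH (Phi : fct -> R) (c : R) : H_continuous Phi -> openH O [set f | c < Phi f].
Proof.
move=> cPhi f Lf /= cf; have [|r r0 rP] := cPhi f Lf (Phi f - c).
  by rewrite subr_gt0.
exists r => // h Lh /(rP h Lh) /(le_lt_trans (ler_norm _)).
by rewrite ltrBlDr -ltrBlDl opprB addrC subrK.
Qed.

Lemma H_continuous_ip v : L2 O v -> H_continuous (fun f => ip f v).
Proof.
move=> Lv; apply: H_continuous_seq => f g Lf Lg gf; exact: (form_cvg FH).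
Qed.

Lemma H_continuous_sqr : H_continuous (fun f => ip f f).
Proof.
apply: H_continuous_seq => f g Lf Lg gf; exact: (form_cvg2 FH).
Qed.

End H_continuity.

Section regularization.
Context {R : realType} {d : nat} (O : set 'rV[R]_d).
Hypotheses (d_gt0 : (0 < d)%N) (oO : open O) (bO : bounded_set O).
Local Notation leb := (lebesgue_rV d).
Local Notation ip := (ipH O).
Local Notation FH := (L2_form oO).
Local Notation FV := (H10_form oO bO).

Definition reg n : ('rV[R]_d -> R) -> 'rV[R]_d -> R :=
  resolvent (H10 O) ip (ipV O) n.+1%:R.
(* Continuous on H and increasing to the square of the V-norm, hence the
   measurability of |X_t|_V in t and in omega. *)
Definition reg_energy n : ('rV[R]_d -> R) -> R :=
  envelope (H10 O) ip (ipV O) n.+1%:R.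

Let VH : H10 O `<=` L2 O. Proof. by move=> u; exact: H10_L2. Qed.
Let pc u := @poincare R d O d_gt0 oO bO u.
Let cpl := H10_complete d_gt0 oO bO.
Let n0 n : 0 < n.+1%:R :> R. Proof. by rewrite ltr0n. Qed.

Lemma reg_H10 n f : L2 O f -> H10 O (reg n f).
Proof. exact: (resolvent_in FH FV VH pc cpl (n0 n)). Qed.

Lemma reg_L2 n f : L2 O f -> L2 O (reg n f).
Proof. by move=> /(reg_H10 n)/VH. Qed.

Lemma reg_lip n f g : L2 O f -> L2 O g ->
  ipV O (reg n f - reg n g) (reg n f - reg n g) <= n.+1%:R * ip (f - g) (f - g).
Proof. exact: (resolvent_lip FH FV VH pc cpl (n0 n)). Qed.

Lemma reg_sym n f g : L2 O f -> L2 O g -> ip f (reg n g) = ip (reg n f) g.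
Proof. exact: (resolvent_sym FH FV VH pc cpl (n0 n)). Qed.

Lemma reg_uniq n f g : L2 O f -> L2 O g -> (forall v, H10 O v -> ip f v = ip g v) ->
  forall v, L2 O v -> ip (reg n f) v = ip (reg n g) v.
Proof. exact: (resolvent_uniq FH FV VH pc cpl (n0 n)). Qed.

Lemma reg_le n f : H10 O f -> ipV O (reg n f) (reg n f) <= ipV O f f.
Proof. exact: (resolvent_form_le FH FV VH pc cpl (n0 n)). Qed.

Lemma reg_cvg f : H10 O f ->
  Num.sqrt (ipV O (reg n f - f) (reg n f - f)) @[n --> \oo] --> 0.
Proof.
move=> Hf; apply/(form_cvg_sqr FV) => //; first by move=> n; exact/reg_H10/VH.
exact: (resolvent_cvg FH FV VH pc cpl (@ipV_null _ _ _ oO bO) Hf).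
Qed.

Lemma normH_le_ipV u : H10 O u ->
  normH O u <= Num.sqrt (poincare_cst O) * Num.sqrt (ipV O u u).
Proof.
move=> Hu; rewrite /normH -sqrtrM; last exact: (poincare_cst_ge0 O).
by rewrite ler_wsqrtr// pc.
Qed.

Lemma reg_energy_continuous n : H_continuous O (reg_energy n).
Proof.
apply: (H_continuous_seq oO) => f g Lf Lg gf.
have LJ m : L2 O (reg n (g m)) by exact: reg_L2.
have JL := reg_L2 n Lf.
have Jgf : Num.sqrt (ip (reg n (g m) - reg n f) (reg n (g m) - reg n f)) @[m --> \oo] --> 0.
  apply: (@sqrt_cvg0_le _ (Num.sqrt (poincare_cst O * n.+1%:R)) _ _ _ gf) => m.
  rewrite sqr_sqrtr; last by rewrite mulr_ge0// (poincare_cst_ge0 O).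
  have HB := form_setB FV (reg_H10 n (Lg m)) (reg_H10 n Lf).
  apply: le_trans (pc HB) _; rewrite -mulrA ler_wpM2l ?(poincare_cst_ge0 O)//.
  exact: reg_lip.
apply: cvgM; first exact: cvg_cst.
apply: (form_cvg2 FH) => //; [by move=> m; exact: (form_setB FH (Lg m) (LJ m))|exact: (form_setB FH Lf JL)|].
pose z m := (-1) *: (reg n (g m) - reg n f) + (g m - f).
apply: (@sqrt_cvg0_le _ 1 _ (fun m => ip (z m) (z m))) => [m|].
  rewrite expr1n mul1r (_ : z m = g m - reg n (g m) - (f - reg n f))//.
  by rewrite /z scaleN1r; apply/funext => x; rewrite !fctE; ring.
by apply: (form_norm_cvg0_lin FH) => // m; exact: (form_setB FH).
Qed.

Lemma reg_energy_ge0 n f : L2 O f -> 0 <= reg_energy n f.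
Proof. exact: (envelope_ge0 FH FV VH pc cpl (n0 n)). Qed.

Lemma reg_energy_nd f m n : L2 O f -> (m <= n)%N -> reg_energy m f <= reg_energy n f.
Proof.
move=> Lf mn; have := envelope_cauchy FH FV VH pc cpl Lf mn.
apply: le_trans; rewrite lerDl; apply: (form_ge0 FV).
by apply: (form_setB FV); exact: reg_H10.
Qed.

Lemma normV_H10 u : H10 O u -> normV O u = (Num.sqrt (ipV O u u))%:E.
Proof.
move=> Hu; rewrite /normV asboolT//; congr (Num.sqrt _)%:E.
have Lg := grad_L2 Hu; have [_] := ipG_dot oO Lg Lg; rewrite /ipV => ->.
by apply: eq_Rintegral => x _; rewrite sqr_sqrtr// dot_ge0.
Qed.

Lemma normV_ge0 u : (0 <= normV O u)%E.
Proof. by rewrite /normV; case: ifP => // _; rewrite lee_fin sqrtr_ge0. Qed.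

Lemma normV_sqr u : H10 O u -> (normV O u ^+ 2)%E = (ipV O u u)%:E.
Proof.
move=> Hu; rewrite normV_H10// -EFin_expe sqr_sqrtr//.
exact: (form_ge0 FV Hu).
Qed.

Lemma normV_out u : ~ H10 O u -> normV O u = +oo%E.
Proof. by move=> Hu; rewrite /normV asboolF. Qed.

(** Lower semicontinuity of the V-norm with respect to H: [envelope_bounded] produces an element of
    V at H-distance 0 from [u], hence equal to [u] almost everywhere. *)
Lemma H10_bounded_energy u M : L2 O u -> (forall n, reg_energy n u <= M) ->
  H10 O u /\ ipV O u u <= M.
Proof.
move=> Lu uM; have [g [Hg ug qg _]] := envelope_bounded FH FV VH pc cpl Lu uM.
have gu : {ae leb, forall x, O x -> g x = u x}.
  have := ipL2_null (open_rV_measurable oO) (form_setB FH Lu (VH Hg)) ug.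
  apply: filterS => x /[apply] /eqP; rewrite -[(u - g) x]/(u x - g x) subr_eq0.
  by move=> /eqP.
have ugr := H10_ae_eq oO bO Lu Hg gu.
split; first by exists (grad O g).
by rewrite (ipV_gradient2 oO bO ugr ugr).
Qed.

(** Outside V the envelopes cannot be bounded, so both sides are infinite. The squared V-norm thus
    becomes a countable supremum of continuous functionals on H. *)
Lemma normV_sup u : L2 O u ->
  (normV O u ^+ 2)%E = ereal_sup [set (reg_energy n u)%:E | n in [set: nat]].
Proof.
move=> Lu; apply/eqP; rewrite eq_le; apply/andP; split.
  case E : (ereal_sup _) => [M| |]; [|by rewrite leey|].
    have [n|Hu uM] := @H10_bounded_energy u M Lu.
      by rewrite -lee_fin -E; apply: ereal_sup_ubound; exists n.
    by rewrite normV_sqr// lee_fin.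
  have : ((reg_energy 0 u)%:E <= -oo)%E by rewrite -E; apply: ereal_sup_ubound; exists 0.
  by [].
apply: ge_ereal_sup => _ [n _ <-].
have [Hu|nHu] := pselect (H10 O u).
  by rewrite normV_sqr// lee_fin; exact: (envelope_le FH FV VH pc cpl (n0 n)).
by rewrite normV_out//= leey.
Qed.

End regularization.

(** * The nonlinearity *)

Section bump.
Context {R : realType}.
Local Notation leb := (@lebesgue_measure R).

(* Closed under differentiation: the derivative of [ebump k] is
   [ebump k.+2 - k * ebump k.+1]. *)
Definition ebump k (x : R) : R :=
  if 0 < x then x^-1 ^+ k * expR (- x^-1) else 0.

Lemma ebump_ge0 k x : 0 <= ebump k x.
Proof.
rewrite /ebump; case: ifPn => // x0.
by rewrite mulr_ge0 ?expR_ge0// exprn_ge0// invr_ge0 ltW.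
Qed.

(** With y = 1 / x one has (y / (k + 1))^(k + 1) <= exp y. The linear bound near 0 is what yields
    differentiability there. *)
Lemma ebump_le k x : ebump k x <= k.+1%:R ^+ k.+1 * `|x|.
Proof.
rewrite /ebump; case: ifPn => x0; last by rewrite mulr_ge0// exprn_ge0.
rewrite gtr0_norm//; set y := x^-1; have y0 : 0 < y by rewrite invr_gt0.
have k0 : 0 < k.+1%:R :> R by rewrite ltr0n.
have h : (y / k.+1%:R) ^+ k.+1 <= expR y.
  rewrite -[X in expR X](_ : k.+1%:R * (y / k.+1%:R) = y); last first.
    by rewrite mulrC divfK// gt_eqF.
  rewrite expRM_natl lerXn2r ?nnegrE ?expR_ge0//; first by rewrite divr_ge0// ltW.
  by apply: le_trans (expR_ge1Dx _); rewrite lerDr.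
rewrite expRN -(ler_pM2r (expR_gt0 y)) mulfVK ?gt_eqF ?expR_gt0//.
have -> : y ^+ k = k.+1%:R ^+ k.+1 * x * (y / k.+1%:R) ^+ k.+1.
  rewrite expr_div_n [y ^+ k.+1]exprS /y; field.
  by rewrite (gt_eqF x0)/= expf_neq0// gt_eqF.
by rewrite ler_wpM2l// mulr_ge0 ?(ltW x0)// exprn_ge0.
Qed.

Lemma is_derive_ebump k (x : R) :
  is_derive x 1 (ebump k) (ebump k.+2 x - k%:R * ebump k.+1 x).
Proof.
have [x0|x0|<-] := ltgtP 0 x.
- have E : \near x, x^-1 ^+ k * expR (- x^-1) = ebump k x.
    by near=> y; rewrite /ebump ifT//; near: y; exact: lt_nbhsr.
  apply: (near_eq_is_derive E).
  have xn0 : x != 0 by rewrite gt_eqF.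
  have D1 : is_derive x 1 (fun y : R => y^-1) (- x ^- 2).
    have := @is_deriveV R id x 1 1 xn0 (is_derive_id x 1).
    by rewrite /GRing.scale /= mulr1.
  have D2 : is_derive x 1 (fun y : R => y^-1 ^+ k) (k%:R * x^-1 ^+ k.-1 * (- x ^- 2)).
    by have := @is_deriveX R _ (fun y : R => y^-1) k x 1 _ D1; rewrite exprfctE.
  have D3 : is_derive x 1 (fun y : R => expR (- y^-1)) (expR (- x^-1) * (- - x ^- 2)).
    exact: (@is_derive1_comp R expR (fun y => - y^-1) x _ _ (is_derive_expR _) (is_deriveN D1)).
  have := is_deriveM D2 D3; rewrite /ebump x0 => D; apply: is_derive_eq D _.
  rewrite /GRing.scale /=; case: k {E D2} => [|k] /=; rewrite ?expr0 !exprS; field => //.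
- have E : \near x, (0 : R) = ebump k x.
    near=> y; rewrite /ebump ifF//; apply/negbTE; rewrite -leNgt ltW//.
    by near: y; exact: lt_nbhsl.
  apply: (near_eq_is_derive E); rewrite /ebump ltNge (ltW x0)/= mulr0 subrr.
  exact: is_derive_cst.
rewrite /ebump ltxx mulr0 subrr.
have l : h^-1 *: ((ebump k \o shift 0) (h *: (1 : R)) - ebump k 0) @[h --> 0^'] --> (0 : R).
  pose C : R := k.+2%:R ^+ k.+2.
  have C0 : `|C * h| @[h --> (0 : R)^'] --> (0 : R).
    have : `|C * h| @[h --> (0 : R)] --> `|C * 0|.
      by apply: cvg_norm; apply: cvgM; [exact: cvg_cst|exact: cvg_id].
    by rewrite mulr0 normr0; apply: cvg_trans; apply: cvg_app; exact: nbhs_dnbhs.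
  have C0' : - `|C * h| @[h --> (0 : R)^'] --> (0 : R).
    by rewrite -[X in _ --> X]oppr0; exact: cvgN.
  apply: (squeeze_cvgr _ C0' C0); apply: nearW => h.
  rewrite -ler_norml /= addr0 /GRing.scale /= mulr1 [ebump k 0]/ebump ltxx subr0.
  have [h0|h0] := ltP 0 h; last by rewrite /ebump ltNge h0/= mulr0 normr0.
  (* The difference quotient at 0 is the next function of the family, which the linear bound sends
     to 0. *)
  have -> : h^-1 * ebump k h = ebump k.+1 h by rewrite /ebump h0 exprS mulrA.
  rewrite ger0_norm ?ebump_ge0// normrM; apply: le_trans (ebump_le _ _) _.
  by rewrite ler_wpM2r// ler_norm.
by apply: DeriveDef; [apply/cvg_ex; exists 0|exact: cvg_lim].
Unshelve. all: by end_near. Qed.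

(** A syntactic class designed to be closed under differentiation ([smoothR_derive]), so that
    derivatives of all orders exist by a plain induction. The last constructor admits the smooth
    step. *)
Inductive smoothR : (R -> R) -> Prop :=
| smoothR_ebump k : smoothR (ebump k)
| smoothR_scale (a : R) f : smoothR f -> smoothR (fun x => a * f x)
| smoothR_add f g : smoothR f -> smoothR g -> smoothR (fun x => f x + g x)
| smoothR_mul f g : smoothR f -> smoothR g -> smoothR (fun x => f x * g x)
| smoothR_affine (a b : R) f : smoothR f -> smoothR (fun x => f (a * x + b))
| smoothR_primitive f g : smoothR f -> (forall x : R, is_derive x 1 g (f x)) -> smoothR g.

Lemma smoothR_derive f : smoothR f ->
  exists2 g, smoothR g & forall x : R, is_derive x 1 f (g x).
Proof.
elim=> {f} [k|a f sf [f' sf' df]|f g sf [f' sf' df] sg [g' sg' dg]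
  |f g sf [f' sf' df] sg [g' sg' dg]|a b f sf [f' sf' df]|f g sf _ dg].
- exists (fun x => (- k%:R) * ebump k.+1 x + ebump k.+2 x).
    by apply: smoothR_add; [apply: smoothR_scale|]; exact: smoothR_ebump.
  by move=> x; apply: is_derive_eq (is_derive_ebump k x) _; rewrite mulNr addrC.
- exists (fun x => a * f' x); first exact: smoothR_scale.
  by move=> x; exact: (is_deriveZ a (df x)).
- exists (fun x => f' x + g' x); first exact: smoothR_add.
  by move=> x; exact: (is_deriveD (df x) (dg x)).
- exists (fun x => f x * g' x + g x * f' x).
    by apply: smoothR_add; exact: smoothR_mul.
  by move=> x; exact: (is_deriveM (df x) (dg x)).
- exists (fun x => a * f' (a * x + b)); first exact/smoothR_scale/smoothR_affine.
  move=> x; rewrite mulrC.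
  suff da : is_derive x 1 (fun x => a * x + b) a.
    exact: (@is_derive1_comp R f (fun x => a * x + b) x _ _ (df _) da).
  have := is_deriveD (is_deriveZ a (is_derive_id x 1)) (is_derive_cst b x 1).
  by rewrite addr0 /GRing.scale /= mulr1.
by exists f.
Qed.

Lemma smoothR_derivable1n f : smoothR f -> forall n (x : R), derivable (derive1n n f) x 1.
Proof.
move=> sf n; have : smoothR (derive1n n f).
  elim: n => [//|n /smoothR_derive[g sg dg]].
  rewrite (_ : derive1n n.+1 f = g)//; apply/funext => x.
  rewrite -[LHS]/(derive1 (derive1n n f) x) derive1E.
  by have [] := dg x.
by move=> /smoothR_derive[g _ dg] x; have [] := dg x.
Qed.

Lemma smoothR_continuous f : smoothR f -> continuous f.
Proof.
move=> /smoothR_derive[g _ dg] x; have [df _] := dg x.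
exact/differentiable_continuous/derivable1_diffP.
Qed.

(** [rho] is the product of a bump starting at 0 and the reflected one ending at [eps], and [P] is
    its primitive. The height [c] is not normalised; only its positivity matters. *)
Lemma smooth_step (eps : R) : 0 < eps -> exists P rho : R -> R,
  [/\ smoothR P, smoothR rho, forall x : R, is_derive x 1 P (rho x), forall x, 0 <= rho x &
      [/\ forall x, x <= 0 -> rho x = 0, forall x, eps <= x -> rho x = 0,
          forall x, x <= 0 -> P x = 0, forall x y, x <= y -> P x <= P y &
          exists2 c : R, 0 < c & forall x, eps <= x -> P x = c]].
Proof.
move=> e0; pose rho x := ebump 0 x * ebump 0 ((-1) * x + eps).
have srho : smoothR rho.
  by apply: smoothR_mul; [|apply: smoothR_affine]; exact: smoothR_ebump.
have crho := smoothR_continuous srho.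
have rho0 x : 0 <= rho x by rewrite mulr_ge0// ebump_ge0.
have rhol x : x <= 0 -> rho x = 0.
  by move=> x0; rewrite /rho /ebump ltNge x0/= mul0r.
have rhor x : eps <= x -> rho x = 0.
  by move=> x0; rewrite /rho {2}/ebump mulN1r ltNge addrC subr_le0 x0/= mulr0.
(* As [rho] vanishes left of 0, any negative starting point gives the same function; a negative one
   keeps all x >= 0 in the interior, where the fundamental theorem applies. *)
pose P x := \int[leb]_(t in `[-1, x]) rho t.
have irho a b : leb.-integrable `[a, b] (EFin \o rho).
  apply: continuous_compact_integrable; first exact: segment_compact.
  exact: continuous_subspaceT.
have Pl x : x <= 0 -> P x = 0.
  move=> x0; rewrite /P /Rintegral integral0_eq// => t /=.
  by rewrite in_itv/= => /andP[_ tx]; rewrite rhol// (le_trans tx).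
have dP (x : R) : is_derive x 1 P (rho x).
  have [x0|x0] := ltP x 0.
    rewrite rhol ?ltW//.
    have E : \near x, (0 : R) = P x.
      by near=> y; rewrite Pl// ltW//; near: y; exact: lt_nbhsl.
    exact: (near_eq_is_derive E).
  have [||d1 d2] := @continuous_FTC1_closed R rho (-1) x (x + 1) _ (irho _ _) _ (crho x).
  - by rewrite ltrDl.
  - by rewrite (lt_le_trans _ x0)// ltrN10.
  - by apply: (DeriveDef d1); rewrite -derive1E; exact: d2.
have FTC a b : a < b -> (\int[leb]_(r in `[a, b]) (rho r)%:E = (P b - P a)%:E)%E.
  by move=> ab; apply: integral_is_derive.
have Pmono x y : x <= y -> P x <= P y.
  rewrite le_eqVlt => /predU1P[->//|xy]; rewrite -subr_ge0 -lee_fin -FTC//.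
  by apply: integral_ge0 => t _; rewrite lee_fin.
exists P, rho; split => //; first exact: smoothR_primitive srho dP.
split => //; exists (P eps).
  have q0 : 0 < eps / 4 by rewrite divr_gt0.
  have eps4 : eps / 4 < eps / 2 by rewrite ltr_pM2l// ltf_pV2 ?posrE// ltr_nat.
  (* A lower bound of [rho] on [[eps / 4, eps / 2]], where both factors have argument at least
     [eps / 4]; it makes [P eps] positive. *)
  pose m : R := expR (- (eps / 4)^-1) * expR (- (eps / 4)^-1).
  have m0 : 0 < m by rewrite mulr_gt0 ?expR_gt0.
  have lb : m * (eps / 4) <= P (eps / 2) - P (eps / 4).
    have -> : m * (eps / 4) = \int[leb]_(r in `[eps / 4, eps / 2]) m.
      rewrite Rintegral_cst//; congr (_ * _).
      rewrite [fine _](_ : _ = fine (lebesgue_measure `[eps / 4, eps / 2]%classic))//.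
      by rewrite lebesgue_measure_itv/= lte_fin eps4 -EFinD/=; field.
    rewrite -[leRHS]/(fine (P (eps / 2) - P (eps / 4))%:E) -FTC//.
    apply: le_Rintegral => //.
      apply: continuous_compact_integrable; first exact: segment_compact.
      by apply: continuous_subspaceT => z; exact: cvg_cst.
    move=> t /=; rewrite in_itv/= => /andP[t1 t2].
    have t0 : 0 < t by exact: lt_le_trans t1.
    have s1 : eps / 4 <= -1 * t + eps.
      suff h (z : R) : z <= eps / 2 -> eps / 4 <= -1 * z + eps by exact: h.
      by lra.
    have s0 : 0 < -1 * t + eps by exact: lt_le_trans s1.
    rewrite /rho /ebump t0 s0 !expr0 !mul1r ler_pM ?expR_ge0// ler_expR lerN2 lef_pV2 ?posrE//.
  apply: (@lt_le_trans _ _ (m * (eps / 4))); first exact: mulr_gt0.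
  apply: le_trans lb _; have h1 : 0 <= P (eps / 4) by rewrite -(Pl 0)// Pmono// ltW.
  by have h2 : P (eps / 2) <= P eps; [apply: Pmono; lra|lra].
move=> x; rewrite le_eqVlt => /predU1P[->//|xe].
apply/eqP; rewrite -subr_eq0 -eqe -FTC// integral0_eq// => t /=.
by rewrite in_itv/= => /andP[et _]; rewrite rhor.
Unshelve. all: by end_near. Qed.

End bump.

Section weak_derivative.
Context {R : realType}.
Local Notation leb := (@lebesgue_measure R).

Lemma Rintegral_supported dd (T : measurableType dd) (mu : {measure set T -> \bar R})
    (D : set T) (f : T -> R) : (forall x, ~ D x -> f x = 0) ->
  \int[mu]_x f x = \int[mu]_(x in D) f x.
Proof.
move=> f0; rewrite [RHS]Rintegral_mkcond; apply: eq_Rintegral => x _.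
by rewrite patchE; case: ifPn => // /negP; rewrite inE => /f0.
Qed.

(** The weak derivative is tested with a smooth trapezoid. Its derivative is concentrated next to
    [x] and [y], so by continuity of [psi] one side is close to a multiple of [psi x - psi y], while
    the other side is estimated on the plateau. *)
Lemma W11loc_increment (psi dpsi : R -> R) (kap x y : R) : W11loc psi dpsi -> 0 <= kap ->
  x <= y -> {ae leb, forall r : R, x < r < y -> kap <= dpsi r} ->
  kap * (y - x) <= psi y - psi x.
Proof.
move=> [cpsi idpsi wd] kap0; rewrite le_eqVlt => /predU1P[->|xy] kd.
  by rewrite !subrr mulr0.
(* [2 * del] comes from the oscillation of [psi] next to the two endpoints, and [2 * kap * del] from
   the two slopes of the trapezoid, of width [eps <= del]. *)
suff main (del : R) : 0 < del -> kap * (y - x) <= psi y - psi x + (2 + 2 * kap) * del.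
  apply/ler_addgt0Pr => e e0; have k0 : 0 < 2 + 2 * kap by rewrite ltr_pwDl ?mulr_ge0.
  by have := main (e / (2 + 2 * kap)) (divr_gt0 e0 k0); rewrite [(2 + _) * _]mulrC divfK// gt_eqF.
move=> del0.
have [eps [eps0 epsd eps4 nx ny]] : exists eps : R, [/\ 0 < eps, eps <= del, eps <= (y - x) / 4,
    (forall t, `|t - x| <= eps -> `|psi t - psi x| <= del) &
    (forall t, `|t - y| <= eps -> `|psi t - psi y| <= del)].
  have near1 z : exists2 e : R, 0 < e & forall t, `|t - z| <= e -> `|psi t - psi z| <= del.
    have /cvgrPdist_le/(_ _ del0)[e /= e0 eP] := cpsi z.
    exists (e / 2); first exact: divr_gt0.
    move=> t tz; rewrite distrC; apply: eP => /=.
    by rewrite distrC (le_lt_trans tz)// ltr_pdivrMr// ltr_pMr// ltr1n.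
  have [e1 e10 e1P] := near1 x; have [e2 e20 e2P] := near1 y.
  exists (Num.min (Num.min del ((y - x) / 4)) (Num.min e1 e2)); split.
  - by rewrite !lt_min del0 e10 e20 divr_gt0 ?subr_gt0.
  - by rewrite !ge_min lexx.
  - by rewrite !ge_min lexx orbT.
  - by move=> t tx; apply: e1P; apply: le_trans tx _; rewrite !ge_min lexx !orbT.
  - by move=> t ty; apply: e2P; apply: le_trans ty _; rewrite !ge_min lexx !orbT.
have [P [rho [sP srho dP rho0 [rhol rhor Pl Pmono [c c0 Pr]]]]] := smooth_step eps0.
have cP := smoothR_continuous sP; have crho := smoothR_continuous srho.
(* Rises on [[x, x + eps]] to the plateau [c], falls on [[y - eps, y]], and is 0 outside; [r1] and
   [r2] are the two bumps of its derivative, each of integral [c]. *)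
pose eta t := P (1 * t + (- x)) + (-1) * P (1 * t + (eps - y)).
pose r1 (t : R) := rho (1 * t + (- x)); pose r2 (t : R) := rho (1 * t + (eps - y)).
have seta : smoothR eta.
  by apply: smoothR_add; [|apply: smoothR_scale]; exact: smoothR_affine.
have sr1 : smoothR r1 by exact: smoothR_affine.
have sr2 : smoothR r2 by exact: smoothR_affine.
have shift_derive b (t : R) : is_derive t 1 (fun t => P (1 * t + b)) (rho (1 * t + b)).
  rewrite -[X in is_derive _ _ _ X]mulr1.
  suff da : is_derive t 1 (fun x => 1 * x + b) (1 : R).
    exact: (@is_derive1_comp R P (fun x => 1 * x + b) t _ _ (dP _) da).
  have := is_deriveD (is_deriveZ (1 : R) (is_derive_id t 1)) (is_derive_cst b t 1).
  by rewrite addr0 /GRing.scale /= mulr1.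
have deta : derive1 eta = fun t => r1 t + (-1) * r2 t.
  apply/funext => t; rewrite derive1E.
  have D : is_derive t 1 eta (r1 t + (-1) * r2 t).
    exact: (is_deriveD (shift_derive _ t) (is_deriveZ (-1) (shift_derive _ t))).
  by have [] := D.
have etal t : t <= x -> eta t = 0.
  by move=> tx; rewrite /eta !Pl ?mulr0 ?addr0//; lra.
have etar t : y <= t -> eta t = 0.
  by move=> ty; rewrite /eta !Pr; [ring|lra|lra].
have eta0 t : 0 <= eta t.
  by rewrite /eta mulN1r subr_ge0 Pmono//; lra.
have etam t : x + eps <= t -> t <= y - eps -> eta t = c.
  by move=> t1 t2; rewrite /eta Pr ?Pl; [ring|lra|lra].
have Pc t : 0 <= P t <= c.
  apply/andP; split.
    rewrite -(Pl (Num.min t 0)); last by rewrite ge_min lexx orbT.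
    by rewrite Pmono// ge_min lexx.
  rewrite -(Pr (Num.max t eps)); last by rewrite le_max lexx orbT.
  by rewrite Pmono// le_max lexx.
have etac t : eta t <= c.
  rewrite /eta; have /andP[_ h1] := Pc (1 * t + - x).
  by have /andP[h2 _] := Pc (1 * t + (eps - y)); lra.
have teta : test_functionR eta.
  split; first by move=> n t; exact: smoothR_derivable1n.
  exists (`|x| + `|y|) => t tM.
  have [t0|t0] := leP 0 t.
    apply: etar; rewrite (le_trans (ler_norm y))//.
    by move: tM; rewrite (ger0_norm t0) => ?; have ? := normr_ge0 x; lra.
  apply: etal; move: tM; rewrite (ltr0_norm t0) => ?.
  by have ? := normr_ge0 y; have := ler_norm (- x); rewrite normrN => ?; lra.
have := wd eta teta; rewrite deta.
have icont f : continuous f -> leb.-integrable `[x, y] (EFin \o f).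
  move=> cf; apply: continuous_compact_integrable; first exact: segment_compact.
  exact: continuous_subspaceT.
have cr1 := smoothR_continuous sr1; have cr2 := smoothR_continuous sr2.
have FTC1 : \int[leb]_(t in `[x, y]) r1 t = c.
  rewrite /Rintegral (integral_is_derive xy (shift_derive (- x)) cr1) /=.
  by rewrite Pr ?Pl ?subr0//; lra.
have FTC2 : \int[leb]_(t in `[x, y]) r2 t = c.
  rewrite /Rintegral (integral_is_derive xy (shift_derive (eps - y)) cr2) /=.
  by rewrite Pr ?Pl ?subr0//; lra.
have lhs : (psi x - del) * c - (psi y + del) * c <=
    \int[leb]_t (psi t * (r1 t + (-1) * r2 t)).
  rewrite (@Rintegral_supported _ _ leb `[x, y]%classic); last first.
    move=> t /negP; rewrite in_itv/= negb_and -!ltNge => /orP[tx|ty].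
      by rewrite /r1 /r2 !rhol; [ring|lra|lra].
    by rewrite /r1 /r2 !rhor; [ring|lra|lra].
  have im1 (k : R) f : continuous f -> leb.-integrable `[x, y] (EFin \o (fun t => k * f t)).
    by move=> cf; apply: icont => t; apply: cvgM; [exact: cvg_cst|exact: cf].
  rewrite -{1}FTC1 -FTC2 -!RintegralZl//; [|exact: icont|exact: icont].
  rewrite -RintegralB//; [|exact: im1|exact: im1].
  apply: le_Rintegral => //.
  - by apply: icont => t; apply: cvgB; apply: cvgM; (try exact: cvg_cst); [exact: cr1|exact: cr2].
  - apply: icont => t; apply: cvgM; first exact: cpsi.
    by apply: cvgD; [exact: cr1|apply: cvgM; [exact: cvg_cst|exact: cr2]].
  move=> t /=; rewrite in_itv/= => /andP[xt ty].
  suff [h1 h2] : (psi x - del) * r1 t <= psi t * r1 t /\ psi t * r2 t <= (psi y + del) * r2 t by lra.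
  split.
    have [te|te] := leP t (x + eps); last by rewrite /r1 rhor ?mulr0//; lra.
    rewrite ler_wpM2r ?rho0//.
    have := nx t; rewrite ger0_norm ?subr_ge0// lerBlDl => /(_ te).
    by rewrite ler_norml => /andP[? _]; lra.
  have [te|te] := leP (y - eps) t; last by rewrite /r2 rhol ?mulr0//; lra.
  rewrite ler_wpM2r ?rho0//.
  have /ny : `|t - y| <= eps.
    by rewrite distrC ger0_norm ?subr_ge0// lerBlDr -lerBlDl.
  by rewrite ler_norml => /andP[_ ?]; lra.
have rhs : kap * c * (y - x - 2 * eps) <= \int[leb]_t (dpsi t * eta t).
  rewrite (@Rintegral_supported _ _ leb `[x, y]%classic); last first.
    move=> t /negP; rewrite in_itv/= negb_and -!ltNge => /orP[tx|ty].
      by rewrite etal ?mulr0// ltW.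
    by rewrite etar ?mulr0// ltW.
  have mdpsi : measurable_fun (`[x, y] : set R) dpsi.
    by have /integrableP[/measurable_EFinP] := idpsi x y.
  have meta : measurable_fun (`[x, y] : set R) eta.
    apply: measurable_funTS; apply: continuous_measurable_fun.
    exact: smoothR_continuous.
  have iabs : leb.-integrable `[x, y] (EFin \o (fun t => `|dpsi t| * eta t)).
    apply: (@integrable_le _ _ _ leb `[x, y]%classic _ _ (fun t => c * `|dpsi t|)) => //.
    - by apply: measurable_funM => //; exact: measurableT_comp.
    - by move=> t _; rewrite normrM normr_id mulrC ler_wpM2r// ger0_norm.
    apply: (@eq_integrable _ _ _ leb _ _ (fun t => c%:E * `|(dpsi t)%:E|)%E) => //.
    by apply: integrableZl => //; exact: (integrable_abse (idpsi x y)).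
  (* [dpsi] is nonnegative only almost everywhere on []x, y[]; with the absolute value the integrand
     is nonnegative everywhere, as the comparison of integrals requires. *)
  have -> : \int[leb]_(t in `[x, y]) (dpsi t * eta t) =
      \int[leb]_(t in `[x, y]) (`|dpsi t| * eta t).
    congr fine; apply: ae_eq_integral => //.
    - by apply/measurable_EFinP; exact: measurable_funM.
    - by case/integrableP : iabs.
    apply: negligibleS kd => t /= nt kt; apply: nt => _; congr EFin.
    have [tx|tx] := leP t x; first by rewrite etal// !mulr0.
    have [ty|ty] := leP y t; first by rewrite etar// !mulr0.
    by rewrite ger0_norm// (le_trans kap0)// kt// tx.
  have Efin : (\int[leb]_(t in `[x, y]) (`|dpsi t| * eta t)%:E)%E =
      (\int[leb]_(t in `[x, y]) (`|dpsi t| * eta t))%:E.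
    by rewrite /Rintegral fineK//; exact: (integrable_fin_num _ iabs).
  rewrite -lee_fin -Efin.
  apply: (@le_trans _ _ (\int[leb]_(t in `[x, y]) (kap * eta t)%:E)%E); last first.
    apply: ae_ge0_le_integral => //.
    - by move=> t _; rewrite lee_fin mulr_ge0.
    - by apply/measurable_EFinP; exact: measurable_funM.
    - by move=> t _; rewrite lee_fin mulr_ge0.
    - by case/integrableP : iabs.
    apply: negligibleS kd => t /= nt kt; apply: nt => _; rewrite lee_fin.
    have [tx|tx] := leP t x; first by rewrite etal// !mulr0.
    have [ty|ty] := leP y t; first by rewrite etar// !mulr0.
    by rewrite ler_wpM2r// (le_trans _ (ler_norm _))// kt// tx.
  apply: (@le_trans _ _ (\int[leb]_(t in `[(x + eps)%R, (y - eps)%R]) (kap * eta t)%:E)%E); last first.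
    apply: ge0_subset_integral => //.
    - by apply/measurable_EFinP; exact: measurable_funM.
    - by move=> t _; rewrite lee_fin mulr_ge0.
    by move=> t /=; rewrite !in_itv/= => /andP[t1 t2]; apply/andP; split; lra.
  have -> : (\int[leb]_(t in `[(x + eps)%R, (y - eps)%R]) (kap * eta t)%:E)%E =
      (\int[leb]_(t in `[(x + eps)%R, (y - eps)%R]) (kap * c)%:E)%E.
    apply: eq_integral => t; rewrite inE/= in_itv/= => /andP[t1 t2].
    by rewrite etam.
  rewrite integral_cst//= lebesgue_measure_itv/= lte_fin ifT; last by lra.
  by rewrite -EFinD -EFinM lee_fin; apply: eqW; ring.
move=> E; have {}E := le_trans lhs (eqW E).
have K : kap * c * (y - x - 2 * eps) <= c * (psi y - psi x + 2 * del).
  by apply: le_trans rhs _; rewrite -lerN2; apply: le_trans E; apply: eqW; ring.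
move: K; rewrite -mulrA mulrCA ler_pM2l// => K.
by have := ler_wpM2l kap0 epsd => ?; lra.
Qed.

End weak_derivative.

(** Heine's theorem for a pseudometric on the parameters, so that it serves real functions and paths
    in H alike. *)
Lemma segment_uniform_continuity {R : realType} (rho : R -> R -> R) (a b : R) :
  (forall s t, a <= s <= b -> a <= t <= b -> rho s t = rho t s) ->
  (forall r s t, a <= r <= b -> a <= s <= b -> a <= t <= b -> rho r t <= rho r s + rho s t) ->
  (forall t, a <= t <= b -> forall eps, 0 < eps -> exists2 del : R, 0 < del &
    forall s, a <= s <= b -> `|s - t| < del -> rho s t < eps) ->
  forall eps, 0 < eps -> exists2 del : R, 0 < del & forall s t,
    a <= s <= b -> a <= t <= b -> `|s - t| < del -> rho s t < eps.
Proof.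
move=> sym tri cont eps e0.
have /compact_near_coveringP cov := @segment_compact R a b.
have := cov R (0^'+) (fun del t => a <= t <= b -> forall s, a <= s <= b -> `|s - t| < del -> rho s t < eps) _.
case.
  move=> x /=; rewrite in_itv/= => xab.
  have [del d0 dP] := cont x xab (eps / 2) (divr_gt0 e0 (ltr0Sn _ 1)).
  have d20 : 0 < del / 2 by rewrite divr_gt0.
  exists ([set t | `|t - x| < del / 2], [set e : R | e < del / 2]) => /=.
    split => /=; last by exact: nbhs_right_lt.
    exists (del / 2) => // t /=; by rewrite distrC.
  move=> [t e] /= [tx ed] tab s sab st.
  have h1 : rho s x < eps / 2.
    apply: dP => //; rewrite -(subrK t s) -addrA (le_lt_trans (ler_normD _ _))//.
    by rewrite [ltRHS](splitr del) ltrD// (lt_trans st).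
  have h2 : rho t x < eps / 2.
    by apply: dP => //; apply: lt_trans tx _; rewrite ltr_pdivrMr// ltr_pMr// ltr1n.
  apply: le_lt_trans (tri s x t sab xab tab) _.
  by rewrite [ltRHS](splitr eps) ltrD// sym.
move=> e /= e1 eP.
exists (e / 2); first exact: divr_gt0.
move=> s t sab tab st; apply: (eP (e / 2)) => //=.
- rewrite sub0r normrN gtr0_norm ?divr_gt0//.
  by rewrite ltr_pdivrMr// ltr_pMr// ltr1n.
- exact: divr_gt0.
Qed.

Section psi_facts.
Context {R : realType}.

(** (C1) and (C4) are integrated once and for all into the increment bound [psi_incr], which no
    longer mentions the weak derivative. *)
Record psi_growth (psi : R -> R) (a b s : R) : Prop := PsiGrowth {
  psi_continuous : continuous psi;
  psi0 : psi 0 = 0;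
  psi_incr : forall x y, 0 <= x -> x <= y -> (y - x) / (a + b * y `^ s) <= psi y - psi x;
  psi_linear : exists2 C : R, 0 < C & forall r, 0 <= r -> psi r <= C * (1 + r);
  psi_a_ge0 : 0 <= a; psi_b_gt0 : 0 < b; psi_s_gt0 : 0 < s; psi_s_le2 : s <= 2 }.

Lemma psi_conditions_growth d psi a b s : psi_conditions d psi a b s -> psi_growth psi a b s.
Proof.
move=> [dpsi W [dpos odd [C C0 lin] [a0 b0 /andP[s0 s2] coer] _]].
have [cpsi _ _] := W.
split => //.
- by have := odd 0; rewrite oppr0 => h; lra.
- move=> x y x0 xy; rewrite mulrC.
  have [y0|y0] := leP y 0.
    have -> : y = x by lra.
    by rewrite !subrr mulr0.
  have k0 : 0 < a + b * y `^ s by rewrite ltr_wpDl// mulr_gt0// powR_gt0.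
  apply: (W11loc_increment W) => //; first by rewrite invr_ge0 ltW.
  have both := negligibleU dpos coer.
  apply: negligibleS both => r /= nr; apply: contrapT => /not_orP[/contrapT h1 /contrapT h2].
  apply: nr => /andP[xr ry]; have r0 := le_lt_trans x0 xr.
  have := h2 (ltW r0); rewrite !gtr0_norm ?h1// => h.
  rewrite -(ler_pM2l k0) divff ?gt_eqF//; apply: le_trans h _.
  rewrite ler_wpM2r ?(ltW (h1 r0))// lerD2l ler_wpM2l ?(ltW b0)//.
  by rewrite ge0_ler_powR ?nnegrE ?(ltW r0) ?(ltW y0) ?(ltW s0) ?(ltW ry).
- by exists C => // r r0; have := lin r r0; rewrite ger0_norm.
Qed.

Variables (psi : R -> R) (a b s : R).
Hypothesis pg : psi_growth psi a b s.

Lemma psi_weight_ge0 r : 0 <= a + b * r `^ s.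
Proof. by rewrite addr_ge0 ?(psi_a_ge0 pg)// mulr_ge0 ?powR_ge0// ltW// (psi_b_gt0 pg). Qed.

Lemma psi_nd x y : 0 <= x -> x <= y -> psi x <= psi y.
Proof.
move=> x0 xy; rewrite -subr_ge0; apply: le_trans (psi_incr pg x0 xy).
by rewrite divr_ge0 ?subr_ge0// psi_weight_ge0.
Qed.

Lemma psi_ge0 x : 0 <= x -> 0 <= psi x.
Proof. by move=> x0; rewrite -(psi0 pg) psi_nd. Qed.

End psi_facts.

Section phi.
Context {R : realType} {d : nat}.
Implicit Types x y z : 'rV[R]_d.

Lemma dot_form : form_on [set: 'rV[R]_d] (@dot R d).
Proof.
split => //.
- by move=> x y _ _; apply: eq_bigr => i _; rewrite mulrC.
- move=> c x y z _ _ _; rewrite /dot mulr_sumr -big_split; apply: eq_bigr => i _ /=.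
  by rewrite !mxE; ring.
- by move=> x _; rewrite sumr_ge0// => i _; rewrite -expr2 sqr_ge0.
Qed.
Local Notation FD := dot_form.

Lemma enorm_sqr x : enorm x ^+ 2 = dot x x.
Proof. by rewrite sqr_sqrtr// (form_ge0 FD). Qed.

Lemma enorm_ge0 x : 0 <= enorm x. Proof. exact: sqrtr_ge0. Qed.

Lemma enorm_leD x y : enorm (x + y) <= enorm x + enorm y.
Proof. exact: (form_norm_leD FD). Qed.

Lemma enormZ c x : enorm (c *: x) = `|c| * enorm x.
Proof. by rewrite /enorm (form_sqrZ FD)// sqrtrM ?sqr_ge0// sqrtr_sqr. Qed.

Lemma enormN x : enorm (- x) = enorm x.
Proof. by rewrite -scaleN1r enormZ normrN1 mul1r. Qed.

Lemma enormBC x y : enorm (x - y) = enorm (y - x).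
Proof. by rewrite -enormN opprB. Qed.

Lemma enorm_leB x y : enorm x - enorm y <= enorm (x - y).
Proof. exact: (form_norm_leB FD). Qed.

Lemma enorm_dist x y : `|enorm x - enorm y| <= enorm (x - y).
Proof.
rewrite ler_norml enorm_leB andbT lerNl opprB enormBC.
exact: enorm_leB.
Qed.

Lemma dot_abs_le x y : `|dot x y| <= enorm x * enorm y.
Proof. exact: (form_abs_le FD). Qed.

Lemma enorm0 : enorm (0 : 'rV[R]_d) = 0.
Proof. by rewrite /enorm (form0l FD)// sqrtr0. Qed.

Lemma enorm_eq0 x : (enorm x == 0) = (x == 0).
Proof.
apply/idP/idP => [/eqP x0|/eqP ->]; last by rewrite enorm0.
apply/eqP/rowP => i; rewrite mxE; apply/eqP.
have : dot x x = 0 by rewrite -enorm_sqr x0 expr0n.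
move=> /eqP; rewrite /dot psumr_eq0; last by move=> j _; rewrite -expr2 sqr_ge0.
by move=> /allP/(_ i); rewrite mem_index_enum -expr2 sqrf_eq0; exact.
Qed.

Variables (psi : R -> R) (a b s : R).
Hypothesis pg : psi_growth psi a b s.
Local Notation phi := (@phi R d psi).

Definition phi_coef z : R := if z == 0 then 0 else psi (enorm z) / enorm z.

Lemma phiE z : phi z = phi_coef z *: z.
Proof. by rewrite /Defs.phi /phi_coef; case: eqP => // ->; rewrite scaler0. Qed.

Lemma phi_coefM z : phi_coef z * enorm z = psi (enorm z).
Proof.
rewrite /phi_coef; case: eqP => [->|/eqP z0].
  by rewrite enorm0 mul0r (psi0 pg).
by rewrite divfK// enorm_eq0.
Qed.

Lemma phi_coef_ge0 z : 0 <= phi_coef z.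
Proof.
rewrite /phi_coef; case: eqP => // _.
by rewrite divr_ge0 ?enorm_ge0// (psi_ge0 pg)// enorm_ge0.
Qed.

Lemma enorm_phi z : enorm (phi z) = psi (enorm z).
Proof. by rewrite phiE enormZ ger0_norm ?phi_coef_ge0// phi_coefM. Qed.

(* Subtracting [kap * id] from [phi], one is left with the monotonicity of the
   field [z |-> f |z| * z / |z|] for a nonnegative nondecreasing [f]. *)
Lemma phi_monotone x y :
  enorm (x - y) ^+ 2 / (a + b * Num.max (enorm x) (enorm y) `^ s) <=
  dot (phi x - phi y) (x - y).
Proof.
set M := Num.max _ _; set kap := (a + b * M `^ s)^-1.
have kap0 : 0 <= kap by rewrite invr_ge0 (psi_weight_ge0 pg).
have kapP r t : 0 <= r -> r <= t -> t <= M -> kap * (t - r) <= psi t - psi r.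
  move=> r0 rt tM; apply: le_trans (psi_incr pg r0 rt).
  have t0 := le_trans r0 rt.
  rewrite mulrC; have [te|te] := leP t 0.
    have -> : t = r by lra.
    by rewrite subrr !mul0r.
  rewrite ler_wpM2l ?subr_ge0// lef_pV2 ?posrE.
  - rewrite lerD2l ler_wpM2l ?(ltW (psi_b_gt0 pg))//.
    by rewrite ge0_ler_powR ?nnegrE ?(ltW (psi_s_gt0 pg))// (le_trans t0).
  - rewrite ltr_wpDl ?(psi_a_ge0 pg)// mulr_gt0 ?(psi_b_gt0 pg)// powR_gt0//.
    exact: lt_le_trans tM.
  - by rewrite ltr_wpDl ?(psi_a_ge0 pg)// mulr_gt0 ?(psi_b_gt0 pg)// powR_gt0.
have r0 := enorm_ge0 x; have t0 := enorm_ge0 y.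
have rM : enorm x <= M by rewrite le_max lexx.
have tM : enorm y <= M by rewrite le_max lexx orbT.
have c1 : dot x y <= enorm x * enorm y by apply: le_trans (ler_norm _) (dot_abs_le x y).
have ex := phi_coefM x; have ey := phi_coefM y.
have -> : dot (phi x - phi y) (x - y) =
    phi_coef x * enorm x ^+ 2 - (phi_coef x + phi_coef y) * dot x y + phi_coef y * enorm y ^+ 2.
  rewrite !phiE (formBl FD)// !(formZl FD)// !(formBr FD)// (formC FD (x := y) (y := x))//.
  by rewrite !enorm_sqr; ring.
have -> : enorm (x - y) ^+ 2 = enorm x ^+ 2 - 2 * dot x y + enorm y ^+ 2.
  by rewrite !enorm_sqr (form_sqrB FD).
rewrite -/kap.
have kx0 : enorm x = 0 -> dot x y = 0.
  by move=> /eqP; rewrite enorm_eq0 => /eqP ->; rewrite (form0l FD).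
have ky0 : enorm y = 0 -> dot x y = 0.
  by move=> /eqP; rewrite enorm_eq0 => /eqP ->; rewrite (formC FD)// (form0l FD).
have px := kapP 0 (enorm x) (lexx _) r0 rM; have py := kapP 0 (enorm y) (lexx _) t0 tM.
have pxy := kapP (enorm x) (enorm y) r0; have pyx := kapP (enorm y) (enorm x) t0.
move: px py pxy pyx ex ey c1 kx0 ky0 r0 t0 rM tM; rewrite (psi0 pg).
set c := dot x y; set r := enorm x; set t := enorm y; set A := phi_coef x; set B := phi_coef y.
move=> px py pxy pyx ex ey c1 kx0 ky0 r0 t0 rM tM.
rewrite -ex -ey in pxy pyx; rewrite -ex in px; rewrite -ey in py.
suff : 0 <= (A - kap) * r ^+ 2 + (B - kap) * t ^+ 2 - (A + B - 2 * kap) * c by lra.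
have [rz|rn] := eqVneq r 0.
  by rewrite (kx0 rz) rz; nra.
have [tz|tn] := eqVneq t 0.
  by rewrite (ky0 tz) tz; nra.
have rp : 0 < r by rewrite lt_def rn.
have tp : 0 < t by rewrite lt_def tn.
have Ak : kap <= A by rewrite -(ler_pM2r rp); lra.
have Bk : kap <= B by rewrite -(ler_pM2r tp); lra.
(* As [A - kap] and [B - kap] are nonnegative, Cauchy-Schwarz may replace [c] by [r * t]; what is
   left factors as ((A - kap) r - (B - kap) t) (r - t), a product of two numbers of the same
   sign. *)
have h1 : (A + B - 2 * kap) * c <= (A + B - 2 * kap) * (r * t) by rewrite ler_wpM2l//; lra.
have h2 : 0 <= ((A * r - kap * r) - (B * t - kap * t)) * (r - t).
  have [rt|tr] := leP r t.
    by have := pxy rt tM => ?; rewrite mulr_le0//; lra.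
  by have := pyx (ltW tr) rM => ?; rewrite mulr_ge0//; lra.
by lra.
Qed.

Lemma phi_linear : exists2 C : R, 0 < C & forall z, enorm (phi z) <= C * (1 + enorm z).
Proof.
have [C C0 CP] := psi_linear pg; exists C => // z.
by rewrite enorm_phi CP// enorm_ge0.
Qed.

(** The direction z / |z| jumps at 0, but [psi] is continuous and vanishes there: for small [x] both
    values are small, and away from 0 the direction is Lipschitz. Only [x] is bounded by [M]; then
    |y| <= M + 1 because [del <= 1]. *)
Lemma phi_uniform M eps : 0 < eps -> exists2 del : R, 0 < del & forall x y,
  enorm x <= M -> enorm (x - y) < del -> enorm (phi x - phi y) <= eps.
Proof.
move=> e0.
have e40 : 0 < eps / 4 by rewrite divr_gt0.
have [rho rho0 rhoP] : exists2 rho : R, 0 < rho & forall r, 0 <= r -> r <= rho -> psi r <= eps / 4.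
  have /cvgrPdist_le/(_ _ e40)[e /= e1 eP] := @psi_continuous _ _ _ _ _ pg 0.
  exists (e / 2); first exact: divr_gt0.
  move=> r r0 re; have : `|psi 0 - psi r| <= eps / 4.
    apply: eP; rewrite /= sub0r normrN ger0_norm// (le_lt_trans re)//.
    by rewrite ltr_pdivrMr// ltr_pMr// ltr1n.
  by rewrite (psi0 pg) sub0r normrN; apply: le_trans; exact: ler_norm.
have [d1 d10 d1P] : exists2 del : R, 0 < del & forall r t, 0 <= r <= M + 1 -> 0 <= t <= M + 1 ->
    `|r - t| < del -> `|psi r - psi t| < eps / 4.
  apply: (@segment_uniform_continuity _ (fun r t => `|psi r - psi t|) 0 (M + 1)) => //.
  - by move=> r t _ _; rewrite distrC.
  - by move=> r u t _ _ _; apply: le_trans (ler_normD _ _); rewrite addrA subrK.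
  - move=> t _ e ee; have /cvgrPdist_lt/(_ _ ee)[del /= dd dP] := @psi_continuous _ _ _ _ _ pg t.
    by exists del => // r _ rt; rewrite distrC; apply: dP => /=; rewrite distrC.
have [M0|M0] := ltP M 0.
  by exists 1 => // x y xM; have := le_lt_trans (le_trans (enorm_ge0 x) xM) M0; rewrite ltxx.
have p0 := psi_ge0 pg M0.
(* Dominates psi(|x|) / |x| for rho / 2 < |x| <= M; the 1 keeps it positive. *)
pose L := 4 * psi M / rho + 1.
have L0 : 0 < L by rewrite ltr_wpDl// divr_ge0 ?(ltW rho0)// mulr_ge0.
exists (Num.min (Num.min 1 d1) (Num.min (rho / 2) (eps / 4 / L))).
  by rewrite !lt_min ltr01 d10 !divr_gt0.
move=> x y xM; rewrite !lt_min => /andP[/andP[xy1 xyd] /andP[xyr xye]].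
have dist := enorm_dist x y.
have r0 := enorm_ge0 x; have t0 := enorm_ge0 y.
have tx : enorm y <= enorm x + enorm (x - y).
  by have := enorm_leB y x; rewrite enormBC; lra.
have tri : enorm (phi x - phi y) <= enorm (phi x) + enorm (phi y).
  by rewrite -(enormN (phi y)); exact: enorm_leD.
have [xr|xr] := leP (enorm x) (rho / 2).
  apply: le_trans tri _; rewrite !enorm_phi.
  have xr' : enorm x <= rho by lra.
  have yr' : enorm y <= rho by lra.
  by have := rhoP _ r0 xr'; have := rhoP _ t0 yr' => ? ?; lra.
have rp : 0 < enorm x by apply: lt_trans xr; exact: divr_gt0.
have tp : 0 < enorm y by have := enorm_leB x y; lra.
have x0 : x != 0 by rewrite -enorm_eq0 gt_eqF.
have y0 : y != 0 by rewrite -enorm_eq0 gt_eqF.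
(* Three changes in turn: of the modulus, of the vector, of the normalising length. The last two are
   both controlled by psi(|x|) / |x| times |x - y|. *)
have E : phi x - phi y = (psi (enorm x) - psi (enorm y)) *: ((enorm y)^-1 *: y) +
    (psi (enorm x) / enorm x) *: (x - y) +
    (psi (enorm x) * (enorm y - enorm x) / (enorm x * enorm y)) *: y.
  rewrite !phiE /phi_coef (negbTE x0) (negbTE y0).
  apply/rowP => i; rewrite !mxE; field.
  by rewrite !gt_eqF.
have px : psi (enorm x) <= psi M by apply: (psi_nd pg).
have px0 := psi_ge0 pg r0.
have T1 : enorm ((psi (enorm x) - psi (enorm y)) *: ((enorm y)^-1 *: y)) <= eps / 4.
  rewrite !enormZ (_ : `|(enorm y)^-1| = (enorm y)^-1); last by rewrite gtr0_norm// invr_gt0.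
  rewrite mulVf ?gt_eqF// mulr1 ltW//.
  apply: d1P; [apply/andP; split; lra|apply/andP; split; lra|].
  exact: le_lt_trans dist _.
have q : psi (enorm x) / enorm x * enorm (x - y) <= eps / 4.
  have h : psi (enorm x) / enorm x <= L.
    rewrite ler_pdivrMr//; apply: le_trans px _.
    apply: (@le_trans _ _ (L * (rho / 2))); last by rewrite ler_wpM2l// ltW.
    have -> : L * (rho / 2) = 2 * psi M + rho / 2 by rewrite /L; field; rewrite gt_eqF.
    by have := rho0; lra.
  apply: (@le_trans _ _ (L * (eps / 4 / L))).
    by apply: ler_pM => //; [exact: divr_ge0|exact: enorm_ge0|exact: ltW].
  by rewrite mulrC divfK// gt_eqF.
have T2 : enorm ((psi (enorm x) / enorm x) *: (x - y)) <= eps / 4.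
  by rewrite enormZ ger0_norm//; exact: divr_ge0.
have T3 : enorm ((psi (enorm x) * (enorm y - enorm x) / (enorm x * enorm y)) *: y) <= eps / 4.
  rewrite enormZ !(normrM, normfV) (ger0_norm px0) (ger0_norm r0) (ger0_norm t0).
  apply: le_trans q.
  have -> : psi (enorm x) * `|enorm y - enorm x| / (enorm x * enorm y) * enorm y =
    psi (enorm x) / enorm x * `|enorm y - enorm x| by field; rewrite !gt_eqF.
  by rewrite distrC ler_wpM2l// divr_ge0.
rewrite E; apply: le_trans (enorm_leD _ _) _.
by have := enorm_leD ((psi (enorm x) - psi (enorm y)) *: ((enorm y)^-1 *: y))
  ((psi (enorm x) / enorm x) *: (x - y)); lra.
Qed.

(* Linear in the gradients, so that the continuity of A follows without dominated convergence. *)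
Lemma phi_modulus M eps : 0 < eps -> exists2 K : R, 0 <= K & forall x y,
  enorm x <= M -> enorm (phi x - phi y) <= eps + K * enorm (x - y).
Proof.
move=> e0; have [del d0 dP] := phi_uniform M e0.
have [C C0 CP] := phi_linear.
pose M' := Num.max M 0.
have M'0 : 0 <= M' by rewrite le_max lexx orbT.
exists (C * (2 + 2 * M') / del + C).
  by rewrite addr_ge0 ?(ltW C0)// divr_ge0 ?(ltW d0)// mulr_ge0 ?(ltW C0)//; lra.
move=> x y xM; have n0 := enorm_ge0 (x - y).
have [xy|xy] := ltP (enorm (x - y)) del.
  apply: le_trans (dP x y xM xy) _; rewrite lerDl mulr_ge0// addr_ge0 ?(ltW C0)//.
  by rewrite divr_ge0 ?(ltW d0)// mulr_ge0 ?(ltW C0)//; lra.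
have tri : enorm (phi x - phi y) <= enorm (phi x) + enorm (phi y).
  by rewrite -(enormN (phi y)); exact: enorm_leD.
have ty : enorm y <= enorm x + enorm (x - y).
  by have := enorm_leB y x; rewrite enormBC; lra.
have xM' : enorm x <= M' by rewrite le_max xM.
have h : C * (2 + 2 * M') <= C * (2 + 2 * M') / del * enorm (x - y).
  rewrite mulrAC ler_pdivlMr// ler_wpM2l// mulr_ge0 ?(ltW C0)//; lra.
have := CP x; have := CP y => h1 h2.
have h3 : C * (1 + enorm y) <= C * (1 + M' + enorm (x - y)) by rewrite ler_pM2l//; lra.
have h4 : C * (1 + enorm x) <= C * (1 + M') by rewrite ler_pM2l//; lra.
by lra.
Qed.

End phi.

(** * The flux as an operator on square-integrable vector fields *)

Section flux.
Context {R : realType} {d : nat} (O : set 'rV[R]_d).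
Hypotheses (oO : open O) (bO : bounded_set O).
Local Notation leb := (lebesgue_rV d).
Local Notation fld := ('rV[R]_d -> 'rV[R]_d).
Local Notation ip := (ipH O).
Local Notation FH := (L2_form oO).
Local Notation FG := (L2fld_form oO).
Local Notation FV := (H10_form oO bO).
Local Notation normG g := (Num.sqrt (ipG O g g)).

Let mO : measurable O. Proof. exact: open_rV_measurable. Qed.
Let volfin : (leb O < +oo)%E. Proof. exact: bounded_rV_fin_measure. Qed.

Lemma measurable_dot (g h : fld) : L2fld O g -> L2fld O h ->
  measurable_fun O (fun x => dot (g x) (h x)).
Proof. by move=> Lg Lh; have [/integrableP[/measurable_EFinP]] := ipG_dot oO Lg Lh. Qed.

Lemma measurable_enorm (g : fld) : L2fld O g -> measurable_fun O (fun x => enorm (g x)).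
Proof.
move=> Lg; apply: (eq_measurable_fun (fun x => dot (g x) (g x) `^ 2^-1)).
  by move=> x _; rewrite /enorm powR12_sqrt// (form_ge0 dot_form).
apply: (measurableT_comp (@measurable_powR R _)).
exact: measurable_dot.
Qed.

Lemma enorm_L2 (g : fld) : L2fld O g -> L2 O (fun x => enorm (g x)) /\
  ip (fun x => enorm (g x)) (fun x => enorm (g x)) = ipG O g g.
Proof.
move=> Lg; have [idot ->] := ipG_dot oO Lg Lg; split.
  split; first exact: measurable_enorm.
  apply: eq_integrable idot => // x _ /=; by rewrite enorm_sqr.
by apply: eq_Rintegral => x _; rewrite -expr2 enorm_sqr.
Qed.

Lemma sqint_ip_le f p : L2 O f -> L2 O p -> (forall x, O x -> `|f x| <= p x) ->
  ip f f <= ip p p.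
Proof.
move=> Lf Lp fp; apply: le_Rintegral => //; try exact: (sqint_mul mO).
move=> x Ox; have := fp x Ox => h; rewrite -[leLHS]real_normK ?num_real//.
by rewrite expr2 ler_pM.
Qed.

Lemma L2fld_dominated (h : fld) p : (forall i, measurable_fun O (comp i h)) ->
  L2 O p -> (forall x, O x -> enorm (h x) <= p x) -> L2fld O h.
Proof.
move=> mh Lp hp i; apply: (@sqint_le _ _ _ leb O mO _ p) => // x Ox.
apply: le_trans (le_trans (hp x Ox) (ler_norm _)).
rewrite /comp -sqrtr_sqr ler_wsqrtr// dotE (bigD1 i)//= lerDl sumr_ge0// => j _.
exact: sqr_ge0.
Qed.

Lemma normG_dominated (h : fld) p : L2fld O h -> L2 O p ->
  (forall x, O x -> enorm (h x) <= p x) -> normG h <= normH O p.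
Proof.
move=> Lh Lp hp; have [Le <-] := enorm_L2 Lh.
apply: ler_wsqrtr; apply: sqint_ip_le => // x Ox.
by rewrite ger0_norm ?enorm_ge0// hp.
Qed.

Lemma cst_L2 (c : R) : L2 O (cst c). Proof. exact: (sqint_cst mO volfin). Qed.

Lemma normH_cst (c : R) : 0 <= c -> normH O (cst c) = c * Num.sqrt (vol O).
Proof.
move=> c0; rewrite /normH /ipH (_ : \int[leb]_(x in O) _ = c ^+ 2 * vol O).
  by rewrite sqrtrM ?sqr_ge0// sqrtr_sqr ger0_norm.
by rewrite expr2; exact: (Rintegral_cst leb mO (c * c)).
Qed.

Lemma tail_L2 (f e : 'rV[R]_d -> R) : L2 O f -> measurable_fun O e ->
  forall eps : R, 0 < eps -> exists M : R,
    L2 O (fun x => if M < e x then f x else 0) /\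
    normH O (fun x => if M < e x then f x else 0) <= eps.
Proof.
move=> Lf me eps e0.
pose g n x := if n%:R < e x then f x else 0.
have mg n : measurable_fun O (g n).
  apply: measurable_fun_if => //; first exact: measurable_fun_ltr.
    by apply: measurable_funS (Lf.1) => // x [].
have gf n x : `|g n x| <= `|f x| by rewrite /g; case: ifP => // _; rewrite normr0.
have Lg n : L2 O (g n) by apply: (@sqint_le _ _ _ leb O mO _ f).
have [_ _] : [/\ leb.-integrable O (cst 0%E : 'rV[R]_d -> \bar R),
   [sequence (\int[leb]_(x in O) (`|(g n x ^+ 2)%:E - 0|))%E]_n @ \oo --> 0%E &
   [sequence (\int[leb]_(x in O) (g n x ^+ 2)%:E)%E]_n @ \oo --> (\int[leb]_(x in O) 0)%E].
  apply: (@dominated_convergence _ _ _ leb O mO (fun n x => (g n x ^+ 2)%:E) (cst 0%E) (fun x => (f x ^+ 2)%:E)).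
  - by move=> n; apply/measurable_EFinP; exact: measurable_funX.
  - exact: measurable_cst.
  - apply: aeW => x Ox; apply: cvg_near_cst.
    exists (Num.truncn (e x)).+1 => // n /= en; rewrite /g ltNge.
    by rewrite (_ : e x <= n%:R) ?expr0n// (le_trans (ltW (truncnS_gt _)))// ler_nat.
  - by case: Lf.
  - apply: aeW => x n Ox; rewrite gee0_abs ?lee_fin ?sqr_ge0//.
    by rewrite -(real_normK (num_real (g n x))) -(real_normK (num_real (f x))) lerXn2r ?nnegrE.
rewrite integral0 => /fine_cvgP[_]; rewrite /comp/= => lim.
have lim0 : (fun n => ip (g n) (g n)) @ \oo --> 0.
  apply: cvg_trans lim; apply: near_eq_cvg; near=> n.
  by rewrite /= -(ipL2_sqr mO (Lg n)).
have /cvg0P[/(_ lim0) + _] : forall n, 0 <= ip (g n) (g n) by move=> n; exact: (form_ge0 FH).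
move=> /(_ (eps ^+ 2))[|N NP]; first by rewrite exprn_gt0.
exists N%:R; split; first exact: Lg.
by have /ler_wsqrtr := NP N (leqnn _); rewrite sqrtr_sqr gtr0_norm.
Unshelve. all: by end_near. Qed.

Variables (psi : R -> R) (a b s : R).
Hypothesis pg : psi_growth psi a b s.
Local Notation ph := (@phi R d psi).

Definition flux (g : fld) : fld := fun x => ph (g x).

Lemma measurable_flux g i : L2fld O g -> measurable_fun O (comp i (flux g)).
Proof.
move=> Lg; apply: (eq_measurable_fun
  (fun x => psi (enorm (g x)) * (enorm (g x))^-1 * comp i g x)).
  move=> x _; rewrite /comp /flux phiE /phi_coef mxE; case: eqP => // ->.
  by rewrite enorm0 invr0 mulr0.
have me := measurable_enorm Lg.
apply: measurable_funM; last by case: (Lg i).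
apply: measurable_funM.
  apply: measurableT_comp me; apply: continuous_measurable_fun.
  exact: (psi_continuous pg).
by apply: measurable_fun_inv_ge0 => // x _; exact: enorm_ge0.
Qed.

Lemma lin_enorm_L2 (c k : R) g : L2fld O g -> L2 O (fun x => c + k * enorm (g x)).
Proof.
move=> /enorm_L2[Le _]; have := form_setD FH (cst_L2 c) (form_setZ FH k Le).
exact.
Qed.

Lemma flux_L2 g : L2fld O g -> L2fld O (flux g).
Proof.
move=> Lg; have [C C0 CP] := @phi_linear _ d _ _ _ _ pg.
apply: (@L2fld_dominated _ (fun x => C + C * enorm (g x))).
- by move=> i; exact: measurable_flux.
- exact: lin_enorm_L2.
- by move=> x _; apply: le_trans (CP _) _; rewrite mulrDr mulr1.
Qed.

Lemma flux_bound : exists2 K : R, 0 <= K &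
  forall g, L2fld O g -> normG (flux g) <= K * (1 + normG g).
Proof.
have [C C0 CP] := @phi_linear _ d _ _ _ _ pg.
have v0 : 0 <= Num.sqrt (vol O) by exact: sqrtr_ge0.
exists (C * (1 + Num.sqrt (vol O))); first by rewrite mulr_ge0 ?addr_ge0// ltW.
move=> g Lg; have [Le eE] := enorm_L2 Lg.
apply: (@le_trans _ _ (normH O (fun x => C + C * enorm (g x)))).
  apply: normG_dominated; [exact: flux_L2|exact: lin_enorm_L2|].
  by move=> x _; apply: le_trans (CP _) _; rewrite mulrDr mulr1.
have := form_norm_leD FH (cst_L2 C) (form_setZ FH C Le).
rewrite -[X in X <= _ -> _]/(normH O (fun x => C + C * enorm (g x))).
rewrite -[Num.sqrt (ip (cst C) _)]/(normH O (cst C)) (normH_cst (ltW C0)).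
rewrite (form_sqrZ FH)// eE sqrtrM ?sqr_ge0// sqrtr_sqr (gtr0_norm C0).
have g0 : 0 <= normG g := sqrtr_ge0 _.
move=> h; apply: le_trans h _.
rewrite -mulrA -mulrDr ler_wpM2l ?(ltW C0)//.
by have := mulr_ge0 v0 g0 => ?; lra.
Qed.

(** Where |k| <= M, [phi_modulus] gives a small constant plus a multiple of |g n - k|; elsewhere
    linear growth gives the tail of k plus such a multiple. The three L^2 norms that result are at
    most eps / 4, eps / 2 and eps / 4. *)
Lemma flux_continuous (g : nat -> fld) k : (forall n, L2fld O (g n)) -> L2fld O k ->
  normG (g n - k) @[n --> \oo] --> 0 -> normG (flux (g n) - flux k) @[n --> \oo] --> 0.
Proof.
move=> Lg Lk gk; have [C C0 CP] := @phi_linear _ d _ _ _ _ pg.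
apply/cvg0P => [n|eps e0]; first exact: sqrtr_ge0.
have v0 : 0 <= Num.sqrt (vol O) by exact: sqrtr_ge0.
have e40 : 0 < eps / 4 / (Num.sqrt (vol O) + 1) by rewrite !divr_gt0// ltr_wpDl.
have Lt : L2 O (fun x => 2 * C + 2 * C * enorm (k x)) by exact: lin_enorm_L2.
have [M [LM tM]] := tail_L2 Lt (measurable_enorm Lk) (divr_gt0 e0 (ltr0Sn _ 3)).
have [K K0 KP] := @phi_modulus _ d _ _ _ _ pg M _ e40.
set c := eps / 4 / _ in e40 KP.
set t := (fun x => if _ then _ else _) in LM tM.
have KC0 : 0 < K + C by rewrite ltr_wpDl.
have /cvg0P : forall n, 0 <= normG (g n - k) by move=> n; exact: sqrtr_ge0.
move=> [/(_ gk) h _]; have [N NP] := h (eps / 2 / (K + C)) (divr_gt0 (divr_gt0 e0 (ltr0Sn _ 1)) KC0).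
exists N => n /NP gn.
have LB := form_setB FG (Lg n) Lk.
have [LeB eB] := enorm_L2 LB.
have LfB := form_setB FG (flux_L2 (Lg n)) (flux_L2 Lk).
have L1 := form_setD FH (cst_L2 c) (form_setZ FH (K + C) LeB).
have L2' := form_setD FH L1 LM.
apply: (@le_trans _ _ (normH O (cst c + (K + C) *: (fun x => enorm ((g n - k) x)) + t))).
  apply: normG_dominated => // x Ox.
  rewrite -[leRHS]/(c + (K + C) * enorm (g n x - k x) + t x) -[leLHS]/(enorm (ph (g n x) - ph (k x))).
  have n0 := enorm_ge0 (g n x - k x); have k0 := enorm_ge0 (k x).
  have Cn0 := mulr_ge0 (ltW C0) n0; have Kn0 := mulr_ge0 K0 n0.
  rewrite enormBC /t; case: ltP => kM.
    have h1 : enorm (ph (k x) - ph (g n x)) <= enorm (ph (k x)) + enorm (ph (g n x)).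
      by rewrite -(enormN (ph (g n x))); exact: enorm_leD.
    have h2 := CP (k x); have h3 := CP (g n x).
    have h4 : C * enorm (g n x) <= C * (enorm (k x) + enorm (g n x - k x)).
      by rewrite ler_pM2l//; have := enorm_leB (g n x) (k x) => ?; lra.
    by have := ltW e40; lra.
  by have := KP (k x) (g n x) kM; rewrite [enorm (k x - _)]enormBC => ?; lra.
have n1 := form_norm_leD FH L1 LM.
have n2 := form_norm_leD FH (cst_L2 c) (form_setZ FH (K + C) LeB).
apply: le_trans n1 _.
have q1 : Num.sqrt (ip (cst c) (cst c)) <= eps / 4.
  rewrite -[leLHS]/(normH O (cst c)) (normH_cst (ltW e40)) /c mulrAC ler_pdivrMr ?ltr_wpDl//.
  by rewrite ler_wpM2l ?divr_ge0 ?(ltW e0)// lerDl.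
have q2 : Num.sqrt (ip ((K + C) *: (fun x => enorm ((g n - k) x))) ((K + C) *: (fun x => enorm ((g n - k) x)))) <= eps / 2.
  rewrite (form_sqrZ FH)// eB sqrtrM ?sqr_ge0// sqrtr_sqr (gtr0_norm KC0).
  by move: gn; rewrite ler_pdivlMr// mulrC.
have q3 : Num.sqrt (ip t t) <= eps / 4 := tM.
by lra.
Qed.

Lemma Apair_flux u v : H10 O u -> H10 O v ->
  Apair psi O u v = ipG O (flux (grad O u)) (grad O v).
Proof.
move=> Hu Hv; have [_ ->] // := ipG_dot oO (flux_L2 (grad_L2 Hu)) (grad_L2 Hv).
Qed.

Lemma ipG_grad k u g : L2fld O k -> H10_gradient O u g -> ipG O k (grad O u) = ipG O k g.
Proof.
move=> Lk ug; have Hu : H10 O u by exists g.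
have Lg : L2fld O g by case: ug.
have Lu := grad_L2 Hu; have LB := form_setB FG Lu Lg.
have n0 : ipG O (grad O u - g) (grad O u - g) = 0.
  by apply: (H10_gradient_unique oO bO (gradP Hu) ug); exact: aeW.
have := form_null FG LB Lk n0; rewrite (formBl FG Lu Lg Lk).
by rewrite (formC FG Lu Lk) (formC FG Lg Lk) => /eqP; rewrite subr_eq0 => /eqP.
Qed.

Lemma Apair_linear a0 u v w : H10 O u -> H10 O v -> H10 O w ->
  Apair psi O u (a0 *: v + w) = a0 * Apair psi O u v + Apair psi O u w.
Proof.
move=> Hu Hv Hw; have Lf := flux_L2 (grad_L2 Hu).
have Hl := formS FV a0 Hv Hw.
have Lv := grad_L2 Hv; have Lw := grad_L2 Hw; have Lav := form_setZ FG a0 Lv.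
rewrite (Apair_flux Hu Hl) (Apair_flux Hu Hv) (Apair_flux Hu Hw).
rewrite (ipG_grad Lf (H10_gradient_lin oO bO a0 (gradP Hv) (gradP Hw))).
by rewrite (formDr FG Lav Lw Lf) (formZr FG a0 Lv Lf).
Qed.

Lemma Apair_bound : exists2 K : R, 0 <= K & forall u v, H10 O u -> H10 O v ->
  `|Apair psi O u v| <= K * (1 + Num.sqrt (ipV O u u)) * Num.sqrt (ipV O v v).
Proof.
have [K K0 KP] := flux_bound; exists K => // u v Hu Hv.
rewrite Apair_flux//; apply: le_trans (form_abs_le FG (flux_L2 (grad_L2 Hu)) (grad_L2 Hv)) _.
by rewrite ler_wpM2r ?sqrtr_ge0// KP//; exact: grad_L2.
Qed.

(** Outside V the gradient defaults to 0 and the flux vanishes. The time integrals in the equation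
    run over such times too, so their contribution has to be known. *)
Lemma Apair_out u v : ~ H10 O u -> Apair psi O u v = 0.
Proof.
move=> Hu; rewrite /Apair /Rintegral integral0_eq// => x _.
have -> : grad O u = cst 0 by rewrite /grad xgetPN// => g ug; apply: Hu; exists g.
by rewrite /Defs.phi /= eqxx (form0l dot_form).
Qed.

Lemma ipV_gradB u v : H10 O u -> H10 O v ->
  ipG O (grad O u - grad O v) (grad O u - grad O v) = ipV O (u - v) (u - v).
Proof.
move=> Hu Hv; have ub := H10_gradientB oO bO (gradP Hu) (gradP Hv).
by rewrite (ipV_gradient2 oO bO ub ub).
Qed.

Lemma Apair_continuous (u v : nat -> 'rV[R]_d -> R) u' v' :
  (forall n, H10 O (u n)) -> (forall n, H10 O (v n)) -> H10 O u' -> H10 O v' ->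
  Num.sqrt (ipV O (u n - u') (u n - u')) @[n --> \oo] --> 0 ->
  Num.sqrt (ipV O (v n - v') (v n - v')) @[n --> \oo] --> 0 ->
  Apair psi O (u n) (v n) @[n --> \oo] --> Apair psi O u' v'.
Proof.
move=> Hu Hv Hu' Hv' uu vv; rewrite Apair_flux//.
have -> : (fun n => Apair psi O (u n) (v n)) =
    (fun n => ipG O (flux (grad O (u n))) (grad O (v n))).
  by apply/funext => n; rewrite Apair_flux.
have Lu n := grad_L2 (Hu n); have Lu' := grad_L2 Hu'.
have Lv n := grad_L2 (Hv n); have Lv' := grad_L2 Hv'.
apply: (form_cvg2 FG) => //.
- by move=> n; exact: (flux_L2 (Lu n)).
- exact: (flux_L2 Lu').
- apply: (flux_continuous Lu Lu').
  by apply: (@sqrt_cvg0_le _ 1 _ _ _ uu) => n; rewrite expr1n mul1r ipV_gradB.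
- by apply: (@sqrt_cvg0_le _ 1 _ _ _ vv) => n; rewrite expr1n mul1r ipV_gradB.
Qed.

End flux.

(** * Coercivity of differences *)

Section powers.
Context {R : realType}.

Lemma powR_sum4 (x y z w p : R) : 0 <= x -> 0 <= y -> 0 <= z -> 0 <= w -> 0 <= p ->
  (x + y + z + w) `^ p <= 4 `^ p * (x `^ p + y `^ p + z `^ p + w `^ p).
Proof.
move=> x0 y0 z0 w0 p0; pose m := Num.max (Num.max x y) (Num.max z w).
have mx : x <= m by rewrite !le_max lexx.
have my : y <= m by rewrite !le_max lexx orbT.
have mz : z <= m by rewrite !le_max lexx !orbT.
have mw : w <= m by rewrite !le_max lexx !orbT.
have m0 : 0 <= m by exact: le_trans mx.
apply: (@le_trans _ _ ((4 * m) `^ p)).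
  by apply: ge0_ler_powR; rewrite // ?nnegrE; lra.
rewrite powRM// ler_wpM2l ?powR_ge0//.
have := powR_ge0 x p; have := powR_ge0 y p; have := powR_ge0 z p; have := powR_ge0 w p.
move=> h1 h2 h3 h4; rewrite /m.
case: (leP (Num.max x y) (Num.max z w)) => _; [case: (leP z w)|case: (leP x y)] => _.
all: by lra.
Qed.

Lemma powR_sum3 (x y z p : R) : 0 <= x -> 0 <= y -> 0 <= z -> 0 < p ->
  (x + y + z) `^ p <= 4 `^ p * (x `^ p + y `^ p + z `^ p).
Proof.
move=> x0 y0 z0 p0; have := powR_sum4 x0 y0 z0 (lexx 0) (ltW p0).
by rewrite (powR0 (lt0r_neq0 p0)) !addr0.
Qed.

Lemma powR_le_1D2 (r q : R) : 0 <= r -> 0 <= q <= 2 -> r `^ q <= 1 + r ^+ 2.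
Proof.
move=> r0 /andP[q0 q2]; have [r1|r1] := leP r 1.
  apply: (@le_trans _ _ 1); last by rewrite lerDl sqr_ge0.
  by rewrite (_ : 1 = 1 `^ q); [|by rewrite powR1]; apply: ge0_ler_powR; rewrite // nnegrE.
apply: (@le_trans _ _ (r `^ 2)); first by rewrite ler_powR// ltW.
by rewrite powR_mulrn// lerDr.
Qed.

Lemma powR_max_le (b x y p : R) : 0 <= b ->
  b * Num.max x y `^ p <= b * x `^ p + b * y `^ p.
Proof.
move=> b0; have h z : 0 <= b * z `^ p by rewrite mulr_ge0 ?powR_ge0.
by case: (leP x y) => _; [rewrite lerDr h|rewrite lerDl h].
Qed.

End powers.

Section coercivity.
Context {R : realType} {d : nat} (O : set 'rV[R]_d).
Hypotheses (d_gt0 : (0 < d)%N) (oO : open O) (bO : bounded_set O).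
Local Notation leb := (lebesgue_rV d).
Local Notation ip := (ipH O).
Local Notation FG := (L2fld_form oO).
Local Notation FV := (H10_form oO bO).
Local Notation d0 := (@dim0 R d).
Local Notation vol := (vol O).

Let mO : measurable O. Proof. exact: open_rV_measurable. Qed.
Let volfin : (leb O < +oo)%E. Proof. exact: bounded_rV_fin_measure. Qed.

Variables (psi : R -> R) (a b s : R).
Hypothesis pg : psi_growth psi a b s.
Hypothesis s_dim : s * d0 <= 2.
Local Notation Ap := (Apair psi O).

Let sd0 : 0 <= s * d0.
Proof. by rewrite mulr_ge0 ?(ltW dim0_gt0)// ltW// (psi_s_gt0 pg). Qed.

Let b0 : 0 <= b. Proof. exact/ltW/(psi_b_gt0 pg). Qed.
Let a0 : 0 <= a. Proof. exact: (psi_a_ge0 pg). Qed.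

(** The denominator in [phi_monotone] may be 0, and then that inequality is empty, division by 0
    being 0. But since b > 0 this forces both vectors to vanish. *)
Lemma phi_monotone_weight (x y : 'rV[R]_d) (om : R) : 0 < om ->
  a + b * Num.max (enorm x) (enorm y) `^ s <= om ->
  dot (x - y) (x - y) / om <= dot (phi psi x - phi psi y) (x - y).
Proof.
move=> om0; have := phi_monotone pg x y; set M := Num.max _ _.
have w0 := psi_weight_ge0 pg M; rewrite enorm_sqr => h Mom.
have [wz|wn] := eqVneq (a + b * M `^ s) 0; last first.
  apply: le_trans h; rewrite ler_wpM2l ?dot_ge0// lef_pV2 ?posrE//.
  by rewrite lt_def wn.
have Mz : M = 0.
  have bM : b * M `^ s = 0.
    have h1 : 0 <= b * M `^ s by rewrite mulr_ge0 ?powR_ge0// ltW// (psi_b_gt0 pg).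
    have h2 := psi_a_ge0 pg; lra.
  apply/eqP; move/eqP: bM.
  rewrite mulf_eq0 (gt_eqF (psi_b_gt0 pg)) /= powR_eq0.
  by case/andP.
have e1 : enorm x = 0.
  by apply/eqP; rewrite eq_le enorm_ge0 andbT -Mz le_max lexx.
have e2 : enorm y = 0.
  by apply/eqP; rewrite eq_le enorm_ge0 andbT -Mz le_max lexx orbT.
move/eqP: e1; move/eqP: e2; rewrite !enorm_eq0 => /eqP -> /eqP ->.
by rewrite !subrr !(form0l dot_form)// mul0r.
Qed.

Section weight_integral.
Variables (eu ev : 'rV[R]_d -> R) (del : R).
Hypothesis del0 : 0 < del.
Hypotheses (meu : measurable_fun O eu) (mev : measurable_fun O ev).
Hypothesis iu : leb.-integrable O (EFin \o (fun x => eu x `^ (s * d0))).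
Hypothesis iv : leb.-integrable O (EFin \o (fun x => ev x `^ (s * d0))).

(* del keeps the weight away from 0 when a = 0. *)
Definition weight x : R := a + del + b * eu x `^ s + b * ev x `^ s.

Let bp0 x : 0 <= b * x `^ s. Proof. by rewrite mulr_ge0 ?powR_ge0. Qed.

Lemma measurable_weight : measurable_fun O weight.
Proof.
have mp f : measurable_fun O f -> measurable_fun O (fun x => b * f x `^ s).
  by move=> mf; apply: measurable_funM => //; exact: (measurableT_comp (@measurable_powR R s) mf).
by apply: measurable_funD; [apply: measurable_funD|]; [|exact: mp|exact: mp].
Qed.

Lemma weight_ge_del x : del <= weight x.
Proof. by rewrite /weight -!addrA addrCA lerDl !addr_ge0// ?a0. Qed.

Lemma weight_ge x : a + b * Num.max (eu x) (ev x) `^ s <= weight x.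
Proof.
rewrite /weight -!addrA lerD2l; apply: ler_wpDl; first exact: ltW.
exact: powR_max_le.
Qed.

Lemma integral_weight : leb.-integrable O (EFin \o (fun x => weight x `^ d0)) /\
  \int[leb]_(x in O) (weight x `^ d0) <= 4 `^ d0 * (a `^ d0 * vol + del `^ d0 * vol +
    b `^ d0 * (\int[leb]_(x in O) (eu x `^ (s * d0)) + \int[leb]_(x in O) (ev x `^ (s * d0)))).
Proof.
have d00 : 0 <= d0 by exact/ltW/dim0_gt0.
pose c := a `^ d0 + del `^ d0.
pose pu x := b `^ d0 * eu x `^ (s * d0); pose pv x := b `^ d0 * ev x `^ (s * d0).
pose bnd x := 4 `^ d0 * (c + pu x + pv x).
have ibc : leb.-integrable O (EFin \o cst c).
  exact: (sqint_integrable mO volfin (sqint_cst mO volfin c)).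
have ibu : leb.-integrable O (EFin \o pu) by exact: (integrableZl mO _ iu).
have ibv : leb.-integrable O (EFin \o pv) by exact: (integrableZl mO _ iv).
have ib1 : leb.-integrable O (EFin \o (cst c \+ pu)) by exact: (integrableD mO ibc ibu).
have ib2 : leb.-integrable O (EFin \o ((cst c \+ pu) \+ pv)) by exact: (integrableD mO ib1 ibv).
have ibnd : leb.-integrable O (EFin \o bnd) by exact: (integrableZl mO _ ib2).
have bndE : \int[leb]_(x in O) bnd x = 4 `^ d0 * (c * vol + \int[leb]_(x in O) pu x + \int[leb]_(x in O) pv x).
  rewrite (RintegralZl _ mO ib2) (RintegralD mO ib1 ibv) (RintegralD mO ibc ibu).
  by rewrite (Rintegral_cst leb mO).
have ombnd x : weight x `^ d0 <= bnd x.
  apply: le_trans (powR_sum4 _ _ _ _ d00) _ => //; first exact: ltW.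
  by rewrite /bnd /c /pu /pv !powRM ?powR_ge0// -!powRrM.
have iom : leb.-integrable O (EFin \o (fun x => weight x `^ d0)).
  apply: (@integrable_le _ _ _ leb O mO _ bnd) => //.
    exact: (measurableT_comp (@measurable_powR R _) measurable_weight).
  by move=> x _; rewrite ger0_norm ?powR_ge0.
split => //; apply: (@le_trans _ _ (\int[leb]_(x in O) bnd x)).
  by apply: le_Rintegral => // x _; exact: ombnd.
rewrite bndE ler_wpM2l ?powR_ge0// /pu /pv (RintegralZl _ mO iu) (RintegralZl _ mO iv) /c.
by apply: eqW; ring.
Qed.

End weight_integral.

Definition grad_power u : R := \int[leb]_(x in O) (enorm (grad O u x) `^ (s * d0)).

Lemma integrable_grad_power u : H10 O u ->
  leb.-integrable O (EFin \o (fun x => enorm (grad O u x) `^ (s * d0))).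
Proof.
move=> Hu; have Lg := grad_L2 Hu; have [Le _] := enorm_L2 oO Lg.
apply: (@integrable_le _ _ _ leb O mO _ (fun x => 1 + enorm (grad O u x) ^+ 2)).
- apply: (measurableT_comp (@measurable_powR R _)); exact: measurable_enorm.
- move=> x _; rewrite ger0_norm ?powR_ge0// powR_le_1D2 ?enorm_ge0//.
  by rewrite sd0.
apply: (@eq_integrable _ _ _ leb _ mO (fun x => 1%:E + (enorm (grad O u x) ^+ 2)%:E)%E) => //.
apply: integrableD => //; last by case: Le.
exact: (sqint_integrable mO volfin (sqint_cst mO volfin 1)).
Qed.

(** Hoelder's inequality against the constant 1, with exponent s d0 / 2. This is the place where
    [s_dim] is essential: the exponent must not exceed 1. *)
Lemma grad_power_le u : H10 O u ->
  grad_power u <= vol `^ (1 - s * d0 / 2) * (ipV O u u) `^ (s * d0 / 2).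
Proof.
move=> Hu; have Lg := grad_L2 Hu; have [Le eE] := enorm_L2 oO Lg.
pose t := s * d0 / 2.
have t01 : 0 < t <= 1.
  rewrite ler_pdivrMr// mul1r s_dim andbT divr_gt0// mulr_gt0 ?dim0_gt0//.
  exact: (psi_s_gt0 pg).
have me := measurable_enorm oO Lg.
have := @hoelder_poweR _ _ _ leb O mO (fun x => (enorm (grad O u x) ^+ 2)%:E) (cst 1%E) t t01.
have mf : measurable_fun O (fun x => (enorm (grad O u x) ^+ 2)%:E).
  by apply/measurable_EFinP; exact: measurable_funX.
have f0 (x : 'rV[R]_d) : O x -> (0 <= (enorm (grad O u x) ^+ 2)%:E)%E.
  by rewrite lee_fin sqr_ge0.
move=> /(_ mf (measurable_cst _) f0 (fun _ _ => lee01)).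
rewrite -(ipL2_sqr mO Le) -[X in (X%:E `^ _)%E]/(ip _ _) eE integral_cst// mul1e.
have volE : leb O = vol%:E by rewrite /vol fineK// ge0_fin_numE.
rewrite [X in (_ * X `^ _)%E](_ : _ = vol%:E)// !poweR_EFin -EFinM => h; rewrite -lee_fin mulrC.
apply: le_trans h.
have ig := integrable_grad_power Hu.
rewrite /grad_power /Rintegral fineK; last exact: (integrable_fin_num mO ig).
apply: eqW; apply: eq_integral => x _ /=.
rewrite powR1 mule1; congr EFin.
by rewrite -powR_mulrn ?enorm_ge0// -powRrM; congr (_ `^ _); rewrite /t; field.
Qed.

Lemma Apair_sub u v : H10 O u -> H10 O v ->
  Ap u (u - v) - Ap v (u - v) =
  ipG O (flux psi (grad O u) - flux psi (grad O v)) (grad O u - grad O v).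
Proof.
move=> Hu Hv; have Lu := flux_L2 oO bO pg (grad_L2 Hu); have Lv := flux_L2 oO bO pg (grad_L2 Hv).
have HB := form_setB FV Hu Hv; have LB := form_setB FG (grad_L2 Hu) (grad_L2 Hv).
have uvg := H10_gradientB oO bO (gradP Hu) (gradP Hv).
rewrite (Apair_flux oO bO pg Hu HB) (Apair_flux oO bO pg Hv HB).
have E k : L2fld O k -> ipG O k (grad O (u - v)) = ipG O k (grad O u - grad O v).
  by move=> Lk; exact: (ipG_grad oO bO Lk uvg).
move: Lu Lv; set fu := flux _ (grad O u); set fv := flux _ (grad O v).
clearbody fu fv => Lu Lv.
by rewrite (E _ Lu) (E _ Lv) (formBl FG Lu Lv LB).
Qed.

Lemma weighted_le_Apair u v (om : 'rV[R]_d -> R) (e : R) : H10 O u -> H10 O v ->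
  measurable_fun O om -> 0 < e -> (forall x, O x -> e <= om x) ->
  (forall x, O x ->
    a + b * Num.max (enorm (grad O u x)) (enorm (grad O v x)) `^ s <= om x) ->
  \int[leb]_(x in O) (dot ((grad O u - grad O v) x) ((grad O u - grad O v) x) / om x) <=
  Ap u (u - v) - Ap v (u - v).
Proof.
move=> Hu Hv mom e0 eom omP; rewrite Apair_sub//.
have Lu := flux_L2 oO bO pg (grad_L2 Hu); have Lv := flux_L2 oO bO pg (grad_L2 Hv).
have Lf := form_setB FG Lu Lv.
have LB := form_setB FG (grad_L2 Hu) (grad_L2 Hv).
have [i1 ->] := ipG_dot oO Lf LB; have [i2 _] := ipG_dot oO LB LB.
have om0 x : O x -> 0 < om x by move=> /eom; exact: lt_le_trans.
apply: le_Rintegral => //.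
  apply: (@integrable_le _ _ _ leb O mO _ (fun x => e^-1 * dot ((grad O u - grad O v) x) ((grad O u - grad O v) x))).
  - apply: measurable_funM; first exact: measurable_dot.
    by apply: measurable_fun_inv_ge0 => // x /om0/ltW.
  - move=> x Ox; rewrite ger0_norm; last by rewrite divr_ge0 ?dot_ge0// ltW// om0.
    by rewrite mulrC ler_wpM2r ?dot_ge0// lef_pV2 ?posrE ?om0// eom.
  - by apply: (integrableZl mO _ i2).
move=> x Ox.
exact: (phi_monotone_weight (om0 x Ox) (omP x Ox)).
Qed.

Lemma powR_dim0_le (x : R) : 0 <= x -> (2 * x) `^ d0^-1 <= 2 * x `^ d0^-1.
Proof.
move=> x0; rewrite powRM// ler_wpM2r ?powR_ge0//.
by rewrite -[leRHS]powRr1// ler_powR ?ler1n// invf_le1 ?dim0_ge1// dim0_gt0.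
Qed.

(** The bound of [integral_weight] for the integrated power of the weight, without the factor 4^d0
    and the share of [del]. *)
Definition weight_total u v : R := a `^ d0 * vol + b `^ d0 * (grad_power u + grad_power v).

Lemma grad_power_ge0 u : 0 <= grad_power u.
Proof. by apply: Rintegral_ge0 => x _; exact: powR_ge0. Qed.

Lemma weight_total_ge0 u v : 0 <= weight_total u v.
Proof.
rewrite /weight_total addr_ge0// mulr_ge0 ?powR_ge0 ?addr_ge0 ?grad_power_ge0//.
exact: vol_ge0.
Qed.

(** The weighted Sobolev inequality for [u - v], whose weighted Dirichlet integral is bounded
    through the monotonicity of [phi]. [eta] allows for a vanishing [weight_total]. The factor 8 is
    4, from the four summands of the weight, times 2, from [powR_dim0_le]. *)
Lemma Apair_coercive_pos u v eta : H10 O u -> H10 O v -> 0 < eta ->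
  ip (u - v) (u - v) <= 8 * (4 + vol) * (weight_total u v + eta) `^ d0^-1 *
    (Ap u (u - v) - Ap v (u - v)).
Proof.
move=> Hu Hv eta0; set Q := weight_total u v; have Q0 : 0 <= Q := weight_total_ge0 u v.
have v0 : 0 <= vol := vol_ge0 O.
have dp : 0 < d0 := dim0_gt0; have d00 := ltW dp.
(* Makes [del] to the power d0, times the volume, at most [Q + eta], so the regularised total is at
   most [2 * (Q + eta)]; [vol + 1] is positive even for a null domain. *)
pose q := (Q + eta) / (vol + 1).
have q0 : 0 < q by rewrite divr_gt0// ?ltr_wpDl.
pose del := q `^ d0^-1; have del0 : 0 < del by rewrite powR_gt0.
have delE : del `^ d0 = q by rewrite /del -powRrM mulVf ?gt_eqF// powRr1// ltW.
pose eu x := enorm (grad O u x); pose ev x := enorm (grad O v x).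
have meu : measurable_fun O eu by exact: (measurable_enorm oO (grad_L2 Hu)).
have mev : measurable_fun O ev by exact: (measurable_enorm oO (grad_L2 Hv)).
have mom := measurable_weight del meu mev.
have [iom I1] := integral_weight del0 meu mev (integrable_grad_power Hu) (integrable_grad_power Hv).
have eom x (_ : O x) := weight_ge_del eu ev del x.
have omP x (_ : O x) := weight_ge eu ev del0 x.
set om := weight eu ev del in mom iom I1 eom omP.
have uvg := H10_gradientB oO bO (gradP Hu) (gradP Hv).
apply: le_trans (sobolev_H10 d_gt0 oO bO mom del0 eom iom uvg) _.
have wl := weighted_le_Apair Hu Hv mom del0 eom omP.
have D0 : 0 <= \int[leb]_(x in O) (dot ((grad O u - grad O v) x) ((grad O u - grad O v) x) / om x).
  apply: Rintegral_ge0 => x Ox; rewrite divr_ge0 ?dot_ge0//.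
  exact: le_trans (ltW del0) (eom x Ox).
have I0 : 0 <= \int[leb]_(x in O) (om x `^ d0) by apply: Rintegral_ge0 => x _; exact: powR_ge0.
have qv : q * vol <= Q + eta.
  by rewrite /q mulrAC ler_pdivrMr ?ltr_wpDl// ler_wpM2l ?lerDl// addr_ge0// ltW.
have Qe : 0 <= Q + eta by rewrite addr_ge0// ltW.
have hh (I X Y : R) : Q = a `^ d0 * vol + b `^ d0 * (X + Y) ->
    I <= 4 `^ d0 * (a `^ d0 * vol + del `^ d0 * vol + b `^ d0 * (X + Y)) ->
    I <= 4 `^ d0 * (2 * (Q + eta)).
  rewrite delE => QE IE; apply: le_trans IE _; rewrite ler_wpM2l ?powR_ge0//.
  rewrite addrAC -QE (_ : 2 * (Q + eta) = (Q + eta) + (Q + eta)); last by ring.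
  by apply: lerD => //; rewrite lerDl ltW.
have {}I1 : \int[leb]_(x in O) (om x `^ d0) <= 4 `^ d0 * (2 * (Q + eta)) := hh _ _ _ (erefl _) I1.
have I2 : (\int[leb]_(x in O) (om x `^ d0)) `^ d0^-1 <= 8 * (Q + eta) `^ d0^-1.
  apply: (@le_trans _ _ ((4 `^ d0 * (2 * (Q + eta))) `^ d0^-1)).
    apply: ge0_ler_powR => //; rewrite ?nnegrE ?invr_ge0//.
    by rewrite mulr_ge0 ?powR_ge0// mulr_ge0.
  rewrite powRM ?powR_ge0//; last by rewrite mulr_ge0.
  rewrite -powRrM divff ?gt_eqF// powRr1// (_ : 8 = 4 * 2 :> R); last by ring.
  by rewrite -mulrA ler_wpM2l// powR_dim0_le.
have := ler_pM (powR_ge0 _ _) D0 I2 wl => h.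
apply: le_trans (ler_wpM2l _ h) _; first by rewrite addr_ge0.
by rewrite !mulrA [(4 + vol) * 8]mulrC.
Qed.

Lemma Apair_sub_ge0 u v : H10 O u -> H10 O v -> 0 <= Ap u (u - v) - Ap v (u - v).
Proof.
move=> Hu Hv; rewrite Apair_sub//.
have Lu := flux_L2 oO bO pg (grad_L2 Hu); have Lv := flux_L2 oO bO pg (grad_L2 Hv).
have Lf := form_setB FG Lu Lv.
have LB := form_setB FG (grad_L2 Hu) (grad_L2 Hv).
have [i1 ->] := ipG_dot oO Lf LB.
apply: Rintegral_ge0 => x Ox; apply: le_trans (phi_monotone pg (grad O u x) (grad O v x)).
by rewrite divr_ge0 ?sqr_ge0// (psi_weight_ge0 pg).
Qed.

(** A positive [weight_total] is itself taken as [eta], which costs another factor 2. If it is 0,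
    [eta] is sent to 0 and the left side must vanish. *)
Lemma Apair_coercive u v : H10 O u -> H10 O v ->
  ip (u - v) (u - v) <= 16 * (4 + vol) * weight_total u v `^ d0^-1 *
    (Ap u (u - v) - Ap v (u - v)).
Proof.
move=> Hu Hv; have D0 := Apair_sub_ge0 Hu Hv; have v0 := vol_ge0 O.
set D := Ap u _ - _ in D0 *.
have dp : 0 < d0 := dim0_gt0.
have := weight_total_ge0 u v; rewrite le_eqVlt => /predU1P[Q0|Q0]; last first.
  apply: le_trans (Apair_coercive_pos Hu Hv Q0) _.
  set W := weight_total u v in Q0 *; have -> : W + W = 2 * W by ring.
  rewrite -/D ler_wpM2r// (_ : 16 * (4 + vol) * W `^ d0^-1 = 8 * (4 + vol) * (2 * W `^ d0^-1)); last by ring.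
  by rewrite ler_wpM2l ?mulr_ge0 ?addr_ge0// powR_dim0_le// ltW.
rewrite -Q0 powR0 ?gt_eqF ?invr_gt0// mulr0 mul0r.
apply/ler_addgt0Pr => e e0; rewrite add0r.
have k0 : 0 < 8 * (4 + vol) * D + 1 by rewrite ltr_wpDl// mulr_ge0// mulr_ge0//; lra.
pose del := e / (8 * (4 + vol) * D + 1).
have del0 : 0 < del by exact: divr_gt0.
have := Apair_coercive_pos Hu Hv (powR_gt0 d0 del0).
rewrite -Q0 add0r -powRrM divff ?gt_eqF// powRr1 ?(ltW del0)// -/D => /le_trans; apply.
rewrite /del mulrAC mulrA ler_pdivrMr// mulrC ler_wpM2l ?(ltW e0)//.
by rewrite lerDl.
Qed.

(** Arises in [rate_le] when the rate of [Apair_coercive] is raised to the power alpha d0: 4^alpha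
    separates the three summands, the power of the volume converts (a^d0 vol)^alpha into (a
    vol)^(alpha d0), and the maximum dominates the Hoelder factor of [grad_power_le]. *)
Definition rate_cst (alpha : R) : R := (16 * (4 + vol)) `^ (alpha * d0) *
  (4 `^ alpha * (vol `^ (alpha - alpha * d0) + Num.max 1 vol)).

Lemma rate_le alpha u v : H10 O u -> H10 O v -> 0 < alpha <= 1 -> 0 < vol ->
  (16 * (4 + vol) * weight_total u v `^ d0^-1) `^ (alpha * d0) <= rate_cst alpha *
  ((a * vol) `^ (alpha * d0) + b `^ (alpha * d0) * Num.sqrt (ipV O u u) `^ (alpha * d0 * s) +
   b `^ (alpha * d0) * Num.sqrt (ipV O v v) `^ (alpha * d0 * s)).
Proof.
move=> Hu Hv /andP[al0 al1] v0; have dp : 0 < d0 := dim0_gt0.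
have al0' := ltW al0; have d00 := ltW dp; have v0' := ltW v0.
have W0 := weight_total_ge0 u v.
have c0 : 0 <= 16 * (4 + vol) by rewrite mulr_ge0// addr_ge0.
rewrite powRM ?powR_ge0// -powRrM (mulrCA d0^-1) mulVf ?gt_eqF// mulr1.
rewrite /rate_cst -!mulrA ler_wpM2l ?powR_ge0//.
set M := Num.max 1 vol; have M1 : 1 <= M by rewrite le_max lexx.
have M0 : 0 <= M by exact: le_trans M1.
pose th := s * d0 / 2.
have th0 : 0 <= th by rewrite divr_ge0.
have th1 : th <= 1 by rewrite ler_pdivrMr// mul1r.
have gp w : H10 O w -> (b `^ d0 * grad_power w) `^ alpha <=
    M * (b `^ (alpha * d0) * Num.sqrt (ipV O w w) `^ (alpha * d0 * s)).
  move=> Hw; have q0 := form_ge0 FV Hw.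
  rewrite powRM ?powR_ge0 ?grad_power_ge0// -powRrM [d0 * alpha]mulrC mulrCA.
  rewrite ler_wpM2l ?powR_ge0//.
  apply: (@le_trans _ _ ((vol `^ (1 - th) * ipV O w w `^ th) `^ alpha)).
    apply: ge0_ler_powR; rewrite // ?nnegrE ?grad_power_ge0 ?mulr_ge0 ?powR_ge0//.
    exact: grad_power_le.
  rewrite powRM ?powR_ge0// -!powRrM.
  have -> : Num.sqrt (ipV O w w) `^ (alpha * d0 * s) = ipV O w w `^ (th * alpha).
    by rewrite -powR12_sqrt// -powRrM; congr (_ `^ _); rewrite /th; field.
  rewrite ler_wpM2r ?powR_ge0//.
  have e0 : 0 <= (1 - th) * alpha by rewrite mulr_ge0 ?subr_ge0.
  apply: (@le_trans _ _ (M `^ ((1 - th) * alpha))).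
    by apply: ge0_ler_powR; rewrite // ?nnegrE// le_max lexx orbT.
  rewrite -[leRHS](powRr1 M0) ler_powR//.
  by rewrite -[leRHS]mulr1 ler_pM ?subr_ge0// gerBl.
have ga : (a `^ d0 * vol) `^ alpha = vol `^ (alpha - alpha * d0) * (a * vol) `^ (alpha * d0).
  rewrite !powRM ?powR_ge0// -powRrM [d0 * alpha]mulrC mulrCA -powRD ?subrK//.
  by apply/implyP; rewrite gt_eqF.
have W4 : weight_total u v `^ alpha <= 4 `^ alpha * ((a `^ d0 * vol) `^ alpha +
    (b `^ d0 * grad_power u) `^ alpha + (b `^ d0 * grad_power v) `^ alpha).
  rewrite /weight_total mulrDr addrA.
  by apply: powR_sum3 => //; rewrite mulr_ge0 ?powR_ge0 ?grad_power_ge0.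
apply: le_trans W4 _; rewrite ler_wpM2l ?powR_ge0// ga [alpha * (d0 * s)]mulrA.
have fin (p A X Y x y : R) : 0 <= p -> 0 <= A -> 0 <= X -> 0 <= Y -> x <= M * X -> y <= M * Y ->
    p * A + x + y <= (p + M) * (A + X + Y).
  move=> p0 A0 X0 Y0 xX yY.
  have := mulr_ge0 p0 X0; have := mulr_ge0 p0 Y0; have := mulr_ge0 M0 A0.
  rewrite mulrDl !mulrDr; move: xX yY; clear.
  by move: (p * A) (p * X) (p * Y) (M * A) (M * X) (M * Y) => pA pX pY MA MX MY ? ? ? ? ?; lra.
by apply: fin; rewrite ?powR_ge0 ?mulr_ge0 ?powR_ge0//; exact: gp.
Qed.

End coercivity.

(** * The energy identity *)

Lemma continuous_seq {R : realType} (f : R -> R) :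
  (forall x (u : nat -> R), u n @[n --> \oo] --> x -> f (u n) @[n --> \oo] --> f x) ->
  continuous f.
Proof.
move=> fs x; apply/cvgrPdist_lt => eps e0; apply: contrapT => nex.
have /choice[u uP] n : exists y, `|x - y| < n.+1%:R^-1 /\ eps <= `|f x - f y|.
  apply: contrapT => ny; apply: nex; exists n.+1%:R^-1; first by rewrite /= invr_gt0.
  move=> y /= xy; rewrite ltNge; apply/negP => le; apply: ny; by exists y.
have ux : u n @[n --> \oo] --> x.
  apply/cvgrPdist_le => e ee; have [N _ NP] : \forall n \near \oo, n.+1%:R^-1 <= e.
    have /cvgrPdist_le/(_ _ ee) := @cvg_harmonic R.
    by apply: filterS => n; rewrite sub0r normrN /harmonic ger0_norm// invr_ge0.
  by exists N => // n Nn /=; have [/ltW/le_trans h _] := uP n; apply/h/NP.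
have /cvgrPdist_lt/(_ _ e0)[N _ NP] := fs x u ux.
by have [_] := uP N; rewrite leNgt NP/=.
Qed.

Section curves.
Context {R : realType} {d : nat} (O : set 'rV[R]_d).
Hypotheses (d_gt0 : (0 < d)%N) (oO : open O) (bO : bounded_set O).
Local Notation FH := (L2_form oO).
Local Notation FV := (H10_form oO bO).
Local Notation leb := (@lebesgue_measure R).
Implicit Types (z f : R -> 'rV[R]_d -> R).

(** Paths are indexed by all of R, which gives plain limits; a path on the half-line is extended to
    negative times by its value at 0. *)
Definition curve z : Prop := (forall t, L2 O (z t)) /\
  (forall t, normH O (z t' - z t) @[t' --> t] --> 0).

Definition vcurve f : Prop := (forall t, H10 O (f t)) /\
  (forall t, Num.sqrt (ipV O (f t' - f t) (f t' - f t)) @[t' --> t] --> 0).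

Lemma curve_continuous z (Phi : ('rV[R]_d -> R) -> R) : curve z -> H_continuous O Phi ->
  continuous (fun t => Phi (z t)).
Proof.
move=> [Lz cz] cPhi t; apply: (H_continuous_cvg oO cPhi (Lz t) _ (cz t)).
by apply: nearW => t'; exact: Lz.
Qed.

Lemma curveB z1 z2 : curve z1 -> curve z2 -> curve (fun t => z1 t - z2 t).
Proof.
move=> [L1 c1] [L2' c2]; split => [t|t]; first exact: (form_setB FH).
have s0 : normH O (z1 t' - z1 t) + normH O (z2 t' - z2 t) @[t' --> t] --> (0 : R).
  by rewrite [X in _ --> X](_ : 0 = 0 + 0); [exact: cvgD|rewrite addr0].
apply: (squeeze_cvgr _ (cvg_cst (0 : R)) s0); apply: nearW => t'.
rewrite sqrtr_ge0/= (_ : z1 t' - z2 t' - (z1 t - z2 t) = (z1 t' - z1 t) - (z2 t' - z2 t)).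
  have S1 := form_setB FH (L1 t') (L1 t); have S2 := form_setB FH (L2' t') (L2' t).
  have := form_norm_leD FH S1 (form_setN FH S2).
  by rewrite [X in _ <= _ + X](_ : _ = normH O (z2 t' - z2 t))// /normH -sub0r
    (form_sqrBC FH (form0 FH) S2) subr0.
by apply/funext => r; rewrite !fctE; ring.
Qed.

Lemma reg_vcurve n z : curve z -> vcurve (fun t => reg O n (z t)).
Proof.
move=> [Lz cz]; split=> [t|t]; first exact: reg_H10.
have l0 : Num.sqrt n.+1%:R * normH O (z t' - z t) @[t' --> t] --> (0 : R).
  rewrite [X in _ --> X](_ : 0 = Num.sqrt n.+1%:R * 0); last by rewrite mulr0.
  by apply: cvgM => //; exact: cvg_cst.
apply: (squeeze_cvgr _ (cvg_cst (0 : R)) l0); apply: nearW => t'.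
rewrite sqrtr_ge0/= -sqrtrM//; apply: ler_wsqrtr.
exact: reg_lip.
Qed.

Lemma vcurve_norm_continuous f : vcurve f -> continuous (fun t => Num.sqrt (ipV O (f t) (f t))).
Proof.
move=> [Hf cf] t.
have h : ipV O (f t') (f t') @[t' --> t] --> ipV O (f t) (f t) by exact: (form_cvg2 FV).
exact: (continuous_cvg _ (@sqrt_continuous R _) h).
Qed.

Lemma measurable_reg_energy n z : curve z ->
  measurable_fun setT (fun t => (reg_energy O n (z t))%:E).
Proof.
move=> cz; apply/measurable_EFinP; apply: continuous_measurable_fun.
by apply: (curve_continuous cz); exact: reg_energy_continuous.
Qed.

Lemma measurable_normV z : curve z -> measurable_fun setT (fun t => (normV O (z t) ^+ 2)%E).
Proof.
move=> cz; apply: (emeasurable_fun_cvg (fun n t => (reg_energy O n (z t))%:E)).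
  by move=> n; exact: measurable_reg_energy.
move=> t _; have Lz : L2 O (z t) by case: cz.
rewrite normV_sup//; apply: ereal_nondecreasing_cvgn => m n mn.
by rewrite lee_fin reg_energy_nd.
Qed.

Definition goodtimes z : set R := [set t | H10 O (z t)].

Lemma goodtimesE z : goodtimes z = [set t | (normV O (z t) ^+ 2 < +oo)%E].
Proof.
apply/funext => t; apply/propext; rewrite /goodtimes /mkset; split.
  by move=> Hz; rewrite normV_sqr// ltry.
by apply: contraPP => nH; rewrite normV_out// => /negP; rewrite -leNgt leey.
Qed.

Lemma measurable_goodtimes z : curve z -> measurable (goodtimes z).
Proof.
move=> cz; rewrite goodtimesE -[X in measurable X]setTI.
apply: emeasurable_fun_infty_o => //; exact: measurable_normV.
Qed.

(** At times outside V the value is 0, because [fine +oo = 0]. *)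
Definition vnorm z t : R := Num.sqrt (fine (normV O (z t) ^+ 2)).

Lemma vnormE z t : H10 O (z t) -> vnorm z t = Num.sqrt (ipV O (z t) (z t)).
Proof. by move=> Hz; rewrite /vnorm normV_sqr. Qed.

Lemma measurable_vnorm z : curve z -> measurable_fun setT (vnorm z).
Proof.
move=> cz; apply: (eq_measurable_fun (fun t => (fine (normV O (z t) ^+ 2)) `^ 2^-1)).
  by move=> t _; rewrite powR12_sqrt// fine_ge0// expe_ge0// normV_ge0.
apply: (measurableT_comp (@measurable_powR R _)).
apply: (measurableT_comp (fine_measurable measurableT)).
exact: measurable_normV.
Qed.

Section flux_curve.
Variables (psi : R -> R) (a b s : R).
Hypothesis pg : psi_growth psi a b s.
Local Notation Ap := (Apair psi O).

Lemma Apair_vcurve_continuous z f : vcurve z -> vcurve f -> continuous (fun t => Ap (z t) (f t)).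
Proof.
move=> [Hz cz] [Hf cf]; apply: continuous_seq => t u ut.
apply: (Apair_continuous oO bO pg) => //.
  exact: (@cvg_comp _ _ _ u (fun t' => Num.sqrt (ipV O (z t' - z t) (z t' - z t))) _ _ _ ut (cz t)).
exact: (@cvg_comp _ _ _ u (fun t' => Num.sqrt (ipV O (f t' - f t) (f t' - f t))) _ _ _ ut (cf t)).
Qed.

(** At times in V the pairing is the limit of its values at the regularised path, which are
    continuous in time; the indicator reproduces the value 0 at the other times. *)
Lemma measurable_Apair z f : curve z -> vcurve f -> measurable_fun setT (fun t => Ap (z t) (f t)).
Proof.
move=> cz vf.
apply: (@measurable_fun_cvg _ _ _ _ (fun n t => \1_(goodtimes z) t * Ap (reg O n (z t)) (f t))).
  move=> n; apply: measurable_funM.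
    by apply: measurable_indic; exact: measurable_goodtimes.
  apply: continuous_measurable_fun.
  exact: (Apair_vcurve_continuous (reg_vcurve n cz) vf).
move=> t _; have [Lz _] := cz; have [Hf _] := vf.
have [Hz|nHz] := pselect (H10 O (z t)).
  have -> : \1_(goodtimes z) t = 1 :> R by rewrite indicE mem_set.
  have := @Apair_continuous _ _ O oO bO psi a b s pg (fun n => reg O n (z t)) (fun=> f t)
    (z t) (f t) (fun n => reg_H10 d_gt0 oO bO n (Lz t)) (fun=> Hf t) Hz (Hf t)
    (reg_cvg d_gt0 oO bO Hz).
  rewrite subrr (form0l FV) ?sqrtr0; last exact: form0 FV.
  move=> /(_ (cvg_cst _)).
  by under [X in _ -> X @ _ --> _]eq_fun do rewrite mul1r.
have -> : \1_(goodtimes z) t = 0 :> R by rewrite indicE memNset.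
under eq_fun do rewrite mul0r.
by rewrite Apair_out//; exact: cvg_cst.
Qed.

End flux_curve.

Lemma ae_goodtimes z T : curve z ->
  (\int[leb]_(t in `[0%R, T]) (normV O (z t) ^+ 2) < +oo)%E ->
  leb.-integrable `[0%R, T] (EFin \o (fun t => vnorm z t ^+ 2)) /\
  leb.-negligible (`[0%R, T]%classic `\` goodtimes z).
Proof.
move=> cz fin.
have m1 : measurable_fun (`[0%R, T]%classic : set R) (fun t => (normV O (z t) ^+ 2)%E).
  by apply: measurable_funTS; exact: measurable_normV.
have i1 : leb.-integrable `[0%R, T] (fun t => (normV O (z t) ^+ 2)%E).
  apply/integrableP; split => //; apply: le_lt_trans fin; apply: ge0_le_integral => //.
    by apply: measurableT_comp.
  by move=> t _; rewrite gee0_abs// expe_ge0// normV_ge0.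
have aefin : {ae leb, forall t, `[0%R, T]%classic t -> (normV O (z t) ^+ 2)%E \is a fin_num}.
  exact: (integrable_ae _ i1).
split.
  apply/integrableP; split.
    apply/measurable_EFinP; apply: measurable_funX.
    by apply: measurable_funTS; exact: measurable_vnorm.
  apply: le_lt_trans fin; apply: ge0_le_integral => //.
    apply: measurableT_comp => //; apply/measurable_EFinP; apply: measurable_funX.
    by apply: measurable_funTS; exact: measurable_vnorm.
  move=> t _; rewrite -[X in (`|X| <= _)%E]/((vnorm z t ^+ 2)%:E) gee0_abs ?lee_fin ?sqr_ge0//.
  have [Hz|nHz] := pselect (H10 O (z t)).
    by rewrite vnormE// sqr_sqrtr ?(form_ge0 FV)// normV_sqr.
  by rewrite normV_out// leey.
apply: negligibleS aefin => t [/= tT nt] /(_ tT).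
by rewrite goodtimesE /= in nt; rewrite fin_numE => /andP[_ /eqP no]; apply: nt; rewrite ltey; exact/eqP.
Qed.

End curves.

(** Telescoping over a fine uniform partition leaves eps times the total increment of [K]. It takes
    the place of differentiation in time, for which the integrands are not regular enough. *)
Lemma local_to_global {R : realType} (Phi K : R -> R) (T : R) : 0 <= T ->
  (forall eps, 0 < eps -> exists2 del : R, 0 < del & forall s t,
    0 <= s -> s <= t -> t <= T -> t - s < del -> `|Phi t - Phi s| <= eps * (K t - K s)) ->
  Phi T = Phi 0.
Proof.
move=> T0 loc; apply/eqP; rewrite -subr_eq0 -normr_le0.
apply/ler_addgt0Pr => e e0; rewrite add0r.
have k0 : 0 < `|K T - K 0| + 1 by rewrite ltr_wpDl.
have [del d0 dP] := loc _ (divr_gt0 e0 k0).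
have [N NP] := div_natS_le T (divr_gt0 d0 (ltr0Sn R 1)).
pose p (i : nat) := T * i%:R / N.+1%:R.
have n0 : 0 < N.+1%:R :> R by rewrite ltr0n.
have p0 i : 0 <= p i by rewrite divr_ge0 ?mulr_ge0.
have pS i : p i.+1 = p i + T / N.+1%:R.
  by rewrite /p -natr1 mulrDr mulr1 mulrDl.
have tel i : (i <= N.+1)%N -> `|Phi (p i) - Phi 0| <= e / (`|K T - K 0| + 1) * (K (p i) - K 0).
  elim: i => [_|i IH iN]; first by rewrite /p mulr0 mul0r !subrr normr0 mulr0.
  have step : `|Phi (p i.+1) - Phi (p i)| <= e / (`|K T - K 0| + 1) * (K (p i.+1) - K (p i)).
    apply: dP => //.
    - by rewrite pS lerDl divr_ge0.
    - by rewrite /p ler_pdivrMr// ler_wpM2l// ler_nat.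
    - rewrite pS addrAC subrr add0r (le_lt_trans (NP N (leqnn _)))//.
      by rewrite ltr_pdivrMr// ltr_pMr// ltr1n.
  have -> : Phi (p i.+1) - Phi 0 = (Phi (p i.+1) - Phi (p i)) + (Phi (p i) - Phi 0) by ring.
  apply: le_trans (ler_normD _ _) _; have := lerD step (IH (ltnW iN)).
  by rewrite -mulrDr addrA subrK.
have := tel N.+1 (leqnn _); rewrite /p mulfK ?gt_eqF// => h.
apply: le_trans h _; rewrite mulrAC ler_pdivrMr// ler_wpM2l ?(ltW e0)//.
by rewrite (le_trans (ler_norm _))// lerDl.
Qed.

(** * Testing a linear equation in the dual of V with its own solution *)

Section energy.
Context {R : realType} {d : nat} (O : set 'rV[R]_d).
Hypotheses (d_gt0 : (0 < d)%N) (oO : open O) (bO : bounded_set O).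
Local Notation ip := (ipH O).
Local Notation FH := (L2_form oO).
Local Notation FV := (H10_form oO bO).
Local Notation leb := (@lebesgue_measure R).
Local Notation normv v := (Num.sqrt (ipV O v v)).
Variables (w : R -> 'rV[R]_d -> R) (w0 : 'rV[R]_d -> R).
Variables (D : R -> ('rV[R]_d -> R) -> R) (k : R -> R).
Hypotheses (cw : curve O w) (Hw0 : H10 O w0).
Hypothesis D_lin : forall t c u v, H10 O u -> H10 O v -> D t (c *: u + v) = c * D t u + D t v.
Hypothesis D_bound : forall t v, H10 O v -> `|D t v| <= k t * normv v.
Hypothesis D_meas : forall f, vcurve O f -> measurable_fun setT (fun t => D t (f t)).
Hypotheses (k_ge0 : forall t, 0 <= k t) (k_meas : measurable_fun setT k).
Hypothesis k_sqr : forall T : R, leb.-integrable `[0, T] (EFin \o (fun t => k t ^+ 2)).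
Hypothesis eqn : forall t v, 0 <= t -> H10 O v ->
  ip (w t) v = ip w0 v - \int[leb]_(r in `[0, t]) D r v.

Let Lw t : L2 O (w t). Proof. by case: cw. Qed.

Let D_D t u v : H10 O u -> H10 O v -> D t (u + v) = D t u + D t v.
Proof. by move=> Hu Hv; have := D_lin t 1 Hu Hv; rewrite scale1r mul1r. Qed.

Let D_B t u v : H10 O u -> H10 O v -> D t (u - v) = D t u - D t v.
Proof.
move=> Hu Hv; have := D_lin t (-1) Hv Hu.
by rewrite scaleN1r mulN1r [- v + u]addrC [- _ + D _ u]addrC.
Qed.

Lemma integrable_cst_itv (c T : R) : leb.-integrable `[0, T] (EFin \o cst c).
Proof.
apply: continuous_compact_integrable; first exact: segment_compact.
by apply: continuous_subspaceT => z; exact: cvg_cst.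
Qed.

Let k_int (c T : R) : leb.-integrable `[0, T] (EFin \o (fun t => c * k t)).
Proof.
apply: (@integrable_le _ _ _ leb _ _ _ (fun t => `|c| * (1 + k t ^+ 2))) => //.
- by apply: measurable_funM => //; exact: measurable_funTS.
- move=> t _; rewrite normrM (ger0_norm (k_ge0 _)) ler_wpM2l//.
  by have := sqr_ge0 (k t - 1); have := sqr_ge0 (k t); rewrite sqrrB mulr1 expr1n => ? ?; lra.
apply: (@eq_integrable _ _ _ leb _ _ (fun t => `|c|%:E * (1%:E + (k t ^+ 2)%:E))%E) => //.
by apply: integrableZl => //; apply: integrableD => //; exact: integrable_cst_itv.
Qed.

Let D_int f T : vcurve O f -> leb.-integrable `[0, T] (EFin \o (fun t => D t (f t))).
Proof.
move=> vf; have [T0|T0] := ltP T 0.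
  by rewrite set_itv_ge ?bnd_simp -?ltNge//; exact: integrable_set0.
have [c _ cP] : exists2 c, c \in `[0, T]%R & forall t, t \in `[0, T]%R -> normv (f t) <= normv (f c).
  apply: EVT_max => //; apply: continuous_subspaceT.
  exact: (vcurve_norm_continuous oO bO vf).
apply: (@integrable_le _ _ _ leb _ _ _ (fun t => normv (f c) * k t)) => //.
- by apply: measurable_funTS; exact: D_meas.
- move=> t tT; have Hf : H10 O (f t) by case: vf.
  apply: le_trans (D_bound t Hf) _; rewrite mulrC; apply: ler_wpM2r; first exact: k_ge0.
  exact: cP.
Qed.

Let vcst v : H10 O v -> vcurve O (fun=> v).
Proof.
move=> Hv; split => // t; rewrite subrr (form0l FV) ?sqrtr0; last exact: form0 FV.
exact: cvg_cst.
Qed.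

Lemma Rintegral_itv_split (f : R -> R) r t : 0 <= r -> r <= t ->
  leb.-integrable `[0, t] (EFin \o f) ->
  \int[leb]_(z in `[0, t]) f z - \int[leb]_(z in `[0, r]) f z = \int[leb]_(z in `]r, t]) f z.
Proof. by move=> r0 rt fi; apply: Rintegral_itvB => //; rewrite bnd_simp. Qed.

Lemma integrable_itv_sub (f : R -> R) r t : 0 <= r ->
  leb.-integrable `[0, t] (EFin \o f) -> leb.-integrable `]r, t] (EFin \o f).
Proof.
move=> r0; apply: integrableS => //.
by move=> z /=; rewrite !in_itv/= => /andP[rz ->]; rewrite (le_trans r0 (ltW rz)).
Qed.

Lemma increment r t v : 0 <= r -> r <= t -> H10 O v ->
  ip (w t - w r) v = - \int[leb]_(z in `]r, t]) D z v.
Proof.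
move=> r0 rt Hv; have t0 := le_trans r0 rt; have Lv := H10_L2 Hv.
rewrite (formBl FH (Lw t) (Lw r) Lv) (eqn t0 Hv) (eqn r0 Hv).
rewrite -(Rintegral_itv_split r0 rt); last exact: (D_int t (vcst Hv)).
suff h (p q r' : R) : p - q - (p - r') = - (q - r') by exact: h.
by ring.
Qed.

Let J n t := reg O n (w t).
Let HJ n t : H10 O (J n t). Proof. exact: reg_H10. Qed.
Let vJ n : vcurve O (J n). Proof. exact: reg_vcurve. Qed.
Let LJ n t : L2 O (J n t). Proof. exact: H10_L2. Qed.

(** The cross terms [ip (J n t) (w r)] and [ip (J n r) (w t)] cancel by symmetry of the resolvent,
    so the product rule has no second-order term. *)
Let J_energyB n r t : ip (J n t) (w t) - ip (J n r) (w r) = ip (w t - w r) (J n t + J n r).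
Proof.
have LS := form_setD FH (LJ n t) (LJ n r).
rewrite (formBl FH (Lw t) (Lw r) LS).
rewrite (formDr FH (LJ n t) (LJ n r) (Lw t)) (formDr FH (LJ n t) (LJ n r) (Lw r)).
rewrite (formC FH (LJ n t) (Lw t)) (formC FH (LJ n r) (Lw r)).
rewrite (reg_sym d_gt0 oO bO n (Lw t) (Lw r)) -/(J n t) (formC FH (LJ n t) (Lw r)).
suff h (p q r' : R) : p - r' = p + q - (q + r') by exact: h.
by ring.
Qed.

Lemma w_uniform (T e : R) : 0 < e -> exists2 del : R, 0 < del & forall r t,
  0 <= r <= T -> 0 <= t <= T -> `|r - t| < del -> normH O (w r - w t) < e.
Proof.
apply: (@segment_uniform_continuity _ (fun r t => normH O (w r - w t))).
- by move=> r t _ _; exact: (normHC oO).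
- move=> p r t _ _ _.
  have := form_norm_leD FH (form_setB FH (Lw p) (Lw r)) (form_setB FH (Lw r) (Lw t)).
  by rewrite addrA subrK.
move=> t _ ee ee0; have [_ /(_ t)/cvgrPdist_lt/(_ _ ee0)[del /= dd dP]] := cw.
exists del => // r _ rt; have : `|0 - normH O (w r - w t)| < ee.
  by apply: dP; rewrite /= distrC.
by rewrite sub0r normrN ger0_norm ?sqrtr_ge0.
Qed.

Let J_lip n q p e : normH O (w q - w p) < e / Num.sqrt n.+1%:R -> normv (J n q - J n p) <= e.
Proof.
have c0 : 0 < Num.sqrt n.+1%:R :> R by rewrite sqrtr_gt0.
rewrite ltr_pdivlMr// => h.
apply: (@le_trans _ _ (Num.sqrt n.+1%:R * normH O (w q - w p))).
  by rewrite -sqrtrM//; apply: ler_wsqrtr; exact: reg_lip.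
by rewrite mulrC ltW.
Qed.

Let D_J_le n q r t e : normv (J n q - J n t) <= e / 2 -> normv (J n q - J n r) <= e / 2 ->
  `|2 * D q (J n q) - D q (J n t + J n r)| <= e * k q.
Proof.
move=> qt qr.
have HB p : H10 O (J n q - J n p) by exact: (form_setB FV).
have -> : 2 * D q (J n q) - D q (J n t + J n r) = D q ((J n q - J n t) + (J n q - J n r)).
  rewrite (D_D _ (HB t) (HB r)) (D_B _ (HJ n q) (HJ n t)) (D_B _ (HJ n q) (HJ n r)).
  rewrite (D_D _ (HJ n t) (HJ n r)).
  suff h (p q' r' : R) : 2 * p - (q' + r') = p - q' + (p - r') by exact: h.
  by ring.
apply: le_trans (D_bound q (form_setD FV (HB t) (HB r))) _.
rewrite mulrC ler_wpM2r//; apply: le_trans (form_norm_leD FV (HB t) (HB r)) _.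
by rewrite [leRHS](splitr e); exact: (lerD qt qr).
Qed.

(** Over a short interval the increment of the energy involves [D] at the sum of the endpoint values
    of [J n], the claim twice its running value. Uniform continuity of [J n] in V bounds the
    discrepancy by eps times the integral of [k], and [local_to_global] concludes. *)
Lemma reg_energy_identity n T : 0 <= T ->
  ip (J n T) (w T) = ip (J n 0) (w 0) - 2 * \int[leb]_(t in `[0, T]) D t (J n t).
Proof.
move=> T0.
pose Phi t := ip (J n t) (w t) + 2 * \int[leb]_(r in `[0, t]) D r (J n r).
pose kk t := \int[leb]_(r in `[0, t]) (1 * k r).
suff : Phi T = Phi 0.
  rewrite /Phi set_itv1 Rintegral_set1 mulr0 addr0 => <-; by rewrite addrK.
apply: (@local_to_global _ _ kk) => // eps e0.
have c0 : 0 < Num.sqrt n.+1%:R :> R by rewrite sqrtr_gt0.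
have [del d0 dP] := w_uniform T (divr_gt0 (divr_gt0 e0 (ltr0Sn _ 1)) c0).
exists del => // r t r0 rt tT trd.
have t0 := le_trans r0 rt; have rT := le_trans rt tT.
have iJ := D_int t (vJ n).
have HS : H10 O (J n t + J n r) by exact: (form_setD FV).
have iS := D_int t (vcst HS).
have ik := k_int 1 t.
have iJ' := integrable_itv_sub r0 iJ; have iS' := integrable_itv_sub r0 iS.
have ik' := integrable_itv_sub r0 ik.
have i2J : leb.-integrable `]r, t] (EFin \o (fun q => 2 * D q (J n q))).
  by apply: (@eq_integrable _ _ _ leb _ _ (fun q => 2%:E * (D q (J n q))%:E)%E) => //;
    exact: integrableZl.
have iB : leb.-integrable `]r, t] (EFin \o (fun q => 2 * D q (J n q) - D q (J n t + J n r))).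
  by apply: (@eq_integrable _ _ _ leb _ _ (fun q => (2 * D q (J n q))%:E - (D q (J n t + J n r))%:E)%E) => //;
    exact: integrableB.
have -> : Phi t - Phi r = \int[leb]_(q in `]r, t]) (2 * D q (J n q) - D q (J n t + J n r)).
  rewrite (RintegralB _ i2J iS')// (RintegralZl _ _ iJ')//.
  rewrite -(Rintegral_itv_split r0 rt iJ).
  have inc := increment r0 rt HS; rewrite -J_energyB in inc.
  suff h (p q p' q' I : R) : p - p' = - I ->
    p + 2 * q - (p' + 2 * q') = 2 * (q - q') - I by exact: (h _ _ _ _ _ inc).
  by move=> pI; rewrite -[I]opprK -pI; ring.
have iek : leb.-integrable `]r, t] (EFin \o (fun q => eps * (1 * k q))).
  by apply: (@eq_integrable _ _ _ leb _ _ (fun q => eps%:E * (1 * k q)%:E)%E) => //;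
    exact: integrableZl.
have -> : eps * (kk t - kk r) = \int[leb]_(q in `]r, t]) (eps * (1 * k q)).
  by rewrite (RintegralZl _ _ ik')// -(Rintegral_itv_split r0 rt ik).
apply: le_trans (le_normr_Rintegral _ iB) _ => //.
apply: le_Rintegral => //; first exact: (integrable_abse iB).
move=> q /=; rewrite in_itv/= mul1r => /andP[rq qt].
have qT : 0 <= q <= T by rewrite (le_trans r0 (ltW rq)) (le_trans qt).
apply: D_J_le; apply: J_lip; apply: dP => //.
- by rewrite t0.
- by rewrite distrC ger0_norm ?subr_ge0// (le_lt_trans _ trd)// lerB// ltW.
- by rewrite r0.
- by rewrite ger0_norm ?subr_ge0 ?(ltW rq)// (le_lt_trans _ trd)// lerB.
Qed.

Hypothesis w_good : forall T, leb.-negligible (`[0, T]%classic `\` goodtimes O w).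
Hypothesis w_k : forall t, H10 O (w t) -> normv (w t) <= k t.

Definition dissipation t : R := \1_(goodtimes O w) t * D t (w t).

Let D_J_cvg t : H10 O (w t) -> D t (J n t) @[n --> \oo] --> D t (w t).
Proof.
move=> Hw; have l0 : k t * normv (J n t - w t) @[n --> \oo] --> 0.
  rewrite [X in _ --> X](_ : 0 = k t * 0); last by rewrite mulr0.
  by apply: cvgM; [exact: cvg_cst|exact: (reg_cvg d_gt0 oO bO Hw)].
apply/cvgrPdist_le => e e0; move/cvgrPdist_le : l0 => /(_ _ e0).
apply: filterS => n; rewrite sub0r normrN => /(le_trans (ler_norm _)); apply: le_trans.
by rewrite distrC -(D_B t (HJ n t) Hw); apply: D_bound; exact: (form_setB FV).
Qed.

Let ind_cvg t : \1_(goodtimes O w) t * D t (J n t) @[n --> \oo] --> dissipation t.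
Proof.
rewrite /dissipation; have [Hw|nHw] := pselect (H10 O (w t)).
  by apply: cvgM; [exact: cvg_cst|exact: D_J_cvg].
have -> : \1_(goodtimes O w) t = 0 :> R by rewrite indicE memNset.
by rewrite mul0r; under eq_fun do rewrite mul0r; exact: cvg_cst.
Qed.

Lemma measurable_dissipation : measurable_fun setT dissipation.
Proof.
apply: (@measurable_fun_cvg _ _ _ _ (fun n t => \1_(goodtimes O w) t * D t (J n t))).
  move=> n; apply: measurable_funM; last exact: D_meas (vJ n).
  by apply: measurable_indic; exact: (measurable_goodtimes d_gt0 oO bO cw).
by move=> t _; exact: ind_cvg.
Qed.

Let dissipation_le t : `|dissipation t| <= k t ^+ 2.
Proof.
rewrite /dissipation; have [Hw|nHw] := pselect (H10 O (w t)); last first.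
  by rewrite indicE memNset// mul0r normr0 sqr_ge0.
rewrite indicE mem_set// mul1r; apply: le_trans (D_bound t Hw) _.
by rewrite expr2 ler_wpM2l// w_k.
Qed.

Lemma integrable_dissipation T : leb.-integrable `[0, T] (EFin \o dissipation).
Proof.
apply: (@integrable_le _ _ _ leb _ _ _ (fun t => k t ^+ 2)) => //.
by apply: measurable_funTS; exact: measurable_dissipation.
Qed.

(** Dominated convergence with majorant [k t ^+ 2]: the resolvent does not increase the V-norm, and
    [w_k] bounds the V-norm of [w t]. *)
Let int_cvg T : \int[leb]_(t in `[0, T]) D t (J n t) @[n --> \oo] -->
  \int[leb]_(t in `[0, T]) dissipation t.
Proof.
have [_ _] : [/\ leb.-integrable `[0, T] (EFin \o dissipation),
   [sequence (\int[leb]_(t in `[0%R, T]) (`|(D t (J n t))%:E - (dissipation t)%:E|))%E]_n @ \oo --> 0%E &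
   [sequence (\int[leb]_(t in `[0%R, T]) (D t (J n t))%:E)%E]_n @ \oo -->
     (\int[leb]_(t in `[0%R, T]) (dissipation t)%:E)%E].
  apply: (@dominated_convergence _ _ _ leb _ _ (fun n t => (D t (J n t))%:E) (EFin \o dissipation) (fun t => (k t ^+ 2)%:E)) => //.
  - by move=> n; apply/measurable_EFinP; apply: measurable_funTS; exact: D_meas.
  - by apply/measurable_EFinP; apply: measurable_funTS; exact: measurable_dissipation.
  - apply: negligibleS (w_good T) => t /= nt.
    have tT : `[0, T]%classic t by apply: contrapT => h; apply: nt => /h.
    split => // gt; apply: nt => _; apply: (cvg_EFin _ _); first by exact: nearW.
    have := @ind_cvg t; rewrite indicE mem_set//.
    by under eq_fun do rewrite mul1r.
  - apply: negligibleS (w_good T) => t /= nt.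
    have tT : `[0, T]%classic t by apply: contrapT => h; apply: nt => n /h.
    split => // gt; apply: nt => n _; rewrite lee_fin.
    apply: le_trans (D_bound t (HJ n t)) _; rewrite expr2 ler_wpM2l//.
    apply: le_trans (w_k gt); apply: ler_wsqrtr.
    exact: (reg_le d_gt0 oO bO n gt).
have iD n := D_int T (vJ n).
have EI n : (\int[leb]_(t in `[0%R, T]) (D t (J n t))%:E)%E = (\int[leb]_(t in `[0, T]) D t (J n t))%:E.
  by rewrite /Rintegral fineK//; exact: (integrable_fin_num _ (iD n)).
have ED : (\int[leb]_(t in `[0%R, T]) (dissipation t)%:E)%E = (\int[leb]_(t in `[0, T]) dissipation t)%:E.
  by rewrite /Rintegral fineK//; exact: (integrable_fin_num _ (integrable_dissipation T)).
rewrite ED => /fine_cvgP[_]; apply: cvg_trans; apply: near_eq_cvg; near=> n.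
by rewrite /= EI.
Unshelve. all: by end_near. Qed.

(** At time 0 the equation identifies [w 0] with [w0] only against elements of V; by [reg_uniq] and
    symmetry the regularised energy sees nothing else. *)
Let J0_cvg : ip (J n 0) (w 0) @[n --> \oo] --> ip w0 w0.
Proof.
have L0 := H10_L2 Hw0.
have e0 v : H10 O v -> ip (w 0) v = ip w0 v.
  by move=> Hv; rewrite (eqn (lexx 0) Hv) set_itv1 Rintegral_set1 subr0.
have E n : ip (J n 0) (w 0) = ip (reg O n w0) w0.
  rewrite (reg_uniq d_gt0 oO bO n (Lw 0) L0 e0 (Lw 0)).
  have HR := reg_H10 d_gt0 oO bO n L0; have LR := H10_L2 HR.
  by rewrite (formC FH LR (Lw 0)) (e0 _ HR) (formC FH LR L0).
rewrite (_ : (fun n => _) = (fun n => ip (reg O n w0) w0)); last by apply/funext => n.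
apply: (form_cvg FH) => //; first by move=> n; exact: reg_L2.
apply: (@sqrt_cvg0_le _ (Num.sqrt (poincare_cst O)) _ _ _ (reg_cvg d_gt0 oO bO Hw0)) => n.
rewrite sqr_sqrtr ?poincare_cst_ge0//; apply: (poincare d_gt0 oO bO).
by apply: (form_setB FV) => //; exact: reg_H10.
Qed.

(** The left side passes to the limit because resolvents converge at elements of V, which is why
    [w T] has to be one. *)
Lemma energy_identity_good T : 0 <= T -> H10 O (w T) ->
  ip (w T) (w T) = ip w0 w0 - 2 * \int[leb]_(t in `[0, T]) dissipation t.
Proof.
move=> T0 HT.
have l1 : ip (J n T) (w T) @[n --> \oo] --> ip (w T) (w T).
  apply: (form_cvg FH) => //.
  apply: (@sqrt_cvg0_le _ (Num.sqrt (poincare_cst O)) _ _ _ (reg_cvg d_gt0 oO bO HT)) => n.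
  rewrite sqr_sqrtr ?poincare_cst_ge0//; apply: (poincare d_gt0 oO bO).
  exact: (form_setB FV).
have l2 : ip (J n 0) (w 0) - 2 * \int[leb]_(t in `[0, T]) D t (J n t) @[n --> \oo] -->
    ip w0 w0 - 2 * \int[leb]_(t in `[0, T]) dissipation t.
  by apply: cvgB => //; apply: cvgM; [exact: cvg_cst|exact: int_cvg].
have E : (fun n => ip (J n T) (w T)) =
    (fun n => ip (J n 0) (w 0) - 2 * \int[leb]_(t in `[0, T]) D t (J n t)).
  by apply/funext => n; exact: reg_energy_identity.
by move: l1; rewrite E => l1; exact: (cvg_unique _ l1 l2).
Qed.

(** An arbitrary time is approached from the right by times at which the path is in V; the energy is
    continuous along the path and the integral is continuous in its endpoint. *)
Lemma energy_identity t : 0 <= t ->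
  ip (w t) (w t) = ip w0 w0 - 2 * \int[leb]_(r in `[0, t]) dissipation r.
Proof.
move=> t0.
(* Such times exist, for otherwise an interval of positive length would be negligible. *)
have /choice[u uP] n : exists u, t < u < t + n.+1%:R^-1 /\ H10 O (w u).
  apply: contrapT => nu; have n0 : 0 < n.+1%:R^-1 :> R by rewrite invr_gt0.
  have : leb.-negligible (`]t, (t + n.+1%:R^-1)[%classic : set R).
    apply: negligibleS (w_good (t + n.+1%:R^-1)) => u /=; rewrite !in_itv/= => /andP[tu ut].
    split; first by rewrite (le_trans t0 (ltW tu)) ltW.
    by move=> Hu; apply: nu; exists u; rewrite tu ut.
  move=> ng; have : leb (`]t, (t + n.+1%:R^-1)[%classic : set R) = 0%E.
    exact: measure_negligible ng.
  rewrite lebesgue_measure_itv/= lte_fin ltrDl n0.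
  by rewrite -EFinD addrAC subrr add0r => /eqP; rewrite eqe gt_eqF.
have ut n : t < u n by have [/andP[]] := uP n.
have u_t : u n @[n --> \oo] --> t.
  have l : t + n.+1%:R^-1 @[n --> \oo] --> t.
    rewrite -[X in _ --> X](addr0 t); exact: (cvgD (cvg_cst t) (@cvg_harmonic R)).
  apply: (squeeze_cvgr _ (cvg_cst t) l); apply: nearW => n.
  by have [/andP[h1 h2] _] := uP n; rewrite !ltW.
have l1 : ip (w (u n)) (w (u n)) @[n --> \oo] --> ip (w t) (w t).
  have := curve_continuous oO cw (H_continuous_sqr oO) => /(_ t) h.
  exact: (@cvg_comp _ _ _ u (fun t' => ip (w t') (w t')) _ _ _ u_t h).
have fi := integrable_dissipation (t + 1).
have fi' : leb.-integrable `[t, t + 1] (EFin \o dissipation).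
  apply: integrableS fi => //; move=> z /=; rewrite !in_itv/= => /andP[tz ->].
  by rewrite (le_trans t0).
have l2 : \int[leb]_(r in `[0, u n]) dissipation r @[n --> \oo] -->
    \int[leb]_(r in `[0, t]) dissipation r.
  have l0 := @parameterized_integral_cvg_left _ t (t + 1) dissipation _ fi'.
  have {}l0 : \int[leb]_(r in `[t, u n]) dissipation r @[n --> \oo] --> 0.
    apply: (@cvg_comp _ _ _ u (fun x => \int[leb]_(r in `[t, x]) dissipation r) _ _ _ u_t).
    by apply: l0; rewrite ltrDl.
  have {}l0 : \int[leb]_(r in `[0, t]) dissipation r + \int[leb]_(r in `[t, u n]) dissipation r
      @[n --> \oo] --> \int[leb]_(r in `[0, t]) dissipation r.
    rewrite -[X in _ --> X]addr0; exact: (cvgD (cvg_cst _) l0).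
  apply: cvg_trans l0; apply: near_eq_cvg; near=> n.
  have iu := integrable_dissipation (u n).
  rewrite -(Rintegral_itv_obnd_cbnd (integrable_itv_sub t0 iu)).
  by rewrite -(Rintegral_itv_split t0 (ltW (ut n)) iu) addrC subrK.
have l3 : ip w0 w0 - 2 * \int[leb]_(r in `[0, u n]) dissipation r @[n --> \oo] -->
    ip w0 w0 - 2 * \int[leb]_(r in `[0, t]) dissipation r.
  by apply: cvgB; [exact: cvg_cst|apply: cvgM => //; exact: cvg_cst].
have E : (fun n => ip (w (u n)) (w (u n))) =
    (fun n => ip w0 w0 - 2 * \int[leb]_(r in `[0, u n]) dissipation r).
  apply/funext => n; apply: energy_identity_good; first exact: le_trans (ltW (ut n)).
  by case: (uP n).
by move: l1; rewrite E => l1; exact: (cvg_unique _ l1 l3).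
Unshelve. all: by end_near. Qed.

End energy.

(** * Decay of the energy *)

Section decay.
Context {R : realType}.
Local Notation leb := (@lebesgue_measure R).
Variables (e f : R -> R) (e0 : R) (Z : R -> \bar R) (G : R -> R).
Hypotheses (e_ge0 : forall t, 0 <= t -> 0 <= e t) (f_ge0 : forall t, 0 <= f t).
Hypothesis f_int : forall T : R, leb.-integrable `[0, T] (EFin \o f).
Hypothesis eE : forall t, 0 <= t -> e t = e0 - 2 * \int[leb]_(r in `[0, t]) f r.
Hypotheses (mZ : measurable_fun setT Z) (Z_ge0 : forall t, (0 <= Z t)%E).
Hypothesis G_gt0 : forall M, 0 < M -> 0 < G M.
Hypothesis coercive : forall M T : R, 0 < M ->
  {ae leb, forall t, 0 <= t <= T -> (Z t <= M%:E)%E -> e t <= G M * f t}.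

Lemma decay_increment r t : 0 <= r -> r <= t ->
  e r - e t = 2 * \int[leb]_(z in `]r, t]) f z.
Proof.
move=> r0 rt; rewrite (eE r0) (eE (le_trans r0 rt)).
by rewrite -(Rintegral_itv_split r0 rt (f_int t)); ring.
Qed.

Lemma decay_ni r t : 0 <= r -> r <= t -> e t <= e r.
Proof.
move=> r0 rt; rewrite -subr_ge0 (decay_increment r0 rt) mulr_ge0//.
by apply: Rintegral_ge0.
Qed.

(* By Chebyshev's inequality Z <= M on at least half of the interval, and there f >= e / G M. *)
Lemma decay_step r h M : 0 <= r -> 0 < h -> 0 < M ->
  (\int[leb]_(t in `]r, (r + h)%R]) Z t <= (M * (h / 2))%:E)%E ->
  e (r + h) * (1 + h / G M) <= e r.
Proof.
move=> r0 h0 M0 ZM; have rh : r <= r + h by rewrite lerDl ltW.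
pose I : set R := `]r, (r + h)]%classic.
pose A : set R := I `&` [set t | (Z t <= M%:E)%E].
pose B : set R := I `&` [set t | (M%:E < Z t)%E].
have mI : measurable I by rewrite /I.
have mZI : measurable_fun I Z by exact: measurable_funTS.
have mB : measurable B by exact: emeasurable_fun_o_infty.
have mA : measurable A by exact: emeasurable_fun_infty_c.
have muI : leb I = h%:E.
  rewrite /I lebesgue_measure_itv/= lte_fin ltrDl h0 -EFinD addrAC subrr add0r //.
have IAB : I = A `|` B.
  apply/seteqP; split => t; last by move=> [[]|[]].
  by move=> It; have [tM|tM] := leP (Z t) M%:E; [left|right].
have dAB : A `&` B = set0.
  by apply/seteqP; split => // t [[_ /= h1] [_ /= h2]]; move: h1; rewrite leNgt h2.
have muB : (M%:E * leb B <= (M * (h / 2))%:E)%E.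
  apply: le_trans ZM; rewrite -integral_cst//.
  apply: (@le_trans _ _ (\int[leb]_(t in B) Z t)%E).
    apply: ge0_le_integral => //.
    - by move=> t _; rewrite lee_fin ltW.
    - by apply: measurable_funS mZI => // t [].
    - by move=> t [_ /= /ltW].
  by apply: ge0_subset_integral => // t [].
have muB' : (leb B <= (h / 2)%:E)%E.
  by move: muB; rewrite EFinM lee_pmul2l.
have muA : ((h / 2)%:E <= leb A)%E.
  have : (h%:E <= leb A + leb B)%E by rewrite -muI IAB; exact: measureU2.
  have hE : h%:E = ((h / 2)%:E + (h / 2)%:E)%E by rewrite -EFinD -splitr.
  move=> hAB; rewrite leNgt; apply/negP => hA.
  move: hAB; rewrite hE leNgt => /negP; apply.
  by apply: lte_leD => //; rewrite ge0_fin_numE// (le_lt_trans muB')// ltry.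
have Gp := G_gt0 M0; have eh0 : 0 <= e (r + h) by rewrite e_ge0// addr_ge0// ltW.
(* A lower bound of [f] almost everywhere on [A]: there e t <= G M * f t, and e t is at least the
   value at the right end because [e] is nonincreasing. *)
pose c := e (r + h) / G M; have c0 : 0 <= c by rewrite divr_ge0// ltW.
have fI : leb.-integrable I (EFin \o f) by exact: integrable_itv_sub (f_int (r + h)).
have low : c * (h / 2) <= \int[leb]_(t in I) f t.
  rewrite -lee_fin /Rintegral fineK; last exact: (integrable_fin_num _ fI).
  apply: (@le_trans _ _ (c%:E * leb A)%E).
    by rewrite EFinM lee_wpmul2l// lee_fin.
  rewrite -integral_cst//.
  have fA : measurable_fun I (EFin \o f) by case/integrableP : fI.
  apply: (@le_trans _ _ (\int[leb]_(t in A) (f t)%:E)%E); last first.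
    by apply: ge0_subset_integral => // [t _|t []//]; rewrite lee_fin.
  apply: ae_ge0_le_integral => //.
  - by move=> t _; rewrite lee_fin.
  - by apply: measurable_funS fA => // t [].
  apply: negligibleS (coercive (r + h) M0) => t /= nt cE; apply: nt => -[/=].
  rewrite /I /= in_itv/= => /andP[rt tr] ZtM; rewrite lee_fin ler_pdivrMr// mulrC.
  have t0 : 0 <= t by exact: le_trans (ltW rt).
  apply: le_trans (cE _ ZtM); last by rewrite t0.
  exact: decay_ni.
have := decay_increment r0 rh; rewrite -/I => inc.
have : 2 * (c * (h / 2)) <= e r - e (r + h) by rewrite inc ler_wpM2l.
have -> : 2 * (c * (h / 2)) = e (r + h) * (h / G M) by rewrite /c; field; rewrite gt_eqF.
by move=> hh; rewrite mulrDr mulr1; lra.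
Qed.

Lemma decay_iter (h M : R) (n : nat) : 0 < h -> 0 < M ->
  (\int[leb]_(t in `[0%R, (h * n%:R)%R]) Z t <= (M * (h / 2))%:E)%E ->
  e (h * n%:R) * (1 + h / G M) ^+ n <= e 0.
Proof.
move=> h0 M0 ZM.
suff H i : (i <= n)%N -> e (h * i%:R) * (1 + h / G M) ^+ i <= e 0 by exact: H.
elim: i => [|i IH] iN; first by rewrite mulr0 expr0 mulr1.
apply: le_trans (IH (ltnW iN)); have hi0 : 0 <= h * i%:R by rewrite mulr_ge0// ltW.
have q0 : 0 <= 1 + h / G M by rewrite addr_ge0// divr_ge0 ?ltW// G_gt0.
rewrite exprS mulrA ler_wpM2r ?exprn_ge0// -natr1 [h * (_ + 1)]mulrDr mulr1.
apply: decay_step => //; apply: le_trans ZM.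
apply: ge0_subset_integral => //; first exact: measurable_funTS.
move=> t /=; rewrite !in_itv/= => /andP[t1 t2].
rewrite (le_trans hi0 (ltW t1)) (le_trans t2)//.
by rewrite -[X in _ + X]mulr1 -mulrDr natr1 ler_pM2l// ler_nat.
Qed.

(** One bound on the integral over the whole of [[0, t]] serves each of the n subintervals, so the
    same level [M] and the same factor are used n times; n >= l then allows the real exponent. *)
Lemma decay_power (l t M : R) (n : nat) : 0 < t -> 0 < M -> (0 < n)%N -> 0 <= l -> l <= n%:R ->
  (\int[leb]_(t in `[0%R, t]) Z t <= (M * (t / n%:R / 2))%:E)%E ->
  e t <= e 0 * (G M * (n%:R / t)) `^ l.
Proof.
move=> t0 M0 n0 l0 ln ZM; have nR : 0 < n%:R :> R by rewrite ltr0n.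
pose h := t / n%:R; have h0 : 0 < h by exact: divr_gt0.
have tE : h * n%:R = t by rewrite divfK// gt_eqF.
have := @decay_iter h M n h0 M0; rewrite tE => /(_ ZM) it.
have Gp := G_gt0 M0; have hG : 0 < h / G M by exact: divr_gt0.
have p1 : (h / G M) `^ l <= (1 + h / G M) ^+ n.
  apply: (@le_trans _ _ ((1 + h / G M) `^ l)).
    by apply: ge0_ler_powR; rewrite // ?nnegrE ?addr_ge0 ?(ltW hG)// lerDr.
  rewrite -powR_mulrn ?addr_ge0 ?(ltW hG)//; apply: ler_powR => //.
  by rewrite lerDl ltW.
have qE : (G M * (n%:R / t)) `^ l = ((h / G M) `^ l)^-1.
  have -> : G M * (n%:R / t) = (h / G M)^-1 by rewrite invf_div /h invf_div.
  by rewrite -powR_inv1 ?(ltW hG)// -powRN -powRrM mulN1r.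
rewrite qE ler_pdivlMr; last by rewrite powR_gt0.
by apply: le_trans it; rewrite ler_wpM2l// e_ge0// ltW.
Qed.

End decay.

Lemma sqrt_powR2 {R : realType} (x alpha : R) : 0 <= x -> Num.sqrt x `^ (2 * alpha) = x `^ alpha.
Proof.
move=> x0; rewrite -powR12_sqrt// -powRrM; congr (_ `^ _); by field.
Qed.

Lemma integrable_itv_lin3 {R : realType} (T c : R) (f g h : R -> R) :
  (@lebesgue_measure R).-integrable `[0, T] (EFin \o f) ->
  (@lebesgue_measure R).-integrable `[0, T] (EFin \o g) ->
  (@lebesgue_measure R).-integrable `[0, T] (EFin \o h) ->
  (@lebesgue_measure R).-integrable `[0, T] (EFin \o (fun t => c * (f t + g t + h t))).
Proof.
move=> fi gi hi.
apply: (@eq_integrable _ _ _ lebesgue_measure _ _ (fun t => c%:E * (((f t)%:E + (g t)%:E) + (h t)%:E))%E) => //.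
by apply: integrableZl => //; apply: integrableD => //; apply: integrableD.
Qed.

(** * Two solutions along one path *)

Section pathwise.
Context {R : realType} {d : nat} (O : set 'rV[R]_d).
Hypotheses (d_gt0 : (0 < d)%N) (oO : open O) (bO : bounded_set O).
Local Notation ip := (ipH O).
Local Notation FH := (L2_form oO).
Local Notation FV := (H10_form oO bO).
Local Notation leb := (@lebesgue_measure R).
Local Notation normv v := (Num.sqrt (ipV O v v)).
Local Notation d0 := (@dim0 R d).
Local Notation vol := (vol O).
Variables (psi : R -> R) (a b s : R).
Hypothesis pg : psi_growth psi a b s.
Hypothesis s_dim : s * d0 <= 2.
Local Notation Ap := (Apair psi O).

Lemma normV_sqrB u v : (normV O (u - v)%R ^+ 2 <= 2%:E * normV O u ^+ 2 + 2%:E * normV O v ^+ 2)%E.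
Proof.
have ge0 z : (0 <= 2%:E * normV O z ^+ 2)%E by rewrite mule_ge0 ?expe_ge0 ?normV_ge0.
have infl (A B C : \bar R) : A = +oo%E -> (0 <= B)%E -> (C <= 2%:E * A ^+ 2 + B)%E.
  move=> -> B0; have -> : (+oo ^+ 2 = +oo :> \bar R)%E by rewrite /= mulyy.
  rewrite gt0_muley ?lte_fin//.
  by rewrite addye ?leey// gt_eqF// (lt_le_trans _ B0)// ltNyr.
have [Hu|nHu] := pselect (H10 O u); last exact: (infl _ _ _ (normV_out nHu) (ge0 v)).
have [Hv|nHv] := pselect (H10 O v); last first.
  by rewrite addeC; exact: (infl _ _ _ (normV_out nHv) (ge0 u)).
suff fin (A B C : \bar R) (p q r : R) : A = p%:E -> B = q%:E -> C = r%:E -> r <= 2 * p + 2 * q ->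
    (C <= 2%:E * A + 2%:E * B)%E.
  apply: (fin _ _ _ _ _ _ (normV_sqr oO bO Hu) (normV_sqr oO bO Hv) (normV_sqr oO bO (form_setB FV Hu Hv))).
  have := form_sqrD_le2 FV Hu (form_setN FV Hv).
  by rewrite -scaleN1r (form_sqrZ FV (-1) Hv) sqrrN expr1n mul1r.
by move=> -> -> -> h; rewrite -!EFinM -EFinD lee_fin.
Qed.

Variables (x y : R -> 'rV[R]_d -> R) (u0 v0 : 'rV[R]_d -> R).
Hypotheses (cx : curve O x) (cy : curve O y) (Hu0 : H10 O u0) (Hv0 : H10 O v0).
Hypothesis fx : forall T : R, (\int[leb]_(t in `[0%R, T]) (normV O (x t) ^+ 2) < +oo)%E.
Hypothesis fy : forall T : R, (\int[leb]_(t in `[0%R, T]) (normV O (y t) ^+ 2) < +oo)%E.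
Hypothesis eqn : forall t v, 0 <= t -> H10 O v -> ip (x t) v - ip (y t) v =
  ip u0 v - ip v0 v - (\int[leb]_(r in `[0, t]) Ap (x r) v - \int[leb]_(r in `[0, t]) Ap (y r) v).

Definition flux_diff (t : R) (v : 'rV[R]_d -> R) : R := Ap (x t) v - Ap (y t) v.
Local Notation w := (fun t : R => x t - y t).

Let cw : curve O w. Proof. exact: curveB. Qed.
Let Lx t : L2 O (x t). Proof. by case: cx. Qed.
Let Ly t : L2 O (y t). Proof. by case: cy. Qed.

Lemma flux_diff_lin t c u v : H10 O u -> H10 O v ->
  flux_diff t (c *: u + v) = c * flux_diff t u + flux_diff t v.
Proof.
move=> Hu Hv; have lin z : Ap z (c *: u + v) = c * Ap z u + Ap z v.
  have [Hz|nHz] := pselect (H10 O z); first exact: (Apair_linear oO bO pg).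
  by rewrite !Apair_out// mulr0 addr0.
rewrite /flux_diff (lin (x t)) (lin (y t)).
suff h (p q p' q' : R) : c * p + q - (c * p' + q') = c * (p - p') + (q - q') by exact: h.
by ring.
Qed.

Let bound_ex : exists2 K : R, 0 <= K & forall z : R -> _, forall t v, H10 O v ->
    `|Ap (z t) v| <= K * (1 + vnorm O z t) * normv v.
Proof.
have [K K0 KP] := Apair_bound oO bO pg; exists K => // z t v Hv.
have [Hz|nHz] := pselect (H10 O (z t)); first by rewrite (vnormE oO bO Hz); exact: KP.
rewrite Apair_out// normr0; apply: mulr_ge0; last exact: sqrtr_ge0.
by apply: mulr_ge0 => //; apply: addr_ge0 => //; exact: sqrtr_ge0.
Qed.
Let K : R := sval (cid2 bound_ex).
Let K_ge0 : 0 <= K. Proof. by rewrite /K; case: cid2. Qed.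
Let K_bound (z : R -> _) t v : H10 O v -> `|Ap (z t) v| <= K * (1 + vnorm O z t) * normv v.
Proof. by rewrite /K; case: cid2 => K' /= _ KP; exact: KP. Qed.

Let int_vnorm (z : R -> _) T : curve O z ->
  (\int[leb]_(t in `[0%R, T]) (normV O (z t) ^+ 2) < +oo)%E ->
  leb.-integrable `[0, T] (EFin \o (fun t => (1 + vnorm O z t ^+ 2))).
Proof.
move=> cz fz; have [iz _] := ae_goodtimes d_gt0 oO bO cz fz.
apply: (@eq_integrable _ _ _ leb _ _ (fun t => 1%:E + (vnorm O z t ^+ 2)%:E)%E) => //.
by apply: integrableD => //; exact: integrable_cst_itv.
Qed.

Let int_Ap (z : R -> _) T v : curve O z ->
  (\int[leb]_(t in `[0%R, T]) (normV O (z t) ^+ 2) < +oo)%E -> H10 O v ->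
  leb.-integrable `[0, T] (EFin \o (fun t => Ap (z t) v)).
Proof.
move=> cz fz Hv; have vv : vcurve O (fun=> v).
  split => // t; rewrite subrr (form0l FV) ?sqrtr0; last exact: form0 FV.
  exact: cvg_cst.
apply: (@integrable_le _ _ _ leb _ _ _ (fun t => (2 * K * normv v) * (1 + vnorm O z t ^+ 2))) => //.
- apply: measurable_funTS; exact: (measurable_Apair d_gt0 oO bO pg cz vv).
- move=> t _; apply: le_trans (K_bound z t Hv) _.
  rewrite mulrAC [2 * K]mulrC -!mulrA ler_wpM2l// mulrCA ler_wpM2l ?sqrtr_ge0//.
  have := sqr_ge0 (vnorm O z t - 1); have := sqr_ge0 (vnorm O z t).
  by move: (vnorm O z t) => p; rewrite sqrrB mulr1 expr1n => ? ?; lra.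
apply: (@eq_integrable _ _ _ leb _ _ (fun t => (2 * K * normv v)%:E * (1 + vnorm O z t ^+ 2)%:E)%E) => //.
by apply: integrableZl => //; exact: int_vnorm.
Qed.

Let fw T : (\int[leb]_(t in `[0%R, T]) (normV O (w t) ^+ 2) < +oo)%E.
Proof.
have mT z : curve O z -> measurable_fun (`[0%R, T]%classic : set R) (fun t => (normV O (z t) ^+ 2)%E).
  by move=> cz; apply: measurable_funTS; exact: measurable_normV.
have ge0 (z : R -> 'rV[R]_d -> R) t : (0 <= normV O (z t) ^+ 2)%E by rewrite expe_ge0// normV_ge0.
apply: (@le_lt_trans _ _ (\int[leb]_(t in `[0%R, T]) (2%:E * normV O (x t) ^+ 2 + 2%:E * normV O (y t) ^+ 2))%E).
  apply: ge0_le_integral => //.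
  - by move=> t _; exact: (ge0 w).
  - exact: (mT w cw).
  - by apply: emeasurable_funD; apply: measurable_funeM; exact: mT.
  - by move=> t _; exact: normV_sqrB.
rewrite ge0_integralD//.
- have fin z : curve O z -> (\int[leb]_(t in `[0%R, T]) (normV O (z t) ^+ 2) < +oo)%E ->
      (\int[leb]_(t in `[0%R, T]) (2%:E * normV O (z t) ^+ 2) < +oo)%E.
    move=> cz fz; rewrite ge0_integralZl//; last exact: mT.
    by rewrite lte_mul_pinfty.
  exact: (lte_add_pinfty (fin x cx (fx T)) (fin y cy (fy T))).
- by move=> t _; rewrite mule_ge0.
- by apply: measurable_funeM; exact: mT.
- by move=> t _; rewrite mule_ge0.
- by apply: measurable_funeM; exact: mT.
Qed.

(** Dominates the dual norm of [flux_diff t], the 2 adding up the two constants 1 of [K_bound]. The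
    last summand and the 1 in [K + 1] make it dominate the V-norm of the difference as well, as the
    energy identity requires. *)
Let k t : R := (K + 1) * (2 + vnorm O x t + vnorm O y t + vnorm O w t).

Let vnorm_ge0 (z : R -> 'rV[R]_d -> R) t : 0 <= vnorm O z t. Proof. exact: sqrtr_ge0. Qed.

Let k_ge0 t : 0 <= k t.
Proof. by rewrite mulr_ge0 ?addr_ge0. Qed.

Let k_meas : measurable_fun setT k.
Proof.
have m z : curve O z -> measurable_fun setT (vnorm O z) by exact: measurable_vnorm.
apply: measurable_funM; first exact: measurable_cst.
apply: measurable_funD; last exact: m.
apply: measurable_funD; last exact: m.
by apply: measurable_funD; [exact: measurable_cst|exact: m].
Qed.

Let k_sqr T : leb.-integrable `[0, T] (EFin \o (fun t => k t ^+ 2)).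
Proof.
have ix := int_vnorm cx (fx T); have iy := int_vnorm cy (fy T); have iw := int_vnorm cw (fw T).
apply: (@integrable_le _ _ _ leb _ _ _ (fun t => (8 * (K + 1) ^+ 2) *
  ((1 + vnorm O x t ^+ 2) + (1 + vnorm O y t ^+ 2) + (1 + vnorm O w t ^+ 2)))) => //.
- by apply: measurable_funX; exact: measurable_funTS.
- move=> t _; rewrite ger0_norm ?sqr_ge0// /k.
  move: (vnorm O x t) (vnorm O y t) (vnorm O w t) => p q r.
  suff h : (2 + p + q + r) ^+ 2 <= 8 * ((1 + p ^+ 2) + (1 + q ^+ 2) + (1 + r ^+ 2)).
    have := ler_wpM2l (sqr_ge0 (K + 1)) h; move: (K + 1) => c {}h.
    by rewrite exprMn [8 * c ^+ 2]mulrC -[c ^+ 2 * 8 * _]mulrA.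
  have := sqr_ge0 (p - q); have := sqr_ge0 (p - r); have := sqr_ge0 (q - r).
  have := sqr_ge0 (p - 2); have := sqr_ge0 (q - 2); have := sqr_ge0 (r - 2).
  by move=> ? ? ? ? ? ?; nra.
exact: (integrable_itv_lin3 _ ix iy iw).
Qed.

Let D_bound t v : H10 O v -> `|flux_diff t v| <= k t * normv v.
Proof.
move=> Hv; apply: le_trans (ler_normB _ _) _.
apply: le_trans (lerD (K_bound x t Hv) (K_bound y t Hv)) _.
rewrite -mulrDl; apply: ler_wpM2r; first exact: sqrtr_ge0.
rewrite -mulrDr /k; have := vnorm_ge0 x t; have := vnorm_ge0 y t; have := vnorm_ge0 w t.
move: (vnorm O x t) (vnorm O y t) (vnorm O w t) => p q r r0 q0 p0.
by apply: ler_pM; rewrite ?addr_ge0//; lra.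
Qed.

Let D_meas f : vcurve O f -> measurable_fun setT (fun t => flux_diff t (f t)).
Proof.
move=> vf; apply: measurable_funB; first exact: (measurable_Apair d_gt0 oO bO pg cx vf).
exact: (measurable_Apair d_gt0 oO bO pg cy vf).
Qed.

Let Hw0 : H10 O (u0 - v0). Proof. exact: (form_setB FV). Qed.

Let eqn_w t v : 0 <= t -> H10 O v ->
  ip (w t) v = ip (u0 - v0) v - \int[leb]_(r in `[0, t]) flux_diff r v.
Proof.
move=> t0 Hv; have Lv := H10_L2 Hv.
rewrite (formBl FH (Lx t) (Ly t) Lv) (formBl FH (H10_L2 Hu0) (H10_L2 Hv0) Lv) (eqn t0 Hv).
congr (_ - _); rewrite RintegralB//; first exact: (int_Ap cx (fx t) Hv).
exact: (int_Ap cy (fy t) Hv).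
Qed.

Let w_good T : leb.-negligible (`[0, T]%classic `\` goodtimes O w).
Proof. by have [] := ae_goodtimes d_gt0 oO bO cw (fw T). Qed.

Let w_k t : H10 O (w t) -> normv (w t) <= k t.
Proof.
move=> Hw; rewrite -(@vnormE _ _ O oO bO w t Hw) /k.
have := vnorm_ge0 x t; have := vnorm_ge0 y t; have := vnorm_ge0 w t; have := K_ge0.
move: (vnorm O x t) (vnorm O y t) (vnorm O w t) K => p q r c c0 r0 q0 p0.
have := mulr_ge0 c0 p0; have := mulr_ge0 c0 q0; have := mulr_ge0 c0 r0.
by move=> ? ? ?; rewrite mulrDl mul1r !mulrDr; lra.
Qed.

Definition bothgood : set R := goodtimes O x `&` goodtimes O y.
(** Agrees almost everywhere with the dissipation of the abstract equation. Restricting to times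
    when both solutions are in V lets nonnegativity and coercivity be read off the inequalities
    between elements of V. *)
Definition damping (t : R) : R := \1_bothgood t * flux_diff t (w t).

Let dampingE t : damping t = \1_bothgood t * dissipation O w flux_diff t.
Proof.
rewrite /damping /dissipation; have [[Hx Hy]|nH] := pselect (bothgood t).
  rewrite [in RHS](_ : \1_(goodtimes O w) t = 1) ?mul1r// indicE mem_set//.
  exact: (form_setB FV).
by rewrite indicE memNset// !mul0r.
Qed.

Let m_both : measurable bothgood.
Proof. by apply: measurableI; exact: measurable_goodtimes. Qed.

Let ngood T : leb.-negligible (`[0, T]%classic `\` bothgood).
Proof.
have [_ nx] := ae_goodtimes d_gt0 oO bO cx (fx T).
have [_ ny] := ae_goodtimes d_gt0 oO bO cy (fy T).
apply: negligibleS (negligibleU nx ny) => t [tT nb].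
have [Hx|nHx] := pselect (H10 O (x t)); last by left.
by right; split => // Hy; apply: nb.
Qed.

Let m_damping : measurable_fun setT damping.
Proof.
rewrite (_ : damping = fun t => \1_bothgood t * dissipation O w flux_diff t).
  apply: measurable_funM; first exact: measurable_indic.
  exact: (measurable_dissipation d_gt0 oO bO cw flux_diff_lin D_bound D_meas).
by apply/funext => t; exact: dampingE.
Qed.

Let ae_damping T : {ae leb, forall t, `[0, T]%classic t -> dissipation O w flux_diff t = damping t}.
Proof.
apply: negligibleS (ngood T) => t /= nt.
have tT : `[0, T]%classic t by apply: contrapT => h; apply: nt => /h.
split => // bt; apply: nt => _; rewrite dampingE indicE mem_set// mul1r.
by [].
Qed.


Lemma damping_ge0 t : 0 <= damping t.
Proof.
rewrite /damping; have [[Hx Hy]|nH] := pselect (bothgood t); last first.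
  by rewrite indicE memNset// mul0r.
rewrite indicE mem_set// mul1r; exact: (Apair_sub_ge0 oO bO pg Hx Hy).
Qed.

Let i_diss T : leb.-integrable `[0, T] (EFin \o dissipation O w flux_diff).
Proof. exact: (integrable_dissipation d_gt0 oO bO cw flux_diff_lin D_bound D_meas k_ge0 k_sqr w_k). Qed.

Let i_damping T : leb.-integrable `[0, T] (EFin \o damping).
Proof.
have mI : measurable_fun (`[0, T]%classic : set R) damping by exact: measurable_funTS.
apply: (@integrable_le _ _ _ leb _ _ _ (fun t => `|dissipation O w flux_diff t|)) => //.
- move=> t _; rewrite dampingE normrM ler_piMl// indicE; by case: (_ \in _); rewrite ?normr1 ?normr0.
by have := integrable_abse (i_diss T).
Qed.

Lemma energy_damping t : 0 <= t ->
  ip (w t) (w t) = ip (u0 - v0) (u0 - v0) - 2 * \int[leb]_(r in `[0, t]) damping r.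
Proof.
move=> t0.
rewrite (energy_identity d_gt0 oO bO cw Hw0 flux_diff_lin D_bound D_meas k_ge0 k_meas k_sqr eqn_w w_good w_k t0).
congr (_ - 2 * _); congr fine; apply: ae_eq_integral => //.
- by case/integrableP : (i_diss t).
- by case/integrableP : (i_damping t).
by apply: negligibleS (ae_damping t) => r /= nr h; apply: nr => rt; rewrite h.
Qed.

Definition weight_norm (alpha : R) (t : R) : \bar R :=
  (((a * vol) `^ (alpha * d0))%:E
   + (b `^ (alpha * d0))%:E * normV O (x t) `^ (alpha * d0 * s)
   + (b `^ (alpha * d0))%:E * normV O (y t) `^ (alpha * d0 * s))%E.

Lemma weight_norm_ge0 alpha t : (0 <= weight_norm alpha t)%E.
Proof.
by rewrite /weight_norm !adde_ge0 ?mule_ge0 ?lee_fin ?powR_ge0 ?poweR_ge0.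
Qed.

Lemma measurable_weight_norm alpha : measurable_fun setT (weight_norm alpha).
Proof.
have m z : curve O z -> measurable_fun setT
    (fun t => ((b `^ (alpha * d0))%:E * normV O (z t) `^ (alpha * d0 * s))%E).
  move=> cz; apply: measurable_funeM.
  apply: (eq_measurable_fun (fun t => ((normV O (z t) ^+ 2) `^ 2^-1) `^ (alpha * d0 * s))%E).
    move=> t _; congr (_ `^ _)%E.
    have [Hz|nHz] := pselect (H10 O (z t)); last first.
      have -> : (normV O (z t) ^+ 2 = +oo)%E by rewrite normV_out// /= mulyy.
      by rewrite normV_out// poweRyr// invr_eq0 pnatr_eq0.
    by rewrite (normV_sqr oO bO Hz) (normV_H10 oO Hz) poweR_EFin powR12_sqrt// (form_ge0 FV).
  apply: (measurableT_comp (@measurable_poweR R _)).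
  apply: (measurableT_comp (@measurable_poweR R _)).
  exact: measurable_normV.
by apply: emeasurable_funD; [apply: emeasurable_funD; [exact: measurable_cst|exact: m]|exact: m].
Qed.

Variables (alpha l : R) (n : nat).
Hypotheses (al : 0 < alpha <= 1) (l1 : 1 <= l) (ln : l <= n%:R) (vol0 : 0 < vol).

Let al0 : 0 < alpha. Proof. by case/andP : al. Qed.

Lemma rate_cst_gt0 : 0 < rate_cst O alpha.
Proof.
rewrite mulr_gt0// ?mulr_gt0 ?powR_gt0 ?mulr_gt0//.
  by rewrite ltr_wpDr// ltW.
by rewrite ltr_wpDl ?powR_ge0// lt_max ltr01.
Qed.

Let G (M : R) : R := (rate_cst O alpha * M) `^ (alpha * d0)^-1.

Let ad0 : 0 < alpha * d0. Proof. by rewrite mulr_gt0// dim0_gt0. Qed.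

Let G_gt0 M : 0 < M -> 0 < G M.
Proof. by move=> M0; rewrite powR_gt0// mulr_gt0// rate_cst_gt0. Qed.

Let coercive_good M t : 0 < M -> bothgood t -> (weight_norm alpha t <= M%:E)%E ->
  ip (w t) (w t) <= G M * damping t.
Proof.
move=> M0 [Hx Hy]; rewrite /weight_norm (normV_H10 oO Hx) (normV_H10 oO Hy).
have fin (A1 A2 B2 p q e N : R) : (A1%:E + A2%:E * p%:E `^ e + B2%:E * q%:E `^ e <= N%:E)%E ->
    A1 + A2 * p `^ e + B2 * q `^ e <= N by [].
move=> /fin WM {fin}.
apply: le_trans (Apair_coercive d_gt0 oO bO pg s_dim Hx Hy) _.
rewrite /damping indicE mem_set// mul1r.
apply: ler_wpM2r; first exact: (Apair_sub_ge0 oO bO pg Hx Hy).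
have := rate_le oO bO pg s_dim Hx Hy al vol0.
set r := 16 * (4 + vol) * _ => rle.
have r0 : 0 <= r.
  by rewrite /r !mulr_ge0 ?powR_ge0// addr_ge0// ltW.
have rG : r `^ (alpha * d0) <= rate_cst O alpha * M.
  by apply: le_trans rle _; rewrite ler_wpM2l// ltW// rate_cst_gt0.
rewrite -[r](@powRr1 R)// -(divff (lt0r_neq0 ad0)) powRrM /G.
by apply: ge0_ler_powR; rewrite ?nnegrE ?invr_ge0 ?powR_ge0 ?(ltW ad0)// mulr_ge0 ?(ltW M0)// ltW// rate_cst_gt0.
Qed.

Let coercive_ae M T : 0 < M ->
  {ae leb, forall t, 0 <= t <= T -> (weight_norm alpha t <= M%:E)%E -> ip (w t) (w t) <= G M * damping t}.
Proof.
move=> M0; apply: negligibleS (ngood T) => t /= nt.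
have tT : `[0, T]%classic t.
  by rewrite /= in_itv/=; apply: contrapT => h; apply: nt => /h.
split => // bt; apply: nt => _; exact: coercive_good.
Qed.

(** For M = 2 n m, the factor (G M n / t)^l of [decay_power] raised to the power alpha is (rate 2 n
    m)^(l / d0) n^(alpha l) t^(- alpha l); this is its part free of t and m. *)
Definition decay_cst : R := (rate_cst O alpha * (2 * n%:R)) `^ (l / d0) * n%:R `^ (alpha * l).

Lemma path_decay t m : 0 < t -> 0 < m ->
  (\int[leb]_(r in `[0%R, t]) weight_norm alpha r <= (t * m)%:E)%E ->
  normH O (w t) `^ (2 * alpha) <= t `^ (- (alpha * l)) * decay_cst * m `^ (l / d0) *
    normH O (u0 - v0) `^ (2 * alpha).
Proof.
move=> t0 m0 Zm; have l0 : 0 <= l by exact: le_trans l1.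
have n0 : (0 < n)%N by rewrite -(ltr_nat R); apply: lt_le_trans ln; exact: lt_le_trans l1.
have nR : 0 < n%:R :> R by rewrite ltr0n.
have M0 : 0 < 2 * n%:R * m by rewrite !mulr_gt0.
have E0 : 0 <= ip (u0 - v0) (u0 - v0) by apply: (form_ge0 FH); exact: H10_L2.
have Lw t' : L2 O (w t') by case: cw.
have e_ge0 t' : 0 <= t' -> 0 <= ip (w t') (w t') by move=> _; exact: (form_ge0 FH).
have Zm' : (\int[leb]_(r in `[0%R, t]) weight_norm alpha r <= ((2 * n%:R * m) * (t / n%:R / 2))%:E)%E.
  by apply: le_trans Zm _; rewrite lee_fin; apply: eqW; field; rewrite gt_eqF.
have := decay_power e_ge0 damping_ge0 i_damping energy_damping (measurable_weight_norm alpha)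
  (weight_norm_ge0 alpha) G_gt0 coercive_ae t0 M0 n0 l0 ln Zm'.
rewrite [ip (w 0) (w 0)](energy_damping (lexx 0)) set_itv1 Rintegral_set1 mulr0 subr0 => dec.
rewrite !sqrt_powR2//; last exact: e_ge0 (ltW t0).
have {}dec := ge0_ler_powR (ltW al0) _ _ dec.
apply: le_trans (dec _ _) _.
- by rewrite nnegrE e_ge0// ltW.
- by rewrite nnegrE mulr_ge0 ?powR_ge0.
have C0 := ltW rate_cst_gt0.
rewrite powRM ?powR_ge0// mulrC ler_wpM2r ?powR_ge0//.
rewrite -powRrM powRM ?(ltW (G_gt0 M0))//; last by rewrite divr_ge0 ?ltW.
rewrite /G -powRrM /decay_cst.
have -> : (alpha * d0)^-1 * (l * alpha) = l / d0.
  by field; rewrite gt_eqF ?gt_eqF// dim0_gt0.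
rewrite [rate_cst _ _ * _]mulrA powRM ?(ltW m0)//; last by rewrite mulr_ge0// mulr_ge0// (ltW nR).
rewrite [(n%:R / t) `^ _]powRM ?invr_ge0 ?(ltW nR) ?(ltW t0)//.
have -> : t^-1 `^ (l * alpha) = t `^ (- (alpha * l)).
  by rewrite -powR_inv1 ?(ltW t0)// -powRrM mulN1r mulrC.
by rewrite [l * alpha]mulrC; apply: eqW; ring.
Qed.

End pathwise.

Lemma ler_cst_powR_le0 {R : realType} (x K q : R) : 0 <= K -> 0 < q ->
  (forall m : R, 0 < m -> x <= K * m `^ q) -> x <= 0.
Proof.
move=> K0 q0 h; apply/ler_addgt0Pr => e e0; rewrite add0r.
have K1 : 0 < K + 1 by rewrite ltr_wpDl.
have m0 : 0 < (e / (K + 1)) `^ q^-1 by rewrite powR_gt0// divr_gt0.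
apply: le_trans (h _ m0) _; rewrite -powRrM mulVf ?gt_eqF// powRr1 ?(ltW (divr_gt0 e0 K1))//.
by rewrite mulrA ler_pdivrMr// mulrC ler_wpM2l ?(ltW e0)// lerDl.
Qed.

Section decay.
Context {R : realType} {d : nat} (O : set 'rV[R]_d).
Hypotheses (d_gt0 : (0 < d)%N) (oO : open O) (bO : bounded_set O).
Local Notation ip := (ipH O).
Local Notation leb := (@lebesgue_measure R).
Local Notation d0 := (@dim0 R d).

Lemma normH_vol0 f : vol O = 0 -> L2 O f -> normH O f = 0.
Proof.
move=> v0 Lf; rewrite /normH /ipH /Rintegral null_set_integral ?sqrtr0//.
- exact: open_rV_measurable.
- by apply/measurable_EFinP; apply: measurable_funM; case: Lf.
have fO : (lebesgue_rV d O \is a fin_num).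
  by rewrite ge0_fin_numE// bounded_rV_fin_measure//; exact: open_rV_measurable.
by apply: etrans (esym (fineK fO)) _; congr EFin.
Qed.

(** The number of subintervals is the least integer above l; the maximum with 1 serves the case
    alpha = 0. *)
Definition bound_cst (alpha l : R) : R := Num.max 1 (decay_cst O alpha l (Num.truncn l).+1).

Variables (psi : R -> R) (a b s : R).
Hypothesis pg : psi_growth psi a b s.
Hypothesis s_dim : s * d0 <= 2.
Local Notation Ap := (Apair psi O).

Variables (x y : R -> 'rV[R]_d -> R) (u0 v0 : 'rV[R]_d -> R).
Hypotheses (cx : curve O x) (cy : curve O y) (Hu0 : H10 O u0) (Hv0 : H10 O v0).
Hypothesis fx : forall T : R, (\int[leb]_(t in `[0%R, T]) (normV O (x t) ^+ 2) < +oo)%E.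
Hypothesis fy : forall T : R, (\int[leb]_(t in `[0%R, T]) (normV O (y t) ^+ 2) < +oo)%E.
Hypothesis eqn : forall t v, 0 <= t -> H10 O v -> ip (x t) v - ip (y t) v =
  ip u0 v - ip v0 v - (\int[leb]_(r in `[0, t]) Ap (x r) v - \int[leb]_(r in `[0, t]) Ap (y r) v).
Variables (alpha l : R).
Hypotheses (al : 0 <= alpha <= 1) (l1 : 1 <= l).

Local Notation cst := (bound_cst alpha l).
Local Notation W := (weight_norm O a b s x y alpha).

Let cst1 : 1 <= cst. Proof. by rewrite le_max lexx. Qed.

Let normH_le t : 0 <= t -> normH O (x t - y t) <= normH O (u0 - v0).
Proof.
move=> t0; rewrite ler_sqrt; last first.
  by apply: (form_ge0 (L2_form oO)); apply: (form_setB (L2_form oO)); exact: H10_L2.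
rewrite (energy_damping d_gt0 oO bO pg cx cy Hu0 Hv0 fx fy eqn t0) lerBlDr lerDl mulr_ge0//.
by apply: Rintegral_ge0 => r _; exact: (damping_ge0 oO bO pg).
Qed.

(** [path_decay] with m the time average of the weight. Exponent 0, null domain, equal data, and
    infinite or zero average are set apart, since powers and extended products take conventional
    values there. *)
Theorem decay_bound t : 0 < t ->
  ((normH O (x t - y t) `^ (2 * alpha))%:E <=
   (t `^ (- (alpha * l)))%:E * cst%:E *
   ((t^-1)%:E * \int[leb]_(r in `[0%R, t]) W r) `^ (l / d0) *
   (normH O (u0 - v0) `^ (2 * alpha))%:E)%E.
Proof.
move=> t0; have q0 : 0 < l / d0 by rewrite divr_gt0 ?dim0_gt0// (lt_le_trans _ l1).
have T0 : 0 <= t `^ (- (alpha * l)) * cst by rewrite mulr_ge0 ?powR_ge0// (le_trans _ cst1).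
have rhs0 : (0 <= (t `^ (- (alpha * l)))%:E * cst%:E *
   ((t^-1)%:E * \int[leb]_(r in `[0%R, t]) W r) `^ (l / d0) *
   (normH O (u0 - v0) `^ (2 * alpha))%:E)%E.
  by rewrite !mule_ge0 ?poweR_ge0 ?lee_fin ?powR_ge0// (le_trans _ cst1).
(* All powers have exponent 0 and equal 1, even at [+oo]. The weight is then 3 and the left side 1,
   so a constant at least 1 suffices. *)
have [a0|a0] := eqVneq alpha 0.
  rewrite a0 mulr0 !powRr0 !mul0r oppr0 powRr0 mul1e mule1.
  have -> : (\int[leb]_(r in `[0%R, t]) weight_norm O a b s x y 0 r = (3 * t)%:E)%E.
    rewrite (eq_integral (fun=> 3%:E))%E.
      by rewrite integral_cst//= lebesgue_measure_itv/= lte_fin t0 oppr0 adde0.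
    have h3 (A B : \bar R) (p q r e : R) : (((p `^ (0 * q))%:E + (r `^ (0 * q))%:E * A `^ (0 * q * e)
        + (r `^ (0 * q))%:E * B `^ (0 * q * e))%E = 3%:E).
      by rewrite !mul0r !powRr0 !poweRe0 !mule1 -!EFinD; congr EFin; ring.
    by move=> r _; exact: h3.
  have -> : ((t^-1)%:E * (3 * t)%:E = 3%:E :> \bar R)%E by rewrite -EFinM mulrC mulfK// gt_eqF.
  rewrite (_ : 3%:E `^ _ = (3 `^ (l / d0))%:E)%E// -EFinM lee_fin.
  have c1 : 1 <= bound_cst 0 l by rewrite le_max lexx.
  have p1 : 1 <= 3 `^ (l / d0) :> R.
    by have := @ler_powR R 3; rewrite ler1n => /(_ isT _ _ (ltW q0)); rewrite powRr0.
  by have := ler_pM ler01 ler01 c1 p1; rewrite mulr1.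
have {}a0 : 0 < alpha by rewrite lt_def a0; case/andP: al.
have ba0 : 2 * alpha != 0 by rewrite gt_eqF// mulr_gt0.
have zero (p : R) (A : \bar R) : p = 0 -> (0 <= A)%E -> ((p `^ (2 * alpha))%:E <= A)%E.
  by move=> -> A0; rewrite powR0.
have [v00|vn0] := eqVneq (vol O) 0.
  apply: (zero _ _ _ rhs0); apply: (normH_vol0 v00).
  by apply: (form_setB (L2_form oO)); [case: cx|case: cy].
have vol0 : 0 < vol O by rewrite lt_def vn0 vol_ge0.
(* The right side is 0 even for an infinite integral, as [+oo * 0 = 0]; equality of the solutions
   comes from the decrease of the norm. *)
have [w00|w0n] := eqVneq (normH O (u0 - v0)) 0.
  apply: (zero _ _ _ rhs0); apply/eqP; rewrite eq_le sqrtr_ge0 andbT -w00.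
  exact: normH_le (ltW t0).
have N0 : 0 < normH O (u0 - v0) `^ (2 * alpha) by rewrite powR_gt0// lt_def w0n sqrtr_ge0.
have W0 r : (0 <= W r)%E by exact: weight_norm_ge0.
have I0 : (0 <= \int[leb]_(r in `[0%R, t]) W r)%E by exact: integral_ge0.
have T1 : 0 < t `^ (- (alpha * l)) * cst.
  by rewrite mulr_gt0 ?powR_gt0// (lt_le_trans _ cst1).
have al' : 0 < alpha <= 1 by rewrite a0; case/andP: al.
have ln : l <= (Num.truncn l).+1%:R by rewrite ltW// truncnS_gt.
have step m : 0 < m -> (\int[leb]_(r in `[0%R, t]) W r <= (t * m)%:E)%E ->
  normH O (x t - y t) `^ (2 * alpha) <=
    t `^ (- (alpha * l)) * cst * m `^ (l / d0) * normH O (u0 - v0) `^ (2 * alpha).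
  move=> m0 Im; apply: le_trans (path_decay d_gt0 oO bO pg s_dim cx cy Hu0 Hv0 fx fy eqn al' l1 ln vol0 t0 m0 Im) _.
  rewrite ler_wpM2r ?(ltW N0)// ler_wpM2r ?powR_ge0// ler_wpM2l ?powR_ge0//.
  by rewrite le_max lexx orbT.
move: step I0; case: (\int[leb]_(r in _) W r)%E => [I step I0|step _|//]; last first.
  rewrite gt0_muley ?lte_fin ?invr_gt0// poweRyr ?gt_eqF//.
  by rewrite -EFinM gt0_muley ?lte_fin// gt0_mulye ?lte_fin// leey.
(* [path_decay] asks for a positive bound on the average; if the average is 0, every positive m is
   allowed and m is sent to 0. *)
rewrite lee_fin in I0; have [I00|In0] := eqVneq I 0.
  have -> : normH O (x t - y t) `^ (2 * alpha) = 0.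
    apply/eqP; rewrite eq_le powR_ge0 andbT.
    apply: (ler_cst_powR_le0 (mulr_ge0 T0 (ltW N0)) q0) => m m0.
    by rewrite mulrAC; apply: step => //; rewrite I00 lee_fin mulr_ge0 ?ltW.
  by rewrite !mule_ge0 ?poweR_ge0 ?lee_fin ?powR_ge0// (le_trans _ cst1).
rewrite -!EFinM lee_fin; apply: step.
  by rewrite mulr_gt0 ?invr_gt0// lt_def In0.
by rewrite mulrA divff ?mul1r// gt_eqF.
Qed.

End decay.

(** * Almost sure properties of solutions *)

(* No measurability: the integral of a nonnegative function is a supremum over simple minorants. *)
Lemma ge0_le_integralT {dT : measure_display} {T : measurableType dT} {R : realType}
    (mu : {measure set T -> \bar R}) (f g : T -> \bar R) :
  (forall x, 0 <= f x)%E -> (forall x, f x <= g x)%E -> (\int[mu]_x f x <= \int[mu]_x g x)%E.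
Proof.
move=> f0 fg; have g0 x : (0 <= g x)%E by apply: le_trans (f0 x) (fg x).
rewrite !ge0_integralTE//; apply: ge_ereal_sup => _ [h hf <-]; apply: ereal_sup_ubound.
by exists h => // x; apply: le_trans (hf x) (fg x).
Qed.

Section grid.
Context {R : realType}.
Implicit Types t : R.

(** Rounds down to a multiple of [m.+1%:R^-1]; negative times go to 0, where [truncn] vanishes, in
    agreement with the extension by [Num.max 0]. *)
Definition grid (m : nat) t : R := (Num.truncn (t * m.+1%:R))%:R / m.+1%:R.

Lemma grid_ge0 m t : 0 <= grid m t. Proof. by rewrite divr_ge0. Qed.

Lemma grid_close m t : `|Num.max 0 t - grid m t| <= m.+1%:R^-1.
Proof.
have m0 : 0 < m.+1%:R :> R by [].
have [t0|t0] := ltP t 0.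
  have : (Num.truncn (t * m.+1%:R) <= 0)%N.
    by rewrite truncn_le_nat (@le_lt_trans _ _ 0)// mulr_le0_ge0// ltW.
  by rewrite leqn0 /grid => /eqP ->; rewrite mul0r subr0 normr0 invr_ge0.
have s0 : 0 <= t * m.+1%:R by rewrite mulr_ge0.
rewrite /grid -[t in t - _](mulfK (lt0r_neq0 m0)) -mulrBl normrM [X in _ * X]ger0_norm ?invr_ge0//.
rewrite -[X in _ <= X]mul1r ler_wpM2r ?invr_ge0// ger0_norm ?subr_ge0 ?truncn_le//.
by rewrite lerBlDr addrC natr1 ltW// truncnS_gt.
Qed.

Lemma grid_cvg t : grid m t @[m --> \oo] --> Num.max 0 t.
Proof.
apply/cvgrPdist_le => e e0; have /cvgrPdist_le/(_ _ e0) := @cvg_harmonic R.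
apply: filterS => m; rewrite sub0r normrN /harmonic ger0_norm ?invr_ge0//.
exact: le_trans (grid_close m t).
Qed.

(** Measurability in omega and continuity in time give joint measurability: with time rounded to the
    grid, preimages are countable unions of measurable rectangles, and the grid is refined. *)
Lemma measurable_caratheodory {dT : measure_display} {T : measurableType dT} (f : R -> T -> R) :
  (forall t, 0 <= t -> measurable_fun setT (f t)) ->
  (forall t w, f (grid m t) w @[m --> \oo] --> f (Num.max 0 t) w) ->
  measurable_fun setT (fun p : measurableTypeR R * T => f (Num.max 0 (p.1 : R)) p.2).
Proof.
move=> mf cf; apply: (measurable_fun_cvg (h := fun m p => f (grid m p.1) p.2)); last first.
  by move=> p _; exact: cf.
move=> m _ Y mY; rewrite setTI.
have mle n : measurable [set t : measurableTypeR R | (Num.truncn ((t : R) * m.+1%:R) <= n)%N].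
  rewrite (_ : [set _ | _] = `]-oo, n.+1%:R / m.+1%:R[%classic)//.
  by apply/seteqP; split => t /=; rewrite in_itv/= truncn_le_nat ltr_pdivlMr.
have meq n : measurable [set t : measurableTypeR R | Num.truncn ((t : R) * m.+1%:R) = n].
  case: n => [|n].
    rewrite (_ : [set _ | _] = [set t : measurableTypeR R | (Num.truncn ((t : R) * m.+1%:R) <= 0)%N])//.
    by apply/seteqP; split => t /=; [move=> ->|rewrite leqn0 => /eqP].
  rewrite (_ : [set _ | _] = [set t : measurableTypeR R | (Num.truncn ((t : R) * m.+1%:R) <= n.+1)%N] `\`
     [set t : measurableTypeR R | (Num.truncn ((t : R) * m.+1%:R) <= n)%N]); first exact: measurableD.
  apply/seteqP; split => t /= => [->|[le1 /negP]]; first by split => //; rewrite ltnn.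
  by rewrite -ltnNge => le2; apply/eqP; rewrite eqn_leq le1.
rewrite (_ : _ @^-1` Y = \bigcup_n ([set t : measurableTypeR R | Num.truncn ((t : R) * m.+1%:R) = n]
    `*` (f (n%:R / m.+1%:R) @^-1` Y))).
  apply: bigcup_measurable => n _; apply: measurableX; first exact: meq.
  by rewrite -[X in measurable X]setTI; apply: mf => //; rewrite divr_ge0.
apply/seteqP; split => -[t w] /=.
  by move=> Ytw; exists (Num.truncn (t * m.+1%:R)).
by move=> [n _ [/= tn]]; rewrite /grid tn.
Qed.

End grid.

Section processes.
Context {R : realType} {d : nat} (O : set 'rV[R]_d).
Hypotheses (d_gt0 : (0 < d)%N) (oO : open O) (bO : bounded_set O).
Local Notation leb := (@lebesgue_measure R).
Context {dO : measure_display} {Om : measurableType dO} (P : probability Om R)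
  (F : R -> set (set Om)).
Hypothesis uf : usual_filtration P F.
Implicit Types X Y : R -> Om -> 'rV[R]_d -> R.

Lemma filtration_measurable t A : 0 <= t -> F t A -> measurable A.
Proof. by move=> t0; case: uf => + _ _ _ => /(_ t t0)[_]; exact. Qed.

(** The usual conditions put all negligible sets into the sigma-algebra at time 0, so an almost sure
    property defines an event. *)
Lemma ae_measurable (Q : Om -> Prop) : {ae P, forall w, Q w} -> measurable [set w | Q w].
Proof.
move=> nQ; rewrite -[X in measurable X]setCK; apply: measurableC.
by case: uf => _ _ _ N0; apply: (@filtration_measurable 0) => //; exact: N0.
Qed.

Lemma adapted_measurable X (Phi : ('rV[R]_d -> R) -> R) t : adaptedH F O X -> H_continuous O Phi ->
  0 <= t -> measurable_fun setT (fun w => Phi (X t w)).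
Proof.
move=> aX cPhi t0; apply: (measurability _ (RGenOInfty.measurableE R)).
move=> _ [_ [c ->] <-]; rewrite setTI.
rewrite (_ : _ @^-1` _ = [set w | [set f | c < Phi f] (X t w)]); last first.
  by apply/seteqP; split => w /=; rewrite in_itv/= andbT.
by apply: (filtration_measurable t0); apply: (aX t t0) => f Lf cf; exact: (H_continuous_openH cPhi Lf cf).
Qed.

Definition H_path (z : R -> 'rV[R]_d -> R) : Prop := (forall t, 0 <= t -> L2 O (z t)) /\
  forall t : R, 0 <= t -> normH O (z t' \- z t) @[t' --> within `[0, +oo[ (nbhs t)] --> 0.

Lemma H_path_curve z : H_path z -> curve O (fun t => z (Num.max 0 t)).
Proof.
have max0 (t : R) : 0 <= Num.max 0 t by rewrite le_max lexx.
move=> [Lz cz]; split => t; first exact: Lz.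
have c0 := cz _ (max0 t).
apply: (@cvg_comp _ _ _ (fun t' : R => Num.max 0 t') (fun t' => normH O (z t' \- z (Num.max 0 t))) _
  (within `[0, +oo[ (nbhs (Num.max 0 t))) _ _ c0).
move=> A /=; rewrite /within /=.
have cm : Num.max 0 t' @[t' --> t] --> Num.max 0 t.
  by apply: (@continuous_max _ _ (fun=> 0) id) => //; exact: cst_continuous.
move=> /cm h; apply: (@filterS _ (nbhs t) _ _ _ _ h) => t' /=; apply.
by rewrite in_itv/= max0.
Qed.

Lemma H_path_grid z (Phi : ('rV[R]_d -> R) -> R) t : H_path z -> H_continuous O Phi ->
  Phi (z (grid m t)) @[m --> \oo] --> Phi (z (Num.max 0 t)).
Proof.
move=> /H_path_curve cz cPhi; have c1 := curve_continuous oO cz cPhi (x := t).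
have c2 := @cvg_comp _ _ _ (fun m => grid m t) (fun r => Phi (z (Num.max 0 r))) _ _ _ (@grid_cvg R t)
  (curve_continuous oO cz cPhi (x := Num.max 0 t)).
have mm (r : R) : 0 <= r -> Num.max 0 r = r by move=> r0; exact/max_idPr.
move: c2; rewrite mm ?le_max ?lexx//.
rewrite (_ : _ \o _ = fun m => Phi (z (grid m t)))//.
by apply/funext => m /=; rewrite mm// grid_ge0.
Qed.

(** The integrand of the expectation is not known to be measurable. Suprema of regularised energies
    give a jointly measurable substitute [h]; by Tonelli its time integral is measurable in omega.
    On [Good] it is the integral wanted, elsewhere it is 0, so its expectation is finite and it is
    finite almost surely. *)
Lemma ae_finite_energy X T : (forall (t : R) w, 0 <= t -> L2 O (X t w)) -> adaptedH F O X ->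
  continuousH P O X ->
  (\int[P]_w \int[leb]_(t in `[0%R, T]) (normV O (X t w) ^+ 2) < +oo)%E ->
  {ae P, forall w, (\int[leb]_(t in `[0%R, T]) (normV O (X t w) ^+ 2) < +oo)%E}.
Proof.
move=> LX aX cX fin.
pose Good := [set w | forall t : R, 0 <= t ->
  normH O (X t' w \- X t w) @[t' --> within `[0, +oo[ (nbhs t)] --> 0].
have mG : measurable Good by exact: ae_measurable cX.
(* The indicator removes the omega with discontinuous paths, so that continuity in time holds for
   every omega. *)
pose g n t w : R := \1_Good w * reg_energy O n (X t w).
have g0 n t w : 0 <= t -> 0 <= g n t w.
  by move=> t0; rewrite mulr_ge0// (reg_energy_ge0 d_gt0 oO bO)//; exact: LX.
have mg n : measurable_fun setT (fun p : measurableTypeR R * Om => g n (Num.max 0 (p.1 : R)) p.2).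
  apply: measurable_caratheodory => [t t0|t w].
    apply: measurable_funM; first exact: measurable_indic.
    exact: (adapted_measurable aX (reg_energy_continuous d_gt0 oO bO n) t0).
  have [Gw|nGw] := pselect (Good w); last first.
    by rewrite /g indicE memNset//; under eq_fun do rewrite mul0r; rewrite mul0r; exact: cvg_cst.
  apply: cvgM; first exact: cvg_cst.
  apply: (@H_path_grid (X ^~ w) _ t _ (reg_energy_continuous d_gt0 oO bO n)).
  by split => // t' t'0; exact: LX.
pose G (p : measurableTypeR R * Om) := esups (fun n => (g n (Num.max 0 (p.1 : R)) p.2)%:E) 0.
have mGp : measurable_fun setT G by apply: measurable_fun_esups => n; exact/measurable_EFinP.
have max0 (t : R) : 0 <= Num.max 0 t by rewrite le_max lexx.
have G0 p : (0 <= G p)%E.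
  apply: le_trans (ereal_sup_ubound _); last by exists 0%N.
  by rewrite lee_fin g0.
pose h (p : measurableTypeR R * Om) : \bar R := (G p * (\1_(`[0%R, T]%classic : set R) (p.1 : R))%:E)%E.
have mh : measurable_fun setT h.
  apply: emeasurable_funM => //; apply/measurable_EFinP.
  by apply: measurableT_comp measurable_fst; exact: measurable_indic.
have h0 p : (0 <= h p)%E by rewrite mule_ge0.
have GE t w : 0 <= t -> Good w -> G (t, w) = (normV O (X t w) ^+ 2)%E.
  move=> t0 Gw; rewrite (normV_sup d_gt0 oO bO (LX t w t0)) /G /esups /sdrop /=.
  congr ereal_sup; apply/seteqP; split => _ [n _ <-]; exists n => //;
    by rewrite /g indicE mem_set// mul1r/= (max_idPr _).
have hE w : Good w -> fubini_G leb h w = (\int[leb]_(t in `[0%R, T]) (normV O (X t w) ^+ 2))%E.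
  move=> Gw; rewrite [RHS]integral_mkcond; apply: eq_integral => t _.
  have indic_or (A B : \bar R) (c : R) : c = 0 \/ A = B -> (A * c%:E = B * c%:E)%E.
    by case=> ->//; rewrite !mule0.
  rewrite epatch_indic; apply: indic_or.
  have [tT|ntT] := pselect ((`[0%R, T]%classic : set R) t); last by left; rewrite indicE memNset.
  by right; apply: GE => //; move: tT; rewrite /= in_itv/= => /andP[].
have hN w : ~ Good w -> fubini_G leb h w = 0%E.
  move=> nGw; rewrite /fubini_G integral0_eq// => t _.
  rewrite /h (_ : G (t, w) = 0%E) ?mul0e//; apply/eqP; rewrite eq_le G0 andbT.
  by apply: ge_ereal_sup => _ [n _ <-]; rewrite lee_fin /g indicE memNset// mul0r.
have mhG := measurable_fun_fubini_tonelli_G (m1 := leb) h mh h0.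
have hG0 w : (0 <= fubini_G leb h w)%E by apply: integral_ge0.
have ih : P.-integrable setT (fubini_G leb h).
  apply/integrableP; split => //; apply: le_lt_trans fin.
  apply: ge0_le_integralT => w; first exact: abse_ge0.
  rewrite gee0_abs//; have [Gw|nGw] := pselect (Good w); first by rewrite hE.
  by rewrite hN//; apply: integral_ge0 => t _; rewrite expe_ge0 ?normV_ge0.
apply: negligibleS (negligibleU cX (integrable_ae measurableT ih)) => w /= nw.
have [Gw|] := pselect (Good w); last by left.
by right => /(_ I); rewrite hE// => /fin_numPlt/andP[_].
Qed.

End processes.

(** The infimum over n lies below each [f n], so its integral is below each [eps n] and hence 0.
    Convergence in mean thus gives an almost sure statement without extracting a subsequence. *)
Lemma ae_einfs_eq0 {dT : measure_display} {T : measurableType dT} {R : realType}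
    (mu : {measure set T -> \bar R}) (f : nat -> T -> \bar R) (eps : nat -> \bar R) :
  (forall n, measurable_fun setT (f n)) -> (forall n w, 0 <= f n w)%E ->
  (forall n, \int[mu]_w f n w <= eps n)%E -> eps n @[n --> \oo] --> 0%E ->
  {ae mu, forall w, einfs (f ^~ w) 0%N = 0%E}.
Proof.
move=> mf f0 fe e0.
have mi : measurable_fun setT (fun w => einfs (f ^~ w) 0%N) by exact: measurable_fun_einfs.
have i0 w : (0 <= einfs (f ^~ w) 0%N)%E by apply: le_ereal_inf_tmp => _ [n _ <-].
have ile n : (\int[mu]_w einfs (f ^~ w) 0%N <= eps n)%E.
  apply: le_trans (fe n); apply: ge0_le_integral => // w _.
  by apply: ereal_inf_lbound; exists n.
have : (\int[mu]_w `|einfs (f ^~ w) 0%N| = 0)%E.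
  under eq_integral do rewrite gee0_abs//.
  apply/eqP; rewrite eq_le integral_ge0// andbT.
  by rewrite -(cvg_lim _ e0)//; apply: lime_ge; [apply/cvg_ex; exists 0%E|exact: nearW].
move/(ae_eq_integral_abs mu measurableT mi).
by apply: filterS => w /(_ I).
Qed.

(** * Agreement of two versions of the noise *)

Section noise.
Context {R : realType} {d : nat} (O : set 'rV[R]_d).
Hypotheses (d_gt0 : (0 < d)%N) (oO : open O) (bO : bounded_set O).
Local Notation ip := (ipH O).
Local Notation FH := (L2_form oO).
Local Notation FV := (H10_form oO bO).
Context {dO : measure_display} {Om : measurableType dO} (P : probability Om R)
  (F : R -> set (set Om)).
Hypothesis uf : usual_filtration P F.
Context {U : completeNormedModType R} (ipU : U -> U -> R).
Variables (e : nat -> U) (beta : nat -> R -> Om -> R) (B : U -> 'rV[R]_d -> R).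
Hypotheses (cyl : cylindrical_wiener P F ipU e beta) (hs : hilbert_schmidt ipU O B).

(** The class is stable under subtracting a random multiple of a fixed vector, by expansion of the
    square, which is how the error of the truncated noise series is built up. *)
Definition weakly_measurable (Z : Om -> 'rV[R]_d -> R) : Prop :=
  [/\ forall w, L2 O (Z w), forall v, L2 O v -> measurable_fun setT (fun w => ip (Z w) v) &
      measurable_fun setT (fun w => ip (Z w) (Z w))].

Lemma weakly_measurableB Z (c : Om -> R) v : weakly_measurable Z -> measurable_fun setT c ->
  L2 O v -> weakly_measurable (fun w => Z w - c w *: v).
Proof.
move=> [LZ mZ mZZ] mc Lv.
have Lc w : L2 O (c w *: v) by exact: (form_setZ FH).
split => [w|v' Lv'|]; first exact: (form_setB FH).
  rewrite (_ : (fun _ => _) = fun w => ip (Z w) v' - c w * ip v v').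
    apply: measurable_funB; first exact: mZ.
    by apply: measurable_funM => //; exact: measurable_cst.
  by apply/funext => w; rewrite (formBl FH)// (formZl FH).
rewrite (_ : (fun _ => _) = fun w => ip (Z w) (Z w) - 2 * (c w * ip (Z w) v) + c w ^+ 2 * ip v v).
  apply: measurable_funD.
    apply: measurable_funB => //; apply: measurable_funM; first exact: measurable_cst.
    by apply: measurable_funM => //; exact: mZ.
  by apply: measurable_funM; [exact: measurable_funX|exact: measurable_cst].
by apply/funext => w; rewrite (form_sqrB FH)// (formZr FH)// (form_sqrZ FH).
Qed.

Let mbeta k t : 0 <= t -> measurable_fun setT (beta k t).
Proof.
move=> t0; case: cyl => _ b0 bm _; have [ek|ek] := eqVneq (e k) 0.
  rewrite (_ : beta k t = cst 0); first exact: measurable_cst.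
  by apply/funext => w; exact: b0.
move=> _ D mD; rewrite setTI; apply: (filtration_measurable uf t0).
by case: (bm k ek) => + _ _ _ _; exact.
Qed.

Definition noise_error (Y : R -> Om -> 'rV[R]_d -> R) (t : R) (n : nat) (w : Om) : 'rV[R]_d -> R :=
  fun x => Y t w x - \sum_(k < n) beta k t w * B (e k) x.

Let HB k : H10 O (B (e k)). Proof. by case: hs. Qed.

Lemma noise_errorS Y t n w : noise_error Y t n.+1 w = noise_error Y t n w - beta n t w *: B (e n).
Proof. by apply/funext => x; rewrite /noise_error big_ord_recr/= opprD addrA. Qed.

Lemma noise_error0 Y t w : noise_error Y t 0 w = Y t w.
Proof. by apply/funext => x; rewrite /noise_error big_ord0 subr0. Qed.

Lemma noise_error_H10 Y t n w : H10 O (Y t w) -> H10 O (noise_error Y t n w).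
Proof.
move=> HY; elim: n => [|n IH]; first by rewrite noise_error0.
by rewrite noise_errorS; apply: (form_setB FV) => //; exact: (form_setZ FV).
Qed.

Lemma noise_error_weak Y t n : 0 <= t -> (forall w, H10 O (Y t w)) -> adaptedH F O Y ->
  weakly_measurable (noise_error Y t n).
Proof.
move=> t0 HY aY; elim: n => [|n IH].
  rewrite (_ : noise_error Y t 0 = Y t); last by apply/funext => w; exact: noise_error0.
  split => [w|v Lv|]; first exact: H10_L2.
    exact: (adapted_measurable uf aY (H_continuous_ip oO Lv) t0).
  exact: (adapted_measurable uf aY (H_continuous_sqr oO) t0).
rewrite (_ : noise_error Y t n.+1 = fun w => noise_error Y t n w - beta n t w *: B (e n)).
  by apply: weakly_measurableB => //; [exact: mbeta|exact: H10_L2].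
by apply/funext => w; exact: noise_errorS.
Qed.

Lemma noise_errorB Y1 Y2 t n w : noise_error Y1 t n w - noise_error Y2 t n w = Y1 t w - Y2 t w.
Proof.
elim: n => [|n IH]; first by rewrite !noise_error0.
rewrite -IH !noise_errorS opprB addrA addrAC -addrA; apply/funext => x; rewrite !fctE; ring.
Qed.

Let pc : R := poincare_cst O + 1.
Let pc_gt0 : 0 < pc. Proof. by rewrite ltr_wpDl// poincare_cst_ge0. Qed.

Lemma ip_le_normV u : H10 O u -> ((ip u u / pc)%:E <= normV O u ^+ 2)%E.
Proof.
move=> Hu; rewrite (normV_sqr oO bO Hu) lee_fin ler_pdivrMr// mulrC.
apply: le_trans (poincare d_gt0 oO bO Hu) _; rewrite ler_wpM2r ?lerDl//.
exact: (form_ge0 FV).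
Qed.

(** The truncated series is common to both versions, so their difference is a difference of two
    errors that tend to 0 in mean square. *)
Lemma noise_unique_at Y1 Y2 t : 0 <= t -> BW_process P F O e beta B Y1 -> BW_process P F O e beta B Y2 ->
  {ae P, forall w, normH O (Y1 t w - Y2 t w) = 0}.
Proof.
move=> t0 [HY1 aY1 _ lim1] [HY2 aY2 _ lim2].
(* The squared H-norms of the errors are measurable by adaptedness, and divided by [pc] they lie
   below the squared V-norms by Poincare's inequality. *)
pose f n w := ((ip (noise_error Y1 t n w) (noise_error Y1 t n w) / pc)%:E
  + (ip (noise_error Y2 t n w) (noise_error Y2 t n w) / pc)%:E)%E.
have ip0 Y n w : (forall t w, 0 <= t -> H10 O (Y t w)) ->
    0 <= ip (noise_error Y t n w) (noise_error Y t n w) / pc.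
  move=> HY; rewrite divr_ge0 ?(ltW pc_gt0)//; apply: (form_ge0 FH).
  by apply: H10_L2; apply: noise_error_H10; exact: HY.
have mY Y n : (forall t w, 0 <= t -> H10 O (Y t w)) -> adaptedH F O Y ->
    measurable_fun setT (fun w => (ip (noise_error Y t n w) (noise_error Y t n w) / pc)%:E).
  move=> HY aY; apply/measurable_EFinP; apply: measurable_funM; last exact: measurable_cst.
  by have [] := noise_error_weak n t0 (fun w => HY t w t0) aY.
have leY Y n : (forall t w, 0 <= t -> H10 O (Y t w)) -> adaptedH F O Y ->
    (\int[P]_w (ip (noise_error Y t n w) (noise_error Y t n w) / pc)%:E <=
     \int[P]_w (normV O (noise_error Y t n w) ^+ 2))%E.
  move=> HY aY; apply: ge0_le_integralT => w; first by rewrite lee_fin ip0.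
  by apply: ip_le_normV; apply: noise_error_H10; exact: HY.
have lim := cvgeD (isT : (0 : \bar R) +? (0 : \bar R))%E (lim1 t t0) (lim2 t t0); rewrite adde0 in lim.
have : {ae P, forall w, einfs (f ^~ w) 0%N = 0%E}.
  apply: (ae_einfs_eq0 _ _ _ (lim eventually_filter)).
- by move=> n; apply: emeasurable_funD; exact: mY.
- by move=> n w; rewrite adde_ge0// lee_fin ip0.
- move=> n; rewrite ge0_integralD//; first by apply: leeD; exact: leY.
  + by move=> w _; rewrite lee_fin ip0.
  + exact: mY.
  + by move=> w _; rewrite lee_fin ip0.
  + exact: mY.
apply: filterS => w inf0.
have L1 n : L2 O (noise_error Y1 t n w) by apply: H10_L2; apply: noise_error_H10; exact: HY1.
have L2' n : L2 O (noise_error Y2 t n w) by apply: H10_L2; apply: noise_error_H10; exact: HY2.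
have LD : L2 O (Y1 t w - Y2 t w) by apply: (form_setB FH); apply: H10_L2; [exact: HY1|exact: HY2].
have le n : ((ip (Y1 t w - Y2 t w) (Y1 t w - Y2 t w) / (2 * pc))%:E <= f n w)%E.
  rewrite /f -EFinD lee_fin -mulrDl invfM mulrA ler_wpM2r ?invr_ge0 ?(ltW pc_gt0)// ler_pdivrMr//.
  rewrite -(noise_errorB Y1 Y2 t n w) mulrC mulrDr.
  have := form_sqrD_le2 FH (L1 n) (form_setN FH (L2' n)).
  by rewrite -scaleN1r (form_sqrZ FH (-1) (L2' n)) sqrrN expr1n mul1r.
have le0 : ((ip (Y1 t w - Y2 t w) (Y1 t w - Y2 t w) / (2 * pc))%:E <= 0)%E.
  by rewrite -inf0; apply: le_ereal_inf_tmp => _ [n _ <-]; exact: le.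
rewrite lee_fin ler_pdivrMr ?mulr_gt0// mul0r in le0.
have eq0 : ip (Y1 t w - Y2 t w) (Y1 t w - Y2 t w) = 0.
  by apply/eqP; rewrite eq_le le0 (form_ge0 FH).
by rewrite /normH eq0 sqrtr0.
Qed.

End noise.

Section noise_unique.
Context {R : realType} {d : nat} (O : set 'rV[R]_d).
Hypotheses (d_gt0 : (0 < d)%N) (oO : open O) (bO : bounded_set O).
Local Notation ip := (ipH O).
Local Notation FH := (L2_form oO).
Local Notation FV := (H10_form oO bO).
Local Notation leb := (@lebesgue_measure R).

Lemma V_path_H z : (forall t : R, 0 <= t -> H10 O (z t)) ->
  (forall t : R, 0 <= t ->
    (normV O (z t' \- z t)%R @[t' --> within `[0%R, +oo[ (nbhs t)] --> 0)%E) -> H_path O z.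
Proof.
move=> Hz cz; split => [t t0|t t0]; first exact/H10_L2/Hz.
have c0 : (fine \o (fun t' => normV O (z t' \- z t))) t' @[t' --> within `[0%R, +oo[ (nbhs t)] --> (0 : R).
  by apply: fine_cvg; exact: cz.
have c1 : Num.sqrt (poincare_cst O) * (fine \o (fun t' => normV O (z t' \- z t))) t'
    @[t' --> within `[0%R, +oo[ (nbhs t)] --> (0 : R).
  by rewrite -[X in _ --> X](mulr0 (Num.sqrt (poincare_cst O))); apply: cvgM => //; exact: cvg_cst.
apply: (squeeze_cvgr _ (cvg_cst 0) c1).
rewrite near_withinE; apply: nearW => t'; rewrite /= in_itv/= andbT => t'0.
have HD : H10 O (z t' \- z t) by exact: (form_setB FV (Hz t' t'0) (Hz t t0)).
rewrite sqrtr_ge0 /= (normV_H10 oO HD) /=; exact: (normH_le_ipV d_gt0 oO bO HD).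
Qed.

Context {dO : measure_display} {Om : measurableType dO} (P : probability Om R)
  (F : R -> set (set Om)).
Hypothesis uf : usual_filtration P F.
Context {U : completeNormedModType R} (ipU : U -> U -> R).
Variables (e : nat -> U) (beta : nat -> R -> Om -> R) (B : U -> 'rV[R]_d -> R).
Hypotheses (cyl : cylindrical_wiener P F ipU e beta) (hs : hilbert_schmidt ipU O B).

(** Equality at the countably many times n / (m + 1) holds off one null set; these contain all grid
    times, and both versions have continuous paths in H. *)
Lemma noise_unique Y1 Y2 : BW_process P F O e beta B Y1 -> BW_process P F O e beta B Y2 ->
  {ae P, forall w, forall (t : R) v, 0 <= t -> L2 O v -> ip (Y1 t w) v = ip (Y2 t w) v}.
Proof.
move=> BW1 BW2; have [HY1 _ cY1 _] := BW1; have [HY2 _ cY2 _] := BW2.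
have rat : {ae P, forall w, forall m n : nat,
    normH O (Y1 (n%:R / m.+1%:R) w - Y2 (n%:R / m.+1%:R) w) = 0}.
  apply: ae_foralln => m; apply: ae_foralln => n.
  by apply: (noise_unique_at d_gt0 oO bO uf cyl hs) => //; rewrite divr_ge0.
apply: filterS3 rat cY1 cY2 => w ratw c1 c2 t v t0 Lv.
have p1 := V_path_H (fun t t0 => HY1 t w t0) c1.
have p2 := V_path_H (fun t t0 => HY2 t w t0) c2.
have l1 := H_path_grid oO (t := t) p1 (H_continuous_ip oO Lv).
have l2 := H_path_grid oO (t := t) p2 (H_continuous_ip oO Lv).
have eq m : ip (Y1 (grid m t) w) v = ip (Y2 (grid m t) w) v.
  have g0 := grid_ge0 m t.
  have L1 := H10_L2 (HY1 _ w g0); have L2' := H10_L2 (HY2 _ w g0).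
  apply/eqP; rewrite -subr_eq0 -(formBl FH)//; apply/eqP.
  apply: (form_null FH) => //; first exact: (form_setB FH).
  have /eqP := ratw m (Num.truncn (t * m.+1%:R)).
  rewrite sqrtr_eq0 => le0; apply/eqP; rewrite eq_le le0.
  by apply: (form_ge0 FH); exact: (form_setB FH).
rewrite (max_idPr t0) in l1 l2.
apply: (cvg_unique _ l1); first exact: norm_hausdorff.
by apply: cvg_trans l2; apply: near_eq_cvg; apply: nearW => m; rewrite eq.
Qed.

End noise_unique.

Section conclusion.
Context {R : realType} {d : nat} (O : set 'rV[R]_d).
Hypotheses (d_gt0 : (0 < d)%N) (oO : open O) (bO : bounded_set O).
Local Notation ip := (ipH O).
Local Notation leb := (@lebesgue_measure R).
Local Notation d0 := (@dim0 R d).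
Variables (psi : R -> R) (a b s : R).
Hypothesis pg : psi_growth psi a b s.
Hypothesis s_dim : s * d0 <= 2.
Local Notation Ap := (Apair psi O).

Lemma H_path_bound (x y z : R -> 'rV[R]_d -> R) (u0 v0 : 'rV[R]_d -> R) (alpha l t : R) :
  H_path O x -> H_path O y -> H10 O u0 -> H10 O v0 ->
  (forall n : nat, (\int[leb]_(t in `[0%R, n.+1%:R]) (normV O (x t) ^+ 2) < +oo)%E) ->
  (forall n : nat, (\int[leb]_(t in `[0%R, n.+1%:R]) (normV O (y t) ^+ 2) < +oo)%E) ->
  (forall t v, 0 <= t -> H10 O v -> ip (x t) v - ip (y t) v =
    ip u0 v - ip v0 v - (\int[leb]_(r in `[0, t]) Ap (x r) v - \int[leb]_(r in `[0, t]) Ap (y r) v)) ->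
  0 <= alpha <= 1 -> 1 <= l -> 0 < t ->
  ((normH O (x t \- y t)%R `^ (2 * alpha))%:E <=
   (t `^ (- (alpha * l)))%:E * (bound_cst O alpha l)%:E *
   ((t^-1)%:E * \int[leb]_(r in `[0%R, t]) weight_norm O a b s x y alpha r) `^ (l / d0) *
   (normH O (u0 \- v0)%R `^ (2 * alpha))%:E)%E.
Proof.
move=> px py Hu0 Hv0 fx fy eqn al l1 t0.
pose ext (f : R -> 'rV[R]_d -> R) (r : R) := f (Num.max 0 r).
have extE f r : 0 <= r -> ext f r = f r by move=> r0; rewrite /ext (max_idPr r0).
have ext_in f T r : r \in (`[0, T]%classic : set R) -> ext f r = f r.
  by rewrite inE /= in_itv/= => /andP[r0 _]; exact: extE.
have fin f : (forall t, 0 <= t -> L2 O (f t)) -> curve O (ext f) ->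
    (forall n : nat, (\int[leb]_(t in `[0%R, n.+1%:R]) (normV O (f t) ^+ 2) < +oo)%E) ->
    forall T : R, (\int[leb]_(t in `[0%R, T]) (normV O (ext f t) ^+ 2) < +oo)%E.
  move=> Lf cf ff T; apply: le_lt_trans (ff (Num.truncn T)).
  have -> : (\int[leb]_(t in `[0%R, (Num.truncn T).+1%:R]) (normV O (f t) ^+ 2) =
      \int[leb]_(t in `[0%R, (Num.truncn T).+1%:R]) (normV O (ext f t) ^+ 2))%E.
    by apply: eq_integral => r /ext_in ->.
  apply: ge0_subset_integral => //.
  - by apply: measurable_funTS; exact: measurable_normV.
  - by move=> r _; rewrite expe_ge0 ?normV_ge0.
  - by apply: subset_itvl; rewrite bnd_simp ltW// truncnS_gt.
have cx := H_path_curve px; have cy := H_path_curve py.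
have fx' := fin x (proj1 px) cx fx; have fy' := fin y (proj1 py) cy fy.
have eqn' r v : 0 <= r -> H10 O v -> ip (ext x r) v - ip (ext y r) v =
    ip u0 v - ip v0 v - (\int[leb]_(r in `[0, r]) Ap (ext x r) v - \int[leb]_(r in `[0, r]) Ap (ext y r) v).
  move=> r0 Hv; have eqA f : \int[leb]_(r in `[0, r]) Ap (ext f r) v = \int[leb]_(r in `[0, r]) Ap (f r) v.
    by apply: eq_Rintegral => q /ext_in ->.
  have h (p p' q q' A A' B B' c : R) : p = p' -> q = q' -> A = A' -> B = B' ->
    p' - q' = c - (A' - B') -> p - q = c - (A - B) by move=> -> -> -> ->.
  apply: (h _ _ _ _ _ _ _ _ _ _ _ (eqA x) (eqA y) (eqn r v r0 Hv)).
    by rewrite (extE x r r0).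
  by rewrite (extE y r r0).
have := decay_bound d_gt0 oO bO pg s_dim cx cy Hu0 Hv0 fx' fy' eqn' al l1 t0.
rewrite (max_idPr (ltW t0)).
have eqW : (\int[leb]_(r in `[0%R, t]) weight_norm O a b s (ext x) (ext y) alpha r =
    \int[leb]_(r in `[0%R, t]) weight_norm O a b s x y alpha r)%E.
  apply: eq_integral => r rt.
  by rewrite /weight_norm (ext_in x _ _ rt) (ext_in y _ _ rt).
have tr (A A' p c K q N : \bar R) (e : R) : A = A' ->
    (p <= c * K * (q * A) `^ e * N)%E -> (p <= c * K * (q * A') `^ e * N)%E by move=> ->.
exact: (tr _ _ _ _ _ _ _ _ eqW).
Qed.

End conclusion.

Theorem proposition3p3 (R : realType) (d : nat) (O : set 'rV[R]_d)
    (alpha l : R) :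
  (1 <= d)%N ->
  bounded_set O -> open O -> convex_set O -> piecewise_C2_boundary O ->
  0 <= alpha <= 1 -> 1 <= l ->
  let d0 : R := Num.max 1 (d%:R / 2) in
  let vol : R := fine (lebesgue_rV d O) in
  exists C : R,
  forall (psi : R -> R) (a b s : R)
    (U : completeNormedModType R) (ip : U -> U -> R)
    (dO : measure_display) (Om : measurableType dO) (P : probability Om R)
    (F : R -> set (set Om)) (e : nat -> U) (beta : nat -> R -> Om -> R)
    (B : U -> 'rV[R]_d -> R) (u0 v0 : 'rV[R]_d -> R)
    (u v : R -> Om -> 'rV[R]_d -> R),
  psi_conditions d psi a b s ->
  separable_hilbert ip ->
  usual_filtration P F ->
  cylindrical_wiener P F ip e beta ->
  hilbert_schmidt ip O B ->
  H10 O u0 -> H10 O v0 ->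
  solution P F O psi e beta B u0 u ->
  solution P F O psi e beta B v0 v ->
  {ae P, forall w, forall t : R, 0 < t ->
    ((normH O (u t w \- v t w)%R `^ (2 * alpha))%:E <=
     (t `^ (- (alpha * l)))%:E * C%:E *
     ((t^-1)%:E * \int[lebesgue_measure]_(tau in `[0%R, t])
        (((a * vol) `^ (alpha * d0))%:E
         + (b `^ (alpha * d0))%:E * normV O (u tau w) `^ (alpha * d0 * s)
         + (b `^ (alpha * d0))%:E * normV O (v tau w) `^ (alpha * d0 * s)))
       `^ (l / d0) *
     (normH O (u0 \- v0)%R `^ (2 * alpha))%:E)%E}.
Proof.
move=> d_gt0 bO oO _ _ al l1 d0 vol; exists (bound_cst O alpha l).
move=> psi a b s U ip dO Om P F e beta B u0 v0 u v pc _ uf cyl hs Hu0 Hv0.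
move=> [Lu au cu finu [Yu BWu equ]] [Lv av cv finv [Yv BWv eqv]].
have pg := psi_conditions_growth pc.
have s_dim : s * @dim0 R d <= 2.
  have d0R : 0 < d%:R :> R by rewrite ltr0n.
  (* Both bounds in (C6) are used: s <= 2 for the branch 1 of the maximum, and s <= 4 / d for the
     branch d / 2. *)
  case: pc => dpsi _ [_ _ _ _ [_ /andP[s0]]]; rewrite le_min => /andP[s4 s2].
  rewrite /dim0 maxr_pMr ?(ltW s0)// ge_max mulr1 s2 /= mulrA ler_pdivrMr//.
  by rewrite -ler_pdivlMr// (le_trans s4)// ler_pM2r ?invr_gt0// -natrM.
(* The null set in the hypotheses depends on the horizon; integer horizons reduce them to countably
   many. *)
have au1 : {ae P, forall w, forall n : nat,
    (\int[lebesgue_measure]_(t in `[0%R, n.+1%:R]) (normV O (u t w) ^+ 2) < +oo)%E}.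
  by apply: ae_foralln => n; apply: (ae_finite_energy d_gt0 oO bO uf Lu au cu); have [|] := finu n.+1%:R.
have av1 : {ae P, forall w, forall n : nat,
    (\int[lebesgue_measure]_(t in `[0%R, n.+1%:R]) (normV O (v t w) ^+ 2) < +oo)%E}.
  by apply: ae_foralln => n; apply: (ae_finite_energy d_gt0 oO bO uf Lv av cv); have [|] := finv n.+1%:R.
have equ1 : {ae P, forall w, forall n : nat, forall t : R, 0 <= t <= n.+1%:R -> forall f, H10 O f ->
    ipH O (u t w) f = ipH O u0 f - \int[lebesgue_measure]_(tau in `[0, t]) Apair psi O (u tau w) f
      + ipH O (Yu t w) f}.
  by apply: ae_foralln => n; exact: equ.
have eqv1 : {ae P, forall w, forall n : nat, forall t : R, 0 <= t <= n.+1%:R -> forall f, H10 O f ->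
    ipH O (v t w) f = ipH O v0 f - \int[lebesgue_measure]_(tau in `[0, t]) Apair psi O (v tau w) f
      + ipH O (Yv t w) f}.
  by apply: ae_foralln => n; exact: eqv.
have aeP : Filter (almost_everywhere P) by exact: ae_filter_ringOfSetsType.
have aeI (Q1 Q2 : Om -> Prop) : {ae P, forall w, Q1 w} -> {ae P, forall w, Q2 w} ->
    {ae P, forall w, Q1 w /\ Q2 w} by move=> q1 q2; exact: (@filterI _ _ aeP _ _ q1 q2).
have ae1 := aeI _ _ au1 (aeI _ _ av1 (aeI _ _ cu cv)).
have ae2 := aeI _ _ equ1 (aeI _ _ eqv1 (noise_unique d_gt0 oO bO uf cyl hs BWu BWv)).
apply: (@filterS _ _ aeP _ _ _ (aeI _ _ ae1 ae2)).
move=> w [[fu [fv [pu pv]]] [eu [ev eY]]] t t0.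
apply: (H_path_bound d_gt0 oO bO pg s_dim (x := u ^~ w) (y := v ^~ w)) => //.
- by split => // r r0; exact: Lu.
- by split => // r r0; exact: Lv.
move=> r f r0 Hf; have rn : 0 <= r <= (Num.truncn r).+1%:R.
  by rewrite r0 ltW// truncnS_gt.
(* Once [eY] has identified the two versions, the same noise term stands in both equations and
   cancels in the difference. *)
rewrite (eu _ r rn f Hf) (ev _ r rn f Hf) (eY r f r0 (H10_L2 Hf)).
suff h (p q p' q' c : R) : p - q + c - (p' - q' + c) = p - p' - (q - q') by exact: h.
by ring.
Qed.
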